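(* Let $X$ be an infinite dimensional real Banach space whose dual $X^*$ is separable. The following are equivalent. (1) $S_z(X)=\omega$. (2) There exist $q>1$ and $K<\infty$ such that for all $n\in\mathbb{N}$, all $(e_i)_{i=1}^n\in\{X\}_n$ and all $(a_i)_{i=1}^n\subseteq\mathbb{R}$, $\big\|\sum_1^n a_ie_i\big\|\le K\big(\sum_1^n|a_i|^q\big)^{1/q}$. (3) There exists $q>1$ so that $X$ satisfies $(\infty,q)$-tree estimates. (4) There exists $p<\infty$ so that $X^*$ satisfies $(p,1)$-$w^*$-tree estimates. (5) There exist $p<\infty$ and a Banach space $Z$ with a boundedly complete FDD $E$ so that $X^*$ embeds into $Z_p(E)$ as a $w^*$-closed subspace. (6) $X$ can be renormed to be a.u.s. of power type $q$ for some $q>1$. (7) $X$ can be renormed to be a.u.s. (8) $X$ can be renormed so that $\bar\rho_X(t)<t$ for some $t>0$. (9) $X$ can be renormed to be $w^*$-UKK with modulus $\delta^*(\varepsilon)\ge c\,\varepsilon^p$ for some $p<\infty$ and $c>0$. (10) $X$ can be renormed to be $w^*$-UKK. (11) There exists $p<\infty$ so that $X$ can be renormed so that the $w^*$-modulus $\bar\delta^*$ of $X^*$ (with the dual norm) is of power type $p$. (12) $X$ can be renormed to be $w^*$-a.u.c.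
   Context: ''Renormed'' means given an equivalent norm; $X^*$ then carries the dual norm. $S_X$, $B_X$ are the unit sphere and ball; $\operatorname{cof}(X)$ is the set of closed finite codimensional subspaces of $X$. Szlenk index: for $\varepsilon>0$ let $K_0(X,\varepsilon)=B_{X^*}$; let $K_{\alpha+1}(X,\varepsilon)$ be the set of $x^*\in K_\alpha(X,\varepsilon)$ for which there is $(x_n^* )\subseteq K_\alpha(X,\varepsilon)$ with $w^*$-$\lim x_n^*=x^*$ and $\liminf\|x_n^*-x^*\|\ge\varepsilon$; $K_\alpha(X,\varepsilon)=\bigcap_{\beta<\alpha}K_\beta(X,\varepsilon)$ for limit $\alpha$. $S_z(X,\varepsilon)$ is the smallest $\alpha$ with $K_\alpha(X,\varepsilon)=\emptyset$ (and $\omega_1$ if there is none), and $S_z(X)=\sup_{0<\varepsilon<1}S_z(X,\varepsilon)$. Asymptotic structure: a normalized monotone basis $(e_i)_{i=1}^n$ (of an $n$-dimensional normed space) belongs to $\{X\}_n$ if for all $\varepsilon>0$: $\forall X_1\in\operatorname{cof}(X)\ \exists x_1\in S_{X_1}\ \forall X_2\in\operatorname{cof}(X)\ \exists x_2\in S_{X_2}\cdots\forall X_n\in\operatorname{cof}(X)\ \exists x_n\in S_{X_n}$ such that $(x_i)_{i=1}^n$ is $(1+\varepsilon)$-equivalent to $(e_i)_{i=1}^n$. Trees: $T_\infty$ is the set of finite nonempty strictly increasing sequences $(n_1,\dots,n_\ell)$ in $\mathbb{N}$. A tree is a family $(x_\alpha)_{\alpha\in T_\infty}$; its nodes are the sequences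 $(x_{(\alpha,n)})_{n>n_\ell}$ for $\alpha=(n_1,\dots,n_\ell)\in T_\infty$ or $\alpha=\emptyset$ (all $n\in\mathbb{N}$); its branches are the sequences $(x_{(n_1,\dots,n_i)})_{i=1}^\infty$ with $n_1<n_2<\cdots$. A tree is weakly null ($w^*$-null) if each node is weakly null ($w^*$-null). For $1\le q\le p\le\infty$, $X$ satisfies $(p,q)$-tree estimates if for some $C<\infty$ every weakly null tree in $S_X$ has branches $(x_i)$ and $(y_i)$ with $C^{-1}(\sum|a_i|^p)^{1/p}\le\|\sum a_ix_i\|$ and $\|\sum a_iy_i\|\le C(\sum|a_i|^q)^{1/q}$ for all $(a_i)\in c_{00}$ (max in place of the sum for exponent $\infty$). $X^*$ satisfies $(p,q)$-$w^*$-tree estimates if for some $C$ the same holds for every $w^*$-null tree in $S_{X^*}$, where $w^*=\sigma(X^*,X)$. $Z_p(E)$: for a Banach space $Z$ with FDD $E=(E_i)$ (finite dimensional decomposition; $P_I^E$ is the projection onto the coordinates in $I$) and $1\le p\le\infty$, $Z_p(E)$ is the completion of $c_{00}(\oplus E_i)$ (finitely supported vectors) under $\|z\|_p=\sup\{(\sum_j\|P^E_{I_j}z\|^p)^{1/p}: I_1<I_2<\cdots\text{ intervals in }\mathbb{N}\}$. For $p<\infty$, $E$ is a bimonotone boundedly complete FDD of $Z_p(E)$, which is therefore the dual of the norm closure of $c_{00}(\oplus E_i^* )$ in $Z_p(E)^*$; this defines the $w^*$-topology on $Z_p(E)$. ''$X^*$ embeds as a $w^*$-closed subspace'' means: there is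 a linear isomorphic embedding which is $w^*$-$w^*$ continuous and has $w^*$-closed range. Moduli: for $t>0$, $\bar\rho_X(t)=\sup_{\|x\|=1}\inf_{Y\in\operatorname{cof}(X)}\sup_{y\in tB_Y}\|x+y\|-1$. $X$ is a.u.s. (asymptotically uniformly smooth) if $\lim_{t\to0^+}\bar\rho_X(t)/t=0$, and a.u.s. of power type $q$ if for some $K<\infty$, $\bar\rho_X(t)\le Kt^q$ for $t>0$. For the dual $X^*$, $\bar\delta^*(t)=\inf_{\|x^*\|=1}\sup_{Y}\inf_{y\in Y,\|y\|\ge t}\|x^*+y\|-1$, where $Y$ ranges over the $w^*$-closed finite codimensional subspaces of $X^*$. $X$ is $w^*$-a.u.c. if $\bar\delta^*(t)>0$ for all $t>0$; $\bar\delta^*$ is of power type $p$ if for some $K>0$, $\bar\delta^*(t)\ge Kt^p$ for $0<t\le1$. $X$ is $w^*$-UKK with modulus $\delta^*$ if for each $\varepsilon>0$ there is $\delta^*(\varepsilon)>0$ such that whenever $(x_n^* )\subseteq B_{X^*}$ converges $w^*$ to $x^*$ and $\liminf\|x_n^*-x^*\|\ge\varepsilon$, then $\|x^*\|\le1-\delta^*(\varepsilon)$. *)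

(* Defs.v *)
From HB Require Import structures.
From mathcomp Require Import all_boot all_order all_algebra.
From mathcomp Require Import all_classical all_reals all_analysis.

Set Implicit Arguments.
Unset Strict Implicit.
Unset Printing Implicit Defensive.

Import Order.TTheory GRing.Theory Num.Theory.
Import numFieldNormedType.Exports.

Local Open Scope classical_set_scope.
Local Open Scope ring_scope.

Section dual.
Context {R : realType} (X : normedModType R).

Definition continuous_linear : {pred X -> R^o} :=
  mem [set f : X -> R^o | linear f /\ continuous f].

Lemma continuous_linear_submod_closed : submod_closed continuous_linear.
Proof.
split=> [|a f g]; rewrite !inE /=.
  split=> [b x y|x]; last exact: cst_continuous.
  by rewrite -[0]/(cst 0) /cst /= scaler0 addr0.
move=> [flin fcont] [glin gcont]; split=> [b x y|x].
  rewrite !fctE flin glin !scalerDr addrACA; congr (_ + _ + _).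
  by rewrite !scalerA mulrC.
apply: (@continuousD _ _ _ (fun x => a *: f x) g); last exact: gcont.
by apply: continuousZl_tmp; exact: fcont.
Qed.

HB.instance Definition _ :=
  GRing.isSubmodClosed.Build R (X -> R^o) continuous_linear
    continuous_linear_submod_closed.

Record dual := Dual { dual_fun :> X -> R^o ; _ : dual_fun \in continuous_linear }.

HB.instance Definition _ := [isSub for dual_fun].
HB.instance Definition _ := [Choice of dual by <:].
HB.instance Definition _ := [SubChoice_isSubLmodule of dual by <:].

Lemma dual_linear (f : dual) : linear f.
Proof. by case: f => f /=; rewrite inE => -[]. Qed.

Lemma dual_continuous (f : dual) : continuous f.
Proof. by case: f => f /=; rewrite inE => -[]. Qed.

HB.instance Definition _ (f : dual) :=
  GRing.isLinear.Build R X R^o *:%R (dual_fun f) (@dual_linear f).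

Definition dual_norm (f : dual) : R := sup [set `|f x| | x in [set x | `|x| <= 1]].

Lemma dual_norm_has_sup (f : dual) :
  has_sup [set `|f x| | x in [set x : X | `|x| <= 1]].
Proof.
split; first by exists `|f 0|, 0 => //=; rewrite normr0.
have /bounded_funP /(_ 1) [M fM] := @continuous_linear_bounded _ _ _ 0 f (@dual_continuous f 0).
by exists M => _ [x /= x1 <-]; exact: fM.
Qed.

Lemma le_dual_norm (f : dual) x : `|x| <= 1 -> `|f x| <= dual_norm f.
Proof.
by move=> x1; apply: sup_upper_bound; [exact: dual_norm_has_sup|exists x].
Qed.

Lemma dual_norm_le (f : dual) M :
  (forall x, `|x| <= 1 -> `|f x| <= M) -> dual_norm f <= M.
Proof.
move=> fM; apply: ge_sup; first by case: (dual_norm_has_sup f).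
by move=> _ [x /= x1 <-]; exact: fM.
Qed.

Lemma dual_norm_ge0 (f : dual) : 0 <= dual_norm f.
Proof.
by apply: le_trans (normr_ge0 (f 0)) (le_dual_norm f _); rewrite normr0.
Qed.

Lemma dual_normD (f g : dual) : dual_norm (f + g) <= dual_norm f + dual_norm g.
Proof.
apply: dual_norm_le => x x1; apply: le_trans (ler_normD _ _) _.
by apply: lerD; exact: le_dual_norm.
Qed.

Lemma dual_normZ a (f : dual) : dual_norm (a *: f) = `|a| * dual_norm f.
Proof.
have le b (g : dual) : dual_norm (b *: g) <= `|b| * dual_norm g.
  apply: dual_norm_le => x x1; rewrite -[(b *: g) x]/(b * g x) normrM.
  by apply: ler_wpM2l => //; exact: le_dual_norm.
apply/eqP; rewrite eq_le le /=.
have [->|a0] := eqVneq a 0.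
  by rewrite normr0 mul0r dual_norm_ge0.
rewrite mulrC -ler_pdivlMr ?normr_gt0 // mulrC -normfV.
by rewrite -{1}(scalerK a0 f); exact: le.
Qed.

Lemma dual_norm0_eq0 (f : dual) : dual_norm f = 0 -> f = 0.
Proof.
move=> f0; apply/val_inj/funext => x /=; apply/eqP; rewrite -normr_le0.
have [->|x0] := eqVneq x 0; first by rewrite linear0 normr0.
have : `|f (`|x|^-1 *: x)| <= dual_norm f.
  by apply: le_dual_norm; rewrite normrZ normfV normr_id mulVf ?normr_eq0.
by rewrite f0 linearZ normrZ pmulr_rle0 // normr_gt0 invr_neq0 // normr_eq0.
Qed.

HB.instance Definition _ :=
  @Lmodule_isNormed.Build R dual dual_norm dual_normD dual_normZ dual_norm0_eq0.

End dual.

Record equiv_norm {R : realType} (X : normedModType R) := EquivNorm {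
  eqnorm :> X -> R;
  eqnormD : forall x y, eqnorm (x + y) <= eqnorm x + eqnorm y;
  eqnormZ : forall a x, eqnorm (a *: x) = `|a| * eqnorm x;
  eqnorm_equiv : exists c C : R, [/\ 0 < c, 0 < C &
    forall x, c * `|x| <= eqnorm x <= C * `|x|] }.

Definition renorm {R : realType} {X : normedModType R} (N : equiv_norm X) : Type :=
  X.

Section renorm.
Context {R : realType} (X : normedModType R) (N : equiv_norm X).

Lemma eqnorm0_eq0 (x : X) : N x = 0 -> x = 0.
Proof.
have [c [C [c0 _ cC]]] := eqnorm_equiv N => Nx.
by have /andP[+ _] := cC x; rewrite Nx pmulr_rle0 // normr_le0 => /eqP.
Qed.

HB.instance Definition _ := GRing.Lmodule.copy (renorm N) X.
HB.instance Definition _ :=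
  @Lmodule_isNormed.Build R (renorm N) N (@eqnormD _ _ N) (@eqnormZ _ _ N) eqnorm0_eq0.

End renorm.

Section renorm_complete.
Context {R : realType} (X : completeNormedModType R) (N : equiv_norm X).

Lemma renorm_complete (F : set_system (renorm N)) :
  ProperFilter F -> cauchy F -> cvg F.
Proof.
move=> FF /cauchy_ballP Fc; have [c [C [c0 C0 cC]]] := eqnorm_equiv N.
have Xc : cauchy (F : set_system X).
  apply/cauchy_ballP => e e0; have := Fc (c * e) (mulr_gt0 c0 e0).
  apply: filterS => -[x y]; rewrite -!ball_normE /= => xy.
  rewrite -(ltr_pM2l c0); apply: le_lt_trans xy.
  by have /andP[] := cC (x - y).
have /cvg_ex[l Fl] := @cauchy_cvg X F FF Xc.
apply/cvg_ex; exists l; apply/cvgrPdist_lt => e e0.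
have eC : 0 < e / C by rewrite divr_gt0.
move/cvgrPdist_lt : Fl => /(_ _ eC); apply: filterS => x /=.
rewrite ltr_pdivlMr // mulrC; apply: le_lt_trans.
by have /andP[] := cC (l - x).
Qed.

HB.instance Definition _ := Uniform_isComplete.Build (renorm N) renorm_complete.

End renorm_complete.


(* sigma(S, I): the coarsest topology on S making b ^~ i continuous for all i *)
Definition pairing_topology {R : realType} {S : choiceType} {I : Type}
    (b : S -> I -> R) : topologicalType :=
  initial_topology (b : S -> {ptws I -> R}).

Definition weak {R : realType} (X : normedModType R) : topologicalType :=
  pairing_topology (fun (x : X) (f : dual X) => f x : R).

Definition wstar {R : realType} (X : normedModType R) : topologicalType :=
  pairing_topology (fun (f : dual X) (x : X) => f x : R).

Definition weakly_null {R : realType} (X : normedModType R) (u : nat -> X) : Prop :=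
  (u : nat -> weak X) @ \oo --> ((0 : X) : weak X).

Definition wstar_cvg {R : realType} (X : normedModType R) (u : nat -> dual X)
    (f : dual X) : Prop :=
  (u : nat -> wstar X) @ \oo --> (f : wstar X).

Definition wstar_null {R : realType} (X : normedModType R) (u : nat -> dual X) :
  Prop := wstar_cvg u 0.

Definition separable (T : topologicalType) : Prop :=
  exists2 D : set T, countable D & dense D.

Section subspaces.
Context {R : realType} {V : lmodType R}.

Definition is_subspace (Y : set V) : Prop :=
  Y 0 /\ forall a x y, Y x -> Y y -> Y (a *: x + y).

Definition fin_dim (Y : set V) : Prop :=
  exists (n : nat) (b : 'I_n -> V),
    forall x, Y x -> exists a : 'I_n -> R, x = \sum_i a i *: b i.

Definition fin_codim (Y : set V) : Prop :=
  exists (n : nat) (b : 'I_n -> V),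
    forall x, exists2 y, Y y & exists a : 'I_n -> R, x = y + \sum_i a i *: b i.

Definition is_basis (n : nat) (e : 'I_n -> V) : Prop :=
  forall x, exists! a : {ffun 'I_n -> R}, x = \sum_i a i *: e i.

End subspaces.

Definition cof {R : realType} (X : normedModType R) : set (set X) :=
  [set Y | [/\ is_subspace Y, fin_codim Y & closed Y]].

Definition wstar_cof {R : realType} (X : normedModType R) : set (set (dual X)) :=
  [set Y | [/\ is_subspace Y, fin_codim Y & closed (Y : set (wstar X))]].

Arguments cof {R} X _.
Arguments wstar_cof {R} X _.

(* [co_sup f] is the supremum of the [f n]; the values of these trees,         *)
(* compared by [co_le], are exactly the countable ordinals.                    *)
Inductive countable_ordinal : Type :=
  co_zero | co_succ of countable_ordinal | co_sup of (nat -> countable_ordinal).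

Inductive co_le : countable_ordinal -> countable_ordinal -> Prop :=
| co_le_zero b : co_le co_zero b
| co_le_succ a b : co_le a b -> co_le (co_succ a) (co_succ b)
| co_le_sup a f n : co_le a (f n) -> co_le a (co_sup f)
| co_sup_le f b : (forall n, co_le (f n) b) -> co_le (co_sup f) b.

Definition co_omega : countable_ordinal := co_sup (fun n => iter n co_succ co_zero).

(* ordinals <= omega_1, with [None] standing for omega_1 *)
Definition xco_le (a b : option countable_ordinal) : Prop :=
  match a, b with
  | Some a, Some b => co_le a b
  | _, None => True
  | None, Some _ => False
  end.

Section szlenk.
Context {R : realType} (X : normedModType R).

Definition szlenk_derivation (eps : R) (K : set (dual X)) : set (dual X) :=
  [set f | K f /\ exists u : nat -> dual X,
    [/\ forall n, K (u n), wstar_cvg u f &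
       (eps%:E <= limn_einf (fun n => `|u n - f|%:E))%E]].

(* [co_sup f] may also denote zero or a successor; as the sets decrease, the   *)
(* intersection of the [K_(f n)] is then still the set of that index.          *)
Fixpoint szlenk_set (eps : R) (a : countable_ordinal) : set (dual X) :=
  match a with
  | co_zero => [set f | `|f| <= 1]
  | co_succ b => szlenk_derivation eps (szlenk_set eps b)
  | co_sup f => \bigcap_n szlenk_set eps (f n)
  end.

Definition is_szlenk_at (eps : R) (a : option countable_ordinal) : Prop :=
  match a with
  | Some a => szlenk_set eps a = set0 /\
              forall b, szlenk_set eps b = set0 -> co_le a b
  | None => forall b, szlenk_set eps b <> set0
  end.

Definition is_szlenk_index (a : option countable_ordinal) : Prop :=
  (forall eps b, 0 < eps < 1 -> is_szlenk_at eps b -> xco_le b a) /\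
  (forall c, (forall eps b, 0 < eps < 1 -> is_szlenk_at eps b -> xco_le b c) ->
             xco_le a c).

End szlenk.

Section asymptotic_structure.
Context {R : realType} (X : normedModType R).

Fixpoint asymptotic_game (n : nat) (P : seq X -> Prop) (s : seq X) : Prop :=
  if n is m.+1 then
    forall Y, cof X Y ->
      exists x, [/\ Y x, `|x| = 1 & asymptotic_game m P (rcons s x)]
  else P s.

Definition monotone_basic (V : normedModType R) (n : nat) (e : 'I_n -> V) : Prop :=
  forall (a : 'I_n -> R) (k : nat),
    `|\sum_(i < n | (i < k)%N) a i *: e i| <= `|\sum_i a i *: e i|.

Definition equivalent_to (C : R) (V : normedModType R) (n : nat) (e : 'I_n -> V)
    (s : seq X) : Prop :=
  forall a : 'I_n -> R,
    C^-1 * `|\sum_i a i *: e i| <= `|\sum_i a i *: s`_i| <=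
    C * `|\sum_i a i *: e i|.

Definition asymptotic_structure (n : nat) (V : normedModType R) (e : 'I_n -> V) :
    Prop :=
  [/\ is_basis e, forall i, `|e i| = 1, monotone_basic e &
    forall eps, 0 < eps -> asymptotic_game n (equivalent_to (1 + eps) e) [::]].

End asymptotic_structure.

(* l_p norm of (a_0, ..., a_{n-1}), for 1 <= p <= +oo *)
Definition lp_norm {R : realType} (p : \bar R) (n : nat) (a : nat -> R) : R :=
  match p with
  | r%:E => (\sum_(i < n) `|a i| `^ r) `^ r^-1
  | +oo%E => \big[Num.max/0]_(i < n) `|a i|
  | -oo%E => 0
  end.

Section trees.
Context {R : realType} {V : normedModType R}.

(* A tree is a function on finite sequences, of which only the values at the  *)
(* nonempty strictly increasing ones matter.                                   *)
Definition in_Tinf (s : seq nat) : bool := (s != [::]) && sorted ltn s.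

Definition tree_in_sphere (x : seq nat -> V) : Prop :=
  forall s, in_Tinf s -> `|x s| = 1.

(* [rcons s n] is in T_oo as soon as n exceeds the last entry of s, so the    *)
(* remaining terms of the node do not affect the limit.                        *)
Definition tree_nodes (null : (nat -> V) -> Prop) (x : seq nat -> V) : Prop :=
  forall s, sorted ltn s -> null (fun n => x (rcons s n)).

Definition is_branch (x : seq nat -> V) (b : nat -> V) : Prop :=
  exists2 m : nat -> nat, {homo m : i j / (i < j)%N} &
    forall i, b i = x (mkseq m i.+1).

Definition lower_estimate (p : \bar R) (C : R) (b : nat -> V) : Prop :=
  forall n (a : nat -> R), C^-1 * lp_norm p n a <= `|\sum_(i < n) a i *: b i|.

Definition upper_estimate (q : \bar R) (C : R) (b : nat -> V) : Prop :=
  forall n (a : nat -> R), `|\sum_(i < n) a i *: b i| <= C * lp_norm q n a.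

Definition tree_estimates (null : (nat -> V) -> Prop) (p q : \bar R) : Prop :=
  exists2 C : R, 0 < C &
    forall x, tree_in_sphere x -> tree_nodes null x ->
      (exists2 b, is_branch x b & lower_estimate p C b) /\
      (exists2 b, is_branch x b & upper_estimate q C b).

End trees.

Definition weak_tree_estimates {R : realType} (X : normedModType R) :=
  tree_estimates (@weakly_null R X).

Definition wstar_tree_estimates {R : realType} (X : normedModType R) :=
  tree_estimates (@wstar_null R X).

Section FDD.
Context {R : realType} {Z : completeNormedModType R} (E : nat -> set Z).

Definition fdd_expansion (z : Z) (u : nat -> Z) : Prop :=
  (forall i, E i (u i)) /\ series u @ \oo --> z.

Definition is_FDD : Prop :=
  (forall i, is_subspace (E i) /\ fin_dim (E i)) /\
  (forall z, exists! u, fdd_expansion z u).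

Definition boundedly_complete : Prop :=
  forall u : nat -> Z, (forall i, E i (u i)) ->
    (exists M : R, forall n, `|series u n| <= M) -> cvgn (series u).

Definition fdd_coord (z : Z) : nat -> Z := get [set u | fdd_expansion z u].

(* P_I^E for the interval I = [m, n[ *)
Definition fdd_proj (m n : nat) (z : Z) : Z := \sum_(m <= i < n) fdd_coord z i.

(* c_00 of the direct sum of the E_i, seen inside Z *)
Definition fdd_c00 : set Z :=
  [set z | exists u n, (forall i, E i (u i)) /\ z = \sum_(i < n) u i].

(* The k intervals of [intervals l r k] are [l j, r j[ for j < k. On finitely *)
(* supported vectors finite families of bounded intervals suffice, and the set *)
(* below is bounded.                                                           *)
Definition intervals (l r : nat -> nat) (k : nat) : Prop :=
  forall j, (j < k)%N -> (l j < r j)%N /\ ((j.+1 < k)%N -> (r j <= l j.+1)%N).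

Definition Zp_norm (p : \bar R) (z : Z) : R :=
  sup [set s | exists l r k, intervals l r k /\
                s = lp_norm p k (fun j => `|fdd_proj (l j) (r j) z|)].

(* W, with the embedding J of c_00 of the E_i, is a completion for [Zp_norm p] *)
Definition is_Zp (p : \bar R) (W : completeNormedModType R) (J : Z -> W) : Prop :=
  [/\ forall a x y, fdd_c00 x -> fdd_c00 y -> J (a *: x + y) = a *: J x + J y,
      forall z, fdd_c00 z -> `|J z| = Zp_norm p z &
      closure (J @` fdd_c00) = setT].

(* Elements of c_00 of the E_i^*: functionals vanishing on all but finitely   *)
(* many E_i.                                                                   *)
Definition dual_c00 (W : completeNormedModType R) (J : Z -> W) : set (dual W) :=
  [set f | exists n, forall i x, (n <= i)%N -> E i x -> f (J x) = 0].

Definition Zp_wstar (W : completeNormedModType R) (J : Z -> W) : topologicalType :=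
  pairing_topology
    (fun (w : W) (f : {f : dual W | closure (dual_c00 J) f}) => proj1_sig f w : R).

End FDD.

Definition wstar_embeds_in_Zp {R : realType} (X : normedModType R) (p : \bar R)
    (Z : completeNormedModType R) (E : nat -> set Z) : Prop :=
  exists (W : completeNormedModType R) (J : Z -> W) (T : {linear dual X -> W}),
    [/\ is_Zp E p J,
        exists c C : R, [/\ 0 < c, 0 < C &
          forall f : dual X, c * `|f| <= `|T f| <= C * `|f|],
        continuous (T : wstar X -> Zp_wstar E J) &
        closed (range T : set (Zp_wstar E J))].

Section moduli.
Context {R : realType} (X : normedModType R).
Local Open Scope ereal_scope.

Definition rho_bar (t : R) : \bar R :=
  ereal_sup [set
    ereal_inf [set
      ereal_sup [set `|x + y|%:E | y in [set y | Y y /\ (`|y| <= t)%R]]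
    | Y in cof X]
  | x in [set x : X | `|x|%R = 1%R]] - 1.

Definition aus : Prop := rho_bar t * t^-1%:E @[t --> 0^'+] --> 0.

Definition aus_power_type (q : R) : Prop :=
  exists K : R, forall t : R, (0 < t)%R -> rho_bar t <= (K * t `^ q)%:E.

Definition delta_bar_star (t : R) : \bar R :=
  ereal_inf [set
    ereal_sup [set
      ereal_inf [set `|f + g|%:E | g in [set g | Y g /\ (t <= `|g|)%R]]
    | Y in wstar_cof X]
  | f in [set f : dual X | `|f|%R = 1%R]] - 1.

Definition wstar_auc : Prop := forall t : R, (0 < t)%R -> 0 < delta_bar_star t.

Definition delta_power_type (p : R) : Prop :=
  exists2 K : R, (0 < K)%R &
    forall t : R, (0 < t <= 1)%R -> (K * t `^ p)%:E <= delta_bar_star t.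

Definition wstar_UKK_with (delta : R -> R) : Prop :=
  forall eps : R, (0 < eps)%R -> (0 < delta eps)%R /\
    forall (u : nat -> dual X) (f : dual X),
      (forall n, `|u n| <= 1)%R -> wstar_cvg u f ->
      eps%:E <= limn_einf (fun n => `|u n - f|%:E) ->
      (`|f| <= 1 - delta eps)%R.

Definition wstar_UKK : Prop := exists delta, wstar_UKK_with delta.

End moduli.

Definition can_be_renormed {R : realType} (X : completeNormedModType R)
    (P : completeNormedModType R -> Prop) : Prop :=
  exists N : equiv_norm X, P (renorm N).

(* Main.v *)
Require Import Defs.
From HB Require Import structures.
From mathcomp Require Import all_boot all_order all_algebra.
From mathcomp Require Import all_classical all_reals all_analysis.
From mathcomp Require Import lra ring zify.

(* For an equivalent norm N let A_t f (x) be the value of the game in which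
   one player picks a finite codimensional subspace, the other a vector y of
   it with N y <= t, and the outcome is f (x + y). Each of (1), (2), (3), (8)
   forces (A_1^k N) 0 < k for some k > 1: otherwise, for every n, the second
   player can keep the norm of a sum of n unit vectors close to n, and this
   produces an element of {X}_n (a limit of plays along an ultrafilter), a
   weakly null tree, or functionals surviving all finite Szlenk derivations.
   Conversely (A_1^k N) 0 < k propagates geometrically to smaller t; averaging
   the iterates at each scale and gluing them by a gauge gives a norm which is
   a.u.s. of power type, that is (6). For such a norm, the sup of a functional
   over the spans of a sequence of vectors chosen far enough in X increases by
   a power of its value at each new vector; telescoping gives the upper
   estimates of (2), (3), the moduli of (9), (11), and the upper bound for the
   embedding (5), which restricts functionals to finite dimensional blocks of
   X. Finally (5) gives (4) by perturbing branches to block sequences, and (4),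
   (10), (12) make finitely many Szlenk derivations exhaust the ball. *)

Set Implicit Arguments.
Unset Strict Implicit.
Unset Printing Implicit Defensive.

Import Order.TTheory GRing.Theory Num.Theory.
Import numFieldNormedType.Exports.

Local Open Scope classical_set_scope.
Local Open Scope ring_scope.

(** * Hahn-Banach, finite rank operators and finite codimensional subspaces *)

Section hahn_banach.
Context {R : realType} {V : lmodType R}.

(** The game is local: the subspace answering a point depends on that point. Uniformity is recovered
    through finite nets, of balls of finite dimensional spans or with respect to finitely many
    functionals, and through the slack kept in the constants. Geometric decay comes from counting a
    run of moves of size [t] as a single move of size [r] as soon as their sum can be kept below
    [r]: a strict gain at one scale is inherited by all smaller ones. The iterates of A_t are
    convex, even and 1-Lipschitz but not homogeneous, so sublevel sets rather than functions are
    combined into a unit ball. Exponents are then replaced by a natural number [P] and slopes by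
    powers of 1/2, so that integer powers and telescoping sums suffice. The space of (5) is a space
    of sequences of linear forms whose norm is already its own Z_P norm; the operator from X^* is
    bounded by telescoping, and it is bounded below with closed range because vectors of X lift to
    paths with controlled partial sums. The existence of a renorming of power type is the hub to
    which all statements are tied. *)

Definition seminorm (p : V -> R) : Prop :=
  (forall x y, p (x + y) <= p x + p y) /\ (forall a x, p (a *: x) = `|a| * p x).

(** Partial linear functionals are kept as graphs, so that Zorn's lemma applies to sets ordered by
    inclusion; single-valuedness will come from domination by a seminorm. *)
Definition graph_subspace (G : set (V * R)) : Prop :=
  G (0, 0) /\ forall t x a y b, G (x, a) -> G (y, b) -> G (t *: x + y, t * a + b).

Lemma seminorm0 (p : V -> R) : seminorm p -> p 0 = 0.
Proof. by move=> [_ pZ]; rewrite -(scale0r (0 : V)) pZ normr0 mul0r. Qed.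

Lemma seminormN (p : V -> R) x : seminorm p -> p (- x) = p x.
Proof. by move=> [_ pZ]; rewrite -scaleN1r pZ normrN1 mul1r. Qed.

Lemma seminorm_ge0 (p : V -> R) x : seminorm p -> 0 <= p x.
Proof.
move=> ps; have := ps.1 x (- x); rewrite subrr (seminorm0 ps) (seminormN _ ps).
lra.
Qed.

Lemma graph_extension (p : V -> R) (G : set (V * R)) (x0 : V) : seminorm p ->
  graph_subspace G -> (forall x a, G (x, a) -> a <= p x) ->
  exists c, forall x a t, G (x, a) -> a + t * c <= p (x + t *: x0).
Proof.
move=> ps [G0 GD] Gp; have [pD pZ] := ps.
(* Any value between the numbers [a - p (x - x0)] and the numbers [p (x + x0) - a] is admissible at
   [x0]; the supremum of the former is taken. *)
pose S := [set s | exists2 xa, G xa & s = xa.2 - p (xa.1 - x0)].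
have SU (x : V) (a : R) : G (x, a) -> ubound S (p (x + x0) - a).
  move=> Gx s [[y b] /= Gy ->].
  have : b + a <= p (y - x0) + p (x + x0).
    apply: le_trans (pD _ _); have := GD 1 _ _ _ _ Gy Gx.
    by rewrite scale1r mul1r => /Gp; rewrite addrACA [- _ + _]addrC subrr addr0.
  lra.
have Sne : S !=set0 by exists (0 - p (0 - x0)), (0, 0).
have Ssup : has_sup S by split => //; exists (p (0 + x0) - 0); exact: SU.
have lb x a : G (x, a) -> a - p (x - x0) <= sup S.
  by move=> Gx; apply: sup_upper_bound => //; exists (x, a).
have ub x a : G (x, a) -> sup S <= p (x + x0) - a.
  by move=> Gx; apply: ge_sup => //; exact: SU.
exists (sup S) => x a t Gx.
have GZ s : G (s *: x, s * a).
  by have := GD s _ _ _ _ Gx G0; rewrite !addr0.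
have [t0|t0|->] := ltgtP t 0; last by rewrite mul0r scale0r !addr0; exact: Gp.
  have := lb _ _ (GZ (- t^-1)).
  have -> : - t^-1 *: x - x0 = (- t^-1) *: (x + t *: x0).
    by rewrite scalerDr scalerA mulNr mulVf ?lt_eqF// scaleN1r.
  rewrite pZ normrN ltr0_norm ?invr_lt0// => h.
  have h2 := ler_wpM2l (ltW (_ : 0 < - t)) h.
  have := h2 _; rewrite oppr_gt0 => /(_ t0); rewrite mulrBr.
  have -> : - t * (- t^-1 * a) = a by rewrite mulrA mulrNN divff ?mul1r// lt_eqF.
  have -> : - t * (- t^-1 * p (x + t *: x0)) = p (x + t *: x0).
    by rewrite mulrA mulrNN divff ?mul1r// lt_eqF.
  lra.
have := ub _ _ (GZ t^-1).
have -> : t^-1 *: x + x0 = t^-1 *: (x + t *: x0).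
  by rewrite scalerDr scalerA mulVf ?gt_eqF// scale1r.
rewrite pZ gtr0_norm ?invr_gt0// => h.
have := ler_wpM2l (ltW t0) h; rewrite mulrBr !mulrA divff ?gt_eqF// !mul1r.
lra.
Qed.

Theorem hahn_banach (p : V -> R) (G0 : set (V * R)) : seminorm p ->
  graph_subspace G0 -> (forall x a, G0 (x, a) -> a <= p x) ->
  exists g : V -> R, [/\ forall t x y, g (t *: x + y) = t * g x + g y,
    forall x, `|g x| <= p x & forall x a, G0 (x, a) -> g x = a].
Proof.
move=> ps G0s G0p.
pose good (G : set (V * R)) :=
  [/\ graph_subspace G, forall x a, G (x, a) -> a <= p x & G0 `<=` G].
have good0 : good G0 by split.
have [|A [PA maxA]] := @Zorn_bigcup _ [set G | G = set0 \/ good G].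
  move=> F FP Ftot.
  have [[G FG Gne]|Fe] := pselect (exists2 G, F G & good G); last first.
    left; rewrite -subset0 => x [G FG Gx]; have [G_0|gG] := FP _ FG.
      by rewrite -G_0.
    by exfalso; apply: Fe; exists G.
  right; case: Gne => -[G00 _] _ G0G; split => //.
  - split; first by exists G.
    move=> t x a y b [G1 FG1 G1x] [G2 FG2 G2y].
    have gd (H : set (V * R)) z : F H -> H z -> good H.
      by move=> FH Hz; have [H0|//] := FP _ FH; rewrite H0 in Hz.
    have [G12|G21] := Ftot _ _ FG1 FG2.
      exists G2 => //; have [[_ GD] _ _] := gd _ _ FG2 G2y.
      by apply: GD => //; exact: G12.
    exists G1 => //; have [[_ GD] _ _] := gd _ _ FG1 G1x.
    by apply: GD => //; exact: G21.
  - move=> x a [H FH Hx]; have [H0|[_ + _]] := FP _ FH; first by rewrite H0 in Hx.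
    exact.
  - by move=> z /G0G Gz; exists G.
have gA : good A.
  case: PA => // A0; exfalso; apply: (maxA G0); last by right.
  by rewrite A0; split => // /(_ (0, 0)); apply; case: G0s.
case: gA => As Ap G0A; have [A0 AD] := As.
have dom x0 : exists a, A (x0, a).
  have [c cP] := graph_extension x0 ps As Ap.
  pose B := [set z | exists x a t, [/\ A (x, a), z.1 = x + t *: x0 & z.2 = a + t * c]].
  apply: contrapT => nx0; apply: (maxA B).
    split; first by move=> [x a] Axa; exists x, a, 0; rewrite scale0r mul0r !addr0.
    move=> BA; apply: nx0; exists c; apply: BA; exists 0, 0, 1.
    by rewrite scale1r mul1r !add0r.
  right; split.
  - split; first by exists 0, 0, 0; rewrite scale0r mul0r !addr0.
    move=> t x a y b [x1 [a1 [t1 /= [A1 -> ->]]]] [x2 [a2 [t2 /= [A2 -> ->]]]].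
    exists (t *: x1 + x2), (t * a1 + a2), (t * t1 + t2); split => /=; first exact: AD.
      by rewrite scalerDr scalerDl scalerA addrACA.
    by ring.
  - by move=> _ _ [x [a [t /= [Ax -> ->]]]]; exact: cP.
  - move=> [x a] /G0A Axa; exists x, a, 0.
    by rewrite scale0r mul0r !addr0.
have [g gP] := choice dom.
have zero a : A (0, a) -> a = 0.
  move=> Aa; apply/eqP; rewrite eq_le -[a <= 0]/(a <= 0) -{1}(seminorm0 ps) Ap//=.
  have := AD (- 2) _ _ _ _ Aa Aa; rewrite scaler0 addr0 => /Ap.
  rewrite (seminorm0 ps); lra.
have uniq x a : A (x, a) -> g x = a.
  move=> Aa; have := AD (- 1) _ _ _ _ Aa (gP x).
  by rewrite scaleN1r addNr => /zero; lra.
exists g; split; last by move=> x a /G0A /uniq.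
  by move=> t x y; apply: uniq; exact: AD.
move=> x; rewrite ler_norml (Ap _ _ (gP x)) andbT lerNl.
have := AD (- 1) _ _ _ _ (gP x) A0; rewrite addr0 scaleN1r addr0 mulN1r => /Ap.
by rewrite (seminormN _ ps).
Qed.

End hahn_banach.

Section dual_basics.
Context {R : realType} {X : normedModType R}.
Implicit Types (f g : dual X) (x y : X).

Lemma dualD f g x : (f + g) x = f x + g x. Proof. by []. Qed.

Lemma dualB f g x : (f - g) x = f x - g x. Proof. by []. Qed.

Lemma dualN f x : (- f) x = - f x. Proof. by []. Qed.

Lemma dualZ (a : R) f x : (a *: f) x = a * f x. Proof. by []. Qed.

Lemma dual0 x : (0 : dual X) x = 0. Proof. by []. Qed.

Lemma duD f x y : f (x + y) = f x + f y :> R. Proof. exact: linearD. Qed.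

Lemma duB f x y : f (x - y) = f x - f y :> R. Proof. exact: linearB. Qed.

Lemma duN f x : f (- x) = - f x :> R. Proof. exact: linearN. Qed.

Lemma duZ (a : R) f x : f (a *: x) = a * f x :> R. Proof. exact: linearZ. Qed.

Lemma du0 f : f 0 = 0 :> R. Proof. exact: linear0. Qed.

Lemma du_sum (I : Type) (s : seq I) f (F : I -> X) :
  f (\sum_(i <- s) F i) = \sum_(i <- s) (f (F i) : R) :> R.
Proof. exact: linear_sum. Qed.

Lemma dual_sum (I : Type) (s : seq I) (F : I -> dual X) x :
  (\sum_(i <- s) F i) x = \sum_(i <- s) F i x.
Proof.
elim: s => [|i s IH]; first by rewrite !big_nil.
by rewrite !big_cons dualD IH.
Qed.

Lemma dualP f x : `|f x| <= `|f| * `|x|.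
Proof.
have [->|x0] := eqVneq x 0; first by rewrite linear0 !normr0 mulr0.
have n0 : 0 < `|x| by rewrite normr_gt0.
have : `|f (`|x|^-1 *: x)| <= `|f|.
  by apply: le_dual_norm; rewrite normrZ normfV normr_id mulVf// gt_eqF.
by rewrite linearZ normrZ normfV normr_id mulrC ler_pdivrMr.
Qed.

Lemma dual_le f (M : R) : 0 <= M -> (forall x, `|f x| <= M * `|x|) -> `|f| <= M.
Proof.
move=> M0 fM; apply: dual_norm_le => x x1; apply: le_trans (fM x) _.
by rewrite -[leRHS]mulr1 ler_wpM2l.
Qed.

Lemma mk_dual (g : X -> R) (M : R) :
  (forall t x y, g (t *: x + y) = t * g x + g y) -> (forall x, `|g x| <= M * `|x|) ->
  exists f, (forall x, f x = g x) /\ `|f| <= `|M|.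
Proof.
move=> gl gM.
have gl' : linear (g : X -> R^o) by move=> t x y; exact: gl.
pose G := GRing.isLinear.Build R X R^o *:%R (g : X -> R^o) gl'.
pose g' : {linear X -> R^o} := HB.pack (g : X -> R^o) G.
have gc : continuous (g : X -> R^o).
  have : continuous g'.
    apply: bounded_linear_continuous; apply/linear_boundedP.
    exists `|M|; split; first exact: normr_real.
    move=> r Mr x; apply: le_trans (gM x) _; rewrite ler_wpM2r//.
    by rewrite (le_trans (ler_norm _))// ltW.
  by [].
have gm : (g : X -> R^o) \in (@continuous_linear R X) by rewrite inE.
exists (Dual gm); split => //; apply: dual_le => // x.
by apply: le_trans (gM x) _; rewrite ler_wpM2r// ler_norm.
Qed.

Lemma norm_seminorm (M : R) : 0 <= M -> seminorm (fun x => M * `|x|).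
Proof.
move=> M0; split=> [x y|a x]; first by rewrite -mulrDr ler_wpM2l// ler_normD.
by rewrite normrZ mulrCA.
Qed.

Lemma dual_extension (G0 : set (X * R)) (M : R) : 0 <= M -> graph_subspace G0 ->
  (forall x a, G0 (x, a) -> a <= M * `|x|) ->
  exists f, (forall x a, G0 (x, a) -> f x = a) /\ `|f| <= M.
Proof.
move=> M0 Gs GM; have [g [gl gM gG]] := hahn_banach (norm_seminorm M0) Gs GM.
have [f [fg fM]] := mk_dual gl gM; exists f; split; last by rewrite -(ger0_norm M0).
by move=> x a /gG; rewrite fg.
Qed.

Lemma norming x : exists f, `|f| <= 1 /\ f x = `|x|.
Proof.
pose G := [set z : X * R | exists t, z = (t *: x, t * `|x|)].
have [||z a [t [-> ->]]|f [fG f1]] := @dual_extension G 1 => //.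
- split; first by exists 0; rewrite scale0r mul0r.
  move=> t _ _ _ _ [a [-> ->]] [b [-> ->]]; exists (t * a + b).
  by rewrite scalerDl scalerA mulrDl mulrA.
- by rewrite mul1r normrZ ler_wpM2r// ler_norm.
exists f; split => //; apply: fG; exists 1; by rewrite scale1r mul1r.
Qed.

Lemma closed_dist (Y : set X) x : closed Y -> ~ Y x ->
  exists2 d : R, 0 < d & forall y, Y y -> d <= `|x - y|.
Proof.
move=> cY nY; apply: contrapT => nd; apply: nY; apply: cY => B.
move=> /nbhs_normP[e e0 eB]; apply: contrapT => YB; apply: nd.
exists e => // y Yy; rewrite leNgt; apply/negP => xy; apply: YB; exists y; split => //.
exact: eB.
Qed.

Lemma closedP_dist (Y : set X) :
  (forall x, (forall e : R, 0 < e -> exists2 y, Y y & `|x - y| < e) -> Y x) -> closed Y.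
Proof.
move=> h x clx; apply: h => e e0.
have /clx [y [Yy /= xy]] : nbhs x [set y | `|x - y| < e] by apply/nbhs_normP; exists e.
by exists y.
Qed.

Lemma separation (Y : set X) r : is_subspace Y -> closed Y -> ~ Y r ->
  exists f, (forall y, Y y -> f y = 0) /\ f r = 1.
Proof.
move=> [Y0 YD] cY nr; have [d d0 dY] := closed_dist cY nr.
pose G := [set z : X * R | exists2 y, Y y & z.1 = y + z.2 *: r].
have [||z a [y Yy /= ->]|f [fG _]] := @dual_extension G d^-1.
- by rewrite invr_ge0 ltW.
- split; first by exists 0; rewrite //= scale0r addr0.
  move=> t x a y b [x1 Y1 /= ->] [x2 Y2 /= ->]; exists (t *: x1 + x2); first exact: YD.
  by rewrite scalerDr scalerA scalerDl addrACA.
- have [->|a0] := eqVneq a 0; first by rewrite mulr_ge0// invr_ge0 ltW.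
  rewrite mulrC ler_pdivlMr// (le_trans (ler_norm _))// normrM (gtr0_norm d0).
  have -> : y + a *: r = a *: (r - (- a^-1 *: y)).
    by rewrite scaleNr opprK scalerDr scalerA divff// scale1r addrC.
  rewrite normrZ ler_wpM2l// dY//; have := YD (- a^-1) _ _ Yy Y0; by rewrite addr0.
exists f; split=> [y Yy|]; first by apply: fG; exists y; rewrite //= scale0r addr0.
by apply: fG; exists 0 => //=; rewrite scale1r add0r.
Qed.

End dual_basics.

Section finite_rank.
Context {R : realType} {X : normedModType R}.
Implicit Types (f g : dual X) (x y v : X) (L : seq (dual X)) (l : seq (dual X * X)).

(** These kernels stand for closed finite codimensional subspaces: each of them is one
    ([cof_of_kerl]), every such subspace contains one ([cof_kerl]), and intersecting becomes
    concatenating lists. *)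
Definition kerl L : set X := [set x | forall f, f \in L -> f x = 0].

Definition fr l x : X := \sum_(p <- l) p.1 x *: p.2.

Fixpoint lspan (b : seq X) : set X :=
  if b is v :: b' then [set x | exists t y, lspan b' y /\ x = t *: v + y]
  else [set 0].

Lemma kerl_subspace L : is_subspace (kerl L).
Proof.
split=> [f _|a x y Lx Ly f fL]; first by rewrite du0.
by rewrite duD duZ (Lx _ fL) (Ly _ fL) mulr0 addr0.
Qed.

Lemma kerl_cat L1 L2 x : kerl (L1 ++ L2) x <-> kerl L1 x /\ kerl L2 x.
Proof.
split=> [h|[h1 h2] f]; last by rewrite mem_cat => /orP[/h1|/h2].
by split=> f fL; apply: h; rewrite mem_cat fL ?orbT.
Qed.

Lemma kerl_cons f L x : kerl (f :: L) x <-> f x = 0 /\ kerl L x.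
Proof.
split=> [h|[h1 h2] g]; last by rewrite inE => /predU1P[->|/h2].
by split=> [|g gL]; apply: h; rewrite inE ?eqxx// gL orbT.
Qed.

Lemma kerlN L x : kerl L x -> kerl L (- x).
Proof.
move=> Lx; have [K0 KD] := kerl_subspace L.
by have := KD (-1) _ _ Lx K0; rewrite addr0 scaleN1r.
Qed.

Lemma kerlZ L a x : kerl L x -> kerl L (a *: x).
Proof.
by move=> Lx; have [K0 KD] := kerl_subspace L; rewrite -[a *: x]addr0; exact: KD.
Qed.

Lemma kerlD L x y : kerl L x -> kerl L y -> kerl L (x + y).
Proof.
by move=> Lx Ly; have [K0 KD] := kerl_subspace L; rewrite -[x]scale1r; exact: KD.
Qed.

Lemma kerl_closed L : closed (kerl L).
Proof.
apply: closedP_dist => x h f fL; apply/eqP; rewrite -normr_le0.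
apply/ler_addgt0Pr => e e0; rewrite add0r.
have [y /(_ _ fL) fy xy] := h (e / (1 + `|f|)) (divr_gt0 e0 (ltr_wpDr (normr_ge0 _) ltr01)).
have -> : f x = f (x - y) by rewrite duB fy subr0.
apply: le_trans (dualP _ _) _; move: xy; rewrite ltr_pdivlMr ?ltr_wpDr// => xy.
have := normr_ge0 (x - y); lra.
Qed.

Lemma frD l x y : fr l (x + y) = fr l x + fr l y.
Proof.
by rewrite /fr -big_split; apply: eq_bigr => p _; rewrite duD scalerDl.
Qed.

Lemma frZ l a x : fr l (a *: x) = a *: fr l x.
Proof.
by rewrite /fr scaler_sumr; apply: eq_bigr => p _; rewrite duZ scalerA.
Qed.

Lemma fr0 l : fr l 0 = 0.
Proof. by have := frZ l 0 0; rewrite !scale0r. Qed.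

Lemma frN l x : fr l (- x) = - fr l x.
Proof. by rewrite -scaleN1r frZ scaleN1r. Qed.

Lemma frB l x y : fr l (x - y) = fr l x - fr l y.
Proof. by rewrite frD frN. Qed.

Lemma fr_cons p l x : fr (p :: l) x = p.1 x *: p.2 + fr l x.
Proof. by rewrite /fr big_cons. Qed.

Lemma fr_bound l : exists2 M : R, 0 < M & forall x, `|fr l x| <= M * `|x|.
Proof.
elim: l => [|p l [M M0 IH]].
  by exists 1 => // x; rewrite /fr big_nil normr0 mul1r.
exists (M + `|p.1| * `|p.2|) => [|x]; first by rewrite ltr_wpDr ?mulr_ge0.
rewrite fr_cons (le_trans (ler_normD _ _))// mulrDl addrC lerD// normrZ.
by rewrite mulrAC ler_wpM2r// dualP.
Qed.

Lemma fr_vanish l x : (forall p, p \in l -> p.1 x = 0) -> fr l x = 0.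
Proof. by move=> h; rewrite /fr big_seq big1// => p /h ->; rewrite scale0r. Qed.

Lemma dual_comp_fr f l : exists g, forall x, g x = f (x - fr l x).
Proof.
exists (f - \sum_(p <- l) f p.2 *: p.1) => x.
rewrite duB dualB dual_sum /fr du_sum; congr (_ - _).
by apply: eq_bigr => p _; rewrite duZ dualZ mulrC.
Qed.

(** Each functional not yet vanishing on the kernel adds one rank-one term. The result turns small
    values on finitely many functionals into a nearby vector lying exactly in the kernel. *)
Lemma kerl_projection L : exists l, (forall x, kerl L (x - fr l x)) /\
  forall p, p \in l -> forall x, kerl L x -> p.1 x = 0.
Proof.
elim: L => [|f L [l [lL l0]]]; first by exists [::].
have [fL|] := pselect (forall v, kerl L v -> f v = 0).
  exists l; split=> [x|p pl x /kerl_cons[_]]; last exact: l0.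
  by apply/kerl_cons; split => //; exact: fL.
move=> /existsNP[v /not_implyP[Lv fv]].
have [g gE] := dual_comp_fr ((f v)^-1 *: f) l.
exists ((g, v) :: l); split=> [x|p].
  rewrite fr_cons /= opprD addrA addrAC; apply/kerl_cons; split.
    by rewrite duB duZ gE dualZ mulrAC mulVf ?mul1r ?subrr//; exact/eqP.
  by apply: kerlD => //; apply/kerlN/kerlZ.
rewrite inE => /predU1P[-> x /kerl_cons[fx Lx]|/l0 h x /kerl_cons[_]]; last exact: h.
by rewrite /= gE fr_vanish ?subr0 ?dualZ ?fx ?mulr0// => q /l0; exact.
Qed.

Lemma lspan_subspace b : is_subspace (lspan b).
Proof.
elim: b => [|v b [b0 bD]] /=; first by split=> // a x y -> ->; rewrite scaler0 addr0.
split; first by exists 0, 0; rewrite scale0r addr0.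
move=> a _ _ [t [x [bx ->]]] [u [y [bY ->]]].
exists (a * t + u), (a *: x + y); split; first exact: bD.
by rewrite scalerDr scalerDl scalerA addrACA.
Qed.

Lemma lspan0 b : lspan b 0. Proof. by case: (lspan_subspace b). Qed.

Lemma lspanZ b a x : lspan b x -> lspan b (a *: x).
Proof. by move=> bx; rewrite -[a *: x]addr0; apply: (lspan_subspace b).2 => //; exact: lspan0. Qed.

Lemma lspanD b x y : lspan b x -> lspan b y -> lspan b (x + y).
Proof. by move=> bx; rewrite -[x]scale1r; exact: (lspan_subspace b).2. Qed.

Lemma lspanN b x : lspan b x -> lspan b (- x).
Proof. by rewrite -scaleN1r; exact: lspanZ. Qed.

Lemma lspanB b x y : lspan b x -> lspan b y -> lspan b (x - y).
Proof. by move=> bx /lspanN; exact: lspanD. Qed.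

Lemma lspan_sum b (I : eqType) (s : seq I) (F : I -> X) :
  (forall i, i \in s -> lspan b (F i)) -> lspan b (\sum_(i <- s) F i).
Proof.
elim: s => [_|i s IH h]; first by rewrite big_nil; exact: lspan0.
rewrite big_cons; apply: lspanD; first by apply: h; rewrite inE eqxx.
by apply: IH => j js; apply: h; rewrite inE js orbT.
Qed.

Lemma lspan_cons v b x : lspan b x -> lspan (v :: b) x.
Proof. by exists 0, x; rewrite scale0r add0r. Qed.

Lemma lspan_mem b v : v \in b -> lspan b v.
Proof.
elim: b => // w b IH; rewrite inE => /predU1P[->|/IH]; last exact: lspan_cons.
by exists 1, 0; split; [exact: lspan0|rewrite scale1r addr0].
Qed.

Lemma lspan_sub b (Y : set X) : is_subspace Y -> (forall v, v \in b -> Y v) ->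
  lspan b `<=` Y.
Proof.
move=> Ys; have [Y0 YD] := Ys; elim: b => [_ x -> //|v b IH h x [t [y [byy ->]]]].
apply: YD; first by apply: h; rewrite inE eqxx.
by apply: IH byy => w wb; apply: h; rewrite inE wb orbT.
Qed.

Lemma lspan_catl b c x : lspan b x -> lspan (b ++ c) x.
Proof.
apply: lspan_sub; first exact: lspan_subspace.
by move=> v vb; apply: lspan_mem; rewrite mem_cat vb.
Qed.

Lemma lspan_catr b c x : lspan c x -> lspan (b ++ c) x.
Proof.
apply: lspan_sub; first exact: lspan_subspace.
by move=> v vb; apply: lspan_mem; rewrite mem_cat vb orbT.
Qed.

Lemma fr_lspan l b x : (forall p, p \in l -> lspan b p.2) -> lspan b (fr l x).
Proof. by move=> h; apply: lspan_sum => p /h; exact: lspanZ. Qed.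

(** Gaussian elimination modulo [Y]: a vector of [b] whose residue is outside [Y] contributes the
    functional separating this residue from [Y]. [Y = 0] yields a projection onto [lspan b]; a
    complement [b] of a finite codimensional [Y] yields a projection along [Y]. *)
Lemma projection_modulo (Y : set X) (b : seq X) : is_subspace Y -> closed Y ->
  exists l, [/\ forall p, p \in l -> lspan b p.2,
    forall p, p \in l -> forall y, Y y -> p.1 y = 0 &
    forall x, lspan b x -> Y (x - fr l x)].
Proof.
move=> Ys cY; have [Y0 YD] := Ys.
have YDD x y : Y x -> Y y -> Y (x + y) by move=> Yx Yy; rewrite -[x]scale1r; exact: YD.
have YZ a x : Y x -> Y (a *: x) by move=> Yx; rewrite -[a *: x]addr0; exact: YD.
elim: b => [|v b [l [lb lY lr]]].
  by exists [::]; split => // x ->; rewrite fr0 subr0.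
have [Yv|Yv] := pselect (Y (v - fr l v)).
  exists l; split => // [p /lb|_ [t [x [bx ->]]]]; first exact: lspan_cons.
  by rewrite frD frZ opprD addrACA -scalerBr; apply: YD => //; exact: lr.
have [h [hY hv]] := separation Ys cY Yv.
have [g gE] := dual_comp_fr h l.
have gY y : Y y -> g y = 0.
  by move=> Yy; rewrite gE fr_vanish ?subr0 ?hY// => p /lY; exact.
have gb x : lspan b x -> g x = 0 by move=> /lr; rewrite gE; exact: hY.
have gv : g v = 1 by rewrite gE.
exists ((g, v - fr l v) :: l); split=> [p|p|].
- rewrite inE => /predU1P[->|/lb]; last exact: lspan_cons.
  apply: lspanB; first by apply: lspan_mem; rewrite inE eqxx.
  by apply: lspan_cons; exact: fr_lspan.
- by rewrite inE => /predU1P[-> y /gY|/lY].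
- move=> _ [t [x [bx ->]]].
  rewrite fr_cons /= duD duZ gv (gb _ bx) addr0 mulr1 frD frZ.
  have -> : t *: v + x - (t *: (v - fr l v) + (t *: fr l v + fr l x)) = x - fr l x.
    by rewrite scalerBr addrA subrK opprD addrACA subrr add0r.
  exact: lr.
Qed.

Lemma lspan_projection b : exists l, (forall p, p \in l -> lspan b p.2) /\
  forall x, lspan b x -> fr l x = x.
Proof.
have [||l [lb _ lr]] := @projection_modulo [set 0] b.
- by split => // a x y -> ->; rewrite scaler0 addr0.
- apply: closedP_dist => x h; apply/eqP; rewrite -normr_le0; apply/ler_addgt0Pr => e.
  by move=> /h [_ -> /ltW]; rewrite subr0 add0r.
- by exists l; split => // x /lr /= /eqP; rewrite subr_eq0 => /eqP.
Qed.

Lemma cof_projection (Y : set X) : is_subspace Y -> fin_codim Y -> closed Y ->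
  exists l, (forall p, p \in l -> forall y, Y y -> p.1 y = 0) /\
    forall x, Y (x - fr l x).
Proof.
move=> Ys [n [b bY]] cY; have [Y0 YD] := Ys.
have [l [_ lY lr]] := projection_modulo [seq b i | i <- enum 'I_n] Ys cY.
exists l; split => // x; have [y Yy [a ->]] := bY x.
rewrite frD (fr_vanish (x := y)) => [|p /lY]; last exact.
rewrite add0r -addrA -[y]scale1r; apply: YD => //; apply: lr.
by apply: lspan_sum => i _; apply/lspanZ/lspan_mem/map_f; rewrite mem_enum.
Qed.

Lemma cof_kerl (Y : set X) : cof X Y -> exists L, kerl L `<=` Y.
Proof.
move=> [Ys Yf cY]; have [l [lY lr]] := cof_projection Ys Yf cY.
exists [seq p.1 | p <- l] => x Lx; have := lr x; rewrite fr_vanish ?subr0// => p pl.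
by apply: Lx; exact: map_f.
Qed.

Lemma kerl_fin_codim L : fin_codim (kerl L).
Proof.
have [l [lL _]] := kerl_projection L.
exists (size l), (fun i => (tnth (in_tuple l) i).2) => x.
exists (x - fr l x); first exact: lL.
exists (fun i => (tnth (in_tuple l) i).1 x).
by rewrite -(big_tnth _ _ _ xpredT (fun p : dual X * X => p.1 x *: p.2)) subrK.
Qed.

Lemma cof_of_kerl L : cof X (kerl L).
Proof. by split; [exact: kerl_subspace|exact: kerl_fin_codim|exact: kerl_closed]. Qed.

(** Points are sorted by the cell of width [d] containing the value of one functional, which is
    bounded on [S]; induction on [L] treats the others inside each cell. The net consists of points
    of [S] itself. *)
Lemma kerl_net L (S : set X) (M d : R) : (forall x, S x -> `|x| <= M) -> 0 < d ->
  exists zs : seq X, (forall z, z \in zs -> S z) /\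
    forall x, S x -> exists2 z, z \in zs & forall f, f \in L -> `|f (x - z)| <= d.
Proof.
move=> SM d0; elim: L S SM => [|f L IH] S SM.
  have [[x Sx]|S0] := pselect (S !=set0).
    by exists [:: x]; split=> [z|y Sy]; [rewrite inE => /eqP ->|exists x; rewrite ?inE].
  by exists [::]; split => // x Sx; exfalso; apply: S0; exists x.
have [N NP] : exists N : nat, forall x, S x -> (Num.truncn ((f x + `|f| * M) / d) < N)%N.
  exists (Num.truncn ((`|f| * M + `|f| * M) / d)).+1 => x Sx; rewrite ltnS.
  rewrite le_truncn// ler_pM2r ?invr_gt0// lerD2r.
  apply: le_trans (ler_norm _) (le_trans (dualP _ _) _).
  by rewrite ler_wpM2l// SM.
have fge x : S x -> 0 <= (f x + `|f| * M) / d.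
  move=> Sx; rewrite divr_ge0 ?(ltW d0)// -lerBlDr sub0r lerNl.
  apply: le_trans (ler_norm _) _; rewrite normrN; apply: le_trans (dualP _ _) _.
  by rewrite ler_wpM2l// SM.
have cell k : exists zs : seq X, (forall z, z \in zs -> S z) /\
    forall x, S x -> Num.truncn ((f x + `|f| * M) / d) = k ->
    exists2 z, z \in zs & forall g, g \in f :: L -> `|g (x - z)| <= d.
  have [|zs [zS zP]] := IH (S `&` [set x | Num.truncn ((f x + `|f| * M) / d) = k]).
    by move=> x [/SM].
  exists zs; split=> [z /zS[]//|x Sx xk].
  have [z zz zd] := zP x (conj Sx xk); exists z => // g.
  rewrite inE => /predU1P[->|/zd//].
  have [Sz /= zk] := zS _ zz.
  have /andP[x1 x2] := truncn_itv (fge _ Sx); have /andP[z1 z2] := truncn_itv (fge _ Sz).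
  rewrite xk in x1 x2; rewrite zk in z1 z2.
  rewrite duB ler_norml; move: x1 x2 z1 z2.
  rewrite !ler_pdivlMr// !ltr_pdivrMr// -(natr1 k) => x1 x2 z1 z2; apply/andP; split; lra.
have [zs zsP] := choice cell.
exists (flatten [seq zs k | k <- iota 0 N]); split.
  by move=> z /flattenP[_ /mapP[k _ ->]]; exact: (zsP k).1.
move=> x Sx; have [z zz zd] := (zsP _).2 x Sx erefl; exists z => //.
apply/flattenP; exists (zs (Num.truncn ((f x + `|f| * M) / d))) => //.
by apply/mapP; eexists; last reflexivity; rewrite mem_iota /= add0n; exact: NP.
Qed.

End finite_rank.

(** * Weak topologies *)

Lemma initial_cvgP (S : choiceType) (T : topologicalType) (f : S -> T) (F : set_system S)
    (s : S) : Filter F ->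
  (F --> (s : initial_topology f)) <-> (f t @[t --> F] --> f s).
Proof.
move=> FF; split=> [Fs|h A [B [[C oC CB] Bs BA]]].
  exact: cvg_comp Fs (@initial_continuous S T f s).
have FC : F (f @^-1` C) by apply: h; apply: open_nbhs_nbhs; split => //; rewrite -CB in Bs.
by apply: filterS FC => t Ct; apply: BA; rewrite -CB.
Qed.

Section pairing.
Context {R : realType} {S : choiceType} {I : Type} (b : S -> I -> R).

Lemma pairing_cvgP (T : Type) (F : set_system T) (FF : Filter F) (u : T -> S) (s : S) :
  (u : T -> pairing_topology b) @ F --> (s : pairing_topology b) <->
  forall i, b (u t) i @[t --> F] --> b s i.
Proof.
apply: iff_trans (initial_cvgP _ _ _) _.
apply: iff_trans (cvg_sup _ _ _) _.
by split=> h i; have hi := h i; [move/initial_cvgP : hi|apply/initial_cvgP].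
Qed.

Lemma pairing_closed (A : set S) :
  (forall s, (forall l : seq I, forall e : R, 0 < e ->
     exists2 t, A t & forall i, List.In i l -> `|b s i - b t i| < e) -> A s) ->
  closed (A : set (pairing_topology b)).
Proof.
move=> h s cls; apply: h => l e e0.
have : nbhs (s : pairing_topology b) [set t | forall i, List.In i l -> `|b s i - b t i| < e].
  elim: l => [|i l IH]; first by apply: filterS filterT => t _ i [].
  have := (pairing_cvgP (nbhs_filter (s : pairing_topology b)) id s).1 (fun _ h => h) i.
  move=> /cvgrPdist_lt/(_ e e0); apply: filterS2 IH => t lt it j [<-//|]; exact: lt.
by move=> /cls [t [At lt]]; exists t.
Qed.

End pairing.

Section real_limits.
Context {R : realType}.

Lemma cvgn_distP (u : nat -> R) (a : R) :
  u @ \oo --> a <-> forall e : R, 0 < e -> exists N, forall n, (N <= n)%N -> `|u n - a| < e.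
Proof.
split=> [/cvgrPdist_lt h e /h [N _ hN]|h].
  by exists N => n Nn; rewrite distrC; exact: hN.
by apply/cvgrPdist_lt => e /h [N hN]; exists N => // n /= /hN; rewrite distrC.
Qed.

Lemma ultra_bounded_cvg (T : Type) (U : set_system T) (g : T -> R) (M : R) :
  UltraFilter U -> U [set t | `|g t| <= M] -> exists l : R, g @ U --> l.
Proof.
move=> UU UM; have := @segment_compact R (- M) M; rewrite compact_ultra /=.
have UP := @ultra_proper _ U UU.
have Ug : UltraFilter (g @ U).
  split=> [|G GP gG]; first exact: fmap_proper_filter.
  apply/seteqP; split => // A GA.
  have [//|nA] := @in_ultra_setVsetC _ U (g @^-1` A) UU.
  exfalso; have : G (~` A) by apply: gG.
  move=> GnA; have : G (A `&` ~` A) by apply: filterI.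
  by rewrite setICr; exact: filter_not_empty.
move=> /(_ _ Ug)[].
  have : U (g @^-1` `[- M, M]%classic); last by [].
  by apply: filterS UM => t /= gt; rewrite in_itv /= -ler_norml.
by move=> l [_ gl]; exists l.
Qed.

(** The sets containing a tail of [A] form a proper filter since [A] is infinite. An ultrafilter
    above it takes the place of subsequence extraction. *)
Lemma infinite_ultra (A : set nat) : (forall N, exists2 n, (N <= n)%N & A n) ->
  exists U : set_system nat, [/\ UltraFilter U, U A & forall N, U [set n | (N <= n)%N]].
Proof.
move=> Ainf; pose F := [set B : set nat | exists N, forall n, (N <= n)%N -> A n -> B n].
have FF : ProperFilter F.
  split; last split.
  - by move=> [N hN]; have [n Nn An] := Ainf N; exact: hN An.
  - by exists 0%N.
  - move=> P Q [N hN] [M hM]; exists (maxn N M) => n; rewrite geq_max => /andP[Nn Mn] An.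
    by split; [exact: hN|exact: hM].
  - by move=> P Q PQ [N hN]; exists N => n Nn An; exact/PQ/hN.
have [U [UU FU]] := ultraFilterLemma FF.
exists U; split => //; first by apply: FU; exists 0%N.
by move=> N; apply: FU; exists N.
Qed.

End real_limits.

Section weak_topologies.
Context {R : realType} {X : normedModType R}.
Implicit Types (f g : dual X) (x y v : X) (L : seq (dual X)) (l : seq (dual X * X)).

Lemma wstar_cvgP (u : nat -> dual X) f :
  wstar_cvg u f <-> forall x (e : R), 0 < e ->
    exists N, forall n, (N <= n)%N -> `|u n x - f x| < e.
Proof.
split=> [/pairing_cvgP uf x|uf]; first exact: (cvgn_distP _ _).1 (uf x).
by apply/pairing_cvgP => x; exact/cvgn_distP/uf.
Qed.

Lemma weakly_nullP (u : nat -> X) :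
  weakly_null u <-> forall f (e : R), 0 < e ->
    exists N, forall n, (N <= n)%N -> `|f (u n)| < e.
Proof.
split=> [/pairing_cvgP uf f e e0|uf].
  have [N hN] := (cvgn_distP _ _).1 (uf f) e e0; exists N => n /hN.
  by rewrite du0 subr0.
apply/pairing_cvgP => f; apply/cvgn_distP => e /(uf f)[N hN]; exists N => n /hN.
by rewrite du0 subr0.
Qed.

Lemma wstar_cvg_seq (u : nat -> dual X) f (s : seq X) (e : R) : 0 < e -> wstar_cvg u f ->
  exists N, forall n, (N <= n)%N -> forall x, x \in s -> `|u n x - f x| < e.
Proof.
move=> e0 /wstar_cvgP uf; elim: s => [|x s [N hN]]; first by exists 0%N.
have [M hM] := uf x e e0; exists (maxn N M) => n; rewrite geq_max => /andP[Nn Mn] y.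
by rewrite inE => /predU1P[->|]; [exact: hM|exact: hN].
Qed.

Lemma weakly_null_seq (u : nat -> X) L (e : R) : 0 < e -> weakly_null u ->
  exists N, forall n, (N <= n)%N -> forall f, f \in L -> `|f (u n)| < e.
Proof.
move=> e0 /weakly_nullP uf; elim: L => [|f L [N hN]]; first by exists 0%N.
have [M hM] := uf f e e0; exists (maxn N M) => n; rewrite geq_max => /andP[Nn Mn] g.
by rewrite inE => /predU1P[->|]; [exact: hM|exact: hN].
Qed.

Lemma fr_small l (e : R) : 0 < e -> exists2 d, 0 < d &
  forall x, (forall p, p \in l -> `|p.1 x| <= d) -> `|fr l x| <= e.
Proof.
move=> e0; pose B := \sum_(p <- l) `|p.2|.
have B0 : 0 <= B by rewrite sumr_ge0.
have B1 : 0 < 1 + B by rewrite ltr_wpDr.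
exists (e / (1 + B)) => [|x h]; first by rewrite divr_gt0.
apply: (@le_trans _ _ (\sum_(p <- l) e / (1 + B) * `|p.2|)).
  apply: le_trans (ler_norm_sum _ _ _) _; rewrite big_seq [leRHS]big_seq.
  by apply: ler_sum => p pl; rewrite normrZ ler_wpM2r// h.
by rewrite -mulr_sumr -/B mulrAC ler_pdivrMr// ler_pM2l// lerDr.
Qed.

Lemma ultra_wstar_limit (T : Type) (U : set_system T) (u : T -> dual X) (M : R) :
  UltraFilter U -> (forall t, `|u t| <= M) ->
  exists f, `|f| <= M /\ forall x, u t x @[t --> U] --> f x.
Proof.
move=> UU uM; have UP := @ultra_proper _ U UU.
have M0 : 0 <= M by have [t _] := @filter_ex _ U UP _ filterT; exact: le_trans (uM t).
have bd t x : `|u t x| <= M * `|x|.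
  by apply: le_trans (dualP _ _) _; rewrite ler_wpM2r.
have lim x : exists a : R, u t x @[t --> U] --> a.
  apply: (@ultra_bounded_cvg _ _ _ (fun t => u t x) (M * `|x|)) => //.
  by apply: filterS filterT => t _ /=.
have [g gP] := choice lim.
have [||f [fg fM]] := @mk_dual _ X g M.
- move=> t x y; apply: (@cvg_unique _ (@Rhausdorff R) _ _ _ _ (gP (t *: x + y))).
  rewrite /=; under eq_fun do rewrite duD duZ.
  by apply: cvgD; [apply: cvgMr; exact: gP|exact: gP].
- move=> x; apply/ler_addgt0Pr => e e0; move/cvgrPdist_lt : (gP x) => /(_ _ e0) /filter_ex[t gt].
  rewrite -(subrK (u t x) (g x)) addrC (le_trans (ler_normD _ _))// lerD//.
  exact: ltW.
exists f; split; first by rewrite -(ger0_norm M0).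
by move=> x; rewrite fg; exact: gP.
Qed.

(** Weak* compactness of balls combined with a pigeonhole: the approximating indices can be kept in
    a prescribed infinite set [A], hence share any property chosen infinitely often. *)
Lemma wstar_cluster (u : nat -> dual X) (M : R) (A : set nat) :
  (forall n, `|u n| <= M) -> (forall N, exists2 n, (N <= n)%N & A n) ->
  exists f, `|f| <= M /\ forall (s : seq X) (e : R) N, 0 < e ->
    exists n, [/\ (N <= n)%N, A n & forall x, x \in s -> `|u n x - f x| < e].
Proof.
move=> uM /infinite_ultra[U [UU UA UN]]; have UP := @ultra_proper _ U UU.
have [f [fM fl]] := ultra_wstar_limit UU uM; exists f; split => // s e N e0.
have : U [set n | forall x, x \in s -> `|u n x - f x| < e].
  elim: s => [|x s IH]; first by apply: filterS filterT => n _ x.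
  move/cvgrPdist_lt : (fl x) => /(_ _ e0); apply: filterS2 IH => n ns nx y.
  by rewrite inE => /predU1P[->|]; [rewrite distrC|exact: ns].
move=> Us; have [n [nA [nN ns]]] := filter_ex (filterI UA (filterI (UN N) Us)).
by exists n.
Qed.

Lemma separable_dense_seq : separable (dual X) ->
  exists fs : nat -> dual X, forall f (e : R), 0 < e -> exists n, `|f - fs n| < e.
Proof.
move=> [D cD dD].
have ball_meet f (e : R) : 0 < e -> exists2 g, D g & `|f - g| < e.
  move=> e0; have [||g [fg Dg]] := dD (ball f e).
  - by exists f; exact: ballxx.
  - exact: ball_open.
  - by exists g => //; rewrite -ball_normE in fg.
have [D0|D0] := pselect (D !=set0); last first.
  by have [g Dg _] := ball_meet 0 1 ltr01; exfalso; apply: D0; exists g.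
move/pcard_surjP : cD => [h hs]; case: D0 => g0 Dg0.
exists h => f e e0; have [g /hs[n _ <-] fg] := ball_meet f e e0.
by exists n.
Qed.

Lemma dual_norm_attained f : exists y, `|y| <= 1 /\ `|f| / 2 <= f y.
Proof.
have [f0|f0] := eqVneq f 0.
  by exists 0; rewrite normr0 ler01 f0 normr0 mul0r du0.
have fp : 0 < `|f| by rewrite normr_gt0.
have [_ [y /= y1 <-] fy] := sup_adherent (divr_gt0 fp (ltr0n _ 2)) (dual_norm_has_sup f).
have {}fy : `|f| / 2 <= `|f y|.
  by apply: le_trans (ltW fy); rewrite -[sup _]/(`|f|); lra.
have [h|h] := leP 0 (f y); first by exists y; rewrite -(ger0_norm h).
by exists (- y); rewrite normrN duN -(ltr0_norm h).
Qed.

(** Separability descends from the dual: each [ys n] almost norms [fs n], so a functional vanishing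
    on all of them cannot be approximated by the [fs n]. *)
Lemma total_seq (fs : nat -> dual X) : (forall f (e : R), 0 < e -> exists n, `|f - fs n| < e) ->
  exists ys : nat -> X, forall x (e : R), 0 < e -> exists n y,
    lspan (mkseq ys n) y /\ `|x - y| < e.
Proof.
move=> dfs; have [ys yP] := choice (fun n => dual_norm_attained (fs n)).
exists ys; pose Y := [set x | forall e : R, 0 < e -> exists n y,
    lspan (mkseq ys n) y /\ `|x - y| < e].
have mono m n x : (m <= n)%N -> lspan (mkseq ys m) x -> lspan (mkseq ys n) x.
  move=> mn; apply: lspan_sub; first exact: lspan_subspace.
  move=> v /mapP[i]; rewrite mem_iota add0n => /andP[_ im] ->.
  by apply: lspan_mem; apply: map_f; rewrite mem_iota add0n (leq_trans im).
apply: contrapT => /existsNP[x nx].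
have [|||f [fY fx]] := @separation _ _ Y x.
- split; first by move=> e e0; exists 0%N, 0; rewrite subr0 normr0.
  move=> a y z Yy Yz e e0.
  have [m [y' [my yy]]] := Yy (e / 2 / (1 + `|a|)) (divr_gt0 (divr_gt0 e0 (ltr0n _ 2)) (ltr_wpDr (normr_ge0 _) ltr01)).
  have [n [z' [nz zz]]] := Yz (e / 2) (divr_gt0 e0 (ltr0n _ 2)).
  exists (maxn m n), (a *: y' + z'); split.
    by apply: lspanD; [apply/lspanZ/mono/my; rewrite leq_maxl|apply/mono/nz; rewrite leq_maxr].
  rewrite opprD addrACA -scalerBr; apply: le_lt_trans (ler_normD _ _) _.
  rewrite [e]splitr ler_ltD// normrZ.
  move: yy; rewrite ltr_pdivlMr ?ltr_wpDr// => yy.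
  have := normr_ge0 (y - y'); have := normr_ge0 a; nra.
- apply: closedP_dist => z hz e e0.
  have [y Yy zy] := hz (e / 2) (divr_gt0 e0 (ltr0n _ 2)).
  have [n [y' [ny yy]]] := Yy (e / 2) (divr_gt0 e0 (ltr0n _ 2)).
  exists n, y'; split => //; rewrite -(subrK y z) -addrA.
  by apply: le_lt_trans (ler_normD _ _) _; rewrite [e]splitr ltrD.
- exact: nx.
have f0 : 0 < `|f|.
  rewrite normr_gt0; apply/eqP => f0; move: fx; rewrite f0 dual0 => /eqP.
  by rewrite eq_sym oner_eq0.
(* With error [|f| / 8] one gets [fs n (ys n) >= 7/16 |f|], whereas [f (ys n) = 0] forces it below
   [|f| / 8]. *)
have [n fn] := dfs f (`|f| / 8) (divr_gt0 f0 (ltr0n _ 8)).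
have [y1 fy] := yP n.
have Yy : Y (ys n).
  move=> e e0; exists n.+1, (ys n); rewrite subrr normr0; split => //.
  by apply: lspan_mem; apply: map_f; rewrite mem_iota add0n ltnS leqnn.
have : `|(f - fs n) (ys n)| <= `|f| / 8.
  apply: le_trans (dualP _ _) _; rewrite -[leRHS]mulr1 ler_pM//.
  exact: ltW.
rewrite dualB (fY _ Yy) sub0r normrN => h.
have : `|f| <= `|fs n| + `|f| / 8.
  by rewrite -{1}(subrK (fs n) f) (le_trans (ler_normD _ _))// addrC lerD2l ltW.
have := ler_norm (fs n (ys n)); lra.
Qed.

(** The bound [M] makes the functionals equicontinuous, so convergence spreads from [ys] to its span
    and then to the closure of the span. *)
Lemma wstar_cvg_total (ys : nat -> X) (u : nat -> dual X) f (M : R) :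
  (forall x (e : R), 0 < e -> exists n y, lspan (mkseq ys n) y /\ `|x - y| < e) ->
  (forall n, `|u n| <= M) -> `|f| <= M ->
  (forall i (e : R), 0 < e -> exists N, forall n, (N <= n)%N -> `|u n (ys i) - f (ys i)| < e) ->
  wstar_cvg u f.
Proof.
move=> tot uM fM cv.
have cvs n y : lspan (mkseq ys n) y -> forall e : R, 0 < e ->
    exists N, forall k, (N <= k)%N -> `|u k y - f y| < e.
  pose Y := [set y | u k y @[k --> \oo] --> (f y : R)].
  suff h : lspan (mkseq ys n) `<=` Y by move=> /h; exact: (cvgn_distP _ _).1.
  apply: lspan_sub; last by move=> v /mapP[i _ ->]; apply/cvgn_distP; exact: cv.
  split; first by rewrite /Y /= du0; under eq_fun do rewrite du0; exact: cvg_cst.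
  move=> a x z Yx Yz; rewrite /Y /= duD duZ; under eq_fun do rewrite duD duZ.
  by apply: cvgD => //; exact: cvgMr.
have M0 : 0 <= M by exact: le_trans fM.
apply/wstar_cvgP => x e e0; have M1 : 0 < 1 + M by rewrite ltr_wpDr.
have [n [y [ny xy]]] := tot x (e / 4 / (1 + M)) (divr_gt0 (divr_gt0 e0 (ltr0n _ 4)) M1).
have [N hN] := cvs _ _ ny (e / 4) (divr_gt0 e0 (ltr0n _ 4)).
exists N => k /hN hk.
have b g : `|g| <= M -> `|g (x - y)| <= e / 4.
  move=> gM; apply: le_trans (dualP _ _) _; move: xy; rewrite ltr_pdivlMr// => xy.
  have := normr_ge0 (x - y); have := normr_ge0 g; nra.
have := b _ (uM k); have := b _ fM; rewrite !duB !ler_norml ltr_norml.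
move: hk; rewrite ltr_norml => /andP[? ?] /andP[? ?] /andP[? ?].
by apply/andP; split; lra.
Qed.

End weak_topologies.

(** * The subspace game and renormings *)

Section equivalent_norms.
Context {R : realType} {X : normedModType R} (N : equiv_norm X).

Lemma eqnorm_seminorm : seminorm N.
Proof. by split; [exact: eqnormD|exact: eqnormZ]. Qed.

Lemma eqnorm0 : N 0 = 0. Proof. exact: seminorm0 eqnorm_seminorm. Qed.

Lemma eqnormN x : N (- x) = N x. Proof. exact: seminormN eqnorm_seminorm. Qed.

Lemma eqnorm_ge0 x : 0 <= N x. Proof. exact: seminorm_ge0 eqnorm_seminorm. Qed.

Lemma eqnormB x y : N (x - y) <= N x + N y.
Proof. by rewrite -(eqnormN y); exact: eqnormD. Qed.

Lemma eqnorm_gt0 x : x != 0 -> 0 < N x.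
Proof.
move=> x0; rewrite lt_neqAle eqnorm_ge0 andbT eq_sym; apply/eqP => /eqnorm0_eq0 x0'.
by rewrite x0' eqxx in x0.
Qed.

Lemma eqnormZp (a : R) x : 0 <= a -> N (a *: x) = a * N x.
Proof. by move=> a0; rewrite eqnormZ ger0_norm. Qed.

Lemma eqnorm_sum (I : Type) (s : seq I) (F : I -> X) :
  N (\sum_(i <- s) F i) <= \sum_(i <- s) N (F i).
Proof.
elim: s => [|i s IH]; first by rewrite !big_nil eqnorm0.
by rewrite !big_cons (le_trans (eqnormD _ _ _))// lerD2l.
Qed.

End equivalent_norms.

Section game_operator.
Context {R : realType} {X : normedModType R} (N : equiv_norm X).
Implicit Types (f g : X -> R) (x y : X) (L : seq (dual X)) (t : R).

(** This bound keeps the infimum defining [Aop] finite. It is preserved by [Aop], as are [cvx] and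
    [even_fun], which make sublevel sets convex and symmetric. *)
Definition lip f := forall x y, f (x + y) <= f x + N y.

Definition cvx f := forall a x y, 0 <= a <= 1 ->
  f (a *: x + (1 - a) *: y) <= a * f x + (1 - a) * f y.

Definition even_fun f := forall x, f (- x) = f x.

(* The value at x of the one-move game: one player picks a finite codimensional *)
(* subspace, the other a vector y of it with N y <= t, and pays f (x + y).      *)
Definition Aop t f x : R :=
  inf [set b | exists L, forall y, kerl L y -> N y <= t -> f (x + y) <= b].

Lemma Aop_has_inf t f x : 0 <= t -> lip f ->
  has_inf [set b | exists L, forall y, kerl L y -> N y <= t -> f (x + y) <= b].
Proof.
move=> t0 fl; split.
  exists (f x + t), [::] => y _ yt; apply: le_trans (fl _ _) _; by rewrite lerD2l.
exists (f x) => b [L h]; rewrite -[x]addr0; apply: h; last by rewrite eqnorm0.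
by case: (kerl_subspace L).
Qed.

Lemma Aop_le t f x b L : 0 <= t -> lip f ->
  (forall y, kerl L y -> N y <= t -> f (x + y) <= b) -> Aop t f x <= b.
Proof.
by move=> t0 fl h; apply: inf_lbound; [case: (Aop_has_inf x t0 fl)|exists L].
Qed.

Lemma Aop_lt t f x b : 0 <= t -> lip f -> Aop t f x < b ->
  exists L, forall y, kerl L y -> N y <= t -> f (x + y) <= b.
Proof.
move=> t0 fl h; have [c [L cL] cb] := inf_lt (Aop_has_inf x t0 fl).1 h.
by exists L => y Ly yt; apply: le_trans (cL _ Ly yt) (ltW cb).
Qed.

Lemma Aop_ge t f x : 0 <= t -> lip f -> f x <= Aop t f x.
Proof.
move=> t0 fl; apply: lb_le_inf; first by case: (Aop_has_inf x t0 fl).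
move=> b [L h]; rewrite -[x]addr0; apply: h; last by rewrite eqnorm0.
by case: (kerl_subspace L).
Qed.

Lemma Aop_lip t f : 0 <= t -> lip f -> lip (Aop t f).
Proof.
move=> t0 fl x z; rewrite -lerBlDr; apply: lb_le_inf; first by case: (Aop_has_inf x t0 fl).
move=> b [L h]; rewrite lerBlDr; apply: (@Aop_le _ _ _ _ L) => // y Ly yt.
by rewrite addrAC; apply: le_trans (fl _ _) _; rewrite lerD2r; exact: h.
Qed.

Lemma Aop_mono t f g x : 0 <= t -> lip f -> lip g -> (forall y, f y <= g y) ->
  Aop t f x <= Aop t g x.
Proof.
move=> t0 fl gl fg; apply: lb_le_inf; first by case: (Aop_has_inf x t0 gl).
by move=> b [L h]; apply: (@Aop_le _ _ _ _ L) => // y Ly yt; exact: le_trans (fg _) (h _ Ly yt).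
Qed.

Lemma Aop_even t f : 0 <= t -> even_fun f -> even_fun (Aop t f).
Proof.
move=> t0 fe x; rewrite /Aop; congr inf; apply/seteqP; split=> b [L h]; exists L => y Ly yt.
  rewrite -fe opprD; apply: h; [exact: kerlN|by rewrite eqnormN].
rewrite -[y]opprK -opprD fe; apply: h; [exact: kerlN|by rewrite eqnormN].
Qed.

Lemma Aop_cvx t f : 0 <= t -> lip f -> cvx f -> cvx (Aop t f).
Proof.
move=> t0 fl fc a x z /andP[a0 a1].
apply/ler_addgt0Pr => e e0.
have [L1 h1] := Aop_lt t0 fl (ltr_pwDr e0 (lexx (Aop t f x))).
have [L2 h2] := Aop_lt t0 fl (ltr_pwDr e0 (lexx (Aop t f z))).
(* One and the same [y] is added to both points, so it is enough that it respect both answers. *)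
apply: (@Aop_le _ _ _ _ (L1 ++ L2)) => // y /kerl_cat[y1 y2] yt.
have -> : a *: x + (1 - a) *: z + y = a *: (x + y) + (1 - a) *: (z + y).
  by rewrite !scalerDr [RHS]addrACA -scalerDl [a + _]addrC subrK scale1r.
have ha : 0 <= a <= 1 by rewrite a0.
apply: le_trans (fc _ _ _ ha) _.
have := ler_wpM2l a0 (h1 _ y1 yt).
have a1' : 0 <= 1 - a by rewrite subr_ge0.
have := ler_wpM2l a1' (h2 _ y2 yt); nra.
Qed.

Lemma lip_N : lip N. Proof. exact: eqnormD. Qed.

Lemma cvx_N : cvx N.
Proof.
move=> a x y /andP[a0 a1]; apply: le_trans (eqnormD _ _ _) _.
by rewrite !eqnormZp ?subr_ge0.
Qed.

Lemma even_N : even_fun N. Proof. exact: eqnormN. Qed.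

Lemma iter_lip t n f : 0 <= t -> lip f -> lip (iter n (Aop t) f).
Proof. by move=> t0 fl; elim: n => //= n; exact: Aop_lip. Qed.

Lemma iter_cvx t n f : 0 <= t -> lip f -> cvx f -> cvx (iter n (Aop t) f).
Proof. by move=> t0 fl fc; elim: n => //= n; apply: Aop_cvx => //; exact: iter_lip. Qed.

Lemma iter_even t n f : 0 <= t -> even_fun f -> even_fun (iter n (Aop t) f).
Proof. by move=> t0 fe; elim: n => //= n; exact: Aop_even. Qed.

Lemma iter_ge t n f x : 0 <= t -> lip f -> f x <= iter n (Aop t) f x.
Proof.
move=> t0 fl; elim: n => //= n IH; apply: le_trans IH _; apply: Aop_ge => //.
exact: iter_lip.
Qed.

(** The first player combines the answer [L0] to a single move of size [r] with a strategy keeping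
    the sum of [m] small moves below [r]: that sum then counts as one legal move of size [r]. *)
Lemma iter_Aop_le_Aop t r m f x : 0 <= t -> 0 <= r -> lip f ->
  iter m (Aop t) N 0 < r -> iter m (Aop t) f x <= Aop r f x.
Proof.
move=> t0 r0 fl mr; apply/ler_addgt0Pr => e e0.
have [L0 h0] := Aop_lt r0 fl (ltr_pwDr e0 (lexx (Aop r f x))).
(* Here [v] is the sum of the moves already made and [i] the number of moves left. *)
have claim i v : kerl L0 v -> iter i (Aop t) N v < r ->
    iter i (Aop t) f (x + v) <= Aop r f x + e.
  elim: i v => [|i IH] v Lv /= vr; first by apply: h0 => //; exact: ltW.
  have [c vc cr] : exists2 c, iter i.+1 (Aop t) N v < c & c < r.
    by exists ((iter i.+1 (Aop t) N v + r) / 2); [rewrite midf_lt|rewrite midf_lt].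
  have [L h] := Aop_lt t0 (iter_lip i t0 lip_N) vc.
  apply: (@Aop_le _ _ _ _ (L ++ L0)) => //; first exact: iter_lip.
  move=> y /kerl_cat[y1 y2] yt; rewrite -addrA; apply: IH; first exact: kerlD.
  exact: le_lt_trans (h _ y1 yt) cr.
have := claim m 0 (kerl_subspace L0).1 mr; by rewrite addr0.
Qed.

Lemma iter_Aop_scale t a n x : 0 <= t -> 0 < a ->
  iter n (Aop (a * t)) N (a *: x) <= a * iter n (Aop t) N x.
Proof.
move=> t0 a0; elim: n x => [|n IH] x /=; first by rewrite eqnormZp// ltW.
apply/ler_addgt0Pr => e e0; have ea : 0 < e / a by rewrite divr_gt0.
have [L h] := Aop_lt t0 (iter_lip n t0 lip_N) (ltr_pwDr ea (lexx (Aop t (iter n (Aop t) N) x))).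
apply: (@Aop_le _ _ _ _ L); [by rewrite mulr_ge0// ltW|by apply: iter_lip lip_N; rewrite mulr_ge0// ltW|].
move=> y Ly yt; have -> : a *: x + y = a *: (x + a^-1 *: y).
  by rewrite scalerDr scalerA divff ?gt_eqF// scale1r.
apply: le_trans (IH _) _.
have : a * iter n (Aop t) N (x + a^-1 *: y) <= a * (Aop t (iter n (Aop t) N) x + e / a).
  rewrite ler_pM2l//; apply: h; first exact: kerlZ.
  by rewrite eqnormZp ?invr_ge0 ?(ltW a0)// mulrC ler_pdivrMr// mulrC.
by rewrite mulrDr [a * (e / a)]mulrC divfK// gt_eqF.
Qed.

Lemma iter_Aop_compare t r m n x : 0 <= t -> 0 <= r ->
  iter m (Aop t) N 0 < r -> iter (n * m) (Aop t) N x <= iter n (Aop r) N x.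
Proof.
move=> t0 r0 mr; elim: n x => // n IH x; rewrite mulSn iterD.
apply: le_trans (iter_Aop_le_Aop x t0 r0 (iter_lip _ t0 lip_N) mr) _.
by rewrite iterS; apply: Aop_mono => //; apply: iter_lip => //; exact: lip_N.
Qed.

Definition sub_linear_game := exists2 k : nat, (1 < k)%N & iter k (Aop 1) N 0 < k%:R.

(** By homogeneity [k] moves of size [tau ^+ j.+1] amount to one move of size [tau ^+ j]; grouping
    the [k ^ j] moves level by level collapses them to a single move of size 1. *)
Lemma sub_linear_game_geometric : sub_linear_game -> exists (k : nat) (tau : R),
  [/\ (1 < k)%N, 0 < tau, tau < 1, 1 < k%:R * tau &
    forall j, iter (k ^ j) (Aop (tau ^+ j)) N 0 <= 1].
Proof.
(* [c] lies strictly between the value of the [k] moves and [k], and above 1; with [tau = c^-1] this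
   gives both [tau < 1] and [1 < k * tau]. *)
move=> [k k1 ck]; pose m := Num.max (iter k (Aop 1) N 0) 1; pose c := (m + k%:R) / 2.
have mk : m < k%:R by rewrite gt_max ck ltr1n.
have m1 : 1 <= m by rewrite le_max lexx orbT.
have mc : iter k (Aop 1) N 0 <= m by rewrite le_max lexx.
have [c1 cm ckk] : [/\ 1 < c, m < c & c < k%:R] by split; rewrite /c; lra.
have c0 : 0 < c by lra.
have i0 : 0 < c^-1 by rewrite invr_gt0.
exists k, c^-1; split => //.
- by rewrite invf_lt1.
- by rewrite ltr_pdivlMr// mul1r.
elim=> [|j IH].
  rewrite expn0 expr0 /=; apply: (@Aop_le _ _ _ _ [::]) => //; first exact: lip_N.
  by move=> y _; rewrite add0r.
rewrite expnSr; apply: le_trans IH; apply: iter_Aop_compare.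
- by rewrite exprn_ge0// ltW.
- by rewrite exprn_ge0// ltW.
have := @iter_Aop_scale 1 (c^-1 ^+ j.+1) k 0 ler01 (exprn_gt0 _ i0).
rewrite scaler0 mulr1 => /le_lt_trans; apply.
rewrite exprSr -mulrA gtr_pMr ?exprn_gt0//.
by rewrite mulrC ltr_pdivrMr// mul1r; lra.
Qed.

(** [g] is the mean of the first [M] iterates. A move sends the [i]-th iterate below the value of
    the next one at [x], up to a slack [1 / M], so the increase of the mean telescopes. *)
Lemma averaged_function t M : 0 <= t -> (0 < M)%N -> iter M (Aop t) N 0 <= 1 ->
  exists g, [/\ cvx g, even_fun g, forall x, N x <= g x <= N x + 1 &
    forall x, exists L, forall y, kerl L y -> N y <= t -> g (x + y) <= g x + 2 / M%:R].
Proof.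
move=> t0 M0 h1; have M0' : 0 < M%:R :> R by rewrite ltr0n.
pose it n := iter n (Aop t) N; have itl n : lip (it n) by apply: iter_lip => //; exact: lip_N.
have itge n x : N x <= it n x by apply: iter_ge => //; exact: lip_N.
have itM n x : (n <= M)%N -> it n x <= N x + 1.
  move=> nM; have : it n 0 <= 1.
    apply: le_trans h1; rewrite -(subnK nM) iterD; apply: iter_ge => //; exact: itl.
  by have := itl n 0 x; rewrite add0r; lra.
have Mi : 0 <= M%:R^-1 :> R by rewrite invr_ge0 ltW.
have cst (a : R) : M%:R^-1 * (\sum_(i < M) a) = a.
  by rewrite sumr_const card_ord -[a *+ M]mulr_natl mulKf// gt_eqF.
exists (fun x => M%:R^-1 * \sum_(i < M) it i x); split.
- move=> a x y a01; rewrite mulrCA [(1 - a) * _]mulrCA -mulrDr ler_wpM2l//.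
  rewrite !mulr_sumr -big_split; apply: ler_sum => i _; apply: iter_cvx a01 => //.
    exact: lip_N.
  exact: cvx_N.
- move=> x; congr (_ * _); apply: eq_bigr => i _; apply: iter_even => //; exact: even_N.
- move=> x; apply/andP; split.
    by rewrite -{1}(cst (N x)) ler_wpM2l// ler_sum.
  by rewrite -(cst (N x + 1)) ler_wpM2l// ler_sum// => i _; apply: itM; exact: ltnW.
move=> x; have e0 : 0 < M%:R^-1 :> R by rewrite invr_gt0.
have [L hL] : exists L, forall y, kerl L y -> N y <= t -> forall i, (i < M)%N ->
    it i (x + y) <= it i.+1 x + M%:R^-1.
  elim: {1}M => [|m [L hL]]; first by exists [::].
  have [L' hL'] := Aop_lt t0 (itl m) (ltr_pwDr e0 (lexx (Aop t (it m) x))).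
  exists (L ++ L') => y /kerl_cat[y1 y2] yt i; rewrite ltnS leq_eqVlt => /predU1P[->|].
    exact: hL'.
  exact: hL.
exists L => y Ly yt.
apply: (@le_trans _ _ (M%:R^-1 * \sum_(i < M) (it i.+1 x + M%:R^-1))).
  by rewrite ler_wpM2l// ler_sum// => i _; exact: hL.
rewrite big_split /= mulrDr cst.
(* Only [it M x - N x <= 1] survives; divided by [M] and added to the slack it gives [2 / M]. *)
have -> : \sum_(i < M) it i.+1 x = \sum_(i < M) it i x + it M x - N x.
  elim: (M) => [|m IH]; first by rewrite !big_ord0 add0r subrr.
  by rewrite !big_ord_recr /= IH; lra.
rewrite !mulrDr; have := ler_wpM2l Mi (itM M x (leqnn M)); lra.
Qed.

(** [N'] is the Minkowski functional of [B]. As [B] may fail to be closed, it is only squeezed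
    between the open and the closed unit ball of [N']. *)
Lemma gauge_norm (B : set X) (r rho : R) : 0 < r -> 0 < rho ->
  (forall a x y, 0 <= a <= 1 -> B x -> B y -> B (a *: x + (1 - a) *: y)) ->
  (forall x, B x -> B (- x)) -> (forall x, N x <= r -> B x) ->
  (forall x, B x -> N x <= rho) ->
  exists N' : equiv_norm X, [/\ forall x, B x -> N' x <= 1,
    forall x, N' x < 1 -> B x & forall x, N x <= rho * N' x].
Proof.
move=> r0 rho0 Bc Bs Br Brho.
have B0 : B 0 by apply: Br; rewrite eqnorm0 ltW.
pose S x := [set s : R | 0 < s /\ B (s^-1 *: x)].
pose G x := inf (S x).
have Sne x : S x !=set0.
  exists ((N x + 1) / r); have N1 : 0 < N x + 1 by rewrite ltr_wpDl ?eqnorm_ge0.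
  split; first by rewrite divr_gt0.
  apply: Br; rewrite eqnormZp ?invr_ge0 ?divr_ge0 ?(ltW N1) ?(ltW r0)//.
  by rewrite invf_div mulrAC ler_pdivrMr// ler_pM2l// lerDl.
have Slb x s : S x s -> N x <= rho * s.
  move=> [s0 /Brho]; rewrite eqnormZp ?invr_ge0 ?(ltW s0)//.
  by rewrite mulrC ler_pdivrMr.
have Sinf x : has_inf (S x).
  by split => //; exists 0 => s [s0 _]; exact: ltW.
have star a x : 0 <= a <= 1 -> B x -> B (a *: x).
  by move=> a01 Bx; have := Bc a x 0 a01 Bx B0; rewrite scaler0 addr0.
have Glt x s : G x < s -> S x s.
  move=> h; have [c [c0 Bcx] cs] := inf_lt (Sne x) h.
  have s0 : 0 < s by exact: lt_trans cs.
  split => //; have -> : s^-1 *: x = (c / s) *: (c^-1 *: x).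
    by rewrite scalerA mulrAC divff ?gt_eqF// mul1r.
  apply: star => //; rewrite divr_ge0 ?(ltW c0) ?(ltW s0)//=.
  by rewrite ler_pdivrMr// mul1r ltW.
have Gle x s : S x s -> G x <= s by move=> h; apply: inf_lbound => //; case: (Sinf x).
have G0 x : 0 <= G x by apply: lb_le_inf => // s [/ltW].
have GD x y : G (x + y) <= G x + G y.
  apply/ler_addgt0Pr => e e0; have e2 : 0 < e / 2 by rewrite divr_gt0.
  have [s0 sx] := Glt _ _ (ltr_pwDr e2 (lexx (G x))).
  have [t0 ty] := Glt _ _ (ltr_pwDr e2 (lexx (G y))).
  set s := G x + e / 2 in s0 sx; set t := G y + e / 2 in t0 ty.
  have -> : G x + G y + e = s + t by rewrite /s /t; lra.
  apply: Gle; split; first by rewrite addr_gt0.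
  have st : 0 < s + t by rewrite addr_gt0.
  have -> : (s + t)^-1 *: (x + y) =
      (s / (s + t)) *: (s^-1 *: x) + (1 - s / (s + t)) *: (t^-1 *: y).
    have -> : 1 - s / (s + t) = t / (s + t) by field; rewrite gt_eqF.
    by rewrite !scalerA mulrAC divff ?gt_eqF// mulrAC divff ?gt_eqF// mul1r scalerDr.
  apply: Bc => //; rewrite divr_ge0 ?(ltW s0) ?(ltW st)//=.
  by rewrite ler_pdivrMr// mul1r lerDl ltW.
have GN x : G (- x) = G x.
  rewrite /G; congr inf; apply/seteqP; split=> s [s0 h]; split => //.
    by rewrite -[x]opprK scalerN; exact: Bs.
  by rewrite scalerN; exact: Bs.
have GZp a x : 0 < a -> G (a *: x) <= a * G x.
  move=> a0; apply/ler_addgt0Pr => e e0; have ea : 0 < e / a by rewrite divr_gt0.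
  have [s0 sx] := Glt _ _ (ltr_pwDr ea (lexx (G x))).
  have -> : a * G x + e = a * (G x + e / a) by rewrite mulrDr [a * (_ / _)]mulrC divfK// gt_eqF.
  apply: Gle; split; first by rewrite mulr_gt0.
  by rewrite invfM scalerA mulrAC mulVf ?gt_eqF// mul1r.
have Gz : G 0 = 0.
  apply/eqP; rewrite eq_le G0 andbT; apply/ler_addgt0Pr => e e0; rewrite add0r.
  by apply: Gle; split => //; rewrite scaler0.
have GZ a x : G (a *: x) = `|a| * G x.
  have GZ' b y : 0 < b -> G (b *: y) = b * G y.
    move=> b0; apply/eqP; rewrite eq_le GZp//=.
    have := GZp b^-1 (b *: y); rewrite invr_gt0 scalerA mulVf ?gt_eqF// scale1r => /(_ b0).
    by rewrite -ler_pdivlMl ?invr_gt0// invrK.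
  have [a0|a0|->] := ltgtP a 0; last by rewrite scale0r Gz normr0 mul0r.
    by rewrite ltr0_norm// -GZ' ?oppr_gt0// scaleNr GN.
  by rewrite gtr0_norm// GZ'.
have Gub x : r * G x <= N x.
  rewrite mulrC -ler_pdivlMr//; apply/ler_addgt0Pr => e e0; apply: Gle.
  have n0 : 0 < N x / r + e by rewrite ltr_wpDl// divr_ge0 ?eqnorm_ge0 ?(ltW r0).
  split => //; apply: Br; rewrite eqnormZp ?invr_ge0 ?(ltW n0)//.
  rewrite mulrC ler_pdivrMr// mulrDr [r * (_ / _)]mulrC divfK ?gt_eqF//.
  by rewrite lerDl mulr_ge0 ?(ltW r0) ?(ltW e0).
have Glb x : N x <= rho * G x.
  rewrite mulrC -ler_pdivrMr//; apply: lb_le_inf => // s /Slb h.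
  by rewrite ler_pdivrMr// mulrC.
have [c [C [c0 C0 cC]]] := eqnorm_equiv N.
have Geq : exists c C : R, [/\ 0 < c, 0 < C & forall x, c * `|x| <= G x <= C * `|x|].
  exists (c / rho), (C / r); split; [by rewrite divr_gt0|by rewrite divr_gt0|move=> x].
  have /andP[h1 h2] := cC x; apply/andP; split.
    by rewrite mulrAC ler_pdivrMr// (le_trans h1)// mulrC.
  by rewrite mulrAC ler_pdivlMr// mulrC (le_trans (Gub x))// mulrC.
exists (EquivNorm GD GZ Geq); split => //= x.
  by move=> Bx; apply: Gle; split => //; rewrite invr1 scale1r.
by move=> /Glt[_]; rewrite invr1 scale1r.
Qed.

Lemma power_type_norm : sub_linear_game ->
  exists (N' : equiv_norm X) (k : nat) (mu c : R),
    [/\ (1 < k)%N, 0 < mu < 1, 1 < k%:R * mu, 0 < c &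
      forall j x, N' x = 1 -> exists L, forall z, kerl L z -> N' z <= c * mu ^+ j ->
        N' (x + z) <= 1 + 5 * k%:R^-1 ^+ j].
Proof.
move=> /sub_linear_game_geometric[k [tau [k1 t0 t1 kt ktau]]].
have k0 : 0 < k%:R :> R by rewrite ltr0n (ltn_trans _ k1).
(* Halfway between [(k * tau)^-1] and 1: the weights are summable and [1 < k * (tau * w)] still
   holds. *)
pose w : R := ((k%:R * tau)^-1 + 1) / 2.
have kti : (k%:R * tau)^-1 < 1 by rewrite invf_lt1//; lra.
have kti0 : 0 < (k%:R * tau)^-1 by rewrite invr_gt0; lra.
have w0 : 0 < w by rewrite /w; lra.
have w1 : w < 1 by rewrite /w; lra.
have wkt : 1 < k%:R * tau * w.
  have : (k%:R * tau) * (k%:R * tau)^-1 < (k%:R * tau) * w by rewrite ltr_pM2l /w; lra.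
  by rewrite divff//; apply/eqP; lra.
have tj0 j : 0 < tau ^+ j by rewrite exprn_gt0.
have kj0 j : (0 < k ^ j)%N by rewrite expn_gt0 (ltn_trans _ k1).
have [g gP] := choice (fun j => averaged_function (ltW (tj0 j)) (kj0 j) (ktau j)).
pose wj j : R := (1 - w) * w ^+ j.
have wj0 j : 0 < wj j by rewrite mulr_gt0 ?subr_gt0// exprn_gt0.
have wsum n : \sum_(j < n) wj j <= 1.
  rewrite -mulr_sumr; have := subrX1 w n; have := exprn_ge0 n (ltW w0); nra.
(* Level 2 leaves room: the unit ball of [N] is inside, and an excess [2 * d] can be undone by
   shrinking towards 0, where [g j 0 <= 1]. *)
pose Bj j := [set x | g j x <= 2].
have gN j x : N x <= g j x by have [_ _ /(_ x)/andP[]] := gP j.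
have gN1 j x : g j x <= N x + 1 by have [_ _ /(_ x)/andP[]] := gP j.
have BjN j x : Bj j x -> N x <= 2 by exact: le_trans.
have Bjr j x : N x <= 1 -> Bj j x by move=> h; apply: le_trans (gN1 j x) _; lra.
have Bj00 j : Bj j 0 by apply: Bjr; rewrite eqnorm0.
have Bjc j a x y : 0 <= a <= 1 -> Bj j x -> Bj j y -> Bj j (a *: x + (1 - a) *: y).
  rewrite /Bj /= => a01 hx hy; have [gc _ _ _] := gP j; apply: le_trans (gc _ _ _ a01) _.
  by case/andP: a01 => a0 a1; nra.
have Bjs j x : Bj j x -> Bj j (- x) by have [_ ge _ _] := gP j; rewrite /Bj /= ge.
have Bjshrink j a x : 0 <= a <= 1 -> Bj j x -> Bj j (a *: x).
  by move=> a01 Bx; have := Bjc j a x 0 a01 Bx (Bj00 j); rewrite scaler0 addr0.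
pose B := [set x | exists2 xs : nat -> X, (forall j, Bj j (xs j)) &
  exists n, forall m, (n <= m)%N -> x = \sum_(j < m) wj j *: xs j].
have [||||||N' [BN' N'B NN']] := @gauge_norm B (1 - w) 2.
- by rewrite subr_gt0.
- by [].
- move=> a x y a01 [xs xB [n nx]] [ys yB [m my]].
  exists (fun j => a *: xs j + (1 - a) *: ys j) => [j|]; first exact: Bjc.
  exists (maxn n m) => q; rewrite geq_max => /andP[nq mq].
  rewrite (nx _ nq) (my _ mq) !scaler_sumr -big_split; apply: eq_bigr => j _ /=.
  by rewrite scalerDr !scalerA [a * _]mulrC [(1 - a) * _]mulrC.
- move=> x [xs xB [n nx]]; exists (fun j => - xs j) => [j|]; first exact: Bjs.
  exists n => m /nx ->; rewrite -sumrN; apply: eq_bigr => j _; by rewrite scalerN.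
- move=> x xw; exists (fun j => if j is 0%N then (1 - w)^-1 *: x else 0) => [[|j]|].
  + apply: Bjr; rewrite eqnormZp; last by rewrite invr_ge0 subr_ge0 ltW.
    by rewrite mulrC ler_pdivrMr ?subr_gt0// mul1r.
  + exact: Bj00.
  exists 1%N => -[//|m] _; rewrite big_ord_recl big1 ?addr0.
    by rewrite /wj expr0 mulr1 scalerA divff ?scale1r// gt_eqF// subr_gt0.
  by move=> i _; rewrite /= scaler0.
- move=> x [xs xB [n /(_ n (leqnn n)) ->]]; apply: le_trans (eqnorm_sum _ _ _) _.
  apply: (@le_trans _ _ (\sum_(j < n) wj j * 2)).
    by apply: ler_sum => j _; rewrite eqnormZp ?ler_wpM2l ?(ltW (wj0 j))// (BjN j).
  by rewrite -mulr_suml -[leRHS]mul1r ler_pM2r// wsum.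
exists N', k, (tau * w), ((1 - w) / 2); split => //.
- by rewrite mulr_gt0//= mulr_ilt1 ?ltW.
- by rewrite mulrA.
- by rewrite divr_gt0 ?subr_gt0.
move=> j x Nx; set d := k%:R^-1 ^+ j.
have d0 : 0 < d by rewrite exprn_gt0// invr_gt0.
have d1 : d <= 1 by rewrite exprn_ile1 ?invr_ge0 ?(ltW k0)// invf_le1// ler1n (ltn_trans _ k1).
have dd : 2 / (k ^ j)%:R = 2 * d by rewrite natrX /d exprVn.
have d10 : 0 < 1 + d by lra.
(* Dividing by [1 + d] enters the open unit ball of [N'], which is where membership in [B] is
   known. *)
have [xs xB [n nx]] : B ((1 + d)^-1 *: x).
  apply: N'B; rewrite eqnormZp ?invr_ge0 ?(ltW d10)// Nx mulr1 invf_lt1//; lra.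
have [gc _ _ /(_ (xs j))[L hL]] := gP j; rewrite dd in hL.
have d20 : 0 < 1 + 2 * d by lra.
have shrink01 : 0 <= (1 + 2 * d)^-1 <= 1 by rewrite invr_ge0 (ltW d20) invf_le1//=; lra.
exists L => z Lz zN.
have zN2 : N ((wj j)^-1 *: ((1 + d)^-1 *: z)) <= tau ^+ j.
  rewrite scalerA -invfM eqnormZp; last by rewrite invr_ge0 mulr_ge0 ?(ltW (wj0 j)) ?(ltW d10).
  rewrite mulrC ler_pdivrMr; last by rewrite mulr_gt0.
  apply: le_trans (NN' z) _.
  have h1 : 2 * N' z <= tau ^+ j * wj j.
    move: zN; rewrite exprMn /wj; nra.
  by apply: le_trans h1 _; have := mulr_ge0 (mulr_ge0 (ltW (tj0 j)) (ltW (wj0 j))) (ltW d0); nra.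
(* Shrinking by [1 + 2 * d] brings the modified [j]-th summand back to level 2. The total factor
   [(1 + d) * (1 + 2 * d)] is at most [1 + 5 * d] as [d <= 1]. *)
have Bsum : B ((1 + 2 * d)^-1 *: ((1 + d)^-1 *: (x + z))).
  exists (fun i => (1 + 2 * d)^-1 *:
      (xs i + (if i == j then (wj j)^-1 *: ((1 + d)^-1 *: z) else 0))) => [i|].
    case: eqP => [->|_]; last by rewrite addr0; exact: Bjshrink.
    set y := _ *: (_ *: z).
    have hy : g j (xs j + y) <= 2 + 2 * d.
      apply: le_trans (hL _ _ zN2) _; first by do 2 apply: kerlZ.
      by rewrite lerD2r; exact: xB.
    have := gc _ (xs j + y) 0 shrink01; rewrite scaler0 addr0 => /le_trans; apply.
    have g0 : g j 0 <= 1 by apply: le_trans (gN1 j 0) _; rewrite eqnorm0 add0r.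
    have h : (1 + 2 * d) * (1 + 2 * d)^-1 = 1 by rewrite divff// gt_eqF.
    move: shrink01 => /andP[a0 a1]; nra.
  exists (maxn n j.+1) => m; rewrite geq_max => /andP[nm jm].
  under eq_bigr => i _ do rewrite scalerA [wj i * _]mulrC -scalerA scalerDr.
  rewrite -scaler_sumr big_split /= -(nx _ nm); congr (_ *: _); rewrite scalerDr; congr (_ + _).
  rewrite (bigD1 (Ordinal jm)) //= eqxx scalerA divff ?gt_eqF// scale1r big1 ?addr0//.
  move=> i; rewrite -val_eqE /= => /negPf ->; by rewrite scaler0.
have := BN' _ Bsum; rewrite scalerA -invfM eqnormZp; last first.
  by rewrite invr_ge0 mulr_ge0 ?(ltW d20) ?(ltW d10).
rewrite mulrC ler_pdivrMr ?mulr_gt0// mul1r => /le_trans; apply; nra.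
Qed.

End game_operator.

Section renorming.
Context {R : realType} {X : normedModType R} (N : equiv_norm X).

Lemma renorm_norm (x : renorm N) : `|x| = N x. Proof. by []. Qed.

Lemma closed_renorm (Y : set X) : closed (Y : set (renorm N)) <-> closed Y.
Proof.
have [c [C [c0 C0 cC]]] := eqnorm_equiv N.
split=> cY.
  apply: closedP_dist => x hx; apply: contrapT => nYx.
  have [d d0 dY] := closed_dist cY nYx.
  have [y Yy xy] := hx (d / C) (divr_gt0 d0 C0).
  have := dY y Yy; rewrite leNgt => /negP; apply; rewrite renorm_norm.
  have /andP[_ h] := cC (x - y); apply: le_lt_trans h _.
  by rewrite mulrC -ltr_pdivlMr.
apply: closedP_dist => x hx; apply: contrapT => nYx.
have [d d0 dY] := closed_dist cY nYx.
have [y Yy] := hx (c * d) (mulr_gt0 c0 d0); rewrite renorm_norm => xy.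
have := dY y Yy; rewrite leNgt => /negP; apply.
have /andP[h _] := cC (x - y); rewrite -(ltr_pM2l c0); exact: le_lt_trans xy.
Qed.

Lemma cof_renorm (Y : set X) : cof (renorm N) Y <-> cof X Y.
Proof. by split=> -[Ys Yf Yc]; split => //; apply/closed_renorm. Qed.

End renorming.

Section rho_bar.
Context {R : realType} {X : normedModType R}.

Lemma rho_bar_lt (t b : R) : (rho_bar X t < b%:E)%E -> forall x : X, `|x| = 1 ->
  exists2 Y, cof X Y & forall z, Y z -> `|z| <= t -> `|x + z| <= 1 + b.
Proof.
rewrite /rho_bar lteBlDr// -EFinD => h x x1.
have : (ereal_inf [set ereal_sup [set `|x + y|%:E | y in [set y | Y y /\ (`|y| <= t)%R]]
    | Y in cof X] < (b + 1)%:E)%E.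
  by apply: le_lt_trans h; apply: ereal_sup_ubound; exists x.
move=> /ereal_inf_lt[_ [Y cY <-] hY]; exists Y => // z Yz zt.
rewrite -lee_fin [1 + b]addrC; apply: le_trans (ltW hY).
by apply: ereal_sup_ubound; exists z.
Qed.

Lemma rho_bar_le (t b : R) : (forall x : X, `|x| = 1 ->
  exists2 Y, cof X Y & forall z, Y z -> `|z| <= t -> `|x + z| <= 1 + b) ->
  (rho_bar X t <= b%:E)%E.
Proof.
move=> h; rewrite /rho_bar leeBlDr// -EFinD.
apply: ge_ereal_sup => _ [x /= x1 <-]; have [Y cY hY] := h x x1.
apply: (@le_trans _ _ (ereal_sup [set `|x + y|%:E | y in [set y | Y y /\ (`|y| <= t)%R]])).
  by apply: ereal_inf_lbound; exists Y.
by apply: ge_ereal_sup => _ [y [Yy yt] <-]; rewrite lee_fin [b + 1]addrC hY.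
Qed.

Lemma rho_bar_ge0 (t : R) (x : X) : 0 <= t -> `|x| = 1 -> (0 <= rho_bar X t)%E.
Proof.
move=> t0 x1; rewrite /rho_bar leeBrDr// add0e.
apply: le_ereal_sup_tmp; eexists; first by exists x.
apply: le_ereal_inf_tmp => _ [Y [[Y0 _] _ _] <-].
apply: ereal_sup_ubound; exists 0; first by rewrite /= normr0.
by rewrite addr0 x1.
Qed.

Lemma rho_bar_le_id (t : R) : (rho_bar X t <= t%:E)%E.
Proof.
apply: rho_bar_le => x x1; exists setT => [|z _ zt].
  split; [by []|exists 0%N, (fun _ => 0) => x'|exact: closedT].
  by exists x' => //; exists (fun _ => 0); rewrite big_ord0 addr0.
by rewrite -x1 (le_trans (ler_normD _ _))// lerD2l.
Qed.

Lemma aus_of_power_type (q : R) (x : X) : `|x| = 1 -> 1 < q -> aus_power_type X q -> aus X.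
Proof.
move=> x1 q1 [K hK]; pose K' := Num.max K 1.
have K0 : 0 < K' by rewrite lt_max ltr01 orbT.
have hK' t : 0 < t -> (rho_bar X t * t^-1%:E <= (K' * t `^ (q - 1))%:E)%E.
  move=> t0; rewrite lee_pdivrMr// -EFinM.
  apply: le_trans (hK _ t0) _; rewrite lee_fin -mulrA [_ * t]mulrC mulr_powRB1 ?(ltW t0)//.
    by rewrite ler_wpM2r ?powR_ge0// le_max lexx.
  by rewrite (lt_trans _ q1).
apply: (@squeeze_cvge _ _ _ _ (cst 0%E) _ (fun t => (K' * t `^ (q - 1))%:E)).
- near=> t; have t0 : 0 < t by near: t; exact: nbhs_right_gt.
  rewrite hK'// andbT mule_ge0 ?lee_fin ?invr_ge0 ?(ltW t0)//.
  by apply: rho_bar_ge0 x1; exact: ltW.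
- exact: cvg_cst.
apply: cvg_EFin; first exact: nearW.
have q10 : 0 < q - 1 by rewrite subr_gt0.
apply/cvgr0Pnorm_le => e e0; near=> t.
have t0 : 0 < t by near: t; exact: nbhs_right_gt.
have tb : t < (e / K') `^ (q - 1)^-1.
  by near: t; apply: nbhs_right_lt; rewrite powR_gt0// divr_gt0.
rewrite /= ger0_norm ?mulr_ge0 ?powR_ge0 ?(ltW K0)// mulrC -ler_pdivlMr//.
have := gt0_ltr_powR q10 _ _ tb; rewrite !nnegrE (ltW t0) powR_ge0 => /(_ isT isT).
by rewrite -powRrM mulVf ?gt_eqF// powRr1 ?divr_ge0 ?(ltW e0) ?(ltW K0)// => /ltW.
Unshelve. all: by end_near. Qed.

Lemma aus_rho_bar_lt : aus X -> exists t : R, 0 < t /\ (rho_bar X t < t%:E)%E.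
Proof.
rewrite /aus => h.
have : \forall t \near 0^'+, (rho_bar X t * t^-1%:E < 1%:E)%E.
  by have /h : nbhs (0 : \bar R) [set y | (y < 1%:E)%E]; [exact: (@nbhs_open_ereal_lt _ 0 (fun=> 1) ltr01)|].
move=> h1; near (0 : R)^'+ => t.
have t0 : 0 < t by near: t; exact: nbhs_right_gt.
exists t; split => //.
have : (rho_bar X t * t^-1%:E < 1%:E)%E by near: t.
by rewrite lte_pdivrMr// mul1e.
Unshelve. all: by end_near. Qed.

End rho_bar.

Section smooth_norms.
Context {R : realType} {X : normedModType R} (N : equiv_norm X).

Lemma rho_bar_renorm_lt (t b : R) : (rho_bar (renorm N) t < b%:E)%E ->
  forall x, N x = 1 -> exists L, forall z, kerl L z -> N z <= t -> N (x + z) <= 1 + b.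
Proof.
move=> h x x1; have [Y /cof_renorm/cof_kerl[L LY] hY] := rho_bar_lt h x1.
by exists L => z /LY; exact: hY.
Qed.

Lemma rho_bar_renorm_le (t b : R) :
  (forall x, N x = 1 -> exists L, forall z, kerl L z -> N z <= t -> N (x + z) <= 1 + b) ->
  (rho_bar (renorm N) t <= b%:E)%E.
Proof.
move=> h; apply: rho_bar_le => x /h[L hL].
by exists (kerl L) => //; apply/cof_renorm; exact: cof_of_kerl.
Qed.

Lemma power_type_of_geometric (k : nat) (mu c : R) : (1 < k)%N -> 0 < mu < 1 ->
  1 < k%:R * mu -> 0 < c -> (forall j x, N x = 1 -> exists L, forall z, kerl L z ->
    N z <= c * mu ^+ j -> N (x + z) <= 1 + 5 * k%:R^-1 ^+ j) ->
  exists q, 1 < q /\ aus_power_type (renorm N) q.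
Proof.
move=> k1 /andP[m0 m1] km c0 h.
have k0 : 0 < k%:R :> R by rewrite ltr0n (ltn_trans _ k1).
have k1' : 1 < k%:R :> R by rewrite ltr1n.
have lnm : ln mu < 0 by rewrite ln_lt0// m0.
have lnk : 0 < ln (k%:R : R) by rewrite ln_gt0.
have lnkm : 0 < ln (k%:R : R) + ln mu by rewrite -lnM ?posrE// ln_gt0.
pose q := ln (k%:R : R) / - ln mu.
have q1 : 1 < q by rewrite /q ltr_pdivlMr ?oppr_gt0// mul1r; lra.
have muq : mu `^ q = k%:R^-1.
  rewrite /powR gt_eqF// /q invrN mulrN mulNr divfK ?lt_eqF//.
  by rewrite expRN lnK ?posrE.
have muqj j : (mu ^+ j) `^ q = k%:R^-1 ^+ j.
  by rewrite -powR_mulrn ?(ltW m0)// -powRrM mulrC powRrM muq powR_mulrn// invr_ge0 ltW.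
exists q; split => //; exists ((5 * k%:R + c) / c `^ q) => t t0.
have cq0 : 0 < c `^ q by rewrite powR_gt0.
have q0 : 0 <= q by lra.
have tc : (t / c) `^ q = t `^ q / c `^ q.
  rewrite powRM ?(ltW t0) ?invr_ge0 ?(ltW c0)//; congr (_ * _).
  by rewrite -powR_inv1 ?(ltW c0)// -powRrM mulN1r powRN.
rewrite mulrAC -mulrA -tc.
have [ct|tc'] := leP c t.
  apply: le_trans (rho_bar_le_id _) _; rewrite lee_fin.
  have h1 : t / c <= (t / c) `^ q by apply: le1r_powR; rewrite ?(ltW q1)// ler_pdivlMr ?mul1r.
  have h2 : t = c * (t / c) by rewrite mulrC divfK// gt_eqF.
  have h3 : 0 <= 5 * (k%:R : R) by rewrite mulr_ge0 ?(ltW k0).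
  rewrite {1}h2; apply: (@le_trans _ _ (c * (t / c) `^ q)); first by rewrite ler_wpM2l// ltW.
  by rewrite ler_wpM2r ?powR_ge0// lerDr.
have ex : exists n, c * mu ^+ n.+1 < t.
  have /cvgn_distP/(_ (t / c) (divr_gt0 t0 c0))[n /(_ n.+1 (leqnSn n))] :
      mu ^+ n @[n --> \oo] --> (0 : R) by apply: cvg_expr; rewrite ger0_norm ?(ltW m0).
  rewrite subr0 ger0_norm ?exprn_ge0 ?(ltW m0)// ltr_pdivlMr// mulrC => hn.
  by exists n.
have [j jt jmin] := ex_minnP ex.
have tj : t <= c * mu ^+ j.
  case: j jt jmin => [_ _|j jt jmin]; first by rewrite expr0 mulr1 ltW.
  by rewrite leNgt; apply/negP => /jmin; rewrite ltnn.
have : (rho_bar (renorm N) t <= (5 * k%:R^-1 ^+ j)%:E)%E.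
  apply: rho_bar_renorm_le => x /(h j)[L hL]; exists L => z Lz zt.
  by apply: hL => //; exact: le_trans tj.
move=> /le_trans; apply; rewrite lee_fin.
have h1 : k%:R^-1 ^+ j.+1 <= (t / c) `^ q.
  rewrite -muqj; apply: ge0_ler_powR => //; rewrite ?nnegrE ?exprn_ge0 ?(ltW m0)//.
    by rewrite divr_ge0 ?(ltW t0) ?(ltW c0).
  by rewrite ler_pdivlMr// mulrC ltW.
have h2 : k%:R^-1 ^+ j = k%:R * k%:R^-1 ^+ j.+1 :> R by rewrite exprS mulVKf// gt_eqF.
have := powR_ge0 (t / c) q; rewrite h2; nra.
Qed.

(** The potential [Num.max (N x) Q] grows by at most [th = b / t < 1] per unit move: smoothness
    applies after normalization once [N x >= t^-1], and below that level one move cannot exceed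
    [Q]. *)
Lemma sub_linear_game_of_rho_bar (t : R) : 0 < t -> (rho_bar (renorm N) t < t%:E)%E ->
  sub_linear_game N.
Proof.
move=> t0 rt.
have [b [b0 bt hb]] : exists b : R, [/\ 0 <= b, b < t & forall x, N x = 1 ->
    exists L, forall z, kerl L z -> N z <= t -> N (x + z) <= 1 + b].
  have [b rb bt] : exists2 b : R, (rho_bar (renorm N) t < b%:E)%E & b < t.
    case: (rho_bar (renorm N) t) rt => [r| |]//.
      rewrite lte_fin => rt; exists ((r + t) / 2); rewrite ?lte_fin; lra.
    by move=> _; exists (t - 1); [rewrite ltNyr|lra].
  exists (Num.max b 0); split; [by rewrite le_max lexx orbT|by rewrite gt_max bt|].
  move=> x x1; have [L hL] := rho_bar_renorm_lt rb x1; exists L => z Lz zt.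
  by apply: le_trans (hL z Lz zt) _; rewrite lerD2l le_max lexx.
pose th := b / t.
have th0 : 0 <= th by rewrite divr_ge0// ltW.
have th1 : th < 1 by rewrite ltr_pdivrMr// mul1r.
pose Q := t^-1 + 1; pose h x := Num.max (N x) Q.
have ti0 : 0 < t^-1 by rewrite invr_gt0.
have step x : exists L, forall y, kerl L y -> N y <= 1 -> h (x + y) <= h x + th.
  have hQ : Q <= h x + th by rewrite ler_wpDr// le_max lexx orbT.
  have [xt|xt] := leP t^-1 (N x); last first.
    exists [::] => y _ y1; rewrite {1}/h ge_max hQ andbT; apply: le_trans hQ.
    apply: le_trans (eqnormD _ _ _) _; rewrite /Q; lra.
  have Nx : 0 < N x by exact: lt_le_trans xt.
  have [|L hL] := hb ((N x)^-1 *: x).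
    by rewrite eqnormZp ?invr_ge0 ?(ltW Nx)// mulVf// gt_eqF.
  exists L => y Ly y1; rewrite {1}/h ge_max hQ andbT.
  apply: (@le_trans _ _ (N x + th)); last by rewrite lerD2r le_max lexx.
  (* [x + y] is [N x] times the convex combination, with weight [la], of the normalized [x] and its
     translate by [t *: y], whose norm is at most [1 + b]. *)
  pose la := (t * N x)^-1.
  have tN : 1 <= t * N x by rewrite -ler_pdivrMl// mulr1.
  have la0 : 0 < la by rewrite invr_gt0; lra.
  have la1 : la <= 1 by rewrite invf_le1//; lra.
  have ex : x + y = N x *: ((1 - la) *: ((N x)^-1 *: x) + la *: ((N x)^-1 *: x + t *: y)).
    rewrite [la *: (_ + _)]scalerDr addrA -scalerDl subrK scale1r scalerDr !scalerA.
    rewrite divff ?gt_eqF// scale1r; congr (_ + _).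
    have -> : N x * la * t = 1 by rewrite /la; field; rewrite !gt_eqF.
    by rewrite scale1r.
  rewrite ex eqnormZp ?(ltW Nx)//.
  have h1 : N ((1 - la) *: ((N x)^-1 *: x) + la *: ((N x)^-1 *: x + t *: y)) <= 1 + la * b.
    apply: le_trans (eqnormD _ _ _) _.
    rewrite eqnormZp ?subr_ge0// (eqnormZp _ _ (ltW la0)).
    rewrite eqnormZp ?invr_ge0 ?(ltW Nx)// mulVf ?gt_eqF//.
    have : N ((N x)^-1 *: x + t *: y) <= 1 + b.
      by apply: hL; [exact: kerlZ|rewrite eqnormZp ?(ltW t0)// -[leRHS]mulr1 ler_wpM2l ?(ltW t0)].
    nra.
  have h2 : N x * (la * b) = th.
    by rewrite /la /th; field; rewrite !gt_eqF.
  have := ler_wpM2l (ltW Nx) h1; rewrite mulrDr h2 mulr1; exact.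
have key n x : iter n (Aop N 1) N x <= h x + n%:R * th.
  elim: n x => [|n IH] x /=; first by rewrite mul0r addr0 le_max lexx.
  have [L hL] := step x; apply: (@Aop_le _ _ _ _ _ _ _ L) => //.
    by apply: iter_lip => //; exact: lip_N.
  move=> y Ly y1; apply: le_trans (IH _) _; have := hL y Ly y1.
  rewrite -natr1; lra.
(* One successor puts [k] above [Q / (1 - th)], so that [Q + k * th < k]; the other ensures
   [1 < k]. *)
pose k := (Num.truncn (Q / (1 - th))).+2.
exists k => //; apply: le_lt_trans (key k 0) _.
rewrite /h eqnorm0 max_r; last by rewrite /Q; lra.
have h1 : Q / (1 - th) < k%:R.
  by apply: lt_trans (truncnS_gt _) _; rewrite ltr_nat.
by move: h1; rewrite ltr_pdivrMr ?subr_gt0//; lra.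
Qed.

(* Asymptotic uniform smoothness at the dyadic slopes 2^-k *)
Definition smooth_norm : Prop := exists (P : nat) (c : R), [/\ 0 < c, (0 < P)%N &
  forall k : nat, exists s : R, [/\ 0 < s <= 1, c * 2^-1 ^+ (k * P) <= s * 2^-1 ^+ k &
    forall x, N x <= 1 -> exists L, forall y, kerl L y -> N y <= 1 ->
      N (x + s *: y) <= 1 + s * 2^-1 ^+ k / 2]].

(** At slope [eta = 2^-k] the size [s = (eta / (4 * K))]^ r[with]r = (q - 1)^-1[makes]K * s [^ q] a
    quarter of [s * eta]. Rounding [r] up to a natural number [m] bounds [s * eta] below by a power
    [m.+1] of [eta]. *)
Lemma smooth_norm_of_power_type (q : R) : 1 < q -> aus_power_type (renorm N) q -> smooth_norm.
Proof.
move=> q1 [K0 hK0]; pose K := Num.max K0 1.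
have K1 : 1 <= K by rewrite le_max lexx orbT.
have Kp : 0 < K by lra.
have hK t : 0 < t -> (rho_bar (renorm N) t <= (K * t `^ q)%:E)%E.
  move=> t0; apply: le_trans (hK0 _ t0) _.
  by rewrite lee_fin ler_wpM2r ?powR_ge0// le_max lexx.
pose r := (q - 1)^-1; have r0 : 0 < r by rewrite invr_gt0 subr_gt0.
pose m := (Num.truncn r).+1.
have rm : r <= m%:R by rewrite ltW// truncnS_gt.
exists m.+1, ((4 * K)^-1 ^+ m); split=> //; first by rewrite exprn_gt0// invr_gt0; lra.
move=> k; pose eta : R := 2^-1 ^+ k.
have e0 : 0 < eta by rewrite exprn_gt0.
have e1 : eta <= 1 by rewrite exprn_ile1//; lra.
pose b := eta / (4 * K).
have b0 : 0 < b by rewrite divr_gt0//; lra.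
have b1 : b <= 1 by rewrite ler_pdivrMr ?mul1r; lra.
pose s := b `^ r.
have s0 : 0 < s by rewrite powR_gt0.
have s1 : s <= 1.
  by have := @ger_powR _ b _ 0 r (ltW r0); rewrite b0 b1 powRr0; apply.
exists s; split; first by rewrite s0.
  have : b ^+ m <= s by rewrite -powR_mulrn ?(ltW b0)//; apply: ger_powR; rewrite ?b0.
  have -> : (4 * K)^-1 ^+ m * 2^-1 ^+ (k * m.+1) = b ^+ m * eta.
    by rewrite exprM exprSr mulrA -exprMn [_^-1 * _]mulrC.
  by move=> h; rewrite ler_wpM2r// ltW.
have sq : K * s `^ q < s * eta / 2.
  have -> : s `^ q = s * b.
    rewrite -(mulr_powRB1 (ltW s0)) ?(lt_trans _ q1)//; congr (_ * _).
    by rewrite /s -powRrM mulVf ?subr_eq0 ?gt_eqF// powRr1// ltW.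
  have -> : K * (s * b) = s * eta / 4 by rewrite /b; field; rewrite gt_eqF.
  have := mulr_gt0 s0 e0; lra.
have h1 x : N x = 1 -> exists L, forall y, kerl L y -> N y <= 1 ->
    N (x + s *: y) <= 1 + s * eta / 2.
  have /rho_bar_renorm_lt h : (rho_bar (renorm N) s < (s * eta / 2)%:E)%E.
    by apply: le_lt_trans (hK _ s0) _; rewrite lte_fin.
  move=> /h[L hL]; exists L => y Ly y1; apply: hL; first exact: kerlZ.
  by rewrite eqnormZp ?(ltW s0)// -[leRHS]mulr1 ler_wpM2l// ltW.
move=> x x1; have [x0|x0] := eqVneq x 0.
  exists [::] => y _ y1; rewrite x0 add0r eqnormZp ?(ltW s0)//.
  have := mulr_gt0 s0 e0; have := eqnorm_ge0 N y; rewrite -/eta; nra.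
have Nx : 0 < N x by exact: eqnorm_gt0.
pose x' := (N x)^-1 *: x.
have [L hL] : exists L, forall y, kerl L y -> N y <= 1 -> N (x' + s *: y) <= 1 + s * eta / 2.
  by apply: h1; rewrite eqnormZp ?invr_ge0 ?(ltW Nx)// mulVf// gt_eqF.
exists L => y Ly y1.
have hp := hL y Ly y1.
have hm : N (- x' + s *: y) <= 1 + s * eta / 2.
  by rewrite -eqnormN opprD opprK -scalerN; apply: hL; [exact: kerlN|rewrite eqnormN].
(* A point of the ball lies between the two opposite unit vectors [x'] and [- x'], and the estimate
   holds at both. *)
have -> : x + s *: y = ((1 + N x) / 2) *: (x' + s *: y) + ((1 - N x) / 2) *: (- x' + s *: y).
  rewrite !scalerDr scalerN addrACA -scalerBl -scalerDl /x'.
  have -> : (1 + N x) / 2 - (1 - N x) / 2 = N x by field.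
  have -> : (1 + N x) / 2 + (1 - N x) / 2 = 1 by field.
  by rewrite scale1r scalerA divff ?gt_eqF// scale1r.
apply: le_trans (eqnormD _ _ _) _; rewrite -/eta.
have a0 : 0 <= (1 + N x) / 2 by lra.
have a1 : 0 <= (1 - N x) / 2 by lra.
rewrite (eqnormZp _ _ a0) (eqnormZp _ _ a1).
by have := ler_wpM2l a0 hp; have := ler_wpM2l a1 hm; lra.
Qed.

End smooth_norms.

Section identity_norm.
Context {R : realType} {X : normedModType R}.

Lemma id_norm_equiv : exists c C : R, [/\ 0 < c, 0 < C &
  forall x : X, c * `|x| <= `|x| <= C * `|x|].
Proof. by exists 1, 1; split => // x; rewrite mul1r lexx. Qed.

Definition id_norm : equiv_norm X :=
  EquivNorm (@ler_normD _ X) (@normrZ _ X) id_norm_equiv.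

Lemma power_type_renorming (N : equiv_norm X) : sub_linear_game N ->
  exists q : R, 1 < q /\ exists N' : equiv_norm X, aus_power_type (renorm N') q.
Proof.
move=> /power_type_norm[N' [k [mu [c [k1 m01 km c0 h]]]]].
have [q [q1 hq]] := power_type_of_geometric k1 m01 km c0 h.
by exists q; split => //; exists N'.
Qed.

End identity_norm.

(** * Szlenk index *)

Section ordinal_codes.

Lemma co_le_succ_succ a b : co_le (co_succ a) (co_succ b) -> co_le a b.
Proof. by move=> h; inversion h. Qed.

Lemma co_le_succ_sup a f : co_le (co_succ a) (co_sup f) -> exists n, co_le (co_succ a) (f n).
Proof. by move=> h; inversion h; subst; exists n. Qed.

Lemma co_sup_le_inv f b : co_le (co_sup f) b -> forall n, co_le (f n) b.
Proof.
move e: (co_sup f) => s h; elim: h f e => // [a g m _ IH f e n|g c h _ f [->] n].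
  by apply: co_le_sup; exact: IH.
exact: h.
Qed.

Lemma co_le_refl a : co_le a a.
Proof.
elim: a => [|a IH|f IH]; [exact: co_le_zero|exact: co_le_succ|].
by apply: co_sup_le => n; exact: co_le_sup (IH n).
Qed.

Lemma co_le_trans a b c : co_le a b -> co_le b c -> co_le a c.
Proof.
move=> ab; elim: ab c => {a b} [b c _|a b _ IH c|a f n _ IH c fc|f b _ IH c bc].
- exact: co_le_zero.
- elim: c => [h|c _ /co_le_succ_succ h|f IHf /co_le_succ_sup[n h]]; first by inversion h.
    by apply: co_le_succ; exact: IH.
  by apply: co_le_sup; exact: IHf h.
- by apply: IH; exact: co_sup_le_inv.
- by apply: co_sup_le => n; exact: IH.
Qed.

Lemma co_le_succr a : co_le a (co_succ a).
Proof.
elim: a => [|a IH|f IH]; [exact: co_le_zero|exact: co_le_succ|].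
apply: co_sup_le => n; apply: co_le_trans (IH n) _; apply: co_le_succ.
by apply: (@co_le_sup _ _ n); exact: co_le_refl.
Qed.

(** [co_le (co_succ b) a] plays the role of the strict order, so this is the trichotomy of ordinals,
    by nested induction on the codes. *)
Lemma co_le_total a b : co_le a b \/ co_le (co_succ b) a.
Proof.
elim: a b => [b|a IHa|f IHf b]; first by left; exact: co_le_zero.
  elim=> [|b _|f IHf].
  - by right; apply: co_le_succ; exact: co_le_zero.
  - by have [h|h] := IHa b; [left|right]; exact: co_le_succ.
  - have [[n h]|nh] := pselect (exists n, co_le (co_succ a) (f n)).
      by left; exact: co_le_sup h.
    right; apply: co_le_succ; apply: co_sup_le => n.
    have [h|/co_le_succ_succ//] := IHf n.
    by exfalso; apply: nh; exists n.
have [[n h]|nh] := pselect (exists n, co_le (co_succ b) (f n)).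
  by right; exact: co_le_sup h.
left; apply: co_sup_le => n; have [//|h] := IHf n b.
by exfalso; apply: nh; exists n.
Qed.

Lemma co_lt_wf : well_founded (fun b a => co_le (co_succ b) a).
Proof.
suff h a : forall b, co_le b a -> Acc (fun b a => co_le (co_succ b) a) b.
  by move=> a; exact: h (co_le_refl a).
elim: a => [b h|a IH b h|f IH b h].
- by constructor=> c hc; have hh := co_le_trans hc h; inversion hh.
- by constructor=> c hc; apply: IH; exact: co_le_succ_succ (co_le_trans hc h).
- constructor=> c hc; have [n hn] := co_le_succ_sup (co_le_trans hc h).
  by apply: (IH n); exact: co_le_trans (co_le_succr c) hn.
Qed.

(** Follows from well-foundedness of the strict order; it provides the least index at which a
    derived set is empty, as required by [is_szlenk_at]. *)
Lemma co_least (P : countable_ordinal -> Prop) : (exists a, P a) ->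
  exists a, P a /\ forall b, P b -> co_le a b.
Proof.
move=> [a Pa]; apply: contrapT => nh; move: Pa.
elim/(well_founded_ind co_lt_wf): a => a IH Pa; apply: nh; exists a; split => // b Pb.
by have [//|h] := co_le_total a b; exfalso; exact: IH h Pb.
Qed.

Definition co_nat (n : nat) : countable_ordinal := iter n co_succ co_zero.

End ordinal_codes.

Section liminf.
Context {R : realType}.
Implicit Types (v : nat -> R).

Lemma limn_einf_supE (u : nat -> \bar R) : limn_einf u = ereal_sup (range (einfs u)).
Proof. by rewrite limn_einf_lim; apply/cvg_lim => //; exact: cvg_einfs_sup. Qed.

Lemma limn_einf_ge v (a : R) :
  (forall d : R, 0 < d -> exists N, forall n, (N <= n)%N -> a - d <= v n) ->
  (a%:E <= limn_einf (fun n => (v n)%:E))%E.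
Proof.
move=> h; rewrite limn_einf_supE; apply/lee_addgt0Pr => d d0.
have [N hN] := h d d0; rewrite -leeBlDr//.
apply: le_ereal_sup_tmp; exists (einfs (fun n => (v n)%:E) N); first by exists N.
apply: le_ereal_inf_tmp => _ [k /= Nk <-].
by rewrite -EFinB lee_fin; exact: hN.
Qed.

Lemma limn_einf_le v (a : R) : (a%:E <= limn_einf (fun n => (v n)%:E))%E ->
  forall d : R, 0 < d -> exists N, forall n, (N <= n)%N -> a - d <= v n.
Proof.
rewrite limn_einf_supE => h d d0.
have : ((a - d)%:E < ereal_sup (range (einfs (fun n => (v n)%:E))))%E.
  by apply: lt_le_trans h; rewrite lte_fin ltrBlDr ltrDl.
move=> /ereal_sup_gt[_ [N _ <-] hN]; exists N => n Nn.
rewrite -lee_fin; apply: le_trans (ltW hN) _.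
by apply: ereal_inf_lbound; exists n.
Qed.

End liminf.

Section real_distance.
Context {R : realType}.

Lemma distR_lt (a b e : R) : `|a - b| < e -> a < b + e /\ b < a + e.
Proof. by rewrite ltr_norml => /andP[h1 h2]; split; lra. Qed.

Lemma distR_ltI (a b e : R) : a < b + e -> b < a + e -> `|a - b| < e.
Proof. by move=> h1 h2; rewrite ltr_norml; apply/andP; split; lra. Qed.

Lemma distR_le (a b e : R) : `|a - b| <= e -> a <= b + e /\ b <= a + e.
Proof. by rewrite ler_norml => /andP[h1 h2]; split; lra. Qed.

End real_distance.

Section szlenk_sets.
Context {R : realType} {X : normedModType R}.
Implicit Types (f g : dual X) (x y : X) (eps : R).

Lemma szlenk_derivation_mono eps (K K' : set (dual X)) : K `<=` K' ->
  szlenk_derivation eps K `<=` szlenk_derivation eps K'.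
Proof.
move=> KK f [Kf [u [Ku uf lim]]]; split; first exact: KK.
by exists u; split => // n; exact: KK.
Qed.

Lemma szlenk_set_ball eps a f : szlenk_set eps a f -> `|f| <= 1.
Proof. by elim: a => //= [a IH [/IH]|g IH /(_ 0%N I)] //; exact: IH. Qed.

Lemma szlenk_set_anti eps a b : co_le a b ->
  (szlenk_set eps b : set (dual X)) `<=` szlenk_set eps a.
Proof.
elim=> {a b} [b f|a b _ IH|a g n _ IH|g b _ IH].
- exact: szlenk_set_ball.
- exact: szlenk_derivation_mono.
- by move=> f /= h; apply: IH; exact: h.
- by move=> f hf n _; exact: IH.
Qed.

Definition szlenk_finite : Prop :=
  forall eps, 0 < eps -> exists n, szlenk_set eps (co_nat n) = set0 :> set (dual X).

(** [U] is a bounded potential that each derivation lowers by the fixed amount [eta]: after more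
    than [M / eta] derivations it would be negative. *)
Lemma szlenk_decrease eps (U : dual X -> R) (M eta : R) : 0 < eta ->
  (forall f, `|f| <= 1 -> 0 <= U f <= M) ->
  (forall s (u : nat -> dual X) f, s <= M -> (forall n, `|u n| <= 1) ->
    (forall n, U (u n) <= s) -> `|f| <= 1 -> wstar_cvg u f ->
    (eps%:E <= limn_einf (fun n => `|u n - f|%:E))%E -> U f <= s - eta) ->
  exists n, szlenk_set eps (co_nat n) = set0 :> set (dual X).
Proof.
move=> eta0 U0M Ud.
have key n f : szlenk_set eps (co_nat n) f -> U f <= M - n%:R * eta.
  elim: n f => [|n IH] f.
    by move=> /= /U0M/andP[_]; rewrite mul0r subr0.
  move=> /= [Kf [u [Ku uf lim]]].
  have := Ud (M - n%:R * eta) u f; rewrite -natr1 mulrDl mul1r opprD addrA; apply => //.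
  - by rewrite lerBlDr lerDl mulr_ge0// ltW.
  - by move=> k; exact: szlenk_set_ball (Ku k).
  - by move=> k; exact: IH.
  - exact: szlenk_set_ball Kf.
exists (Num.truncn (M / eta)).+1; rewrite -subset0 => f Kf.
have := key _ _ Kf; have /andP[U0 _] := U0M _ (szlenk_set_ball Kf).
have := truncnS_gt (M / eta); rewrite ltr_pdivrMr//; lra.
Qed.

Lemma fr_id_fin_dim l : (forall x, fr l x = x) -> fin_dim [set: X].
Proof.
move=> h; exists (size l), (fun i => (tnth (in_tuple l) i).2) => x _.
exists (fun i => (tnth (in_tuple l) i).1 x).
by rewrite -(big_tnth _ _ _ xpredT (fun p : dual X * X => p.1 x *: p.2)) -/(fr l x) h.
Qed.

Lemma annihilator (b : seq X) : ~ fin_dim [set: X] ->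
  exists g : dual X, `|g| = 1 /\ forall v, v \in b -> g v = 0.
Proof.
move=> Xinf; have [l [_ lb]] := lspan_projection b.
have [x hx] : exists x, fr l x <> x.
  by apply/existsNP => h; apply: Xinf; exact: fr_id_fin_dim h.
have [f [_ fx]] := norming (x - fr l x).
have [g gE] := dual_comp_fr f l.
have g0 : 0 < `|g|.
  rewrite normr_gt0; apply/eqP => g0; have := gE x.
  rewrite g0 dual0 fx => /esym/eqP; rewrite normr_eq0 subr_eq0 => /eqP/esym; exact: hx.
exists (`|g|^-1 *: g); split; first by rewrite normrZ normfV normr_id mulVf// gt_eqF.
move=> v vb; rewrite dualZ gE lb ?subrr ?du0 ?mulr0//; exact: lspan_mem.
Qed.

Lemma unit_in_kerl L (N : equiv_norm X) : ~ fin_dim [set: X] -> exists x, kerl L x /\ N x = 1.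
Proof.
move=> Xinf; have [l [lL _]] := kerl_projection L.
have [x hx] : exists x, fr l x <> x.
  by apply/existsNP => h; apply: Xinf; exact: fr_id_fin_dim h.
have x0 : 0 < N (x - fr l x).
  by apply: eqnorm_gt0; rewrite subr_eq0; apply/eqP => /esym.
exists ((N (x - fr l x))^-1 *: (x - fr l x)); split; first exact: kerlZ.
by rewrite eqnormZp ?invr_ge0 ?(ltW x0)// mulVf// gt_eqF.
Qed.

End szlenk_sets.

Arguments szlenk_finite {R} X.

Section szlenk_index.
Context {R : realType} {X : normedModType R}.
Context (ys : nat -> X) (fs : nat -> dual X).
Context (Xinf : ~ fin_dim [set: X]).
Context (ysT : forall x (e : R), 0 < e -> exists n y,
  lspan (mkseq ys n) y /\ `|x - y| < e).
Context (fsD : forall (f : dual X) (e : R), 0 < e -> exists n, `|f - fs n| < e).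

Lemma wstar_null_sphere : exists g : nat -> dual X, (forall n, `|g n| = 1) /\ wstar_null g.
Proof.
have [g gP] := choice (fun n => annihilator (mkseq ys n) Xinf).
exists g; split=> [n|]; first by case: (gP n).
apply: (@wstar_cvg_total _ _ ys g 0 1) => // [n||i e e0].
- by case: (gP n) => ->.
- by rewrite normr0.
exists i.+1 => n ni; rewrite dual0 subr0; have [_ ->] := gP n; first by rewrite normr0.
by apply: map_f; rewrite mem_iota.
Qed.

(** Adding [eps] times a normalized w*-null sequence shows that a derivation shrinks a ball by at
    most [eps]. This is what bounds the index below by omega. *)
Lemma ball_szlenk_set eps n (f : dual X) : 0 < eps -> `|f| <= 1 - n%:R * eps ->
  szlenk_set eps (co_nat n) f.
Proof.
move=> e0; elim: n f => [|n IH] f; first by rewrite mul0r subr0.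
rewrite -natr1 mulrDl mul1r => fn /=; have [g [g1 /wstar_cvgP g0]] := wstar_null_sphere.
split; first by apply: IH; lra.
exists (fun k => f + eps *: g k); split.
- move=> k; apply: IH; apply: le_trans (ler_normD _ _) _.
  rewrite normrZ g1 mulr1 gtr0_norm//; lra.
- apply/wstar_cvgP => x e ep; have [N hN] := g0 x (e / eps) (divr_gt0 ep e0).
  exists N => k /hN; rewrite dual0 subr0 dualD addrAC subrr add0r dualZ normrM gtr0_norm//.
  by rewrite ltr_pdivlMr// mulrC.
- apply: limn_einf_ge => d d0; exists 0%N => k _.
  by rewrite addrAC subrr add0r normrZ g1 mulr1 gtr0_norm// gerBl ltW.
Qed.

Lemma szlenk_index_omega : szlenk_finite X -> is_szlenk_index X (Some co_omega).
Proof.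
move=> fin; split=> [eps [b|] /andP[e0 e1] /=|[c|] h //=].
- move=> [_ hb]; have [n /hb bn] := fin eps e0.
  by apply: co_le_trans bn _; apply: (@co_le_sup _ _ n); exact: co_le_refl.
- by move=> hb; have [n /hb] := fin eps e0.
apply: co_sup_le => n; rewrite -/(co_nat n).
(* Less than 1, as required of the parameter, and with [n * eps <= 1], so that 0 survives [n]
   derivations. *)
pose eps : R := n.+2%:R^-1.
have e0 : 0 < eps by rewrite invr_gt0.
have e1 : eps < 1 by rewrite invf_lt1// ltr1n.
have [b [b0 bmin]] : exists b, szlenk_set eps b = set0 :> set (dual X) /\
    forall a, szlenk_set eps a = set0 :> set (dual X) -> co_le b a.
  by apply: (co_least (P := fun b => szlenk_set eps b = set0 :> set (dual X)));
    have [m hm] := fin eps e0; exists (co_nat m).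
have bc : co_le b c by apply: (h eps (Some b)); rewrite ?e0.
have [/(szlenk_set_anti (eps := eps) (X := X))|nb] := co_le_total b (co_nat n); last first.
  exact: co_le_trans (co_le_succr _) (co_le_trans nb bc).
rewrite b0 subset0 => Kn; exfalso.
suff : szlenk_set eps (co_nat n) (0 : dual X) by rewrite Kn.
apply: ball_szlenk_set => //; rewrite normr0 subr_ge0 /eps ler_pdivrMr// mul1r ler_nat.
by rewrite ltnW// ltnW.
Qed.

Definition nat_eps (n : nat) : R := n.+1%:R^-1.

Lemma nat_eps_gt0 n : 0 < nat_eps n. Proof. by rewrite invr_gt0. Qed.

Lemma nat_eps_lt (e : R) : 0 < e -> exists N, forall n, (N <= n)%N -> nat_eps n < e.
Proof.
move=> e0; exists (Num.truncn e^-1).+1 => n nN.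
rewrite /nat_eps invf_plt ?posrE//; apply: lt_trans (truncnS_gt _) _.
by rewrite ltr_nat ltnS.
Qed.

Definition wclosed (K : set (dual X)) : Prop := forall f : dual X,
  (forall (s : seq X) (e : R), 0 < e -> exists2 u, K u & forall x, x \in s -> `|u x - f x| < e) ->
  K f.

(* Derivation witnessed by almost weakly null vectors: unlike [szlenk_derivation] *)
(* it preserves w*-closedness for trivial reasons.                                *)
Definition wit (j : nat) (f : dual X) (K : set (dual X)) : Prop := exists u y,
  [/\ K u, `|y| <= 1, forall i, (i < j)%N -> `|u (ys i) - f (ys i)| < nat_eps j,
    forall i, (i < j)%N -> `|fs i y| < nat_eps j & 1 / 2 <= (u y : R)].

Definition Lder (K : set (dual X)) : set (dual X) := [set f | K f /\ forall j, wit j f K].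

Definition Lset (m : nat) : set (dual X) := iter m Lder [set f | `|f| <= 1].

Lemma wclosed_Lder K : wclosed K -> wclosed (Lder K).
Proof.
move=> cK f hf; split.
  by apply: cK => s e e0; have [u [Ku _] us] := hf s e e0; exists u.
(* The tolerance at [j'] is half the tolerance at [j], which leaves the other half for the distance
   between [f] and [u']. *)
move=> j; pose j' := (j.*2).+1.
have j'E : nat_eps j' = nat_eps j / 2.
  by rewrite /nat_eps -invfM -natrM /j'; congr (_%:R^-1); lia.
have j0 := nat_eps_gt0 j.
have [u' [Ku' wu'] us] := hf (mkseq ys j) (nat_eps j / 2) (divr_gt0 j0 (ltr0n _ 2)).
have [u [y [Ku y1 uu fy uy]]] := wu' j'.
have jj i : (i < j)%N -> (i < j')%N by rewrite /j'; lia.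
exists u, y; split => // i ij; last first.
  by apply: lt_trans (fy _ (jj _ ij)) _; rewrite j'E; lra.
have h1 := uu _ (jj _ ij); rewrite j'E in h1.
have h2 : `|u' (ys i) - f (ys i)| < nat_eps j / 2 by apply: us; apply: map_f; rewrite mem_iota.
have [h3 h4] := distR_lt (h1 : `|(u (ys i) : R) - u' (ys i)| < _).
have [h5 h6] := distR_lt (h2 : `|(u' (ys i) : R) - f (ys i)| < _).
by apply: (@distR_ltI _ (u (ys i)) (f (ys i))); lra.
Qed.

Lemma wclosed_Lset m : wclosed (Lset m).
Proof.
elim: m => [f h|m IH]; last exact: wclosed_Lder.
apply: dual_le => // x; rewrite mul1r; apply/ler_addgt0Pr => e e0.
have [u /= u1 /(_ x (mem_head _ _)) ux] := h [:: x] e e0.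
rewrite -(subrK (u x) (f x)) addrC (le_trans (ler_normD _ _))// lerD//.
  apply: le_trans (dualP _ _) _; by rewrite -[leRHS]mul1r ler_wpM2r.
by rewrite distrC ltW.
Qed.

Lemma Lset_anti m n : (m <= n)%N -> Lset n `<=` Lset m.
Proof. by move=> /subnK <-; elim: (n - m)%N => // k IH f [/IH]. Qed.

Lemma Lset_ball m f : Lset m f -> `|f| <= 1.
Proof. exact: (@Lset_anti 0). Qed.

(** Along the witnesses [f (y n)] tends to 0, the [y n] being almost annihilated by a dense
    sequence, while [u n (y n) >= 1 / 2]; hence the lower limit of [|u n - f|] is at least
    [1 / 2]. *)
Lemma Lset_szlenk m : Lset m `<=` szlenk_set (1 / 2) (co_nat m).
Proof.
elim: m => // m IH f [Lf wf]; split; first exact: IH.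
have [u up] := choice wf; have [y uyP] := choice up.
have f1 := Lset_ball Lf.
have u1 n : `|u n| <= 1 by have [/Lset_ball] := uyP n.
exists u; split => [n||].
- by apply: IH; have [] := uyP n.
- apply: (@wstar_cvg_total _ _ ys u f 1) => // i e e0.
  have [N hN] := nat_eps_lt e0; exists (maxn N i.+1) => n; rewrite geq_max => /andP[nN ni].
  by have [_ _ h _ _] := uyP n; apply: lt_trans (h i ni) (hN n nN).
- apply: limn_einf_ge => d d0.
  have d2 : 0 < d / 2 by rewrite divr_gt0.
  have [k fk] := fsD f d2; have [N hN] := nat_eps_lt d2.
  exists (maxn N k.+1) => n; rewrite geq_max => /andP[nN nk].
  have [_ y1 _ /(_ k nk) fy uy] := uyP n.
  have h1 : `|(u n - f) (y n)| <= `|u n - f|.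
    by apply: le_trans (dualP _ _) _; rewrite -[leRHS]mulr1 ler_wpM2l.
  have h2 : `|(f - fs k) (y n)| <= d / 2.
    apply: le_trans (dualP _ _) _; rewrite -[leRHS]mulr1 ler_pM//; exact: ltW.
  have h3 := hN n nN.
  have h4 : (u n (y n) : R) - f (y n) <= `|u n - f| by exact: le_trans (ler_norm _) h1.
  have h5 : (f (y n) : R) - fs k (y n) <= d / 2 by exact: le_trans (ler_norm _) h2.
  have h6 : (fs k (y n) : R) < nat_eps n by exact: le_lt_trans (ler_norm _) fy.
  by lra.
Qed.

(** By weak* compactness, nonempty decreasing [Lset m] would have a common point; it would survive
    omega derivations with parameter [1 / 2], against the index being omega. *)
Lemma Lset_empty : is_szlenk_index X (Some co_omega) -> exists N, Lset N = set0.
Proof.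
move=> [ub _]; apply: contrapT => nh.
have [f fP] : exists f, forall m, Lset m f.
  have ne m : exists f, Lset m f.
    by apply: contrapT => h; apply: nh; exists m; rewrite -subset0 => f Lf; apply: h; exists f.
  have [f fP] := choice ne.
  have [||g [_ gP]] := @wstar_cluster _ _ f 1 setT => [n|N|].
  - exact: Lset_ball (fP n).
  - by exists N.
  exists g => m; apply: wclosed_Lset => s e e0.
  have [n [mn _ us]] := gP s e m e0; exists (f n) => //.
  exact: Lset_anti (fP n).
have K0 : szlenk_set (1 / 2) co_omega f by move=> n _; exact: Lset_szlenk.
have e01 : (0 < (1 / 2 : R)) && ((1 / 2 : R) < 1) by apply/andP; split; lra.
have [[a Ka]|na] := pselect (exists a, szlenk_set (1 / 2) a = set0 :> set (dual X)).
  have [b [b0 bmin]] := co_least (ex_intro (fun a => szlenk_set (1 / 2) a = set0 :> set (dual X)) a Ka).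
  have : xco_le (Some b) (Some co_omega) by apply: ub e01 _.
  by move=> /= /(szlenk_set_anti (X := X) (eps := 1 / 2))/(_ _ K0); rewrite b0.
have : xco_le None (Some co_omega) by apply: (ub (1 / 2) None e01) => b hb; apply: na; exists b.
by [].
Qed.

Lemma pigeonhole (h : nat -> nat) N : (forall j, (h j < N)%N) ->
  exists m, forall M, exists2 j, (M <= j)%N & h j = m.
Proof.
move=> hN; apply: contrapT => /forallNP nh.
have /choice[b bP] : forall m, exists M, forall j, (M <= j)%N -> h j <> m.
  move=> m; have /existsNP[M nM] := nh m; exists M => j Mj hj.
  by apply: nM; exists j.
pose B := \max_(m < N) b m.
apply: (bP (h B) B) => //; rewrite /B.
exact: (leq_bigmax (Ordinal (hN B))).
Qed.

(** A move on which the limiting functionals take value at least [1 / 2] costs one derivation, and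
    fewer than [N] are available; every other move gains less than [1 / 2]. Thus [k] moves cannot
    reach [k] for large [k]. *)
Lemma sub_linear_of_Lset N : Lset N = set0 -> sub_linear_game (@id_norm R X).
Proof.
move=> LN; apply: contrapT => nP.
pose phi i := iter i (Aop (@id_norm R X) 1) (@id_norm R X).
have lphi i : lip (@id_norm R X) (phi i) by apply: iter_lip => //; exact: lip_N.
have mN m f : Lset m f -> (m < N)%N.
  move=> Lf; rewrite ltnNge; apply/negP => Nm.
  by have := Lset_anti Nm Lf; rewrite LN.
(* [m] counts the expensive moves, charged 1 each; each of the [i] moves is moreover charged
   [1 / 2]. *)
have claim i : forall s b, b < phi i s -> exists m f, Lset m f /\ b <= f s + m%:R + i%:R / 2.
  elim: i => [|i IH] s b.
    move=> /= bs; have [f [f1 fs']] := norming s; exists 0%N, f; split => //.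
    by rewrite fs' mul0r !addr0 ltW.
  move=> bs.
  have yex j : exists y, [/\ kerl (mkseq fs j) y, `|y| <= 1 & b < phi i (s + y)].
    apply: contrapT => ny; move: bs; rewrite ltNge => /negP; apply.
    apply: (@Aop_le _ _ _ _ _ _ _ (mkseq fs j)) => // y Ly y1.
    by rewrite leNgt; apply/negP => h; apply: ny; exists y.
  have [y yP] := choice yex.
  have mfex j : exists mf : nat * dual X, Lset mf.1 mf.2 /\
      b <= mf.2 (s + y j) + mf.1%:R + i%:R / 2.
    by have [_ _ /IH[m [f [Lf h]]]] := yP j; exists (m, f).
  have [mf mfP] := choice mfex.
  pose big j : bool := 1 / 2 <= ((mf j).2 (y j) : R).
  (* The derivation level and the kind of move are packed into one number, so one pigeonhole
     stabilizes both along infinitely many [j]. *)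
  pose code j := ((mf j).1.*2 + big j)%N.
  have [c cP] : exists c, forall M, exists2 j, (M <= j)%N & code j = c.
    apply: (@pigeonhole code N.*2) => j; have := mN _ _ (mfP j).1.
    by rewrite /code; case: (big j); lia.
  pose m := c./2; pose bb := odd c.
  have codeE j : code j = c -> (mf j).1 = m /\ big j = bb.
    move=> h; rewrite /m /bb -h /code; split; first by case: (big j); lia.
    by rewrite oddD odd_double; case: (big j).
  have [||g [g1 gP]] := @wstar_cluster _ _ (fun j => (mf j).2) 1 [set j | code j = c] => [j||].
  - exact: Lset_ball (mfP j).1.
  - by move=> M; have [j] := cP M; exists j.
  have Lg : Lset m g.
    apply: wclosed_Lset => t e e0; have [j [_ /codeE[jm _] jt]] := gP t e 0%N e0.
    by exists (mf j).2 => //; rewrite -jm; exact: (mfP j).1.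
  (* If the moves are expensive infinitely often, the functionals and the vectors [y k] are
     precisely witnesses for one more derivation at [g]. *)
  case bbE: bb.
    exists m.+1, g; split.
      split => // j; have j0 := nat_eps_gt0 j.
      have [k [jk /codeE[km kb] kt]] := gP (mkseq ys j) _ j j0.
      have [/= Ly y1 _] := yP k; exists (mf k).2, (y k); split => //.
      + by rewrite -/(Lset m) -km; exact: (mfP k).1.
      + by move=> q qj; apply: kt; apply: map_f; rewrite mem_iota.
      + move=> q qj; rewrite Ly ?normr0// map_f// mem_iota add0n.
        exact: leq_trans jk.
      + by move: kb; rewrite bbE.
    apply/ler_addgt0Pr => e e0; have [j [_ /codeE[jm _] jt]] := gP [:: s] e 0%N e0.
    have [_ h] := mfP j; rewrite jm duD in h.
    have h2 : ((mf j).2 (y j) : R) <= 1.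
      apply: le_trans (ler_norm _) (le_trans (dualP _ _) _).
      have [_ y1 _] := yP j; rewrite -[leRHS]mulr1 ler_pM//; exact: Lset_ball (mfP j).1.
    have [h1 _] := distR_lt (jt s (mem_head _ _) : `|((mf j).2 s : R) - g s| < _).
    rewrite -[m.+1%:R]natr1 -[i.+1%:R]natr1; lra.
  exists m, g; split => //.
  apply/ler_addgt0Pr => e e0; have [j [_ /codeE[jm jb] jt]] := gP [:: s] e 0%N e0.
  have [_ h] := mfP j; rewrite jm duD in h.
  have h2 : ((mf j).2 (y j) : R) < 1 / 2 by move: jb; rewrite bbE /big leNgt => /negbFE.
  have [h1 _] := distR_lt (jt s (mem_head _ _) : `|((mf j).2 s : R) - g s| < _).
  rewrite -[i.+1%:R]natr1; lra.
(* The claim gives [k - 1 <= m + k / 2] with [m + 1 <= N], which fails for this [k]. *)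
pose k := (N.*2 + 4)%N.
have kc : k%:R <= phi k 0.
  rewrite leNgt; apply/negP => h; apply: nP; exists k => //; by rewrite /k; lia.
have [|m [f [Lf]]] := claim k 0 (k%:R - 1); first by apply: lt_le_trans kc; lra.
have mn : m%:R + 1 <= N%:R :> R by rewrite natr1 ler_nat; exact: mN Lf.
rewrite du0 /k natrD -muln2 natrM; lra.
Qed.

End szlenk_index.

(** * Moduli of the dual *)

Section renormed_dual.
Context {R : realType} {X : normedModType R}.
Implicit Types (f g : dual X) (x y : X).

Lemma dual_ext f g : (forall x, f x = g x) -> f = g.
Proof. by move=> h; apply/val_inj/funext => x; exact: h. Qed.

(** [dual X] and [dual (renorm N)] are distinct record types with the same underlying functionals;
    [r] transports them with equivalence constants. *)
Lemma renorm_dual (N : equiv_norm X) : exists (r : dual X -> dual (renorm N)) (c C : R),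
  [/\ 0 < c, 0 < C, forall f x, r f x = f x, forall f, `|r f| <= C * `|f| &
    forall f, `|f| <= c * `|r f|].
Proof.
have [c [C [c0 C0 cC]]] := eqnorm_equiv N.
have ex f : exists g : dual (renorm N), (forall x, g x = f x) /\ `|g| <= c^-1 * `|f|.
  have [||g [gE gM]] := @mk_dual _ (renorm N) (f : X -> R) (c^-1 * `|f|).
  - by move=> t x y; rewrite duD duZ.
  - move=> x; have /andP[h _] := cC x; apply: le_trans (dualP f x) _.
    rewrite renorm_norm mulrC mulrAC ler_wpM2r//.
    by rewrite mulrC ler_pdivlMr// mulrC.
  exists g; split => //; move: gM; rewrite ger0_norm// mulr_ge0// invr_ge0 ltW//.
have [r rP] := choice ex.
exists r, C, c^-1; split => //; [by rewrite invr_gt0|by move=> f; case: (rP f)|by move=> f; case: (rP f)|].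
move=> f; apply: dual_le => [|x]; first by rewrite mulr_ge0// ltW.
have [rE _] := rP f; rewrite -rE; apply: le_trans (dualP (r f) x) _.
rewrite mulrC mulrAC ler_wpM2r// renorm_norm.
by have /andP[] := cC x.
Qed.

Lemma wstar_lsc (u : nat -> dual X) f (s : R) : wstar_cvg u f -> (forall n, `|u n| <= s) ->
  `|f| <= s.
Proof.
move=> /wstar_cvgP uf us; have s0 : 0 <= s by exact: le_trans (us 0%N).
apply: dual_le => // x; apply/ler_addgt0Pr => e e0; have [n hn] := uf x e e0.
rewrite -(subrK (u n x : R) (f x : R)) addrC; apply: le_trans (ler_normD _ _) _.
apply: lerD; last by rewrite distrC; exact: ltW (hn n (leqnn n)).
by apply: le_trans (dualP (u n) x) _; rewrite ler_wpM2r.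
Qed.

End renormed_dual.

Section w_star_moduli.
Context {R : realType} {X : normedModType R}.
Implicit Types (f g : dual X) (x y : X).

Lemma delta_bar_star_gt (t d : R) : (d%:E < delta_bar_star X t)%E -> forall f, `|f| = 1 ->
  exists2 Y, wstar_cof X Y & forall g, Y g -> t <= `|g| -> 1 + d <= `|f + g|.
Proof.
rewrite /delta_bar_star lteBrDr// -EFinD => h f f1.
have : ((d + 1)%:E < ereal_sup [set ereal_inf [set `|f + g|%:E | g in [set g | Y g /\ (t <= `|g|)%R]]
    | Y in wstar_cof X])%E.
  by apply: lt_le_trans h _; apply: ereal_inf_lbound; exists f.
move=> /ereal_sup_gt[_ [Y cY <-] hY]; exists Y => // g Yg tg.
rewrite -lee_fin [1 + d]addrC; apply: le_trans (ltW hY) _.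
by apply: ereal_inf_lbound; exists g.
Qed.

Lemma delta_bar_star_ge (t d : R) : (forall f, `|f| = 1 ->
  exists2 Y, wstar_cof X Y & forall g, Y g -> t <= `|g| -> 1 + d <= `|f + g|) ->
  (d%:E <= delta_bar_star X t)%E.
Proof.
move=> h; rewrite /delta_bar_star leeBrDr// -EFinD.
apply: le_ereal_inf_tmp => _ [f /= f1 <-]; have [Y cY hY] := h f f1.
apply: (@le_trans _ _ (ereal_inf [set `|f + g|%:E | g in [set g | Y g /\ (t <= `|g|)%R]])); last first.
  by apply: ereal_sup_ubound; exists Y.
by apply: le_ereal_inf_tmp => _ [g [Yg tg] <-]; rewrite lee_fin [d + 1]addrC hY.
Qed.

Lemma wstar_auc_of_power_type (p : R) : delta_power_type X p -> wstar_auc X.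
Proof.
move=> [K K0 h] t t0; have [t1|t1] := leP t 1.
  by apply: lt_le_trans (h t _); rewrite ?t0// lte_fin mulr_gt0// powR_gt0.
have h1 : ((K / 2)%:E < delta_bar_star X 1)%E.
  have := h 1; rewrite ltr01 lexx powR1 mulr1 => /(_ isT); apply: lt_le_trans.
  by rewrite lte_fin ltr_pdivrMr// ltr_pMr// ltr1n.
apply: (@lt_le_trans _ _ (K / 2)%:E); first by rewrite lte_fin divr_gt0.
apply: delta_bar_star_ge => f /(delta_bar_star_gt h1)[Y cY hY].
by exists Y => // g Yg tg; apply: hY => //; exact: le_trans (ltW t1) tg.
Qed.

Lemma wstar_closed_seq (Y : set (dual X)) (T : Type) (F : set_system T) (u : T -> dual X) f :
  ProperFilter F -> closed (Y : set (wstar X)) -> (forall t, Y (u t)) ->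
  (forall x, u t x @[t --> F] --> (f x : R)) -> Y f.
Proof.
move=> FF cY Yu uf.
have h : (u : T -> wstar X) @ F --> (f : wstar X) by apply/pairing_cvgP => x; exact: uf.
apply: cY => B nB; have FB : F (u @^-1` B) by exact: h.
by have [t Bt] := filter_ex FB; exists (u t).
Qed.

(** The projection along [Y] has coefficients in the bidual, on which w*-null sequences need not
    vanish. Along an ultrafilter the finite rank parts converge in norm to some [h]; w*-closedness
    puts [- h] in [Y], so the projection kills [h]. *)
Lemma wstar_cof_approx (Y : set (dual X)) (u : nat -> dual X) (M : R) : wstar_cof X Y ->
  wstar_null u -> (forall n, `|u n| <= M) -> forall e : R, 0 < e ->
  exists N, forall n, (N <= n)%N -> exists2 h, Y h & `|h - u n| < e.
Proof.
move=> [Ys Yf Yc] /wstar_cvgP u0 uM e e0.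
have Ync : closed Y.
  apply: closedP_dist => f hf.
  have hy n : exists g, Y g /\ `|f - g| < n.+1%:R^-1.
    by have [|g Yg fg] := hf (n.+1%:R^-1); [rewrite invr_gt0|exists g].
  have [g gP] := choice hy.
  apply: (@wstar_closed_seq Y nat \oo g) => // [n|x]; first by case: (gP n).
  apply/cvgn_distP => d d0; have x1 : 0 < 1 + `|x| by rewrite ltr_wpDr.
  have [N hN] := nat_eps_lt (divr_gt0 d0 x1); exists N => n /hN hn.
  have [_ fg] := gP n; have h1 : `|f - g n| < d / (1 + `|x|) by exact: lt_trans hn.
  rewrite distrC; apply: le_lt_trans (dualP (f - g n) x) _.
  move: h1; rewrite ltr_pdivlMr// => h1; have := normr_ge0 (f - g n); lra.
have [l [lY lr]] := cof_projection Ys Yf Ync.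
apply: contrapT => nh.
have inf N : exists2 n, (N <= n)%N & e <= `|fr l (u n)|.
  apply: contrapT => ninf; apply: nh; exists N => n Nn.
  exists (u n - fr l (u n)); first exact: lr.
  rewrite addrAC subrr add0r normrN ltNge; apply/negP => h.
  by apply: ninf; exists n.
have [U [UU UA UN]] := infinite_ultra inf; have UP := @ultra_proper _ U UU.
have ex (p : dual (dual X) * dual X) : exists a : R, p.1 (u n) @[n --> U] --> a.
  apply: (@ultra_bounded_cvg _ _ _ (fun n => p.1 (u n)) (`|p.1| * M)) => //.
  by apply: filterS filterT => n _ /=; apply: le_trans (dualP _ _) _; rewrite ler_wpM2l.
have [a aP] := choice ex.
pose h := \sum_(p <- l) a p *: p.2.
have frh : fr l (u n) @[n --> U] --> h.
  rewrite /h /fr; elim: (l) => [|p q IH].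
    by rewrite big_nil; under eq_fun do rewrite big_nil; exact: cvg_cst.
  rewrite big_cons; under eq_fun do rewrite big_cons.
  by apply: cvgD => //; apply: cvgZr_tmp; exact: aP.
have Yh : Y (- h).
  apply: (@wstar_closed_seq Y nat U (fun n => u n - fr l (u n)) (- h)) => //.
  move=> x; rewrite dualN -[- h x]add0r; under eq_fun do rewrite dualB.
  apply: cvgB.
    apply/cvgrPdist_lt => d d0; have [N hN] := u0 x d d0.
    by apply: filterS (UN N) => n /hN; rewrite dual0 subr0 sub0r normrN.
  move/cvgrPdist_lt : frh => frh; apply/cvgrPdist_lt => d d0.
  have x1 : 0 < 1 + `|x| by rewrite ltr_wpDr.
  apply: filterS (frh _ (divr_gt0 d0 x1)) => n hn.
  rewrite -dualB; apply: le_lt_trans (dualP _ x) _.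
  by move: hn; rewrite ltr_pdivlMr// => hn; have := normr_ge0 (h - fr l (u n)); lra.
have h0 : fr l h = 0.
  by rewrite -[h]opprK frN (fr_vanish (x := - h)) ?oppr0// => p /lY; exact.
have frfr n : fr l (fr l (u n)) = fr l (u n).
  have : fr l (u n - fr l (u n)) = 0 by apply: fr_vanish => p /lY; apply; exact: lr.
  by rewrite frB => /eqP; rewrite subr_eq0 => /eqP.
have [B B0 hB] := fr_bound l.
have eB : 0 < e / B by rewrite divr_gt0.
move/cvgrPdist_lt : frh => /(_ _ eB) hu.
have [n [/= en hn]] := filter_ex (filterI UA hu).
have : `|fr l (fr l (u n))| < e.
  rewrite -normrN -[- _]add0r -h0 -frB; apply: le_lt_trans (hB _) _.
  by rewrite mulrC -ltr_pdivlMr.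
by rewrite frfr ltNge en.
Qed.

Lemma kernel_wstar_cof (s : seq X) : wstar_cof X [set g | forall v, v \in s -> g v = 0].
Proof.
split.
- split=> [v _|a f g hf hg v vs]; first exact: dual0.
  by rewrite dualD dualZ hf// hg// mulr0 addr0.
- have [l [_ ls]] := lspan_projection s.
  exists (size l), (fun i => (tnth (in_tuple l) i).1) => f.
  exists (f - \sum_(p <- l) f p.2 *: p.1).
    move=> v /lspan_mem/ls h; rewrite dualB dual_sum -{1}h du_sum -sumrB big1// => p _.
    by rewrite duZ dualZ mulrC subrr.
  exists (fun i => f (tnth (in_tuple l) i).2).
  by rewrite -(big_tnth _ _ _ xpredT (fun p : dual X * X => f p.2 *: p.1)) subrK.
- apply: pairing_closed => f hf v vs; apply/eqP; rewrite -normr_le0.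
  apply/ler_addgt0Pr => e e0; rewrite add0r.
  have [g gs /(_ v (or_introl erefl))] := hf [:: v] e e0.
  by rewrite gs// subr0 => /ltW.
Qed.

(** A vector almost norming [g] is moved into [kerl L] by subtracting a net point and a small
    combination of the vectors of the projection; [g] is small on both when it is small on [s]. *)
Lemma lifting_list (L : seq (dual X)) : exists s : seq X, forall g (eta : R),
  (forall v, v \in s -> `|g v| <= eta) ->
  exists y, [/\ kerl L y, `|y| <= 1 & `|g| / 5 - eta <= (g y : R)].
Proof.
have [l [lL _]] := kerl_projection L.
have q0 : 0 < 1 / 4 :> R by lra.
have [d1 d10 hd1] := fr_small l q0.
pose d := Num.min d1 (1 + (size l)%:R)^-1.
have sz : 0 < 1 + (size l)%:R :> R by rewrite ltr_wpDr.
have d0 : 0 < d by rewrite lt_min d10 invr_gt0.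
have [zs [zs1 zsP]] := @kerl_net _ _ [seq p.1 | p <- l] [set x | `|x| <= 1] 1 d (fun x h => h) d0.
exists (zs ++ [seq p.2 | p <- l]) => g eta hg.
have eta0 : 0 <= eta \/ (zs = [::] /\ l = [::]).
  case: (zs) hg => [|z zs'] hg.
    by case: (l) hg => [|p l'] hg; [right|left; apply: le_trans (normr_ge0 _) (hg p.2 (mem_head _ _))].
  by left; apply: le_trans (normr_ge0 _) (hg z (mem_head _ _)).
have [x [x1 gx]] := dual_norm_attained g.
have [z zz zd] := zsP x x1.
have {}eta0 : 0 <= eta.
  by case: eta0 => // -[zs0 _]; rewrite zs0 in zz.
have z1 : `|z| <= 1 := zs1 z zz.
pose w := fr l (x - z).
have w1 : `|w| <= 1 / 4.
  apply: hd1 => p pl; apply: le_trans (zd _ _) _; first exact: map_f.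
  by rewrite ge_min lexx.
have gw : `|g w| <= eta.
  rewrite /w /fr du_sum; apply: le_trans (ler_norm_sum _ _ _) _.
  apply: (@le_trans _ _ (\sum_(p <- l) d * eta)).
    rewrite big_seq [leRHS]big_seq; apply: ler_sum => p pl.
    rewrite duZ normrM ler_pM//; first by apply: zd; exact: map_f.
    by apply: hg; rewrite mem_cat map_f ?orbT.
  rewrite big_const_seq count_predT iter_addr_0 -mulr_natl mulrA ler_piMl//.
  have : d <= (1 + (size l)%:R)^-1 by rewrite ge_min lexx orbT.
  move=> /(ler_wpM2l (ler0n R (size l))) /le_trans; apply.
  by rewrite ler_pdivrMr// mul1r lerDr.
have gz : `|g z| <= eta by apply: hg; rewrite mem_cat zz.
(* Its norm is at most [1 + 1 + 1 / 4 = 9 / 4]; normalizing turns [|g| / 2 - 2 * eta] into at least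
   [|g| / 5 - eta]. *)
pose y0 := x - z - w.
have y0n : `|y0| <= 9 / 4.
  have := ler_normB (x - z) w; have := ler_normB x z; rewrite -/y0; lra.
have gy0 : `|g| / 2 - 2 * eta <= (g y0 : R).
  have e : (g y0 : R) = (g x : R) - g z - g w by rewrite /y0 !duB.
  have hz := le_trans (ler_norm (g z : R)) gz.
  have hw := le_trans (ler_norm (g w : R)) gw.
  rewrite e; lra.
exists ((9 / 4)^-1 *: y0); split; first exact/kerlZ/lL.
  rewrite normrZ ger0_norm; last by rewrite invr_ge0; lra.
  rewrite mulrC ler_pdivrMr; lra.
rewrite duZ; have := normr_ge0 g; have : (9 / 4)^-1 = 4 / 9 :> R by rewrite invf_div.
move=> ->; lra.
Qed.

Lemma two_power_scale (a : R) : 0 < a -> a < 1 ->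
  exists k : nat, 2^-1 ^+ k <= a /\ a / 2 < 2^-1 ^+ k.
Proof.
move=> a0 a1; have ex : exists n, (2^-1 : R) ^+ n <= a.
  have : (2^-1 : R) ^+ n @[n --> \oo] --> (0 : R).
    by apply: cvg_expr; rewrite ger0_norm// invf_lt1// ltr1n.
  move=> /cvgn_distP/(_ a a0)[n /(_ n (leqnn n))].
  by rewrite subr0 ger0_norm ?exprn_ge0// => /ltW h; exists n.
have [k hk kmin] := ex_minnP ex; exists k; split => //.
case: k hk kmin => [_ _|k hk kmin]; first by rewrite expr0; lra.
rewrite exprS ltNge; apply/negP => h.
have : 2^-1 ^+ k <= a by lra.
by move=> /kmin; rewrite ltnn.
Qed.

(** Dualization of smoothness: [f + g] is tested on [x + s *: y], where [x] almost norms [f] and [y]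
    in a small subspace almost norms [g] up to the factor 5. *)
Lemma smooth_dual_inequality (k : nat) (s : R) f : 0 < s <= 1 ->
  (forall x : X, `|x| <= 1 -> exists L, forall y, kerl L y -> `|y| <= 1 ->
      `|x + s *: y| <= 1 + s * 2^-1 ^+ k / 2) ->
  exists (t : seq X) (d : R), 0 < d /\ forall g, (forall v, v \in t -> `|g v| <= d) ->
    10 * 2^-1 ^+ k <= `|g| -> `|f| + s * 2^-1 ^+ k <= `|f + g| * (1 + s * 2^-1 ^+ k / 2).
Proof.
set eta := 2^-1 ^+ k => /andP[s0 s1] hs.
have e0 : 0 < eta by rewrite exprn_gt0.
have u0 : 0 < s * eta by rewrite mulr_gt0.
have [x x1 fx] : exists2 x : X, `|x| <= 1 & `|f| - s * eta / 4 <= (f x : R).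
  have d0 : 0 < s * eta / 4 by lra.
  have [_ [y /= y1 <-] fy] := sup_adherent d0 (dual_norm_has_sup f).
  rewrite -[sup _]/(`|f|) in fy.
  have [h|h] := leP 0 (f y : R); first by exists y => //; move: fy; rewrite (ger0_norm h) => /ltW.
  exists (- y); first by rewrite normrN.
  by rewrite duN -(ltr0_norm h) ltW.
have [L hL] := hs x x1.
(* Including [f] in the list makes [f y] vanish, so the two contributions add. *)
have [t ht] := lifting_list (f :: L).
(* From [|g| >= 10 * eta] one gets [g y >= 7/4 * eta]; the losses [s * eta / 4] at [f x] and
   [s * eta / 8] at [g x] still leave more than [s * eta]. *)
pose d := Num.min (eta / 4) (s * eta / 8).
have d0 : 0 < d by rewrite lt_min; apply/andP; split; lra.
exists (x :: t), d; split => // g gt gk.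
have [|y [/kerl_cons[fy Ly] y1 gy]] := ht g d.
  by move=> v vt; apply: gt; rewrite inE vt orbT.
have d1 : d <= eta / 4 by rewrite ge_min lexx.
have d2 : d <= s * eta / 8 by rewrite ge_min lexx orbT.
have gx : - d <= (g x : R).
  by have := gt x (mem_head _ _); rewrite ler_norml => /andP[].
have h1 : ((f + g) (x + s *: y) : R) <= `|f + g| * (1 + s * eta / 2).
  apply: le_trans (ler_norm _) (le_trans (dualP _ _) _).
  by rewrite ler_wpM2l//; exact: hL.
have h2 : ((f + g) (x + s *: y) : R) = (f x : R) + g x + s * g y.
  by rewrite dualD !duD !duZ fy mulr0 addr0; ring.
have h3 : s * (7 / 4 * eta) <= s * (g y : R).
  rewrite ler_wpM2l ?(ltW s0)//; apply: le_trans gy; lra.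
rewrite h2 in h1; lra.
Qed.

End w_star_moduli.

Section ukk_auc.
Context {R : realType}.

Lemma UKK_of_smooth (X : normedModType R) : smooth_norm (@id_norm R X) ->
  exists p c : R, [/\ 1 <= p, 0 < c & exists delta : R -> R, wstar_UKK_with X delta /\
    forall eps, 0 < eps -> c * eps `^ p <= delta eps].
Proof.
move=> [P [c [c0 P0 hs]]].
exists P%:R, (c / 2 / 40 ^+ P); split; first by rewrite ler1n.
  by rewrite !divr_gt0// exprn_gt0.
exists (fun eps => c / 2 * (eps / 40) ^+ P); split; last first.
  by move=> eps e0; rewrite powR_mulrn ?(ltW e0)// expr_div_n mulrAC mulrA.
move=> eps e0; split; first by rewrite mulr_gt0 ?divr_gt0// exprn_gt0// divr_gt0.
move=> u f u1 uf lim.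
have f1 : `|f| <= 1 := wstar_lsc uf u1.
(* Two points of the unit ball are at distance at most 2, so larger [eps] cannot occur. *)
have e2 : eps <= 2.
  rewrite leNgt; apply/negP => e2; have d0 : 0 < (eps - 2) / 2 by lra.
  have [n hn] := limn_einf_le lim d0; have := hn n (leqnn n).
  have := ler_normB (u n) f; have := u1 n; lra.
(* Then [10 * 2^-k <= eps / 2], which [|u n - f|] eventually reaches, while [2^-k > eps / 40] feeds
   the modulus. *)
have [||k [k1 k2]] := @two_power_scale R (eps / 20); [by rewrite divr_gt0|by lra|].
have [s [s01 cs hx]] := hs k.
have [t [d [d0 ht]]] := smooth_dual_inequality f s01 hx.
have [N1 hN1] := wstar_cvg_seq t d0 uf.
have e4 : 0 < eps / 2 by rewrite divr_gt0.
have [N2 hN2] := limn_einf_le lim e4.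
have h : `|f| + s * 2^-1 ^+ k <= `|u (maxn N1 N2)| * (1 + s * 2^-1 ^+ k / 2).
  rewrite -[u _](subrKC f); apply: ht.
    by move=> v vt; apply: ltW; apply: hN1 => //; rewrite leq_maxl.
  by apply: le_trans (hN2 _ (leq_maxr _ _)); lra.
have hu := u1 (maxn N1 N2).
have h2 : c * (eps / 40) ^+ P <= s * 2^-1 ^+ k.
  apply: le_trans cs; rewrite exprM ler_pM2l// lerXn2r ?nnegrE ?exprn_ge0//.
    by rewrite divr_ge0// ltW.
  lra.
set a := s * _ in h h2; have a0 : 0 <= a.
  by rewrite /a mulr_ge0 ?exprn_ge0//; case/andP: s01 => /ltW.
have : `|u (maxn N1 N2)| * (1 + a / 2) <= 1 + a / 2 by rewrite ler_piMl//; lra.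
lra.
Qed.

Lemma delta_power_type_of_smooth (X : normedModType R) : smooth_norm (@id_norm R X) ->
  exists p : R, 1 <= p /\ delta_power_type X p.
Proof.
move=> [P [c [c0 P0 hs]]]; exists P%:R; rewrite ler1n; split => //.
exists (c / 3 / 20 ^+ P); first by rewrite !divr_gt0// exprn_gt0.
move=> t /andP[t0 t1].
have -> : c / 3 / 20 ^+ P * t `^ P%:R = c / 3 * (t / 20) ^+ P.
  by rewrite powR_mulrn ?(ltW t0)// expr_div_n mulrAC mulrA.
apply: delta_bar_star_ge => f f1.
have [||k [k1 k2]] := @two_power_scale R (t / 10); [by rewrite divr_gt0|by lra|].
have [s [s01 cs hx]] := hs k.
have [v [d [d0 hv]]] := smooth_dual_inequality f s01 hx.
exists [set g | forall x, x \in v -> g x = 0]; first exact: kernel_wstar_cof.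
move=> g gv tg.
have : `|f| + s * 2^-1 ^+ k <= `|f + g| * (1 + s * 2^-1 ^+ k / 2).
  by apply: hv => [x /gv ->|]; [rewrite normr0 ltW|apply: le_trans tg; lra].
have h2 : c * (t / 20) ^+ P <= s * 2^-1 ^+ k.
  apply: le_trans cs; rewrite exprM ler_pM2l// lerXn2r ?nnegrE ?exprn_ge0//.
    by rewrite divr_ge0// ltW.
  lra.
have e1 : 2^-1 ^+ k <= 1 :> R by rewrite exprn_ile1// invf_le1// ler1n.
have e0 : 0 <= 2^-1 ^+ k :> R by rewrite exprn_ge0.
have a1 : s * 2^-1 ^+ k <= 1 by case/andP: s01 => s0 s1; rewrite mulr_ile1// ltW.
have a0 : 0 <= s * 2^-1 ^+ k by case/andP: s01 => s0 s1; rewrite mulr_ge0// ltW.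
rewrite f1; move: (s * _) h2 a0 a1 => a h2 a0 a1 h3.
(* For [0 <= a <= 1] one has [(1 + a / 3) * (1 + a / 2) <= 1 + a]. *)
have h4 : 1 + a / 3 <= `|f + g| by rewrite leNgt; apply/negP => h4; nra.
lra.
Qed.

Context {X : normedModType R} (N : equiv_norm X).

Lemma smooth_norm_renorm : smooth_norm N -> smooth_norm (@id_norm R (renorm N)).
Proof.
have [r [c' [C' [_ _ rE _ _]]]] := renorm_dual N.
move=> [P [c [c0 P0 hs]]]; exists P, c; split => // k.
have [s [s01 cs hx]] := hs k; exists s; split => // x x1.
have [L hL] := hx x x1; exists [seq r f | f <- L] => y Ly; apply: hL => f fL.
by rewrite -rE; apply: Ly; exact: map_f.
Qed.

(** The potential is the new dual norm. A sequence bounded by [s] is divided by [s] before the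
    property is used, so a derivation lowers the bound by [s * delta eps']. *)
Lemma szlenk_finite_of_UKK : wstar_UKK (renorm N) -> szlenk_finite X.
Proof.
have [r [c [C [c0 C0 rE rC rc]]]] := renorm_dual N.
have rB f g : r (f - g) = r f - r g by apply: dual_ext => x; rewrite dualB !rE.
move=> [delta hd] eps e0.
pose eps' := eps / 2 / (c * C).
have e'0 : 0 < eps' by rewrite !divr_gt0// mulr_gt0.
have [dl0 ukk] := hd eps' e'0.
(* Points at distance at least [eps / 2], in the original norm, cannot exist in a ball of new norm
   less than [s0]; this bounds the drop below. *)
pose s0 := eps / 2 / (2 * c).
have s00 : 0 < s0 by rewrite !divr_gt0// mulr_gt0.
apply: (@szlenk_decrease _ _ eps (fun f => `|r f|) C (s0 * delta eps')) => [|f f1|s u f sM u1 us f1 uf lim].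
- exact: mulr_gt0.
- rewrite normr_ge0 /=; apply: le_trans (rC f) _; by rewrite -[leRHS]mulr1 ler_pM2l.
have wcv : wstar_cvg (fun n => r (u n)) (r f).
  apply/wstar_cvgP => x e ep; have [n hn] := (wstar_cvgP _ _).1 uf x e ep.
  by exists n => k /hn; rewrite !rE.
have fs : `|r f| <= s := wstar_lsc wcv us.
have e2 : 0 < eps / 2 by rewrite divr_gt0.
have [n0 hn0] := limn_einf_le lim e2.
have low n : (n0 <= n)%N -> eps / 2 <= c * `|r (u n) - r f|.
  move=> /hn0 h; rewrite -rB; apply: le_trans (rc _); lra.
have ss : s0 <= s.
  rewrite /s0 ler_pdivrMr ?mulr_gt0//; have := low n0 (leqnn _).
  have := ler_normB (r (u n0)) (r f); have := us n0; nra.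
have s_gt0 : 0 < s by exact: lt_le_trans ss.
have si0 : 0 < s^-1 by rewrite invr_gt0.
have : `|s^-1 *: r f| <= 1 - delta eps'.
  apply: (ukk (fun n => s^-1 *: r (u n))).
- move=> n; rewrite normrZ gtr0_norm// mulrC ler_pdivrMr// mul1r; exact: us.
- apply/wstar_cvgP => x e ep; have [n hn] := (wstar_cvgP _ _).1 wcv x _ (mulr_gt0 ep s_gt0).
  exists n => k /hn h; rewrite !dualZ -mulrBr normrM gtr0_norm//.
  by rewrite mulrC ltr_pdivrMr.
- apply: limn_einf_ge => d d0; exists n0 => n nn0.
  rewrite -scalerBr normrZ gtr0_norm//; have := low n nn0 => h.
  have h1 : eps' <= s^-1 * `|r (u n) - r f|.
    rewrite mulrC ler_pdivlMr// /eps' mulrAC ler_pdivrMr ?mulr_gt0//.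
    have := normr_ge0 (r (u n) - r f); nra.
  lra.
rewrite normrZ gtr0_norm// mulrC ler_pdivrMr// => h; nra.
Qed.

(** Again the potential is the new dual norm; the differences [r (u n) - r f] are first replaced by
    nearby elements of the w*-closed subspace given by the modulus. *)
Lemma szlenk_finite_of_auc : wstar_auc (renorm N) -> szlenk_finite X.
Proof.
have [r [c [C [c0 C0 rE rC rc]]]] := renorm_dual N.
have rB f g : r (f - g) = r f - r g by apply: dual_ext => x; rewrite dualB !rE.
move=> auc eps e0.
pose t := eps / 4 / (c * C).
have t0 : 0 < t by rewrite !divr_gt0// mulr_gt0.
have [d d0 hd] : exists2 d : R, 0 < d & (d%:E < delta_bar_star (renorm N) t)%E.
  move: (auc t t0); case: (delta_bar_star (renorm N) t) => [a| |]//.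
    by rewrite lte_fin => a0; exists (a / 2); rewrite ?lte_fin; lra.
  by move=> _; exists 1; rewrite ?ltry.
pose s0 := eps / 2 / (2 * c).
have s00 : 0 < s0 by rewrite !divr_gt0// mulr_gt0.
pose eta := Num.min (s0 / 2) (s0 * d / 4).
have eta0 : 0 < eta by rewrite lt_min; apply/andP; split; nra.
have eta1 : eta <= s0 / 2 by rewrite ge_min lexx.
have eta2 : eta <= s0 * d / 4 by rewrite ge_min lexx orbT.
apply: (@szlenk_decrease _ _ eps (fun f => `|r f|) C eta) => [|f f1|s u f sM u1 us f1 uf lim] //.
- rewrite normr_ge0 /=; apply: le_trans (rC f) _; by rewrite -[leRHS]mulr1 ler_pM2l.
have wcv : wstar_cvg (fun n => r (u n)) (r f).
  apply/wstar_cvgP => x e ep; have [n hn] := (wstar_cvgP _ _).1 uf x e ep.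
  by exists n => k /hn; rewrite !rE.
have fs : `|r f| <= s := wstar_lsc wcv us.
have e2 : 0 < eps / 2 by rewrite divr_gt0.
have [n0 hn0] := limn_einf_le lim e2.
have low n : (n0 <= n)%N -> eps / 2 <= c * `|r (u n) - r f|.
  move=> /hn0 h; rewrite -rB; apply: le_trans (rc _); lra.
have ss : s0 <= s.
  rewrite /s0 ler_pdivrMr ?mulr_gt0//; have := low n0 (leqnn _).
  have := ler_normB (r (u n0)) (r f); have := us n0; nra.
(* Normalizing by [|r f|] needs a lower bound on it; when it is small, the drop from [s >= s0] is at
   least [s0 / 2] anyway. *)
have [small|big] := leP `|r f| (s0 / 2); first lra.
have sg0 : 0 < `|r f| by lra.
set sg := `|r f| in fs sg0 big *.
have si0 : 0 < sg^-1 by rewrite invr_gt0.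
have F1 : `|sg^-1 *: r f| = 1 by rewrite normrZ gtr0_norm// mulVf// gt_eqF.
have [Y cY hY] := delta_bar_star_gt hd F1.
pose g n := sg^-1 *: (r (u n) - r f).
have gM n : `|g n| <= sg^-1 * (2 * s).
  rewrite normrZ gtr0_norm// ler_pM2l//; have := ler_normB (r (u n)) (r f); have := us n.
  rewrite -/sg; lra.
have g0 : wstar_null g.
  apply/wstar_cvgP => x e ep; have [n hn] := (wstar_cvgP _ _).1 wcv x _ (mulr_gt0 ep sg0).
  exists n => k /hn h; rewrite dual0 subr0 dualZ dualB normrM gtr0_norm//.
  by rewrite mulrC ltr_pdivrMr.
pose e1 := Num.min t (d / 4).
have e10 : 0 < e1 by rewrite lt_min t0 divr_gt0.
have [n1 hn1] := wstar_cof_approx cY g0 gM e10.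
pose n := maxn n0 n1.
have [h Yh hg] := hn1 n (leq_maxr _ _).
have et : e1 <= t by rewrite ge_min lexx.
have ed : e1 <= d / 4 by rewrite ge_min lexx orbT.
have gt : 2 * t <= `|g n|.
  rewrite normrZ gtr0_norm//; have hl := low n (leq_maxl _ _).
  have -> : 2 * t = eps / 2 / (c * C) by rewrite /t; field; rewrite !gt_eqF.
  rewrite [sg^-1 * _]mulrC ler_pdivlMr// mulrAC ler_pdivrMr ?mulr_gt0//.
  have := normr_ge0 (r (u n) - r f); nra.
have th : t <= `|h|.
  have : `|g n| <= `|h| + `|h - g n| by rewrite -{1}(subKr h (g n)); exact: ler_normB.
  lra.
have := hY h Yh th => Fh.
have Fg : 1 + d / 2 <= `|sg^-1 *: r f + g n|.
  have : `|sg^-1 *: r f + h| <= `|sg^-1 *: r f + g n| + `|h - g n|.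
    by rewrite -[X in `|_ + X|](subrK (g n)) addrCA addrC ler_normD.
  lra.
have : `|sg^-1 *: r f + g n| * sg = `|r (u n)|.
  by rewrite /g -scalerDr addrC subrK normrZ gtr0_norm// mulrAC mulVf ?gt_eqF// mul1r.
have := us n; nra.
Qed.

End ukk_auc.

(** * Trees generated by strategies *)

Section strategy_trees.
Context {R : realType} {V : normedModType R} {S : Type}.
Context (null : (nat -> V) -> Prop) (s0 : S) (next : nat -> S -> nat -> S)
  (out : nat -> S -> nat -> V).

(** A tree is produced by an automaton reading the entries of a node: [next] updates a state, [out]
    gives the vector, and the depth [j] is passed along. Every branch then carries its history of
    states. *)
Fixpoint walk (j : nat) (st : S) (s : seq nat) : S :=
  if s is m :: s' then walk j.+1 (next j st m) s' else st.

Lemma walk_rcons j st s m : walk j st (rcons s m) = next (j + size s) (walk j st s) m.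
Proof.
elim: s j st => [|a s IH] j st /=; first by rewrite addn0.
by rewrite IH addnS addSn.
Qed.

Definition strategy_tree (s : seq nat) : V :=
  if rev s is m :: r then out (size r) (walk 0 s0 (rev r)) m else 0.

Lemma strategy_tree_rcons s m :
  strategy_tree (rcons s m) = out (size s) (walk 0 s0 s) m.
Proof. by rewrite /strategy_tree rev_rcons revK size_rev. Qed.

Lemma strategy_treeP : (forall i st m, `|out i st m| = 1) ->
  (forall i st, null (out i st)) ->
  exists x : seq nat -> V, [/\ tree_in_sphere x, tree_nodes null x &
    forall b, is_branch x b -> exists st m, [/\ st 0%N = s0,
      forall i, st i.+1 = next i (st i) (m i) & forall i, b i = out i (st i) (m i)]].
Proof.
move=> o1 on; exists strategy_tree; split.
- by case/lastP => // s m _; rewrite strategy_tree_rcons.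
- move=> s _; have -> : (fun n => strategy_tree (rcons s n)) = out (size s) (walk 0 s0 s).
    by apply/funext => n; exact: strategy_tree_rcons.
  exact: on.
move=> b [m _ bm]; exists (fun i => walk 0 s0 (mkseq m i)), m; split => // i.
  by rewrite /mkseq -{1}addn1 iotaD map_cat cats1 walk_rcons size_map size_iota.
by rewrite bm /mkseq -addn1 iotaD map_cat cats1 strategy_tree_rcons size_map size_iota.
Qed.

End strategy_trees.

Section tree_to_szlenk.
Context {R : realType} {X : normedModType R}.

(** A point surviving [n] derivations starts a tree of normalized differences descending through the
    derived sets. Along a branch the differences, each of norm at least [eps / 2], add up to a
    vector of norm at most 2, against the lower estimate. *)
Lemma szlenk_finite_of_trees (p : R) (g : nat -> dual X) : (forall n, `|g n| = 1) ->
  wstar_null g -> 1 <= p -> wstar_tree_estimates X p%:E 1%E -> szlenk_finite X.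
Proof.
move=> g1 g0 p1 [C C0 hC] eps e0; apply: contrapT => nK.
have Kne n : exists f : dual X, szlenk_set eps (co_nat n) f.
  apply: contrapT => h; apply: nK; exists n; rewrite -subset0 => f Kf.
  by apply: h; exists f.
have e2 : 0 < eps / 2 by rewrite divr_gt0.
have p0 : 0 < p by lra.
have step i (f : dual X) : exists u : nat -> dual X, szlenk_set eps (co_nat i.+1) f ->
    [/\ forall n, szlenk_set eps (co_nat i) (u n), wstar_cvg u f & forall n, eps / 2 <= `|u n - f|].
  have [[Kf [u [Ku uf lim]]]|nf] := pselect (szlenk_set eps (co_nat i.+1) f); last first.
    by exists (fun=> 0).
  have [N hN] := limn_einf_le lim e2; exists (fun n => u (N + n)%N) => _; split; first by move=> n; exact: Ku.
    apply/wstar_cvgP => x e ep; have [M hM] := (wstar_cvgP _ _).1 uf x e ep.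
    by exists M => n Mn; apply: hM; rewrite (leq_trans Mn)// leq_addl.
  by move=> n; apply: le_trans (hN _ (leq_addr _ _)); lra.
have step2 i : exists U : dual X -> nat -> dual X, forall f, szlenk_set eps (co_nat i.+1) f ->
    [/\ forall n, szlenk_set eps (co_nat i) (U f n), wstar_cvg (U f) f & forall n, eps / 2 <= `|U f n - f|].
  by have [U UP] := choice (step i); exists U.
have [U0 U0P] := choice step2.
(* Chosen to violate [n * (eps / 2)]^ p <= (2 * C) [^ p], the consequence of the lower estimate. *)
pose n := (Num.truncn ((4 * C / eps) `^ p)).+1.
have [f0 Kf0] := Kne n.
pose good i (f : dual X) := (i < n)%N /\ szlenk_set eps (co_nat (n - i)) f.
pose nxt i f m := if `[< good i f >] then U0 (n - i.+1)%N f m else f.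
pose nrm (d : dual X) := `|d|^-1 *: d.
(* After [n] levels, or from an irrelevant state, the node is filled with the fixed normalized
   w*-null sequence [g]. *)
pose out i f m := if `[< good i f >] then nrm (U0 (n - i.+1)%N f m - f) else g m.
have Uok i f : good i f ->
    [/\ forall m, szlenk_set eps (co_nat (n - i.+1)) (U0 (n - i.+1)%N f m),
     wstar_cvg (U0 (n - i.+1)%N f) f & forall m, eps / 2 <= `|U0 (n - i.+1)%N f m - f|].
  by move=> [ilt Kf]; apply: U0P; rewrite subnSK.
have [||x [xs xn xb]] := @strategy_treeP _ _ (dual X) (@wstar_null R X) f0 nxt out.
- move=> i f m; rewrite /out; case: asboolP => [gd|_]; last exact: g1.
  have [_ _ h] := Uok _ _ gd.
  have d0 : 0 < `|U0 (n - i.+1)%N f m - f| by apply: lt_le_trans (h m).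
  by rewrite /nrm normrZ normfV normr_id mulVf// gt_eqF.
- move=> i f; rewrite /out; case: asboolP => [gd|_]; last exact: g0.
  have [_ uf h] := Uok _ _ gd.
  apply/wstar_cvgP => y e ep.
  have [M hM] := (wstar_cvgP _ _).1 uf y _ (mulr_gt0 ep e2); exists M => m /hM hm.
  have d0 : 0 < `|U0 (n - i.+1)%N f m - f| by apply: lt_le_trans (h m).
  rewrite dual0 subr0 /nrm dualZ dualB normrM normfV normr_id mulrC ltr_pdivrMr//.
  by apply: lt_le_trans hm _; rewrite ler_pM2l.
have [[b /xb[st [m [st0 stS bE]]] lower] _] := hC x xs xn.
have inv i : (i <= n)%N -> szlenk_set eps (co_nat (n - i)) (st i).
  elim: i => [_|i IH ilt]; first by rewrite subn0 st0.
  rewrite stS /nxt; case: asboolP => [gd|ng]; first by have [h _ _] := Uok _ _ gd; exact: h.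
  by exfalso; apply: ng; split => //; apply: IH; exact: ltnW.
pose a i := `|st i.+1 - st i|.
have sumE k : (k <= n)%N -> \sum_(i < k) a i *: b i = st k - st 0%N.
  elim: k => [_|k IH kn]; first by rewrite big_ord0 subrr.
  rewrite big_ord_recr /= IH ?(ltnW kn)// bE /out /a stS /nxt.
  have gk : good k (st k) by split => //; apply: inv; exact: ltnW.
  case: asboolP => // gk'; have [_ _ h] := Uok _ _ gk'.
  have d0 : 0 < `|U0 (n - k.+1)%N (st k) (m k) - st k| by apply: lt_le_trans (h _).
  by rewrite /nrm scalerA divff ?gt_eqF// scale1r addrC addrA subrK.
have ab k : (k < n)%N -> eps / 2 <= a k.
  move=> kn; rewrite /a stS /nxt.
  have gk : good k (st k) by split => //; apply: inv; exact: ltnW.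
  by case: asboolP => // gk'; have [_ _ h] := Uok _ _ gk'.
have := lower n a; rewrite sumE// /lp_norm => hl.
have h2 : `|st n - st 0%N| <= 2.
  have K1 i : (i <= n)%N -> `|st i| <= 1 by move=> /inv/szlenk_set_ball.
  have := ler_normB (st n) (st 0%N); have := K1 n (leqnn n); have := K1 0%N (leq0n n); lra.
have h3 : n%:R * (eps / 2) `^ p <= \sum_(i < n) `|a i| `^ p.
  rewrite mulr_natl -[X in _ *+ X](card_ord n) -sumr_const; apply: ler_sum => i _.
  apply: ge0_ler_powR; rewrite ?nnegrE ?(ltW p0) ?(ltW e2)//.
  by rewrite ger0_norm ?normr_ge0//; exact: ab.
have h4 : (\sum_(i < n) `|a i| `^ p) `^ p^-1 <= 2 * C.
  by have := le_trans hl h2; rewrite mulrC ler_pdivrMr.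
have S0 : 0 <= \sum_(i < n) `|a i| `^ p by apply: sumr_ge0 => i _; exact: powR_ge0.
have h5 : \sum_(i < n) `|a i| `^ p <= (2 * C) `^ p.
  have := @ge0_ler_powR R p (ltW p0) _ _ _ _ h4; rewrite !nnegrE powR_ge0.
  rewrite mulr_ge0 ?(ltW C0)// => /(_ isT isT).
  by rewrite -powRrM mulVf ?gt_eqF// powRr1.
have h6 : n%:R <= (4 * C / eps) `^ p.
  have ep0 : 0 < (eps / 2) `^ p by rewrite powR_gt0.
  have -> : 4 * C / eps = (2 * C) * (eps / 2)^-1 by field; rewrite gt_eqF.
  rewrite powRM ?invr_ge0 ?(ltW e2)//; last by rewrite mulr_ge0// ltW.
  have -> : ((eps / 2)^-1) `^ p = ((eps / 2) `^ p)^-1.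
    by rewrite -powR_inv1 ?(ltW e2)// -powRrM mulN1r powRN.
  by rewrite ler_pdivlMr//; exact: le_trans h3 h5.
by have := truncnS_gt ((4 * C / eps) `^ p); rewrite ltNge h6.
Qed.

End tree_to_szlenk.

(** * Estimates along smooth sequences *)

Section nets.
Context {R : realType} {X : normedModType R}.

Lemma subspan_net (b : seq X) (S : set X) (M d : R) : (forall x, S x -> lspan b x) ->
  (forall x, S x -> `|x| <= M) -> 0 < d ->
  exists zs : seq X, (forall z, z \in zs -> S z) /\
    forall x, S x -> exists2 z, z \in zs & `|x - z| <= d.
Proof.
move=> Sb SM d0; have [l [_ lb]] := lspan_projection b.
have [e e0 he] := fr_small l d0.
have [zs [zS zP]] := kerl_net [seq p.1 | p <- l] SM e0.
exists zs; split => // x Sx; have [z zz zd] := zP x Sx; exists z => //.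
rewrite -(lb (x - z)); last by apply: lspanB; apply: Sb => //; exact: zS.
by apply: he => p pl; apply: zd; exact: map_f.
Qed.

Lemma lspan_subset (b c : seq X) : {subset b <= c} -> lspan b `<=` lspan c.
Proof.
by move=> bc; apply: lspan_sub; [exact: lspan_subspace|move=> v /bc; exact: lspan_mem].
Qed.

Lemma mkseq_subset (y : nat -> X) m n : (m <= n)%N -> {subset mkseq y m <= mkseq y n}.
Proof.
move=> mn v /mapP[i]; rewrite mem_iota add0n => /andP[_ im] ->.
by apply: map_f; rewrite mem_iota add0n (leq_trans im).
Qed.

Lemma lspan_mkseq_sum (y : nat -> X) n (a : nat -> R) :
  lspan (mkseq y n) (\sum_(i < n) a i *: y i).
Proof.
apply: lspan_sum => i _; apply/lspanZ/lspan_mem; apply: map_f.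
by rewrite mem_iota /= add0n.
Qed.

(** Mazur's construction of basic sequences: the functionals norm a finite net of the unit ball of
    the span, and a new vector almost annihilated by them barely decreases norms. *)
Lemma mazur_step (b : seq X) (e : R) : 0 < e -> exists (L : seq (dual X)) (d : R), 0 < d /\
  forall y, `|y| = 1 -> (forall f, f \in L -> `|f y| <= d) ->
    forall x a, lspan b x -> `|x| <= (1 + e) * `|x + a *: y|.
Proof.
(* The argument ends with [|x| * (1 - 3 * d) <= |x + a *: y| * (1 + d)], and this [d] gives
   [1 + d <= (1 + e) * (1 - 3 * d)]. *)
move=> e0; pose d := e / (4 * (1 + e)).
have e1 : 0 < 4 * (1 + e) by lra.
have d0 : 0 < d by rewrite divr_gt0.
have dE : d * (4 * (1 + e)) = e by rewrite /d divfK// gt_eqF.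
have d1 : d <= 1 by rewrite ler_pdivrMr ?mul1r; lra.
have [|zs [zS zP]] := @subspan_net b [set x | lspan b x /\ `|x| <= 1] 1 d _ (fun x h => h.2) d0.
  by move=> x [].
have [fz fzP] := choice (@norming R X).
exists [seq fz z | z <- zs], d; split => // y y1 fy x a bx.
have [->|x0] := eqVneq x 0; first by rewrite normr0 mulr_ge0//; lra.
have nx : 0 < `|x| by rewrite normr_gt0.
pose x' := `|x|^-1 *: x.
have x'1 : `|x'| = 1 by rewrite /x' normrZ normfV normr_id mulVf// gt_eqF.
have [|z zz xz] := zP x'; first by split; [exact: lspanZ|rewrite x'1].
have [f1 fzz] := fzP z.
have g1 v : (fz z v : R) <= `|v|.
  by apply: le_trans (ler_norm _) (le_trans (dualP _ _) _); rewrite -[leRHS]mul1r ler_wpM2r.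
have zn : 1 - d <= `|z|.
  have := ler_normD z (x' - z); rewrite subrKC x'1; lra.
have h1 : (fz z x' : R) >= 1 - 2 * d.
  have := g1 (z - x'); rewrite duB fzz distrC; lra.
have h2 : (fz z x : R) = `|x| * fz z x' by rewrite /x' duZ mulVKf// gt_eqF.
have h3 : (fz z (x + a *: y) : R) = fz z x + a * fz z y by rewrite duD duZ.
have h4 := g1 (x + a *: y).
have h5 : - (`|a| * d) <= a * fz z y.
  have : `|a * fz z y| <= `|a| * d by rewrite normrM ler_wpM2l// fy// map_f.
  by rewrite ler_norml => /andP[].
have h6 : `|a| <= `|x + a *: y| + `|x|.
  have : `|a *: y| <= `|x + a *: y| + `|x| by rewrite -{1}[a *: y](addKr x) addrC ler_normB.
  by rewrite normrZ y1 mulr1.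
have h7 : `|x| * (1 - 2 * d) <= `|x| * fz z x' by rewrite ler_pM2l.
have h8 : `|a| * d <= (`|x + a *: y| + `|x|) * d by rewrite ler_pM2r.
set w := `|x + a *: y| in h4 h6 h8 *.
have w0 : 0 <= w by rewrite normr_ge0.
have h9 : `|x| * (1 - 3 * d) <= w * (1 + d) by rewrite h3 in h4; lra.
have q1 : (1 + d) <= (1 + e) * (1 - 3 * d) by nra.
have q2 : 0 < 1 - 3 * d by nra.
rewrite -(ler_pM2r q2); nra.
Qed.

Lemma norming_eqnorm (N : equiv_norm X) v : exists f : dual X,
  (forall x, `|f x| <= N x) /\ f v = N v.
Proof.
pose G := [set z : X * R | exists t, z = (t *: v, t * N v)].
have [||g [gl gN gG]] := @hahn_banach R X N G (eqnorm_seminorm N).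
- split; first by exists 0; rewrite scale0r mul0r.
  move=> t _ _ _ _ [a [-> ->]] [b [-> ->]]; exists (t * a + b).
  by rewrite scalerDl scalerA mulrDl mulrA.
- move=> x a [t [-> ->]]; by rewrite eqnormZ ler_wpM2r ?eqnorm_ge0// ler_norm.
have [c [C [c0 C0 cC]]] := eqnorm_equiv N.
have [|f [fE _]] := @mk_dual _ X g C gl.
  by move=> x; apply: le_trans (gN x) _; have /andP[] := cC x.
exists f; split=> [x|]; first by rewrite fE.
by rewrite fE; apply: gG; exists 1; rewrite scale1r mul1r.
Qed.

End nets.

Section holder.
Context {R : realType}.

(** Young's inequality is applied termwise after normalizing the q-norm of [a]; this yields the
    cruder constant [1 + K] in place of the p-th root of [K]. *)
Lemma holder_sum (n : nat) (a b : 'I_n -> R) (p q K : R) : 1 < p -> 1 < q ->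
  p^-1 + q^-1 = 1 -> 0 <= K -> \sum_i `|b i| `^ p <= K ->
  \sum_i a i * b i <= (1 + K) * (\sum_i `|a i| `^ q) `^ q^-1.
Proof.
move=> p1 q1 pq K0 bK.
have p0 : 0 < p by lra.
have q0 : 0 < q by lra.
set S := \sum_i `|a i| `^ q.
have S0 : 0 <= S by apply: sumr_ge0 => i _; exact: powR_ge0.
have [Sz|Sn] := eqVneq S 0.
  have az i : a i = 0.
    have /eqP := Sz; rewrite psumr_eq0 => [/allP/(_ i)|j _]; last exact: powR_ge0.
    rewrite mem_index_enum => /(_ isT)/=; rewrite powR_eq0 normr_eq0 => /andP[/eqP]//.
  rewrite big1 => [|i _]; last by rewrite az mul0r.
  by rewrite mulr_ge0 ?powR_ge0//; lra.
have Sp : 0 < S by rewrite lt_neqAle eq_sym Sn.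
set A := S `^ q^-1; have A0 : 0 < A by rewrite powR_gt0.
have Aq : A `^ q = S by rewrite /A -powRrM mulVf ?gt_eqF// powRr1.
have h i : a i * b i <= A * ((`|a i| / A) `^ q / q + `|b i| `^ p / p).
  apply: le_trans (ler_norm _) _; rewrite normrM.
  have -> : `|a i| = A * (`|a i| / A) by rewrite mulrC divfK// gt_eqF.
  rewrite -mulrA ler_pM2l// addrC [X in _ <= _ + (X `^ _) / _](_ : _ = `|a i| / A); last first.
    by rewrite [A * _]mulrC divfK// gt_eqF.
  rewrite addrC; apply: conjugate_powR => //; last by rewrite addrC.
  by rewrite divr_ge0// ltW.
apply: le_trans (ler_sum _ (fun i _ => h i)) _.
rewrite -mulr_sumr [leRHS]mulrC ler_pM2l// big_split /= -!mulr_suml.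
have -> : \sum_i (`|a i| / A) `^ q = 1.
  have e i : (`|a i| / A) `^ q = `|a i| `^ q / S.
    rewrite powRM ?invr_ge0 ?(ltW A0)//; congr (_ * _).
    by rewrite -powR_inv1 ?(ltW A0)// -powRrM mulN1r powRN Aq.
  by rewrite (eq_bigr _ (fun i _ => e i)) -mulr_suml divff.
have qi1 : q^-1 <= 1 by rewrite invf_le1 ?(ltW q1).
have pi1 : p^-1 <= 1 by rewrite invf_le1 ?(ltW p1).
have pi0 : 0 < p^-1 by rewrite invr_gt0.
have B0 : 0 <= \sum_i `|b i| `^ p by apply: sumr_ge0 => i _; exact: powR_ge0.
have : (\sum_i `|b i| `^ p) * p^-1 <= \sum_i `|b i| `^ p by rewrite ler_piMr.
lra.
Qed.

End holder.

Section smooth_blocks.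
Context {R : realType} {X : normedModType R} (N : equiv_norm X).

Definition smooth_data (P : nat) (c : R) (s : nat -> R) : Prop :=
  [/\ 0 < c, (0 < P)%N, forall k, 0 < s k <= 1,
    forall k, c * 2^-1 ^+ (k * P) <= s k * 2^-1 ^+ k &
    forall k x, N x <= 1 -> exists L, forall y, kerl L y -> N y <= 1 ->
      N (x + s k *: y) <= 1 + s k * 2^-1 ^+ k / 2].

Lemma smooth_norm_data : smooth_norm N -> exists P c s, smooth_data P c s.
Proof.
move=> [P [c [c0 P0 h]]]; have [s sP] := choice h.
by exists P, c, s; split => // k; have [] := sP k.
Qed.

Context (P : nat) (c : R) (s : nat -> R) (Ns : smooth_data P c s).

(** [y] serves the whole ball of [lspan b] and all scales up to [n] at once. The factor [3 / 4]
    instead of [1 / 2] pays for the passage through a net. *)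
Definition good_step (b : seq X) (n : nat) (y : X) : Prop :=
  forall x, lspan b x -> N x <= 1 -> forall k, (k <= n)%N ->
    N (x + s k *: y) <= 1 + 3 / 4 * (s k * 2^-1 ^+ k).

Lemma good_stepP (b : seq X) (n : nat) : exists (L : seq (dual X)) (d : R), 0 < d /\
  forall y, N y <= 1 -> (forall f, f \in L -> `|f y| <= d) -> good_step b n y.
Proof.
have [c0 P0 s01 cs hs] := Ns.
have [c1 [C1 [c10 C10 cC]]] := eqnorm_equiv N.
(* A common lower bound for [s k * 2^-1 ^+ k] over [k <= n]. Net error and correction of [y] cost
   [m / 16] each, within the spare quarter. *)
pose m := c * 2^-1 ^+ (n * P).
have m0 : 0 < m by rewrite mulr_gt0// exprn_gt0.
have mk k : (k <= n)%N -> m <= s k * 2^-1 ^+ k.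
  move=> kn; apply: le_trans (cs k); rewrite ler_pM2l//.
  rewrite ler_wiXn2l ?leq_mul2r ?kn ?orbT// ?invr_ge0//.
  by rewrite invf_le1// ler1n.
pose S := [set x | lspan b x /\ N x <= 1].
have SM x : S x -> `|x| <= c1^-1.
  move=> [_ x1]; have /andP[h _] := cC x.
  rewrite -[c1^-1]mul1r ler_pdivlMr// mulrC; exact: le_trans x1.
have t0 : 0 < m / 16 / C1 by rewrite !divr_gt0.
have [|zs [zS zP]] := @subspan_net R X b S _ _ _ SM t0; first by move=> x [].
have [L hL] : exists L, forall z, z \in zs -> forall k, (k <= n)%N -> forall y, kerl L y ->
    N y <= 1 -> N (z + s k *: y) <= 1 + s k * 2^-1 ^+ k / 2.
  elim: (zs) zS => [|z zs' IH] zS; first by exists [::].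
  have [|L1 hL1] := IH; first by move=> w wz; apply: zS; rewrite inE wz orbT.
  have [L2 hL2] : exists L, forall k, (k <= n)%N -> forall y, kerl L y ->
      N y <= 1 -> N (z + s k *: y) <= 1 + s k * 2^-1 ^+ k / 2.
    have z1 : N z <= 1 by have [] := zS z (mem_head _ _).
    elim: (n) => [|n' [L hL]].
      have [L hL] := hs 0%N z z1; exists L => k; rewrite leqn0 => /eqP ->; exact: hL.
    have [L' hL'] := hs n'.+1 z z1; exists (L ++ L') => k.
    rewrite leq_eqVlt ltnS => /predU1P[->|kn] y /kerl_cat[y1 y2]; first exact: hL'.
    exact: hL.
  exists (L1 ++ L2) => w; rewrite inE => /predU1P[->|wz] k kn y /kerl_cat[y1 y2].
    exact: hL2.
  exact: hL1.
have [l [lL _]] := kerl_projection L.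
pose e := Num.min (m / 32) 1.
have e0 : 0 < e by rewrite lt_min ltr01 divr_gt0.
have em : e <= m / 32 by rewrite ge_min lexx.
have eC : 0 < e / C1 by rewrite divr_gt0.
have [d d0 hd] := fr_small l eC.
exists [seq p.1 | p <- l], d; split => // y y1 fy x bx x1 k kn.
have [z zz xz] := zP x (conj bx x1).
have wn : N (fr l y) <= e.
  have h : `|fr l y| <= e / C1 by apply: hd => p pl; apply: fy; exact: map_f.
  have /andP[_ h2] := cC (fr l y); apply: le_trans h2 _.
  by rewrite mulrC -ler_pdivlMr.
pose y' := y - fr l y.
have y'n : N y' <= 1 + e by apply: le_trans (eqnormB _ _ _) _; rewrite lerD.
have e1 : 0 < 1 + e by lra.
pose y2 := (1 + e)^-1 *: y'.
have y2n : N y2 <= 1 by rewrite eqnormZp ?invr_ge0 ?(ltW e1)// mulrC ler_pdivrMr// mul1r.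
have hz := hL z zz k kn y2 (kerlZ _ (lL y)) y2n.
have yy : N (y - y2) <= 2 * e.
  have -> : y - y2 = fr l y + (1 - (1 + e)^-1) *: y'.
    by rewrite /y2 scalerBl scale1r addrA subrKC.
  apply: le_trans (eqnormD _ _ _) _.
  have i1 : (1 + e)^-1 <= 1 by rewrite invf_le1//; lra.
  rewrite eqnormZp ?subr_ge0//.
  have : (1 - (1 + e)^-1) * N y' <= (1 - (1 + e)^-1) * (1 + e).
    by rewrite ler_wpM2l// subr_ge0.
  have : (1 + e)^-1 * (1 + e) = 1 by rewrite mulVf ?gt_eqF.
  lra.
have xzn : N (x - z) <= m / 16.
  have /andP[_ h2] := cC (x - z); apply: le_trans h2 _.
  by rewrite mulrC -ler_pdivlMr.
have -> : x + s k *: y = (x - z) + ((z + s k *: y2) + s k *: (y - y2)).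
  by rewrite -[z + _ + _]addrA -scalerDr subrKC addrA subrK.
apply: le_trans (eqnormD _ _ _) _; have := eqnormD N (z + s k *: y2) (s k *: (y - y2)).
have /andP[sk0 sk1] := s01 k.
rewrite (eqnormZp _ _ (ltW sk0)) => h3.
have h4 : s k * N (y - y2) <= 2 * e by have := eqnorm_ge0 N (y - y2); nra.
have := mk k kn; lra.
Qed.

Definition block_const : R := 4 ^+ P / c + 4.

(** The supremum of [f] over the ball of the span of the first [j] vectors stays in [[0, 1]] and
    rises at step [j] by at least [c * (|f (y j)| / 4) ^+ P], unless [|f (y j)|] is already below
    [2 * 2^-j]. The two cases give the two terms of [block_const]. *)
Lemma smooth_blocks (y : nat -> X) (n : nat) :
  (forall j, (j < n)%N -> N (y j) <= 1 /\ good_step (mkseq y j) j (y j)) ->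
  forall f : dual X, (forall x, `|f x| <= N x) -> \sum_(j < n) `|f (y j)| ^+ P <= block_const.
Proof.
have [c0 P0 s01 cs hs] := Ns.
move=> hy f fN.
pose S j := [set (f x : R) | x in [set x | lspan (mkseq y j) x /\ N x <= 1]].
have Ssup j : has_sup (S j).
  split; first by exists (f 0), 0 => //; split; [exact: lspan0|rewrite eqnorm0].
  by exists 1 => _ [x [_ x1] <-]; apply: le_trans (ler_norm _) (le_trans (fN x) x1).
pose sg j := sup (S j).
have sg0 j : 0 <= sg j.
  apply: sup_upper_bound => //; exists 0; last by rewrite du0.
  by split; [exact: lspan0|rewrite eqnorm0].
have sg1 j : sg j <= 1.
  apply: ge_sup; first by case: (Ssup j).
  by move=> _ [x [_ x1] <-]; apply: le_trans (ler_norm _) (le_trans (fN x) x1).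
have sgx j x : lspan (mkseq y j) x -> f x <= sg j * N x :> R.
  move=> bx; have [x0|x0] := eqVneq x 0; first by rewrite x0 du0 eqnorm0 mulr0.
  have Nx := eqnorm_gt0 N x0.
  have : (f ((N x)^-1 *: x) : R) <= sg j.
    apply: sup_upper_bound => //; exists ((N x)^-1 *: x) => //; split; first exact: lspanZ.
    by rewrite eqnormZp ?invr_ge0 ?(ltW Nx)// mulVf// gt_eqF.
  by rewrite duZ mulrC ler_pdivrMr.
have step j : (j < n)%N ->
    `|f (y j)| ^+ P <= 4 ^+ P / c * (sg j.+1 - sg j) + 2 * 2^-1 ^+ j.
  move=> jn; have [y1 gy] := hy j jn.
  have mono : lspan (mkseq y j) `<=` lspan (mkseq y j.+1).
    by apply/lspan_subset/mkseq_subset.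
  have yin : lspan (mkseq y j.+1) (y j).
    by apply: lspan_mem; apply: map_f; rewrite mem_iota add0n ltnS leqnn.
  have sgm : sg j <= sg j.+1.
    apply: ge_sup; first by case: (Ssup j).
    move=> _ [x [bx x1] <-]; apply: sup_upper_bound => //; exists x => //.
    by split => //; exact: mono.
  have K0 : 0 <= 4 ^+ P / c * (sg j.+1 - sg j).
    by rewrite mulr_ge0 ?subr_ge0// divr_ge0 ?exprn_ge0// ltW.
  set a := `|f (y j)|; have a0 : 0 <= a := normr_ge0 _.
  have a1 : a <= 1 := le_trans (fN _) y1.
  have t0 : 0 <= 2 * 2^-1 ^+ j :> R by rewrite mulr_ge0// exprn_ge0.
  have [->|an] := eqVneq a 0; first by rewrite expr0n gtn_eqF//= addr_ge0.
  have ap : 0 < a by rewrite lt_neqAle eq_sym an.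
  have [||k [k1 k2]] := @two_power_scale R (a / 2); [lra|lra|].
  (* A scale [k > j] is not covered by [good_step] at [j]; then [|f (y j)| < 4 * 2^-k <= 2 * 2^-j],
     which is summable. *)
  have [kj|jk] := leqP k j; last first.
    have h1 : a ^+ P <= a.
      by case: (P) P0 => // P' _; rewrite exprS ler_piMr ?exprn_ile1.
    have h2 : 2^-1 ^+ k <= 2^-1 ^+ j / 2 :> R.
      by rewrite -exprSr ler_wiXn2l ?invr_ge0// invf_le1// ler1n.
    apply: le_trans h1 _; lra.
  pose u := s k * 2^-1 ^+ k; have /andP[sk0 sk1] := s01 k.
  have u0 : 0 <= u by rewrite mulr_ge0 ?exprn_ge0// ltW.
  (* Adding [s k *: y j], with the right sign, gains [s k * a >= 2 * u] while the norm grows by at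
     most [3 / 4 * u]. *)
  have main : sg j + 2 * u <= sg j.+1 * (1 + 3 / 4 * u).
    rewrite -lerBrDr; apply: ge_sup; first by case: (Ssup j).
    move=> _ [x [bx x1] <-]; rewrite lerBrDr.
    have ska : 2 * u <= s k * a by rewrite /u; nra.
    have h3 : (f x : R) + s k * a <= sg j.+1 * (1 + 3 / 4 * u).
      have [fy|fy] := leP 0 (f (y j) : R).
        have -> : (f x : R) + s k * a = f (x + s k *: y j).
          by rewrite duD duZ /a ger0_norm.
        apply: le_trans (sgx j.+1 _ _) _; first by apply: lspanD; [exact: mono|exact: lspanZ].
        by rewrite ler_wpM2l//; exact: gy.
      have -> : (f x : R) + s k * a = f (x - s k *: y j).
        by rewrite duB duZ /a ltr0_norm// mulrN.
      apply: le_trans (sgx j.+1 _ _) _; first by apply: lspanB; [exact: mono|exact: lspanZ].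
      rewrite ler_wpM2l// -eqnormN opprB addrC; apply: gy; [exact: lspanN|by rewrite eqnormN|by []].
    lra.
  have du : u <= sg j.+1 - sg j by have := sg1 j.+1; nra.
  have h4 : c * (a / 4) ^+ P <= u.
    apply: le_trans (cs k); rewrite exprM ler_pM2l// lerXn2r ?nnegrE ?exprn_ge0//; lra.
  have h5 : a ^+ P = 4 ^+ P / c * (c * (a / 4) ^+ P).
    have p4 : 4 ^+ P != 0 :> R by rewrite expf_neq0// pnatr_eq0.
    by rewrite expr_div_n; field; rewrite p4 gt_eqF.
  apply: ler_wpDr => //; rewrite h5 ler_wpM2l//; last exact: le_trans du.
  by rewrite divr_ge0 ?exprn_ge0// ltW.
apply: le_trans (ler_sum _ (fun (j : 'I_n) _ => step j (ltn_ord j))) _.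
rewrite big_split /= -!mulr_sumr.
have -> : \sum_(i < n) (sg i.+1 - sg i) = sg n - sg 0%N.
  elim: (n) => [|m IH]; first by rewrite big_ord0 subrr.
  by rewrite big_ord_recr /= IH; lra.
have g : \sum_(i < n) 2^-1 ^+ i <= 2 :> R.
  have : \sum_(i < n) 2^-1 ^+ i = 2 - 2 * 2^-1 ^+ n :> R.
    elim: (n) => [|m IH]; first by rewrite big_ord0 expr0; lra.
    by rewrite big_ord_recr /= IH exprS; lra.
  by move=> ->; rewrite gerBl mulr_ge0// exprn_ge0.
have K0 : 0 <= 4 ^+ P / c by rewrite divr_ge0 ?exprn_ge0// ltW.
have : 4 ^+ P / c * (sg n - sg 0%N) <= 4 ^+ P / c.
  by rewrite -[leRHS]mulr1 ler_wpM2l//; have := sg1 n; have := sg0 0%N; lra.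
rewrite /block_const; lra.
Qed.

(** [P] may be 1, whereas conjugate exponents above 1 are needed; since the values [|f (y j)|] are
    at most 1, raising the exponent only decreases the sums. *)
Definition pexp : R := P.+1%:R.
Definition qexp : R := pexp / (pexp - 1).

Lemma qexp_gt1 : 1 < qexp /\ pexp^-1 + qexp^-1 = 1.
Proof.
have [_ P0 _ _ _] := Ns.
have p1 : 1 < pexp by rewrite /pexp ltr1n ltnS.
split; first by rewrite /qexp ltr_pdivlMr ?subr_gt0// mul1r; lra.
by rewrite /qexp; field; apply/andP; split; apply/eqP; lra.
Qed.

Lemma block_const_ge0 : 0 <= block_const.
Proof.
have [c0 _ _ _ _] := Ns.
by rewrite addr_ge0// divr_ge0 ?exprn_ge0// ltW.
Qed.

Lemma smooth_upper (y : nat -> X) (n : nat) (a : 'I_n -> R) :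
  (forall j, (j < n)%N -> N (y j) <= 1 /\ good_step (mkseq y j) j (y j)) ->
  N (\sum_(i < n) a i *: y i) <= (1 + block_const) * (\sum_i `|a i| `^ qexp) `^ qexp^-1.
Proof.
move=> hy; have [f [fN fv]] := norming_eqnorm N (\sum_(i < n) a i *: y i).
have [q1 pq] := qexp_gt1; have [_ P0 _ _ _] := Ns.
rewrite -fv du_sum.
under eq_bigr => i _ do rewrite duZ.
apply: (@holder_sum R n a (fun i => f (y i)) pexp qexp block_const) => //.
- by rewrite /pexp ltr1n ltnS.
- exact: block_const_ge0.
apply: le_trans (smooth_blocks hy fN); apply: ler_sum => i _.
rewrite /pexp powR_mulrn// exprS ler_piMl ?exprn_ge0//.
by apply: le_trans (fN _) _; case: (hy i (ltn_ord i)).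
Qed.

End smooth_blocks.

(** * Branches, plays and asymptotic structure *)

Section branches.
Context {R : realType} {X : normedModType R}.

Lemma mkseq_sorted (m : nat -> nat) i : {homo m : i j / (i < j)%N} ->
  sorted ltn (mkseq m i).
Proof. by move=> mh; apply: (homo_sorted mh); exact: iota_ltn_sorted. Qed.

Lemma take_mkseq T (f : nat -> T) j i : (j <= i)%N -> take j (mkseq f i) = mkseq f j.
Proof. by move=> ji; rewrite /mkseq -map_take take_iota (minn_idPl ji). Qed.

(** Entries are chosen greedily: large enough to be good for the current prefix, and larger than its
    last entry. *)
Lemma branch_pick (G : seq nat -> nat -> Prop) :
  (forall s, sorted ltn s -> exists M, forall n, (M <= n)%N -> G s n) ->
  exists m : nat -> nat, {homo m : i j / (i < j)%N} /\ forall i, G (mkseq m i) (m i).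
Proof.
move=> H.
have H' s : exists M, sorted ltn s -> forall n, (M <= n)%N -> G s n.
  case: (boolP (sorted ltn s)) => [sS|_]; last by exists 0%N.
  by have [M HM] := H s sS; exists M.
have [F FP] := choice H'.
pose nx s := maxn (F s) (last 0%N s).+1.
pose l := fix l i := if i is j.+1 then rcons (l j) (nx (l j)) else [::].
pose m i := nx (l i).
have lE i : mkseq m i = l i by elim: i => [|i IH] //=; rewrite mkseqS IH.
have mh : {homo m : i j / (i < j)%N}.
  apply: homo_ltn => [i j k|i]; first exact: ltn_trans.
  by rewrite {2}/m /nx /= last_rcons leq_max ltnSn orbT.
exists m; split => // i; apply: FP; first exact: mkseq_sorted.
by rewrite {2}/m /nx lE leq_maxl.
Qed.

Lemma sorted_rcons_last s n : sorted ltn s -> (last 0%N s < n)%N -> sorted ltn (rcons s n).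
Proof. by case: s => [//|a s] /= sS sn; rewrite rcons_path sS. Qed.

Lemma tree_branch {V : normedModType R} (null : (nat -> V) -> Prop)
    (Good : seq V -> V -> Prop) x : tree_in_sphere x -> tree_nodes null x ->
  (forall b u, null u -> exists M, forall n, (M <= n)%N -> `|u n| = 1 -> Good b (u n)) ->
  exists b, is_branch x b /\ forall i, `|b i| = 1 /\ Good (mkseq b i) (b i).
Proof.
(* The vectors already met on the path to [s], in order. *)
move=> xS xN HG; pose bs s := [seq x (take i.+1 s) | i <- iota 0 (size s)].
have [|m [mh mG]] := @branch_pick (fun s n => Good (bs s) (x (rcons s n))).
  move=> s sS; have [M hM] := HG (bs s) _ (xN s sS).
  exists (maxn M (last 0%N s).+1) => n; rewrite geq_max => /andP[Mn sn].
  apply: hM => //; apply: xS; rewrite /in_Tinf sorted_rcons_last// andbT.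
  by rewrite -size_eq0 size_rcons.
exists (fun i => x (mkseq m i.+1)); split; first by exists m.
move=> i; split.
  by apply: xS; rewrite /in_Tinf mkseq_sorted// andbT -size_eq0 size_mkseq.
have := mG i; rewrite -mkseqS; congr (Good _ _).
rewrite /bs size_mkseq; apply/eq_in_map => j; rewrite mem_iota add0n => /andP[_ ji].
by rewrite take_mkseq.
Qed.

Lemma weak_tree_branch (Good : seq X -> X -> Prop) x : tree_in_sphere x ->
  tree_nodes (@weakly_null R X) x ->
  (forall b, exists (L : seq (dual X)) (d : R), 0 < d /\
    forall y, `|y| = 1 -> (forall f, f \in L -> `|f y| <= d) -> Good b y) ->
  exists b, is_branch x b /\ forall i, `|b i| = 1 /\ Good (mkseq b i) (b i).
Proof.
move=> xS xN HG; apply: tree_branch xS xN _ => b u un.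
have [L [d [d0 hd]]] := HG b; have [M hM] := weakly_null_seq L d0 un.
by exists M => n Mn u1; apply: hd => // f fL; rewrite ltW// hM.
Qed.

(** The loss allowed at step [j] is the ratio of two consecutive terms, so losses multiply by
    telescoping and never exceed [1 + e] in total. *)
Definition mratio (e : R) (j : nat) : R := 1 + e * 2^-1 ^+ j.

Definition nearly_monotone (e : R) (b : seq X) (y : X) : Prop :=
  forall x a, lspan b x -> mratio e (size b).+1 * `|x| <= mratio e (size b) * `|x + a *: y|.

Lemma mratio_bounds e j : 0 < e -> 1 < mratio e j <= 1 + e.
Proof.
move=> e0; rewrite /mratio ltrDl mulr_gt0 ?exprn_gt0//= lerD2l ler_piMr ?(ltW e0)//.
by rewrite exprn_ile1 ?invr_ge0// invf_le1// ler1n.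
Qed.

Lemma nearly_monotoneP e b : 0 < e -> exists (L : seq (dual X)) (d : R), 0 < d /\
  forall y, `|y| = 1 -> (forall f, f \in L -> `|f y| <= d) -> nearly_monotone e b y.
Proof.
move=> e0; pose j := size b; pose e' := mratio e j / mratio e j.+1 - 1.
have /andP[r1 _] := mratio_bounds j.+1 e0.
have r0 : 0 < mratio e j.+1 by lra.
have e'0 : 0 < e'.
  rewrite subr_gt0 ltr_pdivlMr// mul1r /mratio ltrD2l ltr_pM2l// exprS.
  have : 0 < 2^-1 ^+ j :> R by rewrite exprn_gt0.
  lra.
have [L [d [d0 hd]]] := mazur_step b e'0.
exists L, d; split => // y y1 fy x a bx; have := hd y y1 fy x a bx.
by rewrite /e' subrKC -[_ / _ * _]mulrAC ler_pdivlMr// mulrC.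
Qed.

Lemma nearly_monotone_sum e (b : nat -> X) n : 0 < e ->
  (forall j, (j < n)%N -> nearly_monotone e (mkseq b j) (b j)) ->
  forall (a : nat -> R) k, (k <= n)%N ->
  `|\sum_(i < k) a i *: b i| <= (1 + e) * `|\sum_(i < n) a i *: b i|.
Proof.
move=> e0 hb a k kn; pose S m := `|\sum_(i < m) a i *: b i|.
rewrite -/(S k) -/(S n).
have r0 j : 0 < mratio e j by have /andP[] := mratio_bounds j e0; lra.
have step j : (j < n)%N -> mratio e j.+1 * S j <= mratio e j * S j.+1.
  move=> jn; rewrite /S big_ord_recr /=; have := hb j jn _ (a j) (lspan_mkseq_sum b j a).
  by rewrite size_mkseq.
have main m : (k + m <= n)%N -> mratio e (k + m) * S k <= mratio e k * S (k + m)%N.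
  elim: m => [|m IH]; first by rewrite addn0.
  rewrite addnS => kmn; have h := IH (ltnW kmn); have h' := step _ kmn.
  have m0 := r0 (k + m)%N; have m1 := r0 (k + m).+1; have k0 := r0 k.
  rewrite -(ler_pM2l m0) mulrCA; apply: le_trans (_ : mratio e (k + m).+1 * (mratio e k * S (k + m)%N) <= _).
    by rewrite ler_pM2l.
  by rewrite mulrCA [leRHS]mulrCA ler_pM2l.
have := main (n - k)%N; rewrite subnKC// => /(_ (leqnn n)).
have /andP[n1 _] := mratio_bounds n e0; have /andP[_ k1] := mratio_bounds k e0.
have : 0 <= S k by exact: normr_ge0.
have : 0 <= S n by exact: normr_ge0.
nra.
Qed.

(** The lower estimate uses a branch with basis constant 2: a coefficient is a difference of two
    partial sums, whence the factor 4. The upper one uses a branch of good steps, rescaled by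
    [C1^-1] to have [N] at most 1. *)
Lemma weak_tree_of_smooth (N : equiv_norm X) : smooth_norm N ->
  exists q : \bar R, (1 < q)%E /\ weak_tree_estimates X +oo%E q.
Proof.
move=> /smooth_norm_data[P [c [s Ns]]].
have [c1 [C1 [c10 C10 cC]]] := eqnorm_equiv N.
have [q1 _] := qexp_gt1 Ns.
pose B := C1 / c1 * (1 + block_const P c).
have b0 := block_const_ge0 Ns.
have B0 : 0 <= B by apply: mulr_ge0; [apply: divr_ge0; exact: ltW|exact: addr_ge0].
exists (@qexp R P)%:E; split; first by rewrite lte_fin.
exists (4 + B); first by rewrite ltr_wpDr.
have C0 : 0 < 4 + B by rewrite ltr_wpDr.
move=> x xS xN; split.
  have [|b [bb hb]] := @weak_tree_branch (nearly_monotone 1) x xS xN.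
    by move=> b; apply: nearly_monotoneP.
  exists b => // n a; rewrite ler_pdivrMl//.
  apply: bigmax_le => [|i _]; first by rewrite mulr_ge0// ltW.
  have hm := @nearly_monotone_sum 1 b n ltr01 (fun j _ => (hb j).2) a.
  have h1 := hm i (ltnW (ltn_ord i)); have h2 := hm i.+1 (ltn_ord i).
  have : `|a i| <= `|\sum_(j < i) a j *: b j| + `|\sum_(j < i.+1) a j *: b j|.
    rewrite big_ord_recr /=; set v := \sum_(j < i) _.
    have -> : `|a i| = `|a i *: b i| by rewrite normrZ (hb i).1 mulr1.
    have := ler_normB (v + a i *: b i) v; rewrite addrAC subrr add0r; lra.
  have : 0 <= B * `|\sum_(i < n) a i *: b i| by rewrite mulr_ge0.
  lra.
have [|b [bb hb]] := @weak_tree_branch (fun b y =>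
    good_step N s (map ( *:%R C1^-1) b) (size b) (C1^-1 *: y)) x xS xN.
  move=> b; have [L [d [d0 hd]]] := good_stepP Ns (map ( *:%R C1^-1) b) (size b).
  exists L, (d * C1); split; first exact: mulr_gt0.
  move=> y y1 fy; apply: hd => [|f fL].
    rewrite eqnormZp ?invr_ge0 ?(ltW C10)// ler_pdivrMl// mulr1.
    by have /andP[_] := cC y; rewrite y1 mulr1.
  by rewrite duZ normrM ger0_norm ?invr_ge0 ?(ltW C10)// ler_pdivrMl// mulrC fy.
exists b => // n a; pose y i := C1^-1 *: b i.
have hy j : (j < n)%N -> N (y j) <= 1 /\ good_step N s (mkseq y j) j (y j).
  move=> _; have [bj1 gb] := hb j; split.
    rewrite eqnormZp ?invr_ge0 ?(ltW C10)// ler_pdivrMl// mulr1.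
    by have /andP[_] := cC (b j); rewrite bj1 mulr1.
  by move: gb; rewrite size_mkseq /mkseq -map_comp.
have := smooth_upper Ns (fun i => a i) hy.
have -> : \sum_(i < n) a i *: y i = C1^-1 *: \sum_(i < n) a i *: b i.
  by rewrite scaler_sumr; apply: eq_bigr => i _; rewrite /y !scalerA mulrC.
rewrite /lp_norm; set v := \sum_(i < n) a i *: b i; set w := _ `^ (qexp _)^-1 => h.
have w0 : 0 <= w by exact: powR_ge0.
have /andP[h1 _] := cC (C1^-1 *: v).
have h2 : c1 * `|C1^-1 *: v| <= (1 + block_const P c) * w by exact: le_trans h1 h.
move: h2; rewrite normrZ ger0_norm ?invr_ge0 ?(ltW C10)// => h2.
have : `|v| <= B * w.
  have -> : `|v| = (C1 / c1) * (c1 * (C1^-1 * `|v|)) by field; rewrite !gt_eqF.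
  by rewrite /B -[leRHS]mulrA ler_pM2l// divr_gt0.
lra.
Qed.

End branches.

Section trees_to_game.
Context {R : realType} {X : normedModType R}.

Lemma lp_norm_sublinear (q : \bar R) (C : R) : (1 < q)%E -> 0 <= C ->
  exists n, (1 < n)%N /\ C * lp_norm q n (fun=> 1) <= n%:R / 2.
Proof.
case: q => [r|_|//] => [|C0]; last first.
  exists (Num.truncn (2 * C)).+2; split => //=.
  have h := truncnS_gt (2 * C).
  have : \big[Num.max/0]_(i < (Num.truncn (2 * C)).+2) `|1| <= 1 :> R.
    by apply: bigmax_le => // i _; rewrite normr1.
  have : (Num.truncn (2 * C)).+1%:R <= (Num.truncn (2 * C)).+2%:R :> R by rewrite ler_nat.
  nra.
rewrite lte_fin => r1 C0; have r0 : 0 < r by lra.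
pose s := 1 - r^-1.
have s0 : 0 < s by rewrite subr_gt0 invf_lt1.
pose t := (2 * C) `^ s^-1; have t0 : 0 <= t := powR_ge0 _ _.
pose n := (Num.truncn t).+2.
exists n; split => //=.
have -> : \sum_(i < n) `|1 : R| `^ r = n%:R.
  under eq_bigr => i _ do rewrite normr1 powR1.
  by rewrite sumr_const card_ord.
have n0 : 0 < n%:R :> R by rewrite ltr0n.
have tn : t <= n%:R.
  by apply: le_trans (ltW (truncnS_gt t)) _; rewrite ler_nat.
have C2 : 2 * C <= n%:R `^ s.
  have -> : 2 * C = t `^ s by rewrite /t -powRrM mulVf ?gt_eqF// powRr1// mulr_ge0.
  by apply: ge0_ler_powR => //; rewrite ?nnegrE ltW.
have nE : n%:R = n%:R `^ r^-1 * n%:R `^ s :> R.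
  by rewrite -powRD ?subrKC ?powRr1 ?(ltW n0)//; apply/implyP; rewrite gt_eqF.
have h0 : 0 <= n%:R `^ r^-1 :> R := powR_ge0 _ _.
have : 2 * C * n%:R `^ r^-1 <= n%:R `^ s * n%:R `^ r^-1 by exact: ler_wpM2r.
rewrite [X in _ <= X]mulrC -nE; lra.
Qed.

(** [Aop] plays in the ball, trees and asymptotic games on the sphere. A vector [t *: u] of the ball
    is a convex combination of [u] and [- u], so convexity shows that one of these does at least as
    well. *)
Lemma unit_above k st (c : R) (L : seq (dual X)) : ~ fin_dim [set: X] ->
  c < iter k.+1 (Aop (@id_norm R X) 1) (@id_norm R X) st ->
  exists y, [/\ kerl L y, `|y| = 1 & c < iter k (Aop (@id_norm R X) 1) (@id_norm R X) (st + y)].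
Proof.
move=> Xinf; set phi := iter k _ _ => cphi.
have phil : lip (@id_norm R X) phi by apply: iter_lip => //; exact: lip_N.
have phic : cvx phi by apply: iter_cvx => //; [exact: lip_N|exact: cvx_N].
apply: contrapT => hn.
have hu y : kerl L y -> `|y| = 1 -> phi (st + y) <= c.
  by move=> Ly y1; rewrite leNgt; apply/negP => cy; apply: hn; exists y.
suff : Aop (@id_norm R X) 1 phi st <= c by rewrite leNgt cphi.
apply: (@Aop_le _ _ _ _ _ _ _ L) => // y Ly y1.
have [u [t [Lu u1 t01 ->]]] : exists u t, [/\ kerl L u, `|u| = 1, 0 <= t <= 1 & y = t *: u].
  have [->|y0] := eqVneq y 0.
    have [u [Lu u1]] := unit_in_kerl L (@id_norm R X) Xinf.
    by exists u, 0; rewrite scale0r lexx ler01; split.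
  have y0' : 0 < `|y| by rewrite normr_gt0.
  exists (`|y|^-1 *: y), `|y|; split; first exact: kerlZ.
  - by rewrite normrZ normfV normr_id mulVf// gt_eqF.
  - by rewrite ltW.
  by rewrite scalerA divff ?gt_eqF// scale1r.
pose a := (1 + t) / 2.
have a01 : 0 <= a <= 1 by rewrite /a; apply/andP; split; lra.
have -> : st + t *: u = a *: (st + u) + (1 - a) *: (st - u).
  rewrite !scalerDr addrACA -scalerDl subrKC scale1r scalerN -scalerBl; congr (_ + _ *: _).
  by rewrite /a; lra.
apply: le_trans (phic _ _ _ a01) _.
have h1 := hu u Lu u1; have h2 : phi (st - u) <= c by apply: hu; [exact: kerlN|rewrite normrN].
nra.
Qed.

Lemma weakly_null_kerl (fs : nat -> dual X) (u : nat -> X) :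
  (forall (f : dual X) (e : R), 0 < e -> exists n, `|f - fs n| < e) ->
  (forall n, `|u n| = 1 /\ kerl (mkseq fs n) (u n)) -> weakly_null u.
Proof.
move=> fsD hu; apply/weakly_nullP => f e e0; have [j fj] := fsD f e e0.
exists j.+1 => n jn; have [u1 kn] := hu n.
have fj0 : fs j (u n) = 0 by apply: kn; apply: map_f; rewrite mem_iota add0n.
have -> : f (u n) = (f - fs j) (u n) by rewrite dualB fj0 subr0.
by apply: le_lt_trans (dualP _ _) _; rewrite u1 mulr1.
Qed.

(** If the game were not sublinear, the second player could keep its value above [n - 1 / 2].
    Playing the [m]-th successor of a node in the kernel of the first [m] functionals gives a weakly
    null tree, all of whose branches contradict the upper estimate. *)
Lemma sub_linear_of_trees (fs : nat -> dual X) : ~ fin_dim [set: X] ->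
  (forall (f : dual X) (e : R), 0 < e -> exists n, `|f - fs n| < e) ->
  (exists q : \bar R, (1 < q)%E /\ weak_tree_estimates X +oo%E q) ->
  sub_linear_game (@id_norm R X).
Proof.
move=> Xinf fsD [q [q1 [C C0 H]]].
have [n [n1 hn]] := lp_norm_sublinear q1 (ltW C0).
exists n => //; rewrite ltNge; apply/negP => big.
pose phi k := iter k (Aop (@id_norm R X) 1) (@id_norm R X).
pose c : R := n%:R - 1 / 2.
have out (z : nat * X * nat) : exists y : X, [/\ `|y| = 1, kerl (mkseq fs z.2) y &
    (z.1.1 < n)%N -> c < phi (n - z.1.1)%N z.1.2 -> c < phi (n - z.1.1.+1)%N (z.1.2 + y)].
  case: z => [[i st] m] /=.
  case: (pselect ((i < n)%N /\ c < phi (n - i)%N st)) => [[i_n cst]|no].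
    have [|y [Ly y1 cy]] := @unit_above (n - i.+1) st c (mkseq fs m) Xinf.
      by rewrite subnSK.
    by exists y; split.
  have [y [Ly y1]] := unit_in_kerl (mkseq fs m) (@id_norm R X) Xinf.
  by exists y; split => // i_n cst; case: no.
have [w wP] := choice out.
have [||x [xS xN xb]] := @strategy_treeP R X X (@weakly_null R X) 0
    (fun i st m => st + w (i, st, m)) (fun i st m => w (i, st, m)).
- by move=> i st m; have [] := wP (i, st, m).
- move=> i st; apply: (weakly_null_kerl fsD) => m.
  by have [] := wP (i, st, m).
have [_ [b bb ub]] := H x xS xN; have [st [m [st0 stS bE]]] := xb b bb.
have stE i : st i = \sum_(j < i) (1 : R) *: b j.
  elim: i => [|i IH]; first by rewrite big_ord0.
  by rewrite big_ord_recr /= -IH scale1r bE stS.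
have inv i : (i <= n)%N -> c < phi (n - i)%N (st i).
  elim: i => [|i IH] i_n; first by rewrite subn0 st0 /c; apply: lt_le_trans big; lra.
  by rewrite stS; have [_ _] := wP (i, st i, m i); apply => //; exact/IH/ltnW.
have := inv n (leqnn n); rewrite subnn /phi /= stE.
have : 1 < n%:R :> R by rewrite ltr1n.
have := ub n (fun=> 1); rewrite /c; lra.
Qed.

End trees_to_game.

(** * Determined games and limits of plays *)

Section forced_games.
Context {R : realType} {X : normedModType R}.

(** The first player can force [P]. Forcing is monotone and stable under conjunction, so the forced
    properties behave like a filter on plays. *)
Fixpoint forced (n : nat) (P : seq X -> Prop) (s : seq X) : Prop :=
  if n is m.+1 then exists L : seq (dual X), forall x, kerl L x -> `|x| = 1 ->
    forced m P (rcons s x)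
  else P s.

Lemma forced_mono n (P Q : seq X -> Prop) s : (forall t, P t -> Q t) ->
  forced n P s -> forced n Q s.
Proof.
move=> PQ; elim: n s => [|n IH] s /=; first exact: PQ.
by move=> [L hL]; exists L => x Lx x1; apply/IH/hL.
Qed.

Lemma forcedI n (P Q : seq X -> Prop) s : forced n P s -> forced n Q s ->
  forced n (fun t => P t /\ Q t) s.
Proof.
elim: n s => [|n IH] s //= [L hL] [M hM]; exists (L ++ M) => x /kerl_cat[Lx Mx] x1.
by apply: IH; [exact: hL|exact: hM].
Qed.

Lemma forced_play n (St : seq X -> seq (dual X)) s :
  forced n (fun t => exists t', [/\ t = s ++ t', size t' = n & forall j, (j < n)%N ->
    kerl (St (s ++ take j t')) t'`_j /\ `|t'`_j| = 1]) s.
Proof.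
elim: n s => [|n IH] s /=; first by exists [::]; rewrite cats0.
exists (St s) => x sx x1; apply: forced_mono (IH (rcons s x)) => t [t' [-> tn ht]].
exists (x :: t'); rewrite cat_rcons /= tn; split => // -[|j]; first by rewrite cats0.
by rewrite ltnS => /ht; rewrite cat_rcons.
Qed.

(** Finite games are determined: negating the alternating quantifiers turns a loss of the second
    player into a winning strategy of the first. *)
Lemma forced_of_not n (P : seq X -> Prop) s : ~ asymptotic_game n P s ->
  forced n (fun t => ~ P t) s.
Proof.
elim: n s => [//|n IH] s /= h; apply: contrapT => hn; apply: h => Y /cof_kerl[L LY].
apply: contrapT => no; apply: hn; exists L => x Lx x1; apply: IH => g; apply: no.
by exists x; split => //; exact: LY.
Qed.

Lemma game_meets_forced n (P Q : seq X -> Prop) s : asymptotic_game n P s ->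
  forced n Q s -> exists t, P t /\ Q t.
Proof.
elim: n s => [|n IH] s /=; first by exists s.
move=> h [L hL]; have [x [Lx x1 g]] := h _ (cof_of_kerl L).
exact: IH g (hL x Lx x1).
Qed.

Lemma take_nth_mkseq (t : seq X) j : (j <= size t)%N -> take j t = mkseq (nth 0 t) j.
Proof. by move=> jt; rewrite -{1}(mkseq_nth 0 t) take_mkseq. Qed.

Lemma forced_steps n (Good : seq X -> X -> Prop) :
  (forall b, exists (L : seq (dual X)) (d : R), 0 < d /\
    forall y, `|y| = 1 -> (forall f, f \in L -> `|f y| <= d) -> Good b y) ->
  forced n (fun t => size t = n /\ forall j, (j < n)%N ->
    `|t`_j| = 1 /\ Good (mkseq (nth 0 t) j) t`_j) [::].
Proof.
move=> HG.
have H b : exists L : seq (dual X), forall y, `|y| = 1 -> kerl L y -> Good b y.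
  have [L [d [d0 hd]]] := HG b; exists L => y y1 Ly; apply: hd => // f fL.
  by rewrite Ly// normr0 ltW.
have [St StP] := choice H.
apply: forced_mono (forced_play n St [::]) => t [t' [-> tn ht]].
rewrite cat0s; split => // j jn; have [kj j1] := ht j jn; split => //.
by apply: StP => //; rewrite -take_nth_mkseq// tn ltnW.
Qed.

(** The first player forces good steps; by equivalence with constant [1 + 1], the upper estimate of
    such a play passes to [e], whence the factor 2. *)
Lemma asymptotic_upper (N : equiv_norm X) : smooth_norm N ->
  exists q K : R, 1 < q /\
    forall (n : nat) (V : normedModType R) (e : 'I_n -> V), asymptotic_structure X e ->
      forall a : 'I_n -> R,
        `|\sum_i a i *: e i| <= K * (\sum_i `|a i| `^ q) `^ q^-1.
Proof.
move=> /smooth_norm_data[P [c [s Ns]]].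
have [c1 [C1 [c10 C10 cC]]] := eqnorm_equiv N.
have [q1 _] := qexp_gt1 Ns.
exists (@qexp R P), (2 * (C1 / c1 * (1 + block_const P c))); split => // n V e [_ _ _ he] a.
have [] := @game_meets_forced n _ _ [::] (he 1 ltr01)
    (@forced_steps n (fun b y =>
      good_step N s (map ( *:%R C1^-1) b) (size b) (C1^-1 *: y)) _).
  move=> b; have [L [d [d0 hd]]] := good_stepP Ns (map ( *:%R C1^-1) b) (size b).
  exists L, (d * C1); split; first exact: mulr_gt0.
  move=> y y1 fy; apply: hd => [|f fL].
    rewrite eqnormZp ?invr_ge0 ?(ltW C10)// ler_pdivrMl// mulr1.
    by have /andP[_] := cC y; rewrite y1 mulr1.
  by rewrite duZ normrM ger0_norm ?invr_ge0 ?(ltW C10)// ler_pdivrMl// mulrC fy.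
move=> t [/(_ a)/andP[hl _] [tn ht]].
pose y j := C1^-1 *: t`_j.
have hy j : (j < n)%N -> N (y j) <= 1 /\ good_step N s (mkseq y j) j (y j).
  move=> jn; have [tj1 gj] := ht j jn; split.
    rewrite eqnormZp ?invr_ge0 ?(ltW C10)// ler_pdivrMl// mulr1.
    by have /andP[_] := cC t`_j; rewrite tj1 mulr1.
  by move: gj; rewrite size_mkseq /mkseq -map_comp.
have h := smooth_upper Ns a hy.
move: h; have -> : \sum_(i < n) a i *: y i = C1^-1 *: \sum_(i < n) a i *: t`_i.
  by rewrite scaler_sumr; apply: eq_bigr => i _; rewrite /y !scalerA mulrC.
move: hl; set v := \sum_(i < n) _ *: t`_i; set w := _ `^ (qexp _)^-1 => hl h.
have /andP[h1 _] := cC (C1^-1 *: v).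
have h2 : c1 * `|C1^-1 *: v| <= (1 + block_const P c) * w by exact: le_trans h1 h.
move: h2; rewrite normrZ ger0_norm ?invr_ge0 ?(ltW C10)// => h2.
have h3 : `|v| <= C1 / c1 * (1 + block_const P c) * w.
  have -> : `|v| = (C1 / c1) * (c1 * (C1^-1 * `|v|)) by field; rewrite !gt_eqF.
  by rewrite -[leRHS]mulrA ler_pM2l// divr_gt0.
move: hl; rewrite -ler_pdivlMl ?invr_gt0// invrK => hl; apply: le_trans hl _.
by rewrite -!mulrA ler_pM2l//; apply: le_trans h3 _; rewrite !mulrA.
Qed.

Lemma game_not_forced n (c : R) s : ~ fin_dim [set: X] ->
  c < iter n (Aop (@id_norm R X) 1) (@id_norm R X) (\sum_(x <- s) x) ->
  forced n (fun t => ~ c < `|\sum_(x <- t) x|) s -> False.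
Proof.
move=> Xinf; elim: n s => [|n IH] s; first by move=> /= h; apply.
move=> cs /= [L hL]; have [y [Ly y1 cy]] := unit_above L Xinf cs.
by apply: IH (hL y Ly y1); rewrite -cats1 big_cat big_seq1.
Qed.

End forced_games.

Section asymptotic_to_game.
Context {R : realType} {X : normedModType R}.
Local Notation rV n := 'rV[R]_n.

Lemma rV_entry n (a : rV n) j : `|a 0 j| <= `|a|.
Proof.
by rewrite [leRHS]/Num.Def.normr /= mx_normrE; apply/bigmax_geP; right => /=; exists (0, j).
Qed.

Lemma rV_norm_le n (a : rV n) (M : R) : 0 <= M -> (forall j, `|a 0 j| <= M) -> `|a| <= M.
Proof.
move=> M0 h; rewrite [leLHS]/Num.Def.normr /= mx_normrE; apply: bigmax_le => // -[i j] _ /=.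
by rewrite (ord1 i).
Qed.

Lemma rV_lspan n (a : rV n) : lspan [seq delta_mx 0 j | j : 'I_n] a.
Proof.
rewrite (row_sum_delta a); apply: lspan_sum => j _; apply/lspanZ/lspan_mem.
by apply: map_f; rewrite mem_enum.
Qed.

Definition comb n (a : rV n) (s : seq X) : X := \sum_(i < n) a 0 i *: s`_i.

Lemma combD n (a b : rV n) s : comb (a + b) s = comb a s + comb b s.
Proof. by rewrite -big_split; apply: eq_bigr => i _; rewrite mxE scalerDl. Qed.

Lemma combZ n (t : R) (a : rV n) s : comb (t *: a) s = t *: comb a s.
Proof. by rewrite scaler_sumr; apply: eq_bigr => i _; rewrite mxE scalerA. Qed.

Lemma comb_bound n (a : rV n) s : (forall j, (j < n)%N -> `|s`_j| = 1) ->
  `|comb a s| <= n%:R * `|a|.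
Proof.
move=> s1; apply: le_trans (ler_norm_sum _ _ _) _.
have -> : n%:R * `|a| = \sum_(i < n) `|a| by rewrite sumr_const card_ord mulr_natl.
by apply: ler_sum => i _; rewrite normrZ s1// mulr1 rV_entry.
Qed.

(* The norm is the limit of [comb a t] along an ultrafilter of plays [t]. *)
Lemma game_norm n (A : seq X -> Prop) : ~ forced n.+1 (fun t => ~ A t) [::] ->
  exists N : equiv_norm (rV n.+1),
    asymptotic_structure X (fun i => delta_mx 0 i : renorm N) /\
    forall a (M : R), (forall t, A t -> M <= `|comb a t|) -> M <= N a.
Proof.
(* These are the properties that can be forced among plays in [A]; the hypothesis says that this
   filter is proper. *)
move=> hA; pose F := [set P : set (seq X) | forced n.+1 (fun t => A t -> P t) [::]].
have FF : ProperFilter F.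
  split; last split.
  - by move=> h; apply: hA; exact: forced_mono h.
  - apply: forced_mono (@forced_play R X n.+1 (fun=> [::]) [::]) => t _ _; exact: I.
  - move=> P Q hP hQ; apply: forced_mono (forcedI hP hQ) => t [h1 h2] At.
    by split; [exact: h1|exact: h2].
  - by move=> P Q PQ; apply: forced_mono => t h At; apply/PQ/h.
have [U [UU FU]] := ultraFilterLemma FF.
have Uf P : forced n.+1 P [::] -> U P by move=> h; apply/FU/(forced_mono _ h).
have UA : U A by apply/FU/(forced_mono _ (@forced_play R X n.+1 (fun=> [::]) [::])).
have mono e : 0 < e -> U (fun t => size t = n.+1 /\ forall j, (j < n.+1)%N ->
    `|t`_j| = 1 /\ nearly_monotone e (mkseq (nth 0 t) j) t`_j).
  by move=> e0; apply/Uf/forced_steps => b; exact: nearly_monotoneP.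
have unit : U (fun t => forall j, (j < n.+1)%N -> `|t`_j| = 1).
  by apply: filterS (mono _ ltr01) => t [_ h] j /h[].
have lim (a : rV n.+1) : exists l : R, `|comb a t| @[t --> U] --> l.
  apply: (@ultra_bounded_cvg R _ U (fun t => `|comb a t|) (n.+1%:R * `|a|) UU).
  by apply: filterS unit => t t1 /=; rewrite normr_id; exact: comb_bound.
have [nu nuP] := choice lim.
have le_lim (f g : seq X -> R) (l l' : R) : f @ U --> l -> g @ U --> l' ->
    U (fun t => f t <= g t) -> l <= l'.
  move=> fl gl h; rewrite -subr_ge0; apply: cvgr_to_ge (cvgB gl fl) _.
  by apply: filterS h => t; rewrite -subr_ge0.
have nu_le a b (k : R) : 0 <= k -> U (fun t => `|comb a t| <= k * `|comb b t|) ->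
    nu a <= k * nu b.
  move=> k0 h; have hb : k * `|comb b t| @[t --> U] --> k * nu b by apply: cvgMr; exact: nuP.
  exact: le_lim (nuP a) hb h.
have nu_ge a (M : R) : U (fun t => M <= `|comb a t|) -> M <= nu a.
  exact: cvgr_to_ge (nuP a).
have nu_le1 a (M : R) : U (fun t => `|comb a t| <= M) -> nu a <= M.
  exact: cvgr_to_le (nuP a).
have nuD a b : nu (a + b) <= nu a + nu b.
  apply: (le_lim _ _ _ _ (nuP _) (cvgD (nuP a) (nuP b))).
  by apply: nearW => t; rewrite combD ler_normD.
have nuZ k a : nu (k *: a) = `|k| * nu a.
  apply: (cvg_unique _ (nuP _)) => //.
  have -> : (fun t => `|comb (k *: a) t|) = (fun t => `|k| * `|comb a t|).
    by apply/funext => t; rewrite combZ normrZ.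
  by apply: cvgMr; exact: nuP.
have msum e (a : rV n.+1) k : 0 < e -> U (fun t => `|\sum_(i < n.+1 | (i < k)%N) a 0 i *: t`_i| <=
    (1 + e) * `|comb a t|).
  move=> e0; apply: filterS (mono e e0) => t [tn ht].
  pose a' i := if insub i is Some j then a 0 j else 0.
  have [kn|nk] := leqP k n.+1; last first.
    rewrite (eq_bigl xpredT) => [|i]; last by rewrite (ltn_trans _ nk).
    by rewrite -[leLHS]mul1r ler_wpM2r// lerDl ltW.
  have hm := nearly_monotone_sum e0 (fun j jn => (ht j jn).2) a' kn.
  have -> : comb a t = \sum_(i < n.+1) a' i *: t`_i.
    by apply: eq_bigr => i _; rewrite /a' valK.
  have -> : \sum_(i < n.+1 | (i < k)%N) a 0 i *: t`_i = \sum_(i < k) a' i *: t`_i.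
    rewrite (big_ord_widen _ (fun i => a' i *: t`_i) kn).
    by apply: eq_bigr => i _; rewrite /a' valK.
  exact: hm.
(* A coordinate is the difference of two initial sums, each bounded by twice the whole; hence 4. *)
have nu_low (a : rV n.+1) : `|a| <= 4 * nu a.
  apply: rV_norm_le => [|j].
    by rewrite mulr_ge0//; apply: nu_ge; apply: nearW => t.
  rewrite -ler_pdivrMl//; apply: nu_ge.
  apply: filterS (filterI unit (filterI (msum _ a j ltr01) (msum _ a j.+1 ltr01))).
  move=> t [t1 [h1 h2]]; rewrite ler_pdivrMl//.
  have -> : `|a 0 j| = `|a 0 j *: t`_j| by rewrite normrZ t1// mulr1.
  have -> : a 0 j *: t`_j = \sum_(i < n.+1 | (i < j.+1)%N) a 0 i *: t`_i -
      \sum_(i < n.+1 | (i < j)%N) a 0 i *: t`_i.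
    rewrite (bigD1 j)//= -addrA [X in _ = _ + X](_ : _ = 0) ?addr0//.
    apply/eqP; rewrite subr_eq0; apply/eqP/eq_bigl => i.
    by rewrite ltnS andbC -ltn_neqAle.
  apply: le_trans (ler_normB _ _) _; lra.
have nu_up (a : rV n.+1) : nu a <= n.+1%:R * `|a|.
  by apply: nu_le1; apply: filterS unit => t; exact: comb_bound.
have nuE : exists c C : R, [/\ 0 < c, 0 < C & forall x, c * `|x| <= nu x <= C * `|x|].
  exists 4^-1, n.+1%:R; split => // x; rewrite nu_up andbT ler_pdivrMl//; exact: nu_low.
pose N := EquivNorm nuD nuZ nuE.
have sumE (a : 'I_n.+1 -> R) : \sum_i a i *: (delta_mx 0 i : rV n.+1) = \row_i a i.
  by rewrite [RHS]row_sum_delta; apply: eq_bigr => i _; rewrite mxE.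
have combE (a : 'I_n.+1 -> R) t : comb (\row_i a i) t = \sum_i a i *: t`_i.
  by apply: eq_bigr => i _; rewrite mxE.
exists N; split; last first.
  by move=> a M h; apply: nu_ge; exact: filterS UA.
split.
- move=> x; exists [ffun i => (x : rV n.+1) 0 i]; split.
    under eq_bigr => i _ do rewrite ffunE.
    exact: row_sum_delta.
  move=> b xb; apply/ffunP => i; rewrite ffunE.
  have -> : x = \row_i b i by rewrite xb; exact: sumE.
  by rewrite mxE.
- move=> i; rewrite [LHS]/Num.Def.normr /=.
  have c1 t : comb (delta_mx 0 i) t = t`_i.
    rewrite /comb (bigD1 i)//= big1 => [|j ji]; last by rewrite mxE (negbTE ji) andbF scale0r.
    by rewrite mxE !eqxx scale1r addr0.
  apply/eqP; rewrite eq_le; apply/andP; split.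
    by apply: nu_le1; apply: filterS unit => t t1; rewrite c1 t1.
  by apply: nu_ge; apply: filterS unit => t t1; rewrite c1 t1.
- move=> a k; rewrite ![`|_|]/Num.Def.normr /=.
  pose a' (i : 'I_n.+1) := if (i < k)%N then a i else 0.
  have -> : \sum_(i < n.+1 | (i < k)%N) a i *: (delta_mx 0 i : rV n.+1) = \row_i a' i.
    rewrite -sumE big_mkcond; apply: eq_bigr => i _ /=.
    by rewrite /a'; case: ifP => //; rewrite scale0r.
  rewrite sumE; apply/ler_addgt0Pr => e e0.
  have n0 : 0 <= nu (\row_i a i) by apply: nu_ge; apply: nearW.
  pose d := e / (1 + nu (\row_i a i)).
  have d0 : 0 < d by rewrite divr_gt0// ltr_wpDr.
  apply: (@le_trans _ _ ((1 + d) * nu (\row_i a i))); last first.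
    rewrite mulrDl mul1r lerD2l /d mulrAC ler_pdivrMr ?ltr_wpDr// ler_pM2l// lerDr//.
  apply: nu_le; first by rewrite addr_ge0// ltW.
  apply: filterS (msum d (\row_i a i) k d0) => t; rewrite !combE.
  suff -> : \sum_i a' i *: t`_i = \sum_(i < n.+1 | (i < k)%N) (\row_i a i) 0 i *: t`_i by [].
  rewrite [RHS]big_mkcond; apply: eq_bigr => i _ /=.
  by rewrite mxE /a'; case: ifP => //; rewrite scale0r.
(* By determinacy, losing the game would make almost every play fail to be equivalent, whereas
   almost every play is shown to be equivalent by means of a finite net. *)
move=> eps eps0; apply: contrapT => /forced_of_not/Uf Uneq.
suff : U (equivalent_to (1 + eps) (fun i => delta_mx 0 i : renorm N)).
  move=> h; apply: (@filter_not_empty _ U _).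
  by apply: filterS (filterI h Uneq) => t [].
(* With [th = eps / (1 + eps)] the total error is at most [th / 4], that is [th * nu b] since
   [nu b >= 1 / 4]; and [1 - th = (1 + eps)^-1]. *)
pose d := eps / (1 + eps) / (4 * (2 * n.+1%:R + 1)).
have n1 : 0 < n.+1%:R :> R by rewrite ltr0n.
have d0 : 0 < d by rewrite !divr_gt0//; lra.
have [|zs [zS zP]] := @subspan_net R _ [seq delta_mx 0 j | j : 'I_n.+1]
    [set a : rV n.+1 | `|a| <= 1] 1 d _ (fun a h => h) d0.
  by move=> a _; exact: rV_lspan.
have Uz : U (fun t => forall z, z \in zs -> `| `|comb z t| - nu z| <= d).
  elim: (zs) => [|z zs' IH]; first by apply: nearW.
  have h : U (fun t => `|nu z - `|comb z t| | < d) by move/cvgrPdist_lt : (nuP z) => /(_ d d0).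
  apply: filterS (filterI h IH) => t [h1 h2] w; rewrite inE => /predU1P[->|/h2//].
  by rewrite distrC ltW.
apply: filterS (filterI unit Uz) => t [t1 tz] a.
have -> : `|\sum_i a i *: (delta_mx 0 i : renorm N)| = nu (\row_i a i) by rewrite -sumE.
rewrite -combE.
move: (\row_i a i) => {}a.
have [->|a0] := eqVneq a 0.
  have -> : nu 0 = 0 by rewrite -(scale0r 0) nuZ normr0 mul0r.
  have -> : comb (0 : rV n.+1) t = 0 by rewrite -(scale0r 0) combZ scale0r.
  by rewrite normr0 !mulr0 lexx.
have na : 0 < `|a| by rewrite normr_gt0.
pose b := `|a|^-1 *: a.
have ab : a = `|a| *: b by rewrite /b scalerA divff ?scale1r// gt_eqF.
have b1 : `|b| = 1 by rewrite /b normrZ normfV normr_id mulVf// gt_eqF.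
have [z zz bz] : exists2 z, z \in zs & `|b - z| <= d by apply: zP => /=; rewrite b1.
have h0 := nu_low b; rewrite b1 in h0.
have h1 : `|comb (b - z) t| <= n.+1%:R * d.
  by apply: le_trans (comb_bound _ t1) _; rewrite ler_pM2l.
have h2 : nu (b - z) <= n.+1%:R * d by apply: le_trans (nu_up _) _; rewrite ler_pM2l.
have zE : z = b + -1 *: (b - z) by rewrite scaleN1r opprB subrKC.
have h3 : nu b <= nu z + n.+1%:R * d.
  by rewrite -{1}(subrK z b) addrC; apply: le_trans (nuD _ _) _; rewrite lerD2l.
have h4 : nu z <= nu b + n.+1%:R * d.
  by rewrite {1}zE; apply: le_trans (nuD _ _) _; rewrite lerD2l nuZ normrN1 mul1r.
have h5 : `|comb b t| <= `|comb z t| + n.+1%:R * d.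
  rewrite -{1}(subrK z b) combD addrC; apply: le_trans (ler_normD _ _) _; by rewrite lerD2l.
have h6 : `|comb z t| <= `|comb b t| + n.+1%:R * d.
  rewrite {1}zE combD (combZ (-1)); apply: le_trans (ler_normD _ _) _.
  by rewrite lerD2l scaleN1r normrN.
have [h7 h8] := distR_le (tz z zz).
have dE : d * (2 * n.+1%:R + 1) = eps / (1 + eps) / 4.
  by rewrite /d; field; apply/andP; split; apply/eqP; lra.
have e1 : 0 < 1 + eps by lra.
pose th := eps / (1 + eps).
have thE : th * (1 + eps) = eps by rewrite /th divfK// gt_eqF.
have th0 : 0 < th by rewrite divr_gt0.
have thl : th < eps by rewrite -thE; nra.
have k1 : (1 - th) * nu b <= `|comb b t| by rewrite -/th in dE; nra.
have k2 : `|comb b t| <= (1 + th) * nu b by rewrite -/th in dE; nra.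
have nb : 0 < nu b by lra.
rewrite ab combZ normrZ nuZ !normr_id; apply/andP; split.
  rewrite mulrCA ler_pM2l//; apply: le_trans k1; rewrite ler_pM2r//.
  rewrite -[leRHS](mulKf (lt0r_neq0 e1)) -[leLHS]mulr1 ler_pM2l ?invr_gt0//; lra.
rewrite mulrCA ler_pM2l//; apply: le_trans k2 _; rewrite ler_pM2r//; lra.
Qed.

Lemma sub_linear_of_asymptotic : ~ fin_dim [set: X] ->
  (exists q K : R, 1 < q /\
    forall (n : nat) (V : normedModType R) (e : 'I_n -> V), asymptotic_structure X e ->
      forall a : 'I_n -> R,
        `|\sum_i a i *: e i| <= K * (\sum_i `|a i| `^ q) `^ q^-1) ->
  sub_linear_game (@id_norm R X).
Proof.
move=> Xinf [q [K [q1 H]]].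
have q1' : (1 < q%:E)%E by rewrite lte_fin.
have [n [n1 hn]] := lp_norm_sublinear q1' (normr_ge0 K).
case: n n1 hn => [//|n] n1 hn.
exists n.+1 => //; rewrite ltNge; apply/negP => big.
pose c : R := n.+1%:R - 1 / 2.
have n2 : 1 < n.+1%:R :> R by rewrite ltr1n.
pose A (t : seq X) := size t = n.+1 /\ c < `|\sum_(x <- t) x|.
have hA : ~ forced n.+1 (fun t => ~ A t) [::].
  move=> h; apply: (@game_not_forced R X n.+1 c [::] Xinf).
    by rewrite big_nil; apply: lt_le_trans big; rewrite /c; lra.
  apply: forced_mono (forcedI h (@forced_play R X n.+1 (fun=> [::]) [::])).
  by move=> t [At [t' [tt' tn _]]] ct; apply: At; split => //; rewrite tt'.
have [N [asN hN]] := game_norm hA.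
have := H n.+1 (renorm N) _ asN (fun=> 1).
have -> : \sum_i (1 : R) *: (delta_mx 0 i : rV n.+1) = \row_(i < n.+1) (1 : R).
  by rewrite [RHS]row_sum_delta; apply: eq_bigr => i _; rewrite mxE.
have h1 : c <= N (\row_(i < n.+1) (1 : R)).
  apply: hN => t [tn ct]; apply: ltW; suff <- : \sum_(x <- t) x = comb (\row_(i < n.+1) (1 : R)) t by [].
  rewrite (big_nth 0) big_mkord tn; apply: eq_bigr => i _; by rewrite mxE scale1r.
rewrite [X in X <= _ -> _]/Num.Def.normr /=.
set w := _ `^ q^-1 => h2; have w0 : 0 <= w by exact: powR_ge0.
have h3 : K * w <= `|K| * w by rewrite ler_wpM2r// ler_norm.
move: hn h1 h2 h3; rewrite /= -/w /c; lra.
Qed.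

End asymptotic_to_game.

(** * A space with a boundedly complete FDD *)

Section power_sums.
Context {R : realType} (P : nat) (P0 : (0 < P)%N).

Lemma convex_expr (l x y : R) : 0 <= l <= 1 -> 0 <= x -> 0 <= y ->
  (l * x + (1 - l) * y) ^+ P <= l * x ^+ P + (1 - l) * y ^+ P.
Proof.
move=> /andP[l0 l1] x0 y0; elim: P => [|n IH]; first by rewrite !expr0; lra.
rewrite !exprS; set a := l * x + _ in IH *.
have a0 : 0 <= a by rewrite addr_ge0// mulr_ge0// subr_ge0.
apply: le_trans (ler_wpM2l a0 IH) _; rewrite /a.
have h : 0 <= (x - y) * (x ^+ n - y ^+ n).
  have [xy|yx] := leP x y.
    by rewrite mulr_le0// subr_le0// lerXn2r.
  by rewrite mulr_ge0// subr_ge0 ?lerXn2r ?nnegrE// ltW.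
have : 0 <= l * (1 - l) * ((x - y) * (x ^+ n - y ^+ n)) by apply: mulr_ge0 h; rewrite mulr_ge0// subr_ge0.
lra.
Qed.

(** Minkowski's inequality for the exponent [P], by convexity with weights [A / (A + B)] and
    [B / (A + B)]; upper bounds [A] and [B] stand for the norms. *)
Lemma power_sum_add (I : Type) (s : seq I) (u v : I -> R) (A B : R) : 0 < A -> 0 < B ->
  \sum_(i <- s) `|u i| ^+ P <= A ^+ P -> \sum_(i <- s) `|v i| ^+ P <= B ^+ P ->
  \sum_(i <- s) `|u i + v i| ^+ P <= (A + B) ^+ P.
Proof.
move=> A0 B0 uA vB; pose l := A / (A + B).
have AB : 0 < A + B by exact: addr_gt0.
have l01 : 0 <= l <= 1.
  by rewrite divr_ge0 ?(ltW A0) ?(ltW AB)//= ler_pdivrMr// mul1r lerDl ltW.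
have lE : 1 - l = B / (A + B) by rewrite /l; field; rewrite gt_eqF.
have h i : `|u i + v i| ^+ P <=
    (A + B) ^+ P * (l * (`|u i| ^+ P / A ^+ P) + (1 - l) * (`|v i| ^+ P / B ^+ P)).
  rewrite -!expr_div_n; apply: le_trans (_ : (A + B) ^+ P *
      (l * (`|u i| / A) + (1 - l) * (`|v i| / B)) ^+ P <= _); last first.
    by rewrite ler_wpM2l ?exprn_ge0 ?(ltW AB)// convex_expr// divr_ge0// ltW.
  rewrite -exprMn lerXn2r ?nnegrE//.
    by case/andP: l01 => l0 l1; rewrite mulr_ge0 ?(ltW AB)// addr_ge0// mulr_ge0 ?subr_ge0// divr_ge0// ltW.
  suff -> : (A + B) * (l * (`|u i| / A) + (1 - l) * (`|v i| / B)) = `|u i| + `|v i|.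
    exact: ler_normD.
  by rewrite lE /l; field; rewrite !gt_eqF.
apply: le_trans (ler_sum _ (fun i _ => h i)) _.
rewrite -mulr_sumr big_split /= -!mulr_sumr -!mulr_suml.
rewrite -[leRHS]mulr1 ler_wpM2l ?exprn_ge0 ?(ltW AB)//.
have AP : 0 < A ^+ P by exact: exprn_gt0.
have BP : 0 < B ^+ P by exact: exprn_gt0.
have h1 : (\sum_(i <- s) `|u i| ^+ P) / A ^+ P <= 1 by rewrite ler_pdivrMr// mul1r.
have h2 : (\sum_(i <- s) `|v i| ^+ P) / B ^+ P <= 1 by rewrite ler_pdivrMr// mul1r.
case/andP: l01 => l0 l1.
set a := _ / A ^+ P in h1 *; set b := _ / B ^+ P in h2 *; nra.
Qed.

Definition root (x : R) : R := x `^ P%:R^-1.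

Lemma root_ge0 x : 0 <= root x. Proof. exact: powR_ge0. Qed.

Lemma rootK x : 0 <= x -> root x ^+ P = x.
Proof.
move=> x0; rewrite -powR_mulrn ?root_ge0// /root -powRrM mulVf ?powRr1//.
by rewrite pnatr_eq0 -lt0n.
Qed.

Lemma root_le x A : 0 <= x -> 0 <= A -> (root x <= A) = (x <= A ^+ P).
Proof. by move=> x0 A0; rewrite -{2}(rootK x0) ler_pXn2r// nnegrE root_ge0. Qed.

Lemma expr_ler (x y : R) : 0 <= x -> 0 <= y -> (x ^+ P <= y ^+ P) = (x <= y).
Proof. by move=> x0 y0; rewrite ler_pXn2r. Qed.

End power_sums.

(* A vector is a sequence of linear forms [z i] on X factoring through the     *)
(* finite rank projections [fr (zQ i)]; its norm is the l_P-sum norm over      *)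
(* successive intervals of the norm dual to that of the paths.                 *)
Record zdata (R : realType) (X : normedModType R) := ZData {
  zN : equiv_norm X;
  zQ : nat -> seq (dual X * X);
  zQK : forall i x, fr (zQ i) (fr (zQ i) x) = fr (zQ i) x;
  zP : nat;
  zP0 : (0 < zP)%N }.

Section zspace.
Context {R : realType} {X : normedModType R} (D : zdata X).

(** The unit ball for the predual norm on an interval: what is bounded is every sum over a
    subinterval, so cutting a path keeps it admissible. *)
Definition test_path (f : nat -> X) : Prop := (forall i, fr (zQ D i) (f i) = f i) /\
  forall m n, zN D (\sum_(m <= i < n) f i) <= 1.

Definition atom := (nat * nat * (nat -> X))%type.

Definition at_ (z : nat -> X -> R^o) (a : atom) : R :=
  \sum_(a.1.1 <= i < a.1.2) (z i (a.2 i) : R).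

Fixpoint test m n (t : seq atom) : Prop :=
  if t is a :: t' then
    [/\ (m <= a.1.1)%N, (a.1.1 <= a.1.2)%N, test_path a.2 & test a.1.2 n t']
  else (m <= n)%N.

Definition psum (t : seq atom) (z : nat -> X -> R^o) : R :=
  \sum_(a <- t) `|at_ z a| ^+ zP D.

Definition zmem : {pred nat -> X -> R^o} := mem [set z : nat -> X -> R^o |
  [/\ forall i (a : R) x y, z i (a *: x + y) = a * z i x + z i y :> R,
      forall i x, z i (fr (zQ D i) x) = z i x &
      exists2 A : R, 0 < A & forall n t, test 0 n t -> psum t z <= A ^+ zP D]].

Lemma at_lin (c : R) (z w : nat -> X -> R^o) a : at_ (c *: z + w) a = c * at_ z a + at_ w a.
Proof. by rewrite /at_ mulr_sumr -big_split. Qed.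

Lemma psum_ge0 t z : 0 <= psum t z.
Proof. by apply: sumr_ge0 => a _; rewrite exprn_ge0. Qed.

Lemma psum_add t (z w : nat -> X -> R^o) (A B : R) : 0 < A -> 0 < B ->
  psum t z <= A ^+ zP D -> psum t w <= B ^+ zP D -> psum t (z + w) <= (A + B) ^+ zP D.
Proof.
move=> A0 B0 hz hw; have := power_sum_add A0 B0 hz hw; apply: le_trans.
by apply: ler_sum => a _; rewrite -[z in z + w]scale1r at_lin mul1r.
Qed.

Lemma psumZ t (c : R) (z : nat -> X -> R^o) : psum t (c *: z) = `|c| ^+ zP D * psum t z.
Proof.
rewrite /psum mulr_sumr; apply: eq_bigr => a _.
by rewrite -[c *: z]addr0 at_lin /at_ [X in _ + X]big1// addr0 normrM exprMn.
Qed.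

Lemma zmem_submod_closed : submod_closed zmem.
Proof.
have P0 := zP0 D.
split=> [|c z w]; rewrite !inE /=.
  split=> [i a x y|//|]; first by rewrite /= mulr0 addr0.
  exists 1 => // n t _; rewrite /psum big1 ?expr1n// => a _.
  by rewrite /at_ big1// normr0 expr0n gtn_eqF.
move=> [zl zq [A A0 hA]] [wl wq [B B0 hB]]; split=> [i a x y|i x|].
- rewrite -[LHS]/(c * z i (a *: x + y) + w i (a *: x + y)) zl wl.
  by rewrite -[RHS]/(a * (c * z i x + w i x) + (c * z i y + w i y)); ring.
- by rewrite -[LHS]/(c * z i (fr (zQ D i) x) + w i (fr (zQ D i) x)) zq wq.
have c1 : 0 < `|c| + 1 by rewrite ltr_wpDl.
exists ((`|c| + 1) * A + B); first by rewrite addr_gt0// mulr_gt0.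
move=> n t tt; apply: psum_add => //; [exact: mulr_gt0| |exact: hB tt].
rewrite psumZ exprMn; apply: ler_pM; [by rewrite exprn_ge0|exact: psum_ge0| |exact: hA tt].
by rewrite lerXn2r ?nnegrE ?(ltW c1)// lerDl.
Qed.

HB.instance Definition _ :=
  GRing.isSubmodClosed.Build R (nat -> X -> R^o) zmem zmem_submod_closed.

Record zsp := Zsp { zval :> nat -> X -> R^o ; _ : zval \in zmem }.

HB.instance Definition _ := [isSub for zval].
HB.instance Definition _ := [Choice of zsp by <:].
HB.instance Definition _ := [SubChoice_isSubLmodule of zsp by <:].

Implicit Types z w : zsp.

Lemma zlin z i (a : R) x y : z i (a *: x + y) = a * z i x + z i y :> R.
Proof. by case: z => z /= ; rewrite inE => -[]. Qed.

Lemma zproj z i x : z i (fr (zQ D i) x) = z i x.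
Proof. by case: z => z /= ; rewrite inE => -[]. Qed.

Lemma zbound z : exists2 A : R, 0 < A & forall n t, test 0 n t -> psum t z <= A ^+ zP D.
Proof. by case: z => z /= ; rewrite inE => -[]. Qed.

Lemma zval_add z w : zval (z + w) = zval z + zval w. Proof. by []. Qed.
Lemma zval_scale (a : R) z : zval (a *: z) = a *: zval z. Proof. by []. Qed.
Lemma zvalD z w i x : (z + w) i x = z i x + w i x :> R. Proof. by []. Qed.
Lemma zvalB z w i x : (z - w) i x = z i x - w i x :> R. Proof. by []. Qed.
Lemma zvalZ (a : R) z i x : (a *: z) i x = a * z i x :> R. Proof. by []. Qed.
Lemma z_0 z i : z i 0 = 0 :> R.
Proof. by have := zlin z i 1 0 0; rewrite scale1r addr0 mul1r => /eqP; rewrite -subr_eq subrr => /eqP <-. Qed.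

Lemma z_Z z i (a : R) x : z i (a *: x) = a * z i x :> R.
Proof. by rewrite -[a *: x]addr0 zlin z_0 addr0. Qed.

Definition znorm_def z : R :=
  sup [set root (zP D) (psum t z) | t in [set t | exists n, test 0 n t]].

(* locked, as [lra] would otherwise unfold the supremum *)
Fact znorm_key : unit. Proof. exact: tt. Qed.
Definition znorm := locked_with znorm_key znorm_def.

Lemma znormE z : znorm z =
  sup [set root (zP D) (psum t z) | t in [set t | exists n, test 0 n t]].
Proof. by rewrite [znorm]unlock. Qed.

Lemma znorm_has_sup z :
  has_sup [set root (zP D) (psum t z) | t in [set t | exists n, test 0 n t]].
Proof.
split; first by exists (root (zP D) (psum [::] z)), [::] => //; exists 0%N.
have [A A0 hA] := zbound z; exists A => _ [t [n tt] <-].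
by rewrite root_le ?zP0 ?psum_ge0 ?(ltW A0)// (hA n).
Qed.

Lemma znorm_ge0 z : 0 <= znorm z.
Proof.
rewrite znormE; apply: le_trans (root_ge0 (zP D) (psum [::] z)) _; apply: sup_upper_bound.
  exact: znorm_has_sup.
by exists [::] => //; exists 0%N.
Qed.

Lemma psum_le z n t : test 0 n t -> psum t z <= znorm z ^+ zP D.
Proof.
move=> tt; rewrite -root_le ?zP0 ?psum_ge0 ?znorm_ge0// znormE; apply: sup_upper_bound.
  exact: znorm_has_sup.
by exists t => //; exists n.
Qed.

Lemma znorm_le z (A : R) : 0 <= A -> (forall n t, test 0 n t -> psum t z <= A ^+ zP D) ->
  znorm z <= A.
Proof.
move=> A0 hA; rewrite znormE; apply: ge_sup; first by case: (znorm_has_sup z).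
by move=> _ [t [n tt] <-]; rewrite root_le ?zP0 ?psum_ge0// (hA n).
Qed.

Lemma znormD z w : znorm (z + w) <= znorm z + znorm w.
Proof.
apply/ler_addgt0Pr => e e0; have e2 : 0 < e / 2 by rewrite divr_gt0.
have z0 := znorm_ge0 z; have w0 := znorm_ge0 w.
have -> : znorm z + znorm w + e = (znorm z + e / 2) + (znorm w + e / 2).
  by rewrite addrACA -splitr.
have za : 0 < znorm z + e / 2 by rewrite ltr_wpDl.
have wa : 0 < znorm w + e / 2 by rewrite ltr_wpDl.
apply: znorm_le => [|n t tt]; first by rewrite addr_ge0// ltW.
rewrite zval_add; apply: psum_add => //; apply: le_trans (psum_le _ tt) _.
  by rewrite lerXn2r ?nnegrE ?(ltW za)// lerDl ltW.
by rewrite lerXn2r ?nnegrE ?(ltW wa)// lerDl ltW.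
Qed.

Lemma znormZ (c : R) z : znorm (c *: z) = `|c| * znorm z.
Proof.
have le b w : znorm (b *: w) <= `|b| * znorm w.
  apply: znorm_le => [|n t tt]; first by rewrite mulr_ge0// znorm_ge0.
  by rewrite zval_scale psumZ exprMn ler_wpM2l ?exprn_ge0// (psum_le _ tt).
apply/eqP; rewrite eq_le le /=.
have [->|c0] := eqVneq c 0; first by rewrite normr0 mul0r znorm_ge0.
have := le c^-1 (c *: z); rewrite scalerA mulVf// scale1r normfV.
by rewrite ler_pdivlMl ?normr_gt0.
Qed.

Lemma test_widen m m' n n' t : (m' <= m)%N -> (n <= n')%N -> test m n t -> test m' n' t.
Proof.
elim: t m m' => [|a t IH] m m' mm nn /=; first by move=> mn; apply: leq_trans mm (leq_trans mn nn).
by move=> [ma aa pa tt]; split => //; [exact: leq_trans ma|exact: IH tt].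
Qed.

Lemma path_delta i x : zN D x <= 1 -> fr (zQ D i) x = x ->
  test_path (fun j => if j == i then x else 0).
Proof.
move=> x1 xi; split=> [j|m n]; first by case: eqP => [->//|_]; rewrite fr0.
have [/andP[mi i_n]|no] := boolP (m <= i < n)%N.
  rewrite (bigD1_seq i) ?mem_index_iota ?mi ?iota_uniq//= eqxx big1 ?addr0// => j /negPf ->//.
rewrite big1_seq ?eqnorm0// => j /andP[_]; rewrite mem_index_iota => jmn.
by case: eqP => // ji; move: jmn; rewrite ji (negPf no).
Qed.

Lemma zval_le z i x : `|z i x| <= zN D (fr (zQ D i) x) * znorm z.
Proof.
rewrite -zproj; set v := fr _ x.
have [->|v0] := eqVneq v 0; first by rewrite z_0 normr0 eqnorm0 mul0r.
have Nv := eqnorm_gt0 (zN D) v0.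
pose u := (zN D v)^-1 *: v.
have u1 : zN D u <= 1 by rewrite eqnormZp ?invr_ge0 ?(ltW Nv)// mulVf// gt_eqF.
have uq : fr (zQ D i) u = u by rewrite frZ zQK.
have ut : test 0 i.+1 [:: (i, i.+1, fun j => if j == i then u else 0)].
  by split => //=; exact: path_delta.
have := psum_le z ut; rewrite /psum big_seq1 /at_ /= big_nat1 eqxx.
rewrite expr_ler ?zP0 ?znorm_ge0// z_Z normrM ger0_norm ?invr_ge0 ?(ltW Nv)//.
by rewrite ler_pdivrMl.
Qed.

Lemma znorm0_eq0 z : znorm z = 0 -> z = 0.
Proof.
move=> z0; apply/val_inj/funext => i; apply/funext => x /=; apply/eqP.
by rewrite -normr_le0; have := zval_le z i x; rewrite z0 mulr0.
Qed.

HB.instance Definition _ :=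
  @Lmodule_isNormed.Build R zsp znorm znormD znormZ znorm0_eq0.

Lemma zval_le_norm z i x : `|z i x| <= zN D (fr (zQ D i) x) * `|z|.
Proof. exact: zval_le. Qed.

(** Coordinates are continuous, so the limit is taken coordinatewise; each test involves finitely
    many coordinates, so its bound survives the limit. *)
Lemma zsp_complete (F : set_system zsp) : ProperFilter F -> cauchy F -> cvg F.
Proof.
move=> FF /cauchyP Fc.
have Fe e : 0 < e -> exists w, F [set z | `|w - z| < e].
  move=> e0; have [w hw] := Fc e e0; exists w.
  by move: hw; rewrite -ball_normE.
have lim (q : nat * X) : exists l : R, (fun z : zsp => z q.1 q.2 : R) @ F --> l.
  apply/cvg_ex; apply: cauchy_cvg; apply/cauchyP => e e0.
  pose d := e / (zN D (fr (zQ D q.1) q.2) + 1).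
  have n0 : 0 < zN D (fr (zQ D q.1) q.2) + 1 by rewrite ltr_wpDl ?eqnorm_ge0.
  have d0 : 0 < d by rewrite divr_gt0.
  have [w hw] := Fe d d0; exists (w q.1 q.2); rewrite /fmap /=.
  apply: filterS hw => z /= wz; rewrite -ball_normE /= -zvalB.
  apply: le_lt_trans (zval_le_norm _ _ _) _.
  have dE : d * (zN D (fr (zQ D q.1) q.2) + 1) = e by rewrite /d divfK// gt_eqF.
  have := eqnorm_ge0 (zN D) (fr (zQ D q.1) q.2); have := normr_ge0 (w - z).
  rewrite -dE; nra.
have [l' lP'] := choice lim.
pose l : nat -> X -> R^o := fun i x => l' (i, x).
have lP i x : (fun z : zsp => z i x : R) @ F --> (l i x : R) by exact: (lP' (i, x)).
have atP a : (fun z : zsp => at_ z a) @ F --> at_ l a.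
  by rewrite /at_; apply: cvg_big => [|i _]; [exact: add_continuous|exact: lP].
have psP w t (A : R) : F [set z | psum t (z - w) <= A] -> psum t (l - zval w) <= A.
  move=> h; apply: (cvgr_to_le (F := F) (f := fun z : zsp => psum t (z - w))) => //.
  apply: cvg_big => [|a _]; [exact: add_continuous|idtac].
  apply: (@cvg_comp _ _ _ (fun z : zsp => `|at_ (z - w) a|) (fun x => x ^+ zP D) _ _ _ _
    (@exprn_continuous R (zP D) _)).
  apply: cvg_norm.
  have -> : (fun z : zsp => at_ (z - w) a) = (fun z : zsp => at_ z a - at_ w a).
    by apply/funext => z; rewrite /at_ -sumrB.
  have -> : at_ (l - zval w) a = at_ l a - at_ w a by rewrite /at_ -sumrB.
  by apply: cvgB => //; exact: cvg_cst.
have near_l e w : 0 < e -> F [set z | `|w - z| < e] ->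
    forall n t, test 0 n t -> psum t (l - zval w) <= e ^+ zP D.
  move=> e0 hw n t tt; apply: psP; apply: filterS hw => z /= wz.
  have wz' : znorm (z - w) <= e by rewrite ltW// -[znorm _]/(`|z - w|) distrC.
  by apply: le_trans (psum_le (z - w) tt) _; rewrite lerXn2r ?nnegrE ?znorm_ge0 ?(ltW e0).
have lmem : l \in zmem.
  rewrite inE; split=> [i a x y|i x|].
  - apply: (cvg_unique _ (lP i (a *: x + y))) => //.
    have -> : (fun z : zsp => z i (a *: x + y) : R) = (fun z : zsp => a * z i x + z i y).
      by apply/funext => z; rewrite zlin.
    by apply: cvgD; [apply: cvgMr|]; exact: lP.
  - apply: (cvg_unique _ (lP i (fr (zQ D i) x))) => //.
    have -> : (fun z : zsp => z i (fr (zQ D i) x) : R) = (fun z : zsp => z i x).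
      by apply/funext => z; rewrite zproj.
    exact: lP.
  have [w hw] := Fe 1 ltr01; have [A A0 hA] := zbound w.
  exists (1 + A) => [|n t tt]; first exact: addr_gt0.
  have -> : l = (l - zval w) + zval w by rewrite subrK.
  by apply: psum_add => //; [exact: (near_l _ _ ltr01 hw n)|exact: hA tt].
apply/cvg_ex; exists (Zsp lmem); apply/cvgrPdist_lt => e e0.
have e2 : 0 < e / 2 by rewrite divr_gt0.
have [w hw] := Fe (e / 2) e2; apply: filterS (hw) => z /= wz.
have lw : `|Zsp lmem - w| <= e / 2.
  by apply: znorm_le => [|n t tt]; [exact: ltW|exact: (near_l _ _ e2 hw n)].
have := ler_normD (Zsp lmem - w) (w - z); rewrite addrA subrK; lra.
Qed.

HB.instance Definition _ := Uniform_isComplete.Build zsp zsp_complete.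

End zspace.

Section zspace_fdd.
Context {R : realType} {X : normedModType R} (D : zdata X).
Implicit Types z w : zsp D.

(** Restricting a vector to [[m, n)] has the same effect on a test as clamping the endpoints of its
    intervals; this reduces cut vectors to uncut ones. *)
Definition clampn m n x := minn (maxn x m) n.

Lemma clamp_sum (V : zmodType) (g : nat -> V) m n l r : (m <= n)%N -> (l <= r)%N ->
  \sum_(l <= i < r) (if (m <= i < n)%N then g i else 0) =
  \sum_(clampn m n l <= i < clampn m n r) g i.
Proof.
move=> mn lr; rewrite -big_mkcond /= -big_filter.
suff -> : [seq i <- index_iota l r | (m <= i < n)%N] =
  index_iota (clampn m n l) (clampn m n r) by [].
apply: (irr_sorted_eq ltn_trans ltnn).
- exact/(sorted_filter ltn_trans)/iota_ltn_sorted.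
- exact: iota_ltn_sorted.
by move=> i; rewrite mem_filter !mem_index_iota /clampn; lia.
Qed.

Definition clampa m n (a : @atom R X) : atom := ((clampn m n a.1.1, clampn m n a.1.2), a.2).

Lemma test_le m n t : test D m n t -> (m <= n)%N.
Proof.
by elim: t m => [//|a t IH] m /= [ma aa _ /IH]; exact/leq_trans/(leq_trans ma).
Qed.

Lemma test_cat m k n t t' : test D m k t -> test D k n t' -> test D m n (t ++ t').
Proof.
elim: t m => [|a t IH] m /=; first by move=> mk; exact: test_widen.
by move=> [ma aa pa tt] tt'; split => //; exact: IH.
Qed.

Lemma test_clamp m n j k t : (m <= n)%N -> test D j k t ->
  test D (clampn m n j) (clampn m n k) (map (clampa m n) t).
Proof.
move=> mn; have mono a b : (a <= b)%N -> (clampn m n a <= clampn m n b)%N.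
  by rewrite /clampn; lia.
elim: t j => [|a t IH] j /=; first exact: mono.
by move=> [ja aa pa tt]; split => //; [exact: mono|exact: mono|exact: IH].
Qed.

Definition zcut m n (z : nat -> X -> R^o) : nat -> X -> R^o :=
  fun i x => if (m <= i < n)%N then z i x else 0.

Lemma psum_clamp m n (z : nat -> X -> R^o) j k t : (m <= n)%N -> test D j k t ->
  psum D t (zcut m n z) = psum D (map (clampa m n) t) z.
Proof.
move=> mn; elim: t j => [|a t IH] j /=; first by rewrite /psum !big_nil.
move=> [_ aa _ tt]; rewrite /psum !big_cons -!/(psum _ _ _) (IH _ tt); congr (`|_| ^+ _ + _).
exact: (@clamp_sum _ (fun i => z i (a.2 i))).
Qed.

Lemma zcut_mem m n z : zcut m n z \in zmem D.
Proof.
wlog mn : n / (m <= n)%N => [hw|].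
  have -> : zcut m n z = zcut m (maxn m n) z.
    by apply/funext => i; apply/funext => x; rewrite /zcut; congr (if _ then _ else _); lia.
  by apply: hw; rewrite leq_maxl.
rewrite inE; split=> [i a x y|i x|].
- by rewrite /zcut; case: ifP => _; [exact: zlin|rewrite mulr0 addr0].
- by rewrite /zcut; case: ifP => _ //; exact: zproj.
have [A A0 hA] := zbound z; exists A => // k t tt; rewrite (psum_clamp _ mn tt).
by apply: (hA n); apply: test_widen (test_clamp mn tt) => //; exact: geq_minr.
Qed.

Definition pr m n z : zsp D := Zsp (zcut_mem m n z).

Lemma prE m n z i x : pr m n z i x = if (m <= i < n)%N then z i x else 0.
Proof. by []. Qed.

Lemma zext z w : (forall i x, z i x = w i x) -> z = w.
Proof. by move=> zw; apply/val_inj/funext => i; apply/funext => x; exact: zw. Qed.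

Lemma zval_sum (I : Type) (s : seq I) (F : I -> zsp D) i x :
  (\sum_(j <- s) F j) i x = \sum_(j <- s) (F j i x : R) :> R.
Proof. by elim/big_rec2 : _ => // j a b _ <-; rewrite zvalD. Qed.

Lemma psum_ext m n t (z w : nat -> X -> R^o) : test D m n t ->
  (forall i x, (m <= i < n)%N -> z i x = w i x) -> psum D t z = psum D t w.
Proof.
elim: t m => [|a t IH] m /=; first by rewrite /psum !big_nil.
move=> [ma aa _ tt] zw; have an := test_le tt.
rewrite /psum !big_cons -!/(psum _ _ _); congr (`|_| ^+ _ + _).
  by apply: eq_big_nat => i ia; apply: zw; lia.
by apply: IH tt _ => i x ia; apply: zw; lia.
Qed.

Lemma psum_le_norm n t z : test D 0 n t -> psum D t z <= `|z| ^+ zP D.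
Proof. exact: psum_le. Qed.

Lemma norm_pow_le z (C : R) : 0 <= C -> (forall n t, test D 0 n t -> psum D t z <= C) ->
  `|z| ^+ zP D <= C.
Proof.
move=> C0 h; rewrite -(rootK (zP0 D) C0) (expr_ler (zP0 D)) ?root_ge0//.
apply: znorm_le => [|n t tt]; first exact: root_ge0.
by rewrite rootK ?(zP0 D)//; exact: h tt.
Qed.

Lemma pr_pow_le m n z (C : R) : (m <= n)%N -> 0 <= C ->
  (forall t, test D m n t -> psum D t z <= C) -> `|pr m n z| ^+ zP D <= C.
Proof.
move=> mn C0 h; apply: norm_pow_le => // k t tt; rewrite (psum_clamp _ mn tt).
apply: h; apply: test_widen (test_clamp mn tt); last exact: geq_minr.
by rewrite /clampn; lia.
Qed.

Lemma psum_le_pr m n t z : test D m n t -> psum D t z <= `|pr m n z| ^+ zP D.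
Proof.
move=> tt; rewrite (@psum_ext m n t z (pr m n z)) => [|//|i x imn]; last by rewrite prE imn.
by apply: (@psum_le_norm n); exact: test_widen tt.
Qed.

(** Tests on adjacent intervals concatenate. Convergence of expansions and the equality of the norm
    with its Z_P norm both rest on this. *)
Lemma pr_superadd m k n z : (m <= k <= n)%N ->
  `|pr m k z| ^+ zP D + `|pr k n z| ^+ zP D <= `|pr m n z| ^+ zP D.
Proof.
move=> /andP[mk kn]; rewrite -lerBrDr.
have h t' : test D k n t' -> `|pr m k z| ^+ zP D <= `|pr m n z| ^+ zP D - psum D t' z.
  move=> tt'; apply: pr_pow_le => // [|t tt].
    by rewrite subr_ge0; apply: psum_le_pr; exact: test_widen tt'.
  by rewrite lerBrDr /psum -big_cat; apply: psum_le_pr; exact: test_cat tt tt'.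
rewrite lerBrDl -lerBrDr; apply: le_trans (_ : _ <= `|pr m n z| ^+ zP D - `|pr m k z| ^+ zP D) _.
  apply: pr_pow_le => // [|t tt]; last by rewrite lerBrDl -lerBrDr h.
  have /h : test D k n [::] by [].
  by rewrite /psum big_nil subr0 subr_ge0.
by [].
Qed.

Lemma pr_le m n m' n' z : (m' <= m)%N -> (m <= n)%N -> (n <= n')%N ->
  `|pr m n z| ^+ zP D <= `|pr m' n' z| ^+ zP D.
Proof.
move=> mm mn nn; apply: pr_pow_le => // t tt.
by apply: psum_le_pr; exact: test_widen tt.
Qed.

Lemma pr_le_norm m n z : `|pr m n z| ^+ zP D <= `|z| ^+ zP D.
Proof.
have [mn|nm] := leqP m n.
  apply: pr_pow_le => // t tt.
  by apply: (@psum_le_norm n); exact: test_widen tt.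
suff -> : pr m n z = 0 by rewrite normr0 lerXn2r ?nnegrE.
by apply: zext => i x; rewrite prE; case: ifP => //; lia.
Qed.

Lemma tail_pow_le m z (C : R) : (forall n, (m <= n)%N -> `|pr m n z| ^+ zP D <= C) ->
  `|z - pr 0 m z| ^+ zP D <= C.
Proof.
move=> h; have C0 : 0 <= C by apply: le_trans (h m (leqnn m)); rewrite exprn_ge0.
apply: norm_pow_le => // n t tt.
rewrite (@psum_ext 0 n t _ (pr m (maxn m n) z)) => [|//|i x /andP[_ i_n]]; last first.
  rewrite zvalB !prE /=; case: (ltnP i m) => im.
    by rewrite subrr.
  by rewrite subr0 /= leq_max i_n orbT.
by apply: le_trans (psum_le_norm _ tt) (h _ _); rewrite leq_maxl.
Qed.

(** The powers [|pr 0 n z| ^+ zP D] increase and are bounded; by superadditivity their increments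
    dominate the norms of the pieces. *)
Lemma pr_cvg_dist z (e : R) : 0 < e -> exists M, forall n, (M <= n)%N -> `|z - pr 0 n z| < e.
Proof.
move=> e0; pose a n := `|pr 0 n z| ^+ zP D; have P0 := zP0 D.
have aS : has_sup (range a).
  by split; [exists (a 0%N), 0%N|exists (`|z| ^+ zP D) => _ [n _ <-]; exact: pr_le_norm].
have e2 : 0 < e / 2 by rewrite divr_gt0.
have eP : 0 < (e / 2) ^+ zP D by exact: exprn_gt0.
have [_ [M _ <-] hM] := sup_adherent eP aS.
exists M => m Mm; apply: (@le_lt_trans _ _ (e / 2)); last lra.
rewrite -(expr_ler P0)// ?(ltW e2)//; apply: tail_pow_le => n mn.
have h1 : a n <= sup (range a) by apply: sup_upper_bound => //; exists n.
have h2 : a M <= a m by apply: pr_le.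
have h3 : a m + `|pr m n z| ^+ zP D <= a n by exact: pr_superadd.
lra.
Qed.

Lemma pr_cvg z : (fun n => pr 0 n z) @ \oo --> z.
Proof.
apply/cvgrPdist_lt => e e0; have [M hM] := pr_cvg_dist z e0.
by exists M => // n /= Mn; exact: hM.
Qed.

Definition zE (i : nat) : set (zsp D) := [set z | forall j x, j != i -> z j x = 0].

Lemma zE_pr i z : zE i (pr i i.+1 z).
Proof. by move=> j x ji; rewrite prE; case: ifP => //; lia. Qed.

Lemma pr_sum m n z : \sum_(m <= i < n) pr i i.+1 z = pr m n z.
Proof.
apply: zext => j x; rewrite zval_sum prE.
case: ifPn => [jmn|jmn].
  rewrite (bigD1_seq j) ?mem_index_iota ?iota_uniq// prE ltnS !leqnn big1 => [|i ij]; first exact: addr0.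
  by rewrite prE; case: ifP => //; lia.
rewrite big1_seq// => i /andP[_]; rewrite mem_index_iota => imn.
by rewrite prE; case: ifP => //; lia.
Qed.

Lemma series_coord (u : nat -> zsp D) n j x : (forall i, zE i (u i)) ->
  (series u n) j x = if (j < n)%N then u j j x else 0.
Proof.
move=> uE; rewrite /series zval_sum; case: ltnP => jn.
  rewrite (bigD1_seq j) ?mem_index_iota ?iota_uniq//= big1 ?addr0// => i ij.
  by apply: uE; rewrite eq_sym.
rewrite big1_seq// => i /andP[_]; rewrite mem_index_iota => i_n.
by apply: uE; lia.
Qed.

Lemma fdd_expansion_unique z (u : nat -> zsp D) : fdd_expansion zE z u ->
  u = fun i => pr i i.+1 z.
Proof.
move=> [uE uz]; apply/funext => i; apply: zext => j x.
have [->|ji] := eqVneq j i; last by rewrite uE// (zE_pr _ _ ji).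
rewrite prE ltnS !leqnn /=; apply/eqP; rewrite -subr_eq0 -normr_le0.
apply/ler_addgt0Pr => e e0; rewrite add0r.
pose k := zN D (fr (zQ D i) x) + 1.
have k0 : 0 < k by rewrite ltr_wpDl ?eqnorm_ge0.
have ek : 0 < e / k by rewrite divr_gt0.
have /cvgrPdist_lt/(_ _ ek)[M _ hM] := uz.
have := hM (maxn M i.+1) (leq_maxl _ _); rewrite distrC => h.
have -> : (u i i x : R) - z i x = (series u (maxn M i.+1) - z) i x.
  by rewrite zvalB series_coord// leq_max ltnSn orbT.
apply: le_trans (zval_le_norm _ _ _) _.
have : k * `|series u (maxn M i.+1) - z| <= e by rewrite mulrC -ler_pdivlMr// ltW.
by apply: le_trans; rewrite ler_wpM2r// lerDl.
Qed.

Lemma fdd_expansion_pr z : fdd_expansion zE z (fun i => pr i i.+1 z).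
Proof.
split; first by move=> i; exact: zE_pr.
have -> : series (fun i => pr i i.+1 z) = fun n => pr 0 n z.
  by apply/funext => n; exact: pr_sum.
exact: pr_cvg.
Qed.

Lemma path_entry f i : test_path D f -> zN D (f i) <= 1.
Proof. by move=> [_ /(_ i i.+1)]; rewrite big_nat1. Qed.

Definition zdelta_fun i (g : dual X) : nat -> X -> R^o :=
  fun j x => if j == i then g (fr (zQ D i) x) else 0.

Lemma zdelta_mem i g : zdelta_fun i g \in zmem D.
Proof.
have [c [C [c0 _ cC]]] := eqnorm_equiv (zN D).
rewrite inE; split=> [j a x y|j x|].
- rewrite /zdelta_fun; case: eqP => _; last by rewrite mulr0 addr0.
  by rewrite frD frZ duD duZ.
- by rewrite /zdelta_fun; case: eqP => [->|//]; rewrite zQK.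
have B0 : 0 < `|g| * c^-1 + 1 by rewrite ltr_wpDl// mulr_ge0// invr_ge0 ltW.
exists (`|g| * c^-1 + 1) => // n t.
have gen m : test D m n t -> psum D t (zdelta_fun i g) <= (`|g| * c^-1 + 1) ^+ zP D.
  elim: t m => [|a t IH] m /=; first by rewrite /psum big_nil exprn_ge0 ?(ltW B0).
  move=> [ma aa pa tt]; rewrite /psum big_cons -/(psum _ _ _).
  have z0 m' n' : (~~ (m' <= i < n'))%N -> forall j x, (m' <= j < n')%N ->
      zdelta_fun i g j x = (0 : nat -> X -> R^o) j x.
    by move=> no j x jmn; rewrite /zdelta_fun; case: eqP => // ji; rewrite ji (negPf no) in jmn.
  have P0 := zP0 D.
  have [ia|ai] := ltnP i a.1.2; last first.
    have -> : at_ (zdelta_fun i g) a = 0.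
      rewrite /at_ big_nat big1// => j ja; rewrite (z0 a.1.1 a.1.2)//; lia.
    by rewrite normr0 expr0n gtn_eqF//= add0r; exact: IH tt.
  have -> : psum D t (zdelta_fun i g) = 0.
    rewrite (psum_ext tt (z0 a.1.2 n _)); last lia.
    rewrite /psum big1// => b _; rewrite /at_ big1// normr0 expr0n gtn_eqF//.
  rewrite addr0 lerXn2r ?nnegrE ?(ltW B0)//.
  have [ai|ai] := leqP a.1.1 i; last first.
    rewrite /at_ big_nat big1 ?normr0 ?(ltW B0)// => j ja.
    by rewrite (z0 a.1.1 a.1.2)//; lia.
  rewrite /at_ (bigD1_seq i) ?mem_index_iota ?iota_uniq ?ai//= big1 => [|j ji]; last first.
    by rewrite /zdelta_fun (negPf ji).
  rewrite addr0 /zdelta_fun eqxx (proj1 pa i); apply: le_trans (dualP _ _) _.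
  have h : `|a.2 i| <= c^-1.
    have /andP[h _] := cC (a.2 i); rewrite -[c^-1]mulr1 ler_pdivlMl//.
    exact: le_trans h (path_entry i pa).
  by apply: (le_trans (ler_wpM2l (normr_ge0 _) h)); rewrite lerDl.
exact: gen.
Qed.

Definition zdelta i g : zsp D := Zsp (zdelta_mem i g).

Lemma zE_zdelta i g : zE i (zdelta i g).
Proof. by move=> j x ji; rewrite /= /zdelta_fun (negPf ji). Qed.

Lemma z_fr z i (l : seq (dual X * X)) x :
  z i (fr l x) = \sum_(p <- l) p.1 x * z i p.2 :> R.
Proof.
elim: l => [|p l IH]; first by rewrite /fr !big_nil z_0.
by rewrite fr_cons zlin IH big_cons.
Qed.

Lemma zE_expand z i : zE i z -> z = \sum_(p <- zQ D i) z i p.2 *: zdelta i p.1.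
Proof.
move=> zi; apply: zext => j x; rewrite zval_sum.
have [->|ji] := eqVneq j i; last first.
  rewrite (zi j x ji) big1// => p _; rewrite zvalZ (zE_zdelta _ _ ji) mulr0 //.
rewrite -zproj -(zproj z) z_fr; apply: eq_bigr => p _.
by rewrite zvalZ /= /zdelta_fun eqxx mulrC.
Qed.

Lemma zE_FDD : is_FDD zE.
Proof.
split=> [i|z]; last first.
  exists (fun i => pr i i.+1 z); split; first exact: fdd_expansion_pr.
  by move=> u /fdd_expansion_unique.
split; first split=> [//|a z w zi wi j x ji].
  by rewrite zvalD zvalZ (zi j x ji) (wi j x ji) mulr0 addr0.
exists (size (zQ D i)), (fun k => zdelta i (tnth (in_tuple (zQ D i)) k).1) => z zi.
exists (fun k => z i (tnth (in_tuple (zQ D i)) k).2).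
by rewrite [LHS](zE_expand zi) big_tnth.
Qed.

(** The diagonal sequence of coordinates is itself a vector, since any test sees only a partial sum;
    the partial sums are its projections. *)
Lemma zE_boundedly_complete : boundedly_complete zE.
Proof.
move=> u uE [M hM]; pose w : nat -> X -> R^o := fun j x => u j j x.
have wm : w \in zmem D.
  rewrite inE; split=> [i a x y|i x|]; [exact: zlin|exact: zproj|].
  exists (`|M| + 1) => [|n t tt]; first by rewrite ltr_wpDl.
  rewrite (@psum_ext 0 n t w (series u n)) => [|//|i x /andP[_ i_n]]; last first.
    by rewrite series_coord// i_n.
  apply: le_trans (psum_le_norm _ tt) _; rewrite lerXn2r ?nnegrE ?addr_ge0//.
  by apply: le_trans (hM n) _; apply: le_trans (ler_norm M) _; rewrite lerDl.
have -> : series u = fun n => pr 0 n (Zsp wm).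
  by apply/funext => n; apply: zext => j x; rewrite series_coord.
by apply: cvgP; exact: pr_cvg.
Qed.

Lemma zE_proj m n z : fdd_proj zE m n z = pr m n z.
Proof.
have -> : fdd_proj zE m n z = \sum_(m <= i < n) pr i i.+1 z; last exact: pr_sum.
rewrite /fdd_proj /fdd_coord.
have := getPex (ex_intro [set u | fdd_expansion zE z u] _ (fdd_expansion_pr z)).
by move=> /= /fdd_expansion_unique ->.
Qed.

Lemma zE_c00 z : fdd_c00 zE z -> exists n, forall m, (n <= m)%N -> pr 0 m z = z.
Proof.
move=> [u [n [uE ->]]]; exists n => m nm; apply: zext => j x; rewrite prE /=.
case: ltnP => // mj; rewrite zval_sum big1// => i _; apply: uE.
by have := ltn_ord i; lia.
Qed.

Lemma pr_c00 n z : fdd_c00 zE (pr 0 n z).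
Proof.
exists (fun i => pr i i.+1 z), n; split; first by move=> i; exact: zE_pr.
by rewrite -pr_sum big_mkord.
Qed.

Lemma lp_norm_root k (a : nat -> R) :
  lp_norm (zP D)%:R%:E k a = root (zP D) (\sum_(j < k) `|a j| ^+ zP D).
Proof. by rewrite /lp_norm /root; congr (_ `^ _); apply: eq_bigr => j _; rewrite powR_mulrn. Qed.

Lemma interval_sum_le (l r : nat -> nat) k z : intervals l r k ->
  \sum_(j < k) `|pr (l j) (r j) z| ^+ zP D <= `|z| ^+ zP D.
Proof.
move=> lr; case: k lr => [|k] lr; first by rewrite big_ord0 exprn_ge0.
suff h j : (j <= k)%N -> \sum_(i < j.+1) `|pr (l i) (r i) z| ^+ zP D <= `|pr 0 (r j) z| ^+ zP D.
  by apply: le_trans (h k (leqnn k)) (pr_le_norm _ _ _).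
elim: j => [|j IH] jk.
  by rewrite big_ord1; have [l0 _] := lr 0%N isT; apply: pr_le => //; exact: ltnW.
rewrite big_ord_recr /=; have [_ /(_ jk) rl] := lr j (ltnW jk).
have [lrj _] := lr j.+1 jk.
apply: le_trans (_ : `|pr 0 (l j.+1) z| ^+ zP D + `|pr (l j.+1) (r j.+1) z| ^+ zP D <= _).
  rewrite lerD2r; apply: le_trans (IH (ltnW jk)) _.
  by apply: pr_le => //; exact: leq0n.
by apply: pr_superadd; rewrite leq0n ltnW.
Qed.

(** One long interval recovers the norm, and superadditivity prevents several intervals from
    exceeding it. Hence the space is its own Z_P, with [J] the identity. *)
Lemma zE_Zp_norm z : fdd_c00 zE z -> Zp_norm zE (zP D)%:R%:E z = `|z|.
Proof.
move=> /zE_c00[n hn]; apply/eqP; rewrite eq_le; apply/andP.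
have ub s : (exists l r k, intervals l r k /\
    s = lp_norm (zP D)%:R%:E k (fun j => `|fdd_proj zE (l j) (r j) z|)) -> s <= `|z|.
  move=> [l [r [k [lr ->]]]]; rewrite lp_norm_root root_le ?zP0//; last first.
    by apply: sumr_ge0 => j _; rewrite exprn_ge0.
  apply: le_trans (interval_sum_le z lr).
  by apply: ler_sum => j _; rewrite zE_proj normr_id.
have mem : (exists l r k, intervals l r k /\
    `|z| = lp_norm (zP D)%:R%:E k (fun j => `|fdd_proj zE (l j) (r j) z|)).
  exists (fun=> 0%N), (fun=> n.+1), 1%N; split; first by move=> j; rewrite ltnS leqn0 => /eqP ->.
  rewrite lp_norm_root big_ord1 zE_proj hn ?leqnSn// normr_id.
  apply/eqP; rewrite eq_le root_le ?zP0 ?exprn_ge0// lexx andbT.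
  by rewrite -(expr_ler (zP0 D)) ?root_ge0// rootK ?zP0 ?exprn_ge0.
split; first by apply: ge_sup => //; exists `|z|.
by apply: sup_upper_bound => //; split; [exists `|z| | exists `|z| => s /ub].
Qed.

Lemma zE_Zp : is_Zp zE (zP D)%:R%:E (id : zsp D -> zsp D).
Proof.
split => // [z zc|]; first by rewrite zE_Zp_norm.
apply/seteqP; split => // z _ B zB.
have [M _ hM] := pr_cvg zB; exists (pr 0 M z); split; last by apply: hM => /=.
by exists (pr 0 M z) => //; exact: pr_c00.
Qed.

End zspace_fdd.

(** * Embedding of the dual into the sequence space *)

Section embedding.
Context {R : realType} {X : completeNormedModType R} (D : zdata X).

Definition zT_fun (f : dual X) : nat -> X -> R^o := fun i x => f (fr (zQ D i) x).

Definition zbounded (C : R) : Prop := 0 < C /\ forall (f : dual X) n t,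
  test D 0 n t -> psum D t (zT_fun f) <= (C * `|f|) ^+ zP D.

Definition admissible (v : nat -> X) : Prop := forall i, fr (zQ D i) (v i) = v i.

(** X behaves as a quotient of the space of paths: each finite sum of blocks can be rewritten so
    that all interval sums are controlled by the sum itself. This yields the lower bound and the
    closed range. *)
Definition has_lifts (c : R) : Prop := forall n v, admissible v ->
  exists n' g, [/\ admissible g, \sum_(i < n) v i = \sum_(i < n') g i &
    forall j k, zN D (\sum_(j <= i < k) g i) <= c * zN D (\sum_(i < n) v i)].

Definition has_dense_sums : Prop := forall x (e : R), 0 < e ->
  exists n v, admissible v /\ `|x - \sum_(i < n) v i| < e.

Lemma zT_mem C f : zbounded C -> zT_fun f \in zmem D.
Proof.
move=> [C0 hC]; rewrite inE; split=> [i a x y|i x|].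
- by rewrite /zT_fun frD frZ duD duZ.
- by rewrite /zT_fun zQK.
exists (C * `|f| + 1) => [|n t tt]; first by rewrite ltr_wpDl// mulr_ge0// ltW.
apply: le_trans (hC f n t tt) _; rewrite lerXn2r ?nnegrE ?addr_ge0 ?mulr_ge0 ?(ltW C0)//.
by rewrite lerDl.
Qed.

Lemma sum_trunc (V : zmodType) (F : nat -> V) n m : (n <= m)%N ->
  \sum_(i < m) (if (i < n)%N then F i else 0) = \sum_(i < n) F i.
Proof. by move=> nm; rewrite (big_ord_widen m F nm) [RHS]big_mkcond. Qed.

Lemma lift_bound_gt0 (z : zsp D) n g (B : R) : admissible g -> 0 < B ->
  (forall j k, zN D (\sum_(j <= i < k) g i) <= B) ->
  `|\sum_(i < n) (z i (g i) : R)| <= B * `|z|.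
Proof.
move=> ga B0 gB; have Bi : 0 <= B^-1 by rewrite invr_ge0 ltW.
have pg : test_path D (fun i => B^-1 *: g i).
  split=> [i|j k]; first by rewrite frZ ga.
  by rewrite -scaler_sumr eqnormZp// ler_pdivrMl// mulr1.
have tt : test D 0 n [:: ((0%N, n), fun i => B^-1 *: g i)] by split => //=.
have := psum_le_norm z tt; rewrite /psum big_seq1 (expr_ler (zP0 D))//.
rewrite /at_ /= big_mkord.
rewrite (eq_bigr (fun i : 'I_n => B^-1 * z i (g i))) => [|i _]; last exact: z_Z.
by rewrite -mulr_sumr normrM ger0_norm// ler_pdivrMl.
Qed.

Lemma lift_bound (z : zsp D) n g (B : R) : admissible g -> 0 <= B ->
  (forall j k, zN D (\sum_(j <= i < k) g i) <= B) ->
  `|\sum_(i < n) (z i (g i) : R)| <= B * `|z|.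
Proof.
move=> ga B0 gB; apply/ler_addgt0Pr => e e0.
pose d := e / (`|z| + 1).
have z1 : 0 < `|z| + 1 by rewrite ltr_wpDl.
have d0 : 0 < d by rewrite divr_gt0.
have Bd : 0 < B + d by rewrite ltr_wpDl.
apply: le_trans (@lift_bound_gt0 z n g (B + d) ga Bd _) _.
  by move=> j k; apply: le_trans (gB j k) _; rewrite lerDl ltW.
rewrite mulrDl lerD2l /d -mulrA ler_piMr ?(ltW e0)// mulrC ler_pdivrMr// mul1r.
by rewrite lerDl.
Qed.

Context (C : R) (hC : zbounded C).

Definition zT (f : dual X) : zsp D := Zsp (zT_mem f hC).

Lemma zT_linear : linear zT.
Proof. by move=> a f g; apply: zext => i x; rewrite zvalD zvalZ. Qed.

HB.instance Definition _ :=
  GRing.isLinear.Build R (dual X) (zsp D) *:%R zT zT_linear.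

Lemma zTE f i x : zT f i x = f (fr (zQ D i) x). Proof. by []. Qed.

Lemma zT_le f : `|zT f| <= C * `|f|.
Proof.
case: (hC) => C0 hC'; apply: znorm_le => [|n t tt]; last exact: hC' tt.
by rewrite mulr_ge0// ltW.
Qed.

Lemma zT_sum f n v : admissible v ->
  \sum_(i < n) (zT f i (v i) : R) = f (\sum_(i < n) v i).
Proof. by move=> va; rewrite du_sum; apply: eq_bigr => i _; rewrite zTE va. Qed.

(** Pairing [zT f] with a lift of [x] returns [f x], so the norm of [f] is controlled on the dense
    set of finite sums. *)
Lemma zT_ge (c : R) : 0 < c -> has_lifts c -> has_dense_sums ->
  exists2 c' : R, 0 < c' & forall f, c' * `|f| <= `|zT f|.
Proof.
move=> c0 hl hd; have [c1 [C1 [c10 C10 cC]]] := eqnorm_equiv (zN D).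
have K0 : 0 < c * C1 by exact: mulr_gt0.
exists (c * C1)^-1 => [|f]; first by rewrite invr_gt0.
rewrite ler_pdivrMl//; apply: dual_le => [|x]; first by rewrite mulr_ge0// ltW.
have h n v : admissible v -> `|f (\sum_(i < n) v i)| <= c * C1 * `|zT f| * `|\sum_(i < n) v i|.
  move=> va; have [n' [g [ga gE gB]]] := hl n v va.
  have N0 := eqnorm_ge0 (zN D) (\sum_(i < n) v i).
  have := @lift_bound (zT f) n' g _ ga (mulr_ge0 (ltW c0) N0) gB.
  rewrite zT_sum// -gE => h; apply: le_trans h _.
  have -> (s t : R) : c * C1 * t * s = c * (C1 * s) * t by ring.
  rewrite ler_wpM2r// ler_pM2l//.
  by have /andP[_] := cC (\sum_(i < n) v i).
apply/ler_addgt0Pr => e e0.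
have q0 : 0 <= c * C1 * `|zT f| by rewrite mulr_ge0// ltW.
pose q := `|f| + c * C1 * `|zT f| + 1.
have q1 : 0 < q by rewrite ltr_wpDl// addr_ge0.
have eq0 : 0 < e / q by rewrite divr_gt0.
have [n [v [va vx]]] := hd x _ eq0.
set y := \sum_(i < n) v i in vx *.
have h1 : `|f x| <= `|f| * `|x - y| + `|f y|.
  have -> : f x = f (x - y) + f y :> R by rewrite duB subrK.
  by apply: le_trans (ler_normD _ _) _; rewrite lerD2r dualP.
have h2 := h n v va; rewrite -/y in h2.
have h3 : `|y| <= `|x| + `|x - y| by rewrite -{1}[y](subKr x) ler_normB.
have h4 : e = e / q * q by rewrite divfK// gt_eqF.
have h5 : `|x - y| * q <= e by rewrite h4 ler_pM2r// ltW.
have h6 : c * C1 * `|zT f| * `|y| <= c * C1 * `|zT f| * (`|x| + `|x - y|) by rewrite ler_wpM2l.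
have h7 : 0 <= `|x - y| := normr_ge0 _.
rewrite /q in h5; set a := c * C1 * `|zT f| in h2 h5 h6 *; lra.
Qed.

Definition evaluates (phi : dual (zsp D)) (x : X) : Prop := forall f, phi (zT f) = f x.

(** On the range, [phi] depends on finitely many coordinates, each spanned by the [zdelta];
    expanding [phi (zT f)] in them exhibits the vector of X. *)
Lemma c00_evaluates phi : dual_c00 (@zE _ _ D) (id : zsp D -> zsp D) phi ->
  exists x, evaluates phi x.
Proof.
move=> [n hn]; exists (\sum_(i < n) \sum_(p <- zQ D i)
  (phi (zdelta D i p.1) : R) *: fr (zQ D i) p.2) => f.
have tail : phi (zT f - pr 0 n (zT f)) = 0 :> R.
  apply/eqP; rewrite -normr_le0; apply/ler_addgt0Pr => e e0; rewrite add0r.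
  have k0 : 0 < `|phi| + 1 by rewrite ltr_wpDl.
  have ek : 0 < e / (`|phi| + 1) by rewrite divr_gt0.
  have [M hM] := pr_cvg_dist (zT f) ek.
  have := hM (maxn M n) (leq_maxl _ _); set m := maxn M n => hm.
  have nm : (n <= m)%N by exact: leq_maxr.
  have -> : phi (zT f - pr 0 n (zT f)) = phi (zT f - pr 0 m (zT f)).
    apply/eqP; rewrite -subr_eq0 -duB opprB addrC addrA subrK; apply/eqP.
    rewrite -!pr_sum (big_cat_nat (leq0n n) nm) /= addrAC subrr add0r.
    rewrite du_sum big1_seq// => i /andP[_]; rewrite mem_index_iota => /andP[ni _].
    by apply: (hn i) => //; exact: zE_pr.
  apply: le_trans (dualP _ _) _.
  rewrite mulrC; move: hm; rewrite ltr_pdivlMr// => /ltW; apply: le_trans.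
  by rewrite ler_wpM2l// lerDl.
have -> : phi (zT f) = phi (pr 0 n (zT f)) :> R.
  by apply/eqP; rewrite -subr_eq0 -duB tail.
rewrite -pr_sum big_mkord !du_sum; apply: eq_bigr => i _.
rewrite (zE_expand (@zE_pr _ _ D i (zT f))) !du_sum; apply: eq_bigr => p _.
by rewrite !duZ prE ltnS !leqnn zTE mulrC.
Qed.

Lemma evaluates_dist phi psi x y : evaluates phi x -> evaluates psi y ->
  `|x - y| <= C * `|phi - psi|.
Proof.
move=> hx hy; have [g [g1 gE]] := norming (x - y).
rewrite -gE duB -hx -hy; apply: le_trans (ler_norm _) _.
rewrite -dualB; apply: le_trans (dualP _ _) _; rewrite mulrC ler_wpM2r//.
case: (hC) => C0 _; apply: le_trans (zT_le g) _.
by rewrite -[leRHS]mulr1 ler_pM2l.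
Qed.

(** The evaluation vector is a Lipschitz function of the functional, so completeness of X extends it
    to the closure. This makes [zT] weak* continuous. *)
Lemma closure_evaluates phi :
  closure (dual_c00 (@zE _ _ D) (id : zsp D -> zsp D)) phi -> exists x, evaluates phi x.
Proof.
move=> hphi; case: (hC) => C0 _.
have H n : exists q : dual (zsp D) * X, `|phi - q.1| < @nat_eps R n /\ evaluates q.1 q.2.
  have [|psi [psi0 psid]] := hphi (ball phi (@nat_eps R n)).
    by apply: nbhsx_ballx; exact: nat_eps_gt0.
  have [x hx] := c00_evaluates psi0; exists (psi, x).
  by split=> //; move: psid; rewrite -ball_normE.
have [q hq] := choice H; pose u n := (q n).2.
have uC m n : `|u m - u n| <= C * (@nat_eps R m + @nat_eps R n).
  have [m1 m2] := hq m; have [n1 n2] := hq n.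
  apply: le_trans (evaluates_dist m2 n2) _; rewrite ler_pM2l//.
  rewrite -(subrKA phi); apply: le_trans (ler_normD _ _) _.
  by rewrite [X in X + _]distrC lerD// ltW.
have [x ux] : exists x : X, u @ \oo --> x.
  apply/cvg_ex; apply: cauchy_cvg; apply/cauchyP => e e0.
  have e2 : 0 < e / (2 * C) by rewrite divr_gt0// mulr_gt0.
  have [N hN] := nat_eps_lt e2; exists (u N); exists N => // n /= Nn.
  rewrite -ball_normE /=; apply: le_lt_trans (uC N n) _.
  have h1 := hN N (leqnn N); have h2 := hN n Nn.
  have -> : e = C * (e / (2 * C) + e / (2 * C)) by field; rewrite gt_eqF.
  by rewrite ltr_pM2l// ltrD.
exists x => f; apply/eqP; rewrite -subr_eq0 -normr_le0.
apply/ler_addgt0Pr => e e0; rewrite add0r.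
pose k := `|zT f| + `|f| + 1.
have k0 : 0 < k by rewrite ltr_wpDl// addr_ge0.
have ek : 0 < e / k by rewrite divr_gt0.
have [N hN] := nat_eps_lt ek.
have /cvgrPdist_lt/(_ _ ek)[M _ hM] := ux.
pose n := maxn N M; have [n1 n2] := hq n.
have h1 : `|phi - (q n).1| < e / k by apply: lt_trans n1 (hN n (leq_maxl _ _)).
have h2 : `|x - u n| < e / k by apply: hM; exact: leq_maxr.
have -> : (phi (zT f) : R) - f x = (phi - (q n).1) (zT f) - f (x - u n).
  by rewrite dualB duB n2; ring.
apply: le_trans (ler_normB _ _) _.
have h3 := dualP (phi - (q n).1) (zT f); have h4 := dualP f (x - u n).
have h5 : `|phi - (q n).1| * `|zT f| <= e / k * `|zT f| by rewrite ler_wpM2r// ltW.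
have h6 : `|f| * `|x - u n| <= `|f| * (e / k) by rewrite ler_wpM2l// ltW.
have h7 : e = e / k * k by rewrite divfK// gt_eqF.
rewrite [X in _ <= X]h7; apply: le_trans (lerD (le_trans h3 h5) (le_trans h4 h6)) _.
by rewrite [`|f| * _]mulrC -mulrDr ler_wpM2l ?(ltW ek)// lerDl.
Qed.

Lemma zT_wstar_continuous : continuous (zT : wstar X ->
  Zp_wstar (@zE _ _ D) (id : zsp D -> zsp D)).
Proof.
move=> f; apply/(@pairing_cvgP R _ _ _ (wstar X) (nbhs (f : wstar X)) _ zT (zT f)) => -[phi hphi] /=.
have [x hx] := closure_evaluates hphi.
have -> : (fun g => phi (zT g) : R) = (fun g : dual X => g x : R).
  by apply/funext => g; exact: hx.
rewrite hx.
have /pairing_cvgP : (id : wstar X -> wstar X) @ nbhs (f : wstar X) --> (f : wstar X).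
  exact: cvg_id.
exact.
Qed.

Lemma sum_functional n (v : nat -> X) : exists phi : dual (zsp D),
  dual_c00 (@zE _ _ D) (id : zsp D -> zsp D) phi /\
  forall z, phi z = \sum_(i < n) (z i (v i) : R) :> R.
Proof.
pose g (z : zsp D) : R := \sum_(i < n) (z i (v i) : R).
have [|z|phi [hphi _]] := @mk_dual R (zsp D) g (\sum_(i < n) zN D (fr (zQ D i) (v i))).
- by move=> t z w; rewrite /g mulr_sumr -big_split; apply: eq_bigr => i _; rewrite zvalD zvalZ.
- apply: le_trans (ler_norm_sum _ _ _) _; rewrite mulr_suml; apply: ler_sum => i _.
  exact: zval_le_norm.
exists phi; split; last exact: hphi.
exists n => i z ni zi; rewrite hphi /g big1// => j _; apply: zi.
by have := ltn_ord j; lia.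
Qed.

(** For [z] in the weak* closure of the range, [f (\sum v i) = \sum z i (v i)] should define a
    preimage; lifts bound this functional, and it is extended to X by Hahn-Banach. *)
Lemma zT_closed_range (c : R) : 0 < c -> has_lifts c ->
  closed (range zT : set (Zp_wstar (@zE _ _ D) (id : zsp D -> zsp D))).
Proof.
move=> c0 hl; apply: pairing_closed => z hz.
(* Well-definedness: linear relations between blocks hold on the range and involve a finitely
   supported functional, hence pass to the weak* closure. *)
have rel0 n v : admissible v -> \sum_(i < n) v i = 0 -> \sum_(i < n) (z i (v i) : R) = 0.
  move=> va v0; have [phi [phi0 hphi]] := sum_functional n v.
  apply/eqP; rewrite -normr_le0; apply/ler_addgt0Pr => e e0; rewrite add0r.
  have [w [f _ <-]] := hz [:: exist _ phi (subset_closure phi0)] e e0.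
  move=> /(_ _ (or_introl erefl)) /=; rewrite !hphi zT_sum// v0 du0 subr0.
  exact: ltW.
have trunc_adm n v : admissible v -> admissible (fun i => if (i < n)%N then v i else 0).
  by move=> va i; case: ifP => _; [exact: va|exact: fr0].
have trunc_z n m (v : nat -> X) : (n <= m)%N ->
    \sum_(i < m) (z i (if (i < n)%N then v i else 0) : R) = \sum_(i < n) (z i (v i) : R).
  move=> nm; rewrite -(@sum_trunc R (fun i => z i (v i)) n m nm); apply: eq_bigr => i _.
  by case: ifP => // _; exact: z_0.
have comb t n v n' v' : admissible v -> admissible v' -> exists m w, [/\ admissible w,
    \sum_(i < m) w i = t *: (\sum_(i < n) v i) + \sum_(i < n') v' i &
    \sum_(i < m) (z i (w i) : R) = t * (\sum_(i < n) (z i (v i) : R)) +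
      \sum_(i < n') (z i (v' i) : R)].
  move=> va va'; pose m := maxn n n'.
  have nm : (n <= m)%N by exact: leq_maxl.
  have nm' : (n' <= m)%N by exact: leq_maxr.
  exists m, (fun i => t *: (if (i < n)%N then v i else 0) + (if (i < n')%N then v' i else 0)).
  split.
  - by move=> i; rewrite frD frZ (trunc_adm n v va) (trunc_adm n' v' va').
  - by rewrite big_split /= -scaler_sumr !sum_trunc.
  rewrite -(trunc_z n m v nm) -(trunc_z n' m v' nm') mulr_sumr -big_split.
  by apply: eq_bigr => i _; rewrite zlin.
pose G := [set q : X * R | exists n v, [/\ admissible v, q.1 = \sum_(i < n) v i &
  q.2 = \sum_(i < n) (z i (v i) : R)]].
have [c1 [C1 [c10 C10 cC]]] := eqnorm_equiv (zN D).
have M0 : 0 <= c * C1 * `|z| by rewrite !mulr_ge0// ltW.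
have [||f [fG _]] := @dual_extension R X G _ M0.
- split; first by exists 0%N, (fun=> 0); rewrite !big_ord0; split => // i; exact: fr0.
  move=> t x a y b [n [v [va /= -> ->]]] [n' [v' [va' /= -> ->]]].
  by have [m [w [wa w1 w2]]] := comb t n v n' v' va va'; exists m, w.
- move=> x a [n [v [va /= -> ->]]].
  have [n' [g [ga gE gB]]] := hl n v va.
  have -> : \sum_(i < n) (z i (v i) : R) = \sum_(i < n') (z i (g i) : R).
    have [m [w [wa w1 w2]]] := comb (-1) n' g n v ga va.
    have := rel0 m w wa; rewrite w1 w2 gE scaleN1r addNr => /(_ erefl) /eqP.
    by rewrite mulN1r addrC subr_eq0 => /eqP.
  apply: le_trans (ler_norm _) _.
  have N0 := eqnorm_ge0 (zN D) (\sum_(i < n) v i).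
  apply: le_trans (@lift_bound z n' g _ ga (mulr_ge0 (ltW c0) N0) gB) _.
  have -> (s t : R) : c * C1 * t * s = c * (C1 * s) * t by ring.
  rewrite ler_wpM2r// ler_pM2l//.
  by have /andP[_] := cC (\sum_(i < n) v i).
exists f => //; apply: zext => i x; rewrite zTE -zproj.
have va : admissible (fun j => if j == i then fr (zQ D i) x else 0).
  by move=> j; case: eqP => [->|_]; [exact: zQK|exact: fr0].
apply: fG; exists i.+1, (fun j => if j == i then fr (zQ D i) x else 0); split => //=.
  rewrite big_ord_recr /= eqxx big1 ?add0r// => j _.
  by rewrite (ltn_eqF (ltn_ord j)).
rewrite big_ord_recr /= eqxx big1 ?add0r// => j _.
by rewrite (ltn_eqF (ltn_ord j)) z_0.
Qed.

Lemma zT_wstar_embeds (c : R) : 0 < c -> has_lifts c -> has_dense_sums ->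
  wstar_embeds_in_Zp X (zP D)%:R%:E (@zE _ _ D).
Proof.
move=> c0 hl hd; exists (zsp D), id, (zT : {linear dual X -> zsp D}); split.
- exact: zE_Zp.
- have [c' c'0 h] := zT_ge c0 hl hd; exists c', C; case: (hC) => C0 _; split => // f.
  by rewrite h zT_le.
- exact: zT_wstar_continuous.
exact: zT_closed_range c0 hl.
Qed.

End embedding.

(** * Blocking the space X *)

Section blocking.
Context {R : realType} {X : normedModType R} (N : equiv_norm X).

(** A net point plus a small finite rank correction agrees with [x] modulo [kerl L]; each has [N] at
    most 1 after normalization, hence the factor 2. *)
Lemma lifting_vectors (L : seq (dual X)) : exists H : seq X, forall x, exists v,
  [/\ lspan H v, kerl L (x - v) & N v <= 2 * N x].
Proof.
have [c1 [C1 [c10 C10 cC]]] := eqnorm_equiv N.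
have [l [lL _]] := kerl_projection L.
have C1i : 0 < C1^-1 by rewrite invr_gt0.
have [d d0 hd] := fr_small l C1i.
have SM x : N x <= 1 -> `|x| <= c1^-1.
  move=> x1; have /andP[h _] := cC x.
  rewrite -[c1^-1]mul1r ler_pdivlMr// mulrC; exact: le_trans x1.
have [zs [zS zP]] := @kerl_net R X [seq p.1 | p <- l] [set x | N x <= 1] _ d SM d0.
exists (zs ++ [seq p.2 | p <- l]) => x.
have [->|x0] := eqVneq x 0.
  by exists 0; rewrite subrr eqnorm0 mulr0; split => //; [exact: lspan0|move=> f _; exact: du0].
have Nx := eqnorm_gt0 N x0; pose x' := (N x)^-1 *: x.
have x'1 : N x' <= 1 by rewrite eqnormZp ?invr_ge0 ?(ltW Nx)// mulVf// gt_eqF.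
have [z zz xz] := zP x' x'1; pose v := z + fr l (x' - z).
exists (N x *: v); split.
- apply/lspanZ/lspanD; first exact/lspan_catl/lspan_mem.
  by apply: lspan_catr; apply: fr_lspan => p pl; apply/lspan_mem/map_f.
- have -> : x - N x *: v = N x *: ((x' - z) - fr l (x' - z)).
    by rewrite -addrA -opprD scalerBr /x' scalerA divff ?gt_eqF// scale1r.
  exact: kerlZ.
rewrite eqnormZp ?(ltW Nx)// mulrC ler_pM2r//.
have h : N (fr l (x' - z)) <= 1.
  have /andP[_ h] := cC (fr l (x' - z)); apply: le_trans h _.
  by rewrite mulrC -ler_pdivlMr// mul1r; apply: hd => p pl; apply: xz; exact: map_f.
by apply: le_trans (eqnormD _ _ _) _; have := zS z zz; rewrite /=; lra.
Qed.

Context (P : nat) (c : R) (s : nat -> R) (Ns : smooth_data N P c s) (ys : nat -> X).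

Lemma blocking_lists : exists (L : nat -> seq (dual X)) (H : nat -> seq X)
    (l : nat -> seq (dual X * X)),
  [/\ L 0%N = [::] /\ (forall n, {subset L n <= L n.+1}),
      (forall n, {subset H n <= H n.+1}) /\ (forall n, ys n \in H n),
      [/\ forall n x, kerl (L n) (x - fr (l n) x), forall n x, kerl (L n) x -> fr (l n) x = 0 &
        forall n p, p \in l n -> p.2 \in H n],
      forall n x, exists v, [/\ lspan (H n) v, kerl (L n) (x - v) & N v <= 2 * N x] &
      forall n y, kerl (L n.+1) y -> N y <= 1 -> good_step N s (H n) n.+2 y].
Proof.
have hg (bn : seq X * nat) : exists L : seq (dual X), forall y, kerl L y -> N y <= 1 ->
    good_step N s bn.1 bn.2 y.
  have [L [d [d0 hd]]] := good_stepP Ns bn.1 bn.2; exists L => y Ly y1.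
  by apply: hd => // f fL; rewrite Ly// normr0 ltW.
have [gl glP] := choice hg.
have [lf lfP] := choice lifting_vectors.
have hp (L : seq (dual X)) : exists l : seq (dual X * X),
    (forall x, kerl L (x - fr l x)) /\ forall x, kerl L x -> fr l x = 0.
  have [l [h1 h2]] := kerl_projection L; exists l; split => // x Lx.
  by apply: fr_vanish => p pl; exact: h2.
have [pj pjP] := choice hp.
pose add n L b := ys n :: b ++ (lf L ++ [seq p.2 | p <- pj L]) : seq X.
(* The functionals of level [n.+1] are chosen from the vectors of level [n], and the new vectors are
   then chosen from these functionals. *)
pose st := fix st n : seq (dual X) * seq X := if n is m.+1 then
    let L := (st m).1 ++ gl ((st m).2, m.+2) in (L, add n L (st m).2)
  else ([::], add 0%N [::] [::]).
have HE n : exists b, (st n).2 = add n (st n).1 b by case: n => [|n] /=; eexists.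
have inH n v : v \in lf (st n).1 ++ [seq p.2 | p <- pj (st n).1] -> v \in (st n).2.
  by have [b ->] := HE n; move=> h; rewrite inE mem_cat h !orbT.
exists (fun n => (st n).1), (fun n => (st n).2), (fun n => pj (st n).1); split.
- by split => // n f fL /=; rewrite mem_cat fL.
- split=> n; first by move=> v vH /=; rewrite inE mem_cat vH orbT.
  by have [b ->] := HE n; rewrite inE eqxx.
- split=> [n x|n x|n p pl]; [by have [] := pjP (st n).1|by have [_] := pjP (st n).1; apply|].
  by apply: inH; rewrite mem_cat map_f ?orbT.
- move=> n x; have [v [v1 v2 v3]] := lfP (st n).1 x; exists v; split => //.
  by apply: lspan_subset v1 => w wl; apply: inH; rewrite mem_cat wl.
move=> n y /= /kerl_cat[_ yg] y1; exact: (glP ((st n).2, n.+2)).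
Qed.

End blocking.

Section strict_tests.
Context {R : realType} {X : normedModType R} (D : zdata X).

Fixpoint strict_test m n (t : seq (@atom R X)) : Prop :=
  if t is a :: t' then
    [/\ (m <= a.1.1)%N, (a.1.1 < a.1.2)%N, test_path D a.2 & strict_test a.1.2 n t']
  else (m <= n)%N.

Lemma strict_testP m n t z : test D m n t ->
  exists t', strict_test m n t' /\ psum D t z = psum D t' z.
Proof.
elim: t m => [|a t IH] m /=; first by exists [::].
move=> [ma aa pa tt]; have [aE|aN] := eqVneq a.1.1 a.1.2; last first.
  have [t' [tt' tE]] := IH _ tt; exists (a :: t').
  by rewrite /psum !big_cons -!/(psum _ _ _) tE; split => //; split => //; rewrite ltn_neqAle aN.
have [t' [tt' tE]] := IH m (test_widen (leq_trans ma aa) (leqnn n) tt).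
exists t'; split => //.
have -> : psum D (a :: t) z = `|at_ z a| ^+ zP D + psum D t z by rewrite /psum big_cons.
rewrite tE.
by rewrite /at_ aE big_geq// normr0 expr0n gtn_eqF ?(zP0 D)// add0r.
Qed.

Lemma strict_test_nth m n t a0 j : strict_test m n t -> (j < size t)%N ->
  let a := nth a0 t j in
  [/\ (m + j <= a.1.1)%N, (a.1.1 < a.1.2)%N, test_path D a.2 &
    forall k, (j < k < size t)%N -> (a.1.2 <= (nth a0 t k).1.1)%N].
Proof.
elim: t m j => [|a t IH] m j //= [ma aa pa tt] js.
case: j js => [_|j js] /=.
  split => //; first by rewrite addn0.
  move=> [//|k] /=; rewrite ltnS => ks; have [h _ _ _] := IH _ k tt ks.
  exact: leq_trans (leq_addr _ _) h.
have [h1 h2 h3 h4] := IH _ j tt js; split => //; first by lia.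
by move=> [//|k] /=; rewrite !ltnS => ks; exact: h4.
Qed.

End strict_tests.

Section blocked_space.
Context {R : realType} {X : completeNormedModType R} (N : equiv_norm X).
Context (P : nat) (c : R) (s : nat -> R) (Ns : smooth_data N P c s) (ys : nat -> X).
Context (L : nat -> seq (dual X)) (H : nat -> seq X) (l : nat -> seq (dual X * X)).
Context (L0 : L 0%N = [::]) (LS : forall n, {subset L n <= L n.+1})
  (HS : forall n, {subset H n <= H n.+1}) (yH : forall n, ys n \in H n)
  (lK : forall n x, kerl (L n) (x - fr (l n) x))
  (l0 : forall n x, kerl (L n) x -> fr (l n) x = 0)
  (lH : forall n p, p \in l n -> p.2 \in H n)
  (lift : forall n x, exists v, [/\ lspan (H n) v, kerl (L n) (x - v) & N v <= 2 * N x])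
  (good : forall n y, kerl (L n.+1) y -> N y <= 1 -> good_step N s (H n) n.+2 y)
  (ysT : forall x (e : R), 0 < e -> exists n y, lspan (mkseq ys n) y /\ `|x - y| < e).

Lemma kerl_anti m n x : (m <= n)%N -> kerl (L n) x -> kerl (L m) x.
Proof.
elim: n => [|n IH]; first by rewrite leqn0 => /eqP ->.
rewrite leq_eqVlt ltnS => /predU1P[->//|mn] nx; apply: IH => // f fL.
by apply: nx; exact: LS.
Qed.

Lemma lspanH_mono m n x : (m <= n)%N -> lspan (H m) x -> lspan (H n) x.
Proof.
move=> mn; apply: lspan_subset; elim: n mn => [|n IH]; first by rewrite leqn0 => /eqP ->.
by rewrite leq_eqVlt ltnS => /predU1P[->//|mn] v /(IH mn)/HS.
Qed.

(** The residues span the vectors of [H n] killed by [L n.-1]. The lag by one lets [lift_sum] write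
    a vector as a sum of increments. *)
Definition block_list n : seq X := [seq v - fr (l n.-1) v | v <- H n].

Lemma block_listP n x : lspan (block_list n) x <-> lspan (H n) x /\ kerl (L n.-1) x.
Proof.
have frH v : lspan (H n) (fr (l n.-1) v).
  apply: fr_lspan => p pl; apply: (@lspanH_mono n.-1); first exact: leq_pred.
  exact/lspan_mem/lH.
split=> [xb|[xH xk]].
  split.
    apply: lspan_sub xb; first exact: lspan_subspace.
    by move=> _ /mapP[v vH ->]; apply: lspanB => //; exact: lspan_mem.
  apply: lspan_sub xb; first exact: kerl_subspace.
  by move=> _ /mapP[v vH ->]; exact: lK.
have -> : x = x - fr (l n.-1) x by rewrite l0// subr0.
pose Y := [set x | lspan (block_list n) (x - fr (l n.-1) x)].
suff : Y x by [].
apply: lspan_sub xH; last by move=> v vH; apply/lspan_mem/map_f.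
split; first by rewrite /Y /= fr0 subr0; exact: lspan0.
move=> a u v; rewrite /Y /= => hu hv.
have -> : a *: u + v - fr (l n.-1) (a *: u + v) =
    a *: (u - fr (l n.-1) u) + (v - fr (l n.-1) v).
  by rewrite frD frZ scalerBr opprD addrACA.
by apply: lspanD => //; exact: lspanZ.
Qed.

Lemma block_projection : exists q : nat -> seq (dual X * X), forall n,
  (forall x, lspan (block_list n) (fr (q n) x)) /\
  forall x, lspan (block_list n) x -> fr (q n) x = x.
Proof.
have h n := lspan_projection (block_list n).
have [q qP] := choice h; exists q => n; have [q1 q2] := qP n; split => // x.
exact: fr_lspan.
Qed.

Context (q : nat -> seq (dual X * X)).
Context (qP : forall n, (forall x, lspan (block_list n) (fr (q n) x)) /\
  forall x, lspan (block_list n) x -> fr (q n) x = x).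

Lemma block_idem n x : fr (q n) (fr (q n) x) = fr (q n) x.
Proof. by have [q1 q2] := qP n; rewrite q2. Qed.

Definition block_data : zdata X := ZData N block_idem (let: And5 _ P0 _ _ _ := Ns in P0).

Lemma block_memP n x : fr (q n) x = x <-> lspan (H n) x /\ kerl (L n.-1) x.
Proof.
rewrite -block_listP; have [q1 q2] := qP n.
by split=> [<-|]; [exact: q1|exact: q2].
Qed.

(** The lifts of [x] at successive levels approximate it modulo smaller and smaller kernels. Their
    increments are blocks, and an interval sum is a difference of two lifts, of norm at most
    [2 * N x] each. *)
Lemma lift_sum n x : lspan (H n) x -> exists n' g, [/\ admissible block_data g,
  x = \sum_(i < n') g i & forall j k, N (\sum_(j <= i < k) g i) <= 4 * N x].
Proof.
move=> xH; have [sg sgP] := choice (fun i => lift i x).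
pose sm i := if (i < n)%N then sg i else x.
have smH i : lspan (H i) (sm i).
  rewrite /sm; case: ltnP => i_n; first by have [] := sgP i.
  exact: lspanH_mono xH.
have smL i : kerl (L i) (x - sm i).
  rewrite /sm; case: ifP => _; first by have [] := sgP i.
  by rewrite subrr => f _; exact: du0.
have Nx := eqnorm_ge0 N x.
have smN i : N (sm i) <= 2 * N x.
  by rewrite /sm; case: ifP => _; [have [] := sgP i|lra].
pose g i := if i is j.+1 then sm j.+1 - sm j else sm 0%N.
pose S k := if k is j.+1 then sm j else 0.
have gS k : \sum_(0 <= i < k) g i = S k.
  elim: k => [|[|k] IH]; first by rewrite big_geq.
    by rewrite big_nat1.
  by rewrite big_nat_recr//= IH /= subrKC.
have SN k : N (S k) <= 2 * N x.
  by case: k => [|k]; [rewrite /= eqnorm0; lra|exact: smN].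
exists n.+1, g; split.
- move=> [|i]; apply/block_memP; first by rewrite L0.
  split; first by apply: lspanB => //; apply: lspanH_mono (smH i).
  have -> : g i.+1 = (x - sm i) + - (x - sm i.+1) by rewrite opprB addrC subrKA.
  by apply: kerlD => //; apply/kerlN/(@kerl_anti i i.+1).
- by rewrite -(big_mkord xpredT) gS /= /sm ltnn.
move=> j k; have [jk|kj] := leqP j k; last by rewrite big_geq 1?ltnW// eqnorm0 mulr_ge0.
have -> : \sum_(j <= i < k) g i = S k - S j.
  by rewrite -!gS (big_cat_nat (leq0n j) jk) /= addrAC subrr add0r.
apply: le_trans (eqnormB _ _ _) _; have := SN k; have := SN j; lra.
Qed.

Lemma block_lifts : has_lifts block_data 4.
Proof.
move=> n v va; apply: lift_sum.
apply: lspan_sum => i _; have /block_memP[h _] := va i.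
by apply: lspanH_mono h; exact/ltnW/ltn_ord.
Qed.

Lemma block_dense : has_dense_sums block_data.
Proof.
move=> x e e0; have [n [y [ny xy]]] := ysT x e0.
have [|n' [g [ga gE _]]] := @lift_sum n y.
  apply: lspan_subset ny => v /mapP[i]; rewrite mem_iota add0n => /andP[_ i_n] ->.
  have mono m k : {subset H m <= H (m + k)%N}.
    by elim: k => [|k IH] w; [rewrite addn0|move/IH/HS; rewrite addnS].
  by rewrite -(subnKC (ltnW i_n)); apply/mono/yH.
by exists n', g; rewrite -gE.
Qed.

Definition block_vec (a : @atom R X) : X := \sum_(a.1.1 <= i < a.1.2) a.2 i.

Lemma block_vec_ker a m : test_path block_data a.2 -> (m <= a.1.1.-1)%N ->
  kerl (L m) (block_vec a).
Proof.
move=> [pa _] ma; rewrite /block_vec big_nat.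
elim/big_rec : _ => [f _|i x ia hx]; first exact: du0.
apply: kerlD => //; have /block_memP[_ h] := pa i.
by apply: kerl_anti h; lia.
Qed.

Lemma block_vec_span a m : test_path block_data a.2 -> (a.1.2 <= m.+1)%N ->
  lspan (H m) (block_vec a).
Proof.
move=> [pa _] ma; rewrite /block_vec big_nat.
elim/big_rec : _ => [|i x ia hx]; first exact: lspan0.
apply: lspanD => //; have /block_memP[h _] := pa i.
by apply: lspanH_mono h; lia.
Qed.

Lemma at_block_vec f a : test_path block_data a.2 ->
  at_ (zT_fun block_data f) a = f (block_vec a).
Proof.
move=> [pa _]; rewrite /at_ /block_vec du_sum; apply: eq_bigr => i _.
by rewrite /zT_fun (pa i).
Qed.

Lemma good_step_mono b b' m m' y : (forall x, lspan b x -> lspan b' x) -> (m <= m')%N ->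
  good_step N s b' m' y -> good_step N s b m y.
Proof. by move=> bb mm g x bx x1 k km; apply: g => //; [exact: bb|exact: leq_trans mm]. Qed.

Lemma good_step_nil y m : N y <= 1 -> good_step N s [::] m y.
Proof.
have [_ _ s01 _ _] := Ns; move=> y1 x /= -> _ k _; rewrite add0r.
have /andP[s0 s1] := s01 k; rewrite eqnormZp ?(ltW s0)//.
have p0 : 0 <= 2^-1 ^+ k :> R by rewrite exprn_ge0// invr_ge0.
have := eqnorm_ge0 N y; have : 0 <= s k * 2^-1 ^+ k by rewrite mulr_ge0// ltW.
nra.
Qed.

Lemma good_step0 b m : good_step N s b m 0.
Proof.
have [_ _ s01 _ _] := Ns; move=> x _ x1 k _; rewrite scaler0 addr0.
have /andP[s0 _] := s01 k; apply: le_trans x1 _; rewrite lerDl mulr_ge0//.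
by rewrite mulr_ge0 ?(ltW s0)// exprn_ge0// invr_ge0.
Qed.

(* Two consecutive blocks interact, so the even and the odd blocks are treated *)
(* separately.                                                                 *)
Lemma block_upper (f : dual X) n t : (forall x, `|f x| <= N x) -> test block_data 0 n t ->
  psum block_data t (zT_fun block_data f) <= 2 * block_const P c.
Proof.
move=> fN /(strict_testP (zT_fun block_data f))[{}t [tt ->]].
pose a0 : @atom R X := ((0%N, 0%N), fun=> 0).
pose y e j := block_vec (nth a0 t (j.*2 + e)).
have nthP j := @strict_test_nth R X block_data 0 n t a0 j tt.
have y_out e j : (size t <= j.*2 + e)%N -> y e j = 0.
  by move=> h; rewrite /y nth_default// /block_vec big_geq.
have hy e j : (e < 2)%N -> N (y e j) <= 1 /\ good_step N s (mkseq (y e) j) j (y e j).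
  move=> e2; have [js|sj] := ltnP (j.*2 + e) (size t); last first.
    by rewrite y_out// eqnorm0; split => //; exact: good_step0.
  have [h1 h2 h3 h4] := nthP _ js; rewrite add0n in h1.
  have y1 : N (y e j) <= 1 by have [_ h] := h3; exact: h.
  split => //; case: j js h1 h2 h3 h4 y1 => [|j] js h1 h2 h3 h4 y1.
    exact: good_step_nil.
  set a := nth a0 t (j.+1.*2 + e) in h1 h2 h3 h4.
  have aE : a.1.1 = a.1.1.-2.+2 by lia.
  (* The nonempty atom skipped in between separates the preceding vectors from [a]: they end by
     [a.1.1.-1] and hence lie in the span of [H a.1.1.-2]. *)
  apply: (@good_step_mono _ (H a.1.1.-2) _ a.1.1.-2.+2); last first.
  - by apply: good => //; apply: block_vec_ker h3 _; lia.
  - by lia.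
  move=> x; apply: lspan_sub; first exact: lspan_subspace.
  move=> w /mapP[i]; rewrite mem_iota add0n => /andP[_ ij] ->.
  have i1 : (i.*2 + e < size t)%N by lia.
  have i2 : ((i.*2 + e).+1 < size t)%N by lia.
  have [_ _ g3 g4] := nthP _ i1; have [_ k2 _ k4] := nthP _ i2.
  apply: block_vec_span g3 _.
  have := g4 (i.*2 + e).+1 _; have := k4 (j.+1.*2 + e)%N _; rewrite -/a.
  by move=> /(_ ltac:(lia)) u1 /(_ ltac:(lia)) u2; lia.
pose G j := `|f (block_vec (nth a0 t j))| ^+ P.
have G0 j : 0 <= G j by rewrite exprn_ge0.
have P0 := zP0 block_data.
have -> : psum block_data t (zT_fun block_data f) = \sum_(j < size t) G j.
  rewrite /psum (big_nth a0) big_mkord; apply: eq_bigr => j _.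
  by have [_ _ h3 _] := nthP _ (ltn_ord j); rewrite at_block_vec.
have dbl m : \sum_(j < m.*2) G j = \sum_(j < m) G j.*2 + \sum_(j < m) G (j.*2.+1).
  elim: m => [|m IH]; first by rewrite !big_ord0 addr0.
  by rewrite doubleS !big_ord_recr /= IH; ring.
have le2 : \sum_(j < size t) G j <= \sum_(j < (size t).*2) G j.
  rewrite -addnn big_split_ord /= lerDl; exact: sumr_ge0.
apply: le_trans le2 _; rewrite dbl.
have he : \sum_(j < size t) G j.*2 <= block_const P c.
  have := smooth_blocks Ns (fun j _ => hy 0%N j isT) fN (n := size t).
  by rewrite /y; under eq_bigr => j _ do rewrite addn0.
have ho : \sum_(j < size t) G (j.*2.+1) <= block_const P c.
  have := smooth_blocks Ns (fun j _ => hy 1%N j isT) fN (n := size t).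
  by rewrite /y; under eq_bigr => j _ do rewrite addn1.
by rewrite mulr_natl mulr2n lerD.
Qed.

Lemma block_bounded : exists C, zbounded block_data C.
Proof.
have [c1 [C1 [c10 C10 cC]]] := eqnorm_equiv N; have P0 := zP0 block_data.
have B0 := block_const_ge0 Ns; set B := block_const P c in B0.
have B1 : 1 <= 2 * B + 1 by rewrite lerDr mulr_ge0.
(* The extra 1 makes the base at least 1, so that [2 * B] is below its [zP]-th power. *)
have C0 : 0 < c1^-1 * (2 * B + 1) by rewrite mulr_gt0 ?invr_gt0// (lt_le_trans ltr01 B1).
exists (c1^-1 * (2 * B + 1)); split => // f n t tt.
have [f0|f0] := eqVneq `|f| 0.
  have -> : psum block_data t (zT_fun block_data f) = 0.
    rewrite /psum big1// => a _; rewrite /at_ big1 ?normr0 ?expr0n ?gtn_eqF// => i _.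
    by move/eqP: f0; rewrite normr_eq0 => /eqP ->.
  by rewrite exprn_ge0// f0 mulr0.
have k0 : 0 < `|f| * c1^-1 by rewrite mulr_gt0 ?invr_gt0// lt_neqAle eq_sym f0 normr_ge0.
pose k := `|f| * c1^-1; pose f' : dual X := k^-1 *: f.
have f'N x : `|f' x| <= N x.
  rewrite dualZ normrM ger0_norm ?invr_ge0 ?(ltW k0)// ler_pdivrMl//.
  apply: le_trans (dualP f x) _; rewrite -mulrA ler_wpM2l// ler_pdivlMl//.
  by have /andP[] := cC x.
have -> : zT_fun block_data f = k *: zT_fun block_data f'.
  apply/funext => i; apply/funext => x.
  by rewrite -[RHS]/(k * (k^-1 * f (fr (q i) x))) mulrA divff ?gt_eqF// mul1r.
rewrite psumZ ger0_norm ?(ltW k0)//.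
have -> : c1^-1 * (2 * B + 1) * `|f| = k * (2 * B + 1) by rewrite /k; ring.
rewrite [leRHS]exprMn ler_wpM2l ?exprn_ge0 ?(ltW k0)//.
apply: le_trans (block_upper f'N tt) _; rewrite -/B.
apply: (@le_trans _ _ (2 * B + 1)); first by rewrite lerDl.
by case: (zP block_data) P0 => // m _; rewrite exprS ler_peMr ?exprn_ege1// (le_trans ler01).
Qed.

End blocked_space.

Lemma wstar_embeds_of_smooth {R : realType} {X : completeNormedModType R} (N : equiv_norm X)
    (ys : nat -> X) : smooth_norm N ->
  (forall x (e : R), 0 < e -> exists n y, lspan (mkseq ys n) y /\ `|x - y| < e) ->
  exists (p : R) (Z : completeNormedModType R) (E : nat -> set Z),
    [/\ 1 <= p, is_FDD E, boundedly_complete E & wstar_embeds_in_Zp X p%:E E].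
Proof.
move=> /smooth_norm_data[P [c [s Ns]]] ysT.
have [L [H [l [[L0 LS] [HS yH] [lK l0 lH] lift good]]]] := blocking_lists Ns ys.
have [q qP] := block_projection H l.
pose D := block_data Ns qP.
have [C hC] := block_bounded Ns LS HS lK l0 lH good qP.
exists P%:R, (zsp D), (@zE _ _ D); split.
- by have [_ P0 _ _ _] := Ns; rewrite ler1n.
- exact: zE_FDD.
- exact: zE_boundedly_complete.
apply: (zT_wstar_embeds hC (c := 4)) => //; first exact: (block_lifts L0 LS HS lK l0 lH lift).
exact: (block_dense Ns L0 LS HS yH lK l0 lH lift ysT qP).
Qed.

(** * Trees in a subspace of Z_p(E) *)

Section spanning_lists.
Context {R : realType} {V : normedModType R}.

Lemma subspace_of_lspan (Y : set V) (B : seq V) : is_subspace Y -> Y `<=` lspan B ->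
  exists b, (forall v, v \in b -> Y v) /\ Y `<=` lspan b.
Proof.
elim: B Y => [|v B IH] Y YS YB; first by exists [::].
have [Y0 YL] := YS.
have YZ (t : R) x : Y x -> Y (t *: x) by move=> Yx; rewrite -[_ *: _]addr0; exact: YL.
pose Y' := Y `&` lspan B.
have [|b [bY' Yb]] := IH Y' _ (fun x h => h.2).
  split=> [|a x y [Yx Bx] [Yy By]]; first by split => //; exact: lspan0.
  by split; [exact: YL|apply: lspanD => //; exact: lspanZ].
have [[y [t [w [Yy t0 Bw yE]]]]|no] :=
    pselect (exists y t w, [/\ Y y, t != 0, lspan B w & y = t *: v + w]); last first.
  exists b; split => [u /bY'[]//|x Yx]; apply: Yb; split => //.
  have [s [w [Bw xE]]] := YB x Yx; rewrite xE.
  have [->|s0] := eqVneq s 0; first by rewrite scale0r add0r.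
  by exfalso; apply: no; exists x, s, w.
exists (y :: b); split=> [u|x Yx]; first by rewrite inE => /predU1P[->//|/bY'[]].
have [s [w' [Bw' xE]]] := YB x Yx.
exists (s / t), (x - (s / t) *: y); split; last by rewrite subrKC.
apply: Yb; split.
  by rewrite -scaleN1r addrC; apply: YL => //; exact: YZ.
rewrite xE yE scalerDr scalerA divfK// opprD addrACA subrr add0r.
by apply: lspanB => //; exact: lspanZ.
Qed.

Lemma fin_dim_list (Y : set V) : is_subspace Y -> fin_dim Y ->
  exists b, (forall v, v \in b -> Y v) /\ Y `<=` lspan b.
Proof.
move=> YS [n [b hb]]; apply: (@subspace_of_lspan Y [seq b i | i : 'I_n]) => // x /hb[a ->].
by apply: lspan_sum => i _; apply/lspanZ/lspan_mem/map_f; rewrite mem_enum.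
Qed.

End spanning_lists.

Section interval_sums.
Context {R : realType} {Z : completeNormedModType R} (E : nat -> set Z) (hE : is_FDD E).

Local Notation co := (fdd_coord E).
Local Notation PP := (fdd_proj E).

Lemma fdd_coordP z : fdd_expansion E z (co z).
Proof. by have [_ /(_ z)[u [hu _]]] := hE; exact: (@getPex _ [set v | fdd_expansion E z v] (ex_intro _ u hu)). Qed.

Lemma fdd_coord_unique z u : fdd_expansion E z u -> co z = u.
Proof. by move=> hu; have [_ /(_ z)[v [_ hv]]] := hE; rewrite -(hv _ (fdd_coordP z)) (hv _ hu). Qed.

Lemma E_subspace i : is_subspace (E i). Proof. by have [/(_ i)[]] := hE. Qed.

Lemma E_coord z i : E i (co z i). Proof. by have [] := fdd_coordP z. Qed.

Lemma expansion_fin (u : nat -> Z) n : (forall i, E i (u i)) ->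
  (forall i, (n <= i)%N -> u i = 0) -> co (\sum_(i < n) u i) = u.
Proof.
move=> uE u0; apply: fdd_coord_unique; split => //; apply/cvgrPdist_lt => e e0.
exists n => // m /= nm; rewrite /series /= (big_cat_nat (leq0n n) nm) /= big_mkord.
rewrite [X in _ - (_ + X)]big1_seq => [|i /andP[_]]; first by rewrite addr0 subrr normr0.
by rewrite mem_index_iota => /andP[ni _]; exact: u0.
Qed.

Lemma co_lin (a : R) z w i : co (a *: z + w) i = a *: co z i + co w i.
Proof.
suff -> : co (a *: z + w) = fun i => a *: co z i + co w i by [].
apply: fdd_coord_unique; have [zE zc] := fdd_coordP z; have [wE wc] := fdd_coordP w.
split=> [j|]; first by have [_] := E_subspace j; apply.
have -> : series (fun i => a *: co z i + co w i) =
    (fun n => a *: series (co z) n + series (co w) n).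
  by apply/funext => n; rewrite /series scaler_sumr -big_split.
by apply: cvgD => //; apply: cvgZl_tmp.
Qed.

Lemma PP_mkord m n z : PP m n z = \sum_(i < n) (if (m <= i < n)%N then co z i else 0).
Proof.
rewrite /fdd_proj big_geq_mkord big_mkcond; apply: eq_bigr => i _.
by rewrite ltn_ord andbT.
Qed.

Lemma co_PP m n z i : co (PP m n z) i = if (m <= i < n)%N then co z i else 0.
Proof.
rewrite PP_mkord (expansion_fin (u := fun i => if (m <= i < n)%N then co z i else 0))//.
  by move=> j; case: ifP => _; [exact: E_coord|have [] := E_subspace j].
by move=> j nj; case: ifP => //; lia.
Qed.

Lemma PP_c00 m n z : fdd_c00 E (PP m n z).
Proof.
exists (fun i => if (m <= i < n)%N then co z i else 0), n; split; last exact: PP_mkord.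
by move=> j; case: ifP => _; [exact: E_coord|have [] := E_subspace j].
Qed.

Lemma PP_lin m n (a : R) z w : PP m n (a *: z + w) = a *: PP m n z + PP m n w.
Proof. by rewrite /fdd_proj scaler_sumr -big_split; apply: eq_bigr => i _; exact: co_lin. Qed.

Lemma c00_coord z : fdd_c00 E z -> exists n, forall i, (n <= i)%N -> co z i = 0.
Proof.
move=> [u [n [uE ->]]]; exists n => i ni.
have -> : \sum_(j < n) u j = \sum_(j < n) (if (j < n)%N then u j else 0).
  by apply: eq_bigr => j _; rewrite ltn_ord.
rewrite (expansion_fin (u := fun i => if (i < n)%N then u i else 0)) ?ltnNge ?ni// => j.
  by case: ifP => _; [exact: uE|have [] := E_subspace j].
by move=> nj; rewrite ltnNge nj.
Qed.

Lemma c00_PP z n : fdd_c00 E z -> (forall i, (n <= i)%N -> co z i = 0) -> PP 0 n z = z.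
Proof.
move=> zc z0; have [u [k [uE zE]]] := zc.
have [_ zl] := fdd_coordP z.
have h : series (co z) @ \oo --> PP 0 n z.
  have -> : PP 0 n z = \sum_(i < n) co z i by rewrite /fdd_proj big_mkord.
  apply/cvgrPdist_lt => e e0.
  exists n => // m /= nm; rewrite /series /= (big_cat_nat (leq0n n) nm) /= big_mkord.
  rewrite [X in _ - (_ + X)]big1_seq => [|i /andP[_]]; first by rewrite addr0 subrr normr0.
  by rewrite mem_index_iota => /andP[ni _]; exact: z0.
exact: (cvg_unique _ h zl).
Qed.

Lemma c00_0 : fdd_c00 E 0.
Proof.
exists (fun=> 0), 0%N; split; last by rewrite big_ord0.
by move=> i; have [] := E_subspace i.
Qed.

Lemma c00_lin (a : R) z w : fdd_c00 E z -> fdd_c00 E w -> fdd_c00 E (a *: z + w).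
Proof.
move=> zc wc; have [n hn] := c00_coord zc; have [m hm] := c00_coord wc.
rewrite -(c00_PP (n := maxn n m) zc) => [|i]; last by rewrite geq_max => /andP[/hn].
rewrite -(c00_PP (n := maxn n m) wc) => [|i]; last by rewrite geq_max => /andP[_ /hm].
by rewrite -PP_lin; exact: PP_c00.
Qed.

Lemma c00_E i x : E i x -> fdd_c00 E x /\ forall j, j != i -> co x j = 0.
Proof.
move=> xi; pose u j := if j == i then x else 0.
have uE j : E j (u j).
  by rewrite /u; case: eqP => [->//|_]; have [] := E_subspace j.
have xE : x = \sum_(j < i.+1) u j.
  rewrite big_ord_recr /= /u eqxx big1 ?add0r// => j _.
  by rewrite (ltn_eqF (ltn_ord j)).
split; first by exists u, i.+1.
move=> j ji; rewrite xE (expansion_fin uE) /u ?(negPf ji)// => k ik.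
by rewrite gtn_eqF.
Qed.

Lemma PP_empty m n z : (n <= m)%N -> PP m n z = 0.
Proof. by move=> nm; rewrite /fdd_proj big_geq. Qed.

Lemma PP_clamp m n l r z : (m <= n)%N -> (l <= r)%N ->
  PP l r (PP m n z) = PP (clampn m n l) (clampn m n r) z.
Proof.
move=> mn lr; rewrite /fdd_proj -(clamp_sum (co z) mn lr).
by apply: eq_bigr => i _; exact: co_PP.
Qed.

Lemma PP_0 m n : PP m n 0 = 0.
Proof.
have := PP_lin m n 1 0 0.
by rewrite !scale1r addr0 => /eqP; rewrite -subr_eq subrr => /eqP <-.
Qed.

Context (p : R) (p1 : 1 <= p).

Local Notation Zp := (Zp_norm E p%:E).

(** Empty intervals are allowed here, which makes tests stable under clamping and concatenation;
    [swtest] excludes them to match [intervals]. *)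
Fixpoint wtest m n (t : seq (nat * nat)) : Prop :=
  if t is a :: t' then [/\ (m <= a.1)%N, (a.1 <= a.2)%N & wtest a.2 n t'] else (m <= n)%N.

Fixpoint swtest m (t : seq (nat * nat)) : Prop :=
  if t is a :: t' then [/\ (m <= a.1)%N, (a.1 < a.2)%N & swtest a.2 t'] else True.

Definition vsum (t : seq (nat * nat)) z : R := \sum_(a <- t) `|PP a.1 a.2 z| `^ p.

Lemma p_gt0 : 0 < p. Proof. exact: lt_le_trans p1. Qed.

Lemma vsum_ge0 t z : 0 <= vsum t z.
Proof. by apply: sumr_ge0 => a _; exact: powR_ge0. Qed.

Lemma wtest_widen m m' n n' t : (m' <= m)%N -> (n <= n')%N -> wtest m n t -> wtest m' n' t.
Proof.
elim: t m m' => [|a t IH] m m' mm nn /=; first by move=> mn; apply: leq_trans mm (leq_trans mn nn).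
by move=> [ma aa tt]; split => //; [exact: leq_trans ma|exact: IH tt].
Qed.

Lemma wtest_cat m k n t t' : wtest m k t -> wtest k n t' -> wtest m n (t ++ t').
Proof.
elim: t m => [|a t IH] m /=; first by move=> mk; exact: wtest_widen.
by move=> [ma aa tt] tt'; split => //; exact: IH.
Qed.

Lemma wtest_clamp m n j k t : (m <= n)%N -> wtest j k t ->
  wtest (clampn m n j) (clampn m n k) [seq (clampn m n a.1, clampn m n a.2) | a <- t].
Proof.
move=> mn; have mono a b : (a <= b)%N -> (clampn m n a <= clampn m n b)%N.
  by rewrite /clampn; lia.
elim: t j => [|a t IH] j /=; first exact: mono.
by move=> [ja aa tt]; split => //; [exact: mono|exact: mono|exact: IH].
Qed.

Lemma vsum_clamp m n j k t z : (m <= n)%N -> wtest j k t ->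
  vsum t (PP m n z) = vsum [seq (clampn m n a.1, clampn m n a.2) | a <- t] z.
Proof.
move=> mn; elim: t j => [|a t IH] j /=; first by rewrite /vsum !big_nil.
by move=> [_ aa tt]; rewrite /vsum !big_cons -!/(vsum _ _) (IH _ tt) PP_clamp.
Qed.

Lemma wtest_strict m n t z : wtest m n t -> exists t', swtest m t' /\ vsum t z = vsum t' z.
Proof.
elim: t m => [|a t IH] m /=; first by exists [::].
move=> [ma aa tt]; have vE : vsum (a :: t) z = `|PP a.1 a.2 z| `^ p + vsum t z.
  by rewrite /vsum big_cons.
have [aE|aN] := eqVneq a.1 a.2; last first.
  have [t' [tt' tE]] := IH _ tt; exists (a :: t'); split; last by rewrite vE tE /vsum big_cons.
  by split => //; rewrite ltn_neqAle aN.
have [t' [tt' tE]] := IH m (wtest_widen (leq_trans ma aa) (leqnn n) tt).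
exists t'; split => //; rewrite vE PP_empty ?aE// normr0 powR0 ?add0r//.
by rewrite gt_eqF// p_gt0.
Qed.

Lemma swtest_intervals m t : swtest m t ->
  intervals (fun j => (nth (0, 0)%N t j).1) (fun j => (nth (0, 0)%N t j).2) (size t).
Proof.
elim: t m => [//|a t IH] m /= [ma aa tt] [_|j js] /=; last exact: IH tt j js.
by split => //; case: t tt {IH} => [//|b t] /= [].
Qed.

Lemma intervals_wtest l r k : intervals l r k ->
  exists n, wtest 0 n [seq (l j, r j) | j <- iota 0 k].
Proof.
move=> lr; suff h d i m : (i + d = k)%N -> ((0 < d)%N -> (m <= l i)%N) ->
    exists n, wtest m n [seq (l j, r j) | j <- iota i d] by exact: (h k 0%N 0%N).
elim: d i m => [|d IH] i m /= idk ml; first by exists m.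
have [lri rl] := lr i ltac:(lia).
have [||n hn] := IH i.+1 (r i); [lia|by move=> d0; apply: rl; lia|].
by exists n; split => //; [exact: ml|exact: ltnW].
Qed.

Lemma powR_root (x : R) : 0 <= x -> (x `^ p^-1) `^ p = x.
Proof. by move=> x0; rewrite -powRrM mulVf ?powRr1// gt_eqF// p_gt0. Qed.

Lemma root_powR (x : R) : 0 <= x -> (x `^ p) `^ p^-1 = x.
Proof. by move=> x0; rewrite -powRrM divff ?powRr1// gt_eqF// p_gt0. Qed.

Lemma powR_mono (x y : R) : 0 <= x -> x <= y -> x `^ p <= y `^ p.
Proof.
move=> x0 xy; apply: ge0_ler_powR; rewrite ?nnegrE ?(ltW p_gt0)//.
exact: le_trans xy.
Qed.

Lemma root_mono (x y : R) : 0 <= x -> x <= y -> x `^ p^-1 <= y `^ p^-1.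
Proof.
move=> x0 xy; apply: ge0_ler_powR; rewrite ?nnegrE ?invr_ge0 ?(ltW p_gt0)//.
exact: le_trans xy.
Qed.

Definition Zp_set z := [set s | exists l r k, intervals l r k /\
  s = lp_norm p%:E k (fun j => `|PP (l j) (r j) z|)].

Lemma lp_normE (l r : nat -> nat) k z : lp_norm p%:E k (fun j => `|PP (l j) (r j) z|) =
  (vsum [seq (l j, r j) | j <- iota 0 k] z) `^ p^-1.
Proof.
have -> : iota 0 k = index_iota 0 k by rewrite /index_iota subn0.
rewrite /lp_norm /vsum big_map big_mkord; congr (_ `^ _).
by apply: eq_bigr => j _; rewrite normr_id.
Qed.

Lemma vsum_bounded z : fdd_c00 E z -> exists2 B : R, 0 <= B &
  forall n t, wtest 0 n t -> vsum t z <= B.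
Proof.
move=> zc; have [n hn] := c00_coord zc.
pose B := \sum_(i < n) `|co z i|.
have B0 : 0 <= B by exact: sumr_ge0.
have tail m k : \sum_(m <= i < k) `|co z i| <= B.
  apply: le_trans (_ : \sum_(0 <= i < maxn n k) `|co z i| <= _).
    have [mk|km] := leqP m k; last by rewrite big_geq ?sumr_ge0// ltnW.
    rewrite (big_cat_nat (leq0n m) (leq_trans mk (leq_maxr n k))) /= ler_wpDl ?sumr_ge0//.
    by rewrite (big_cat_nat mk (leq_maxr n k)) /= lerDl sumr_ge0.
  rewrite (big_cat_nat (leq0n n) (leq_maxl n k)) /= big_mkord gerDl.
  rewrite big1_seq// => i /andP[_]; rewrite mem_index_iota => /andP[ni _].
  by rewrite hn// normr0.
have sumB t m k : wtest m k t -> \sum_(a <- t) `|PP a.1 a.2 z| <= \sum_(m <= i < k) `|co z i|.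
  elim: t m => [|a t IH] m /=; first by rewrite big_nil sumr_ge0.
  move=> [ma aa tt]; rewrite big_cons; apply: le_trans (lerD (ler_norm_sum _ _ _) (IH _ tt)) _.
  have ak : (a.2 <= k)%N.
    elim: t a.2 tt {IH aa} => [//|b t IH] j /= [jb bb /IH]; exact/leq_trans/(leq_trans jb).
  rewrite -(big_cat_nat aa ak) (big_cat_nat ma (leq_trans aa ak)) /= lerDr sumr_ge0//.
exists (B * B `^ (p - 1)) => [|k t tt]; first by rewrite mulr_ge0// powR_ge0.
have le1 a : `|PP a.1 a.2 z| <= B by apply: le_trans (ler_norm_sum _ _ _) (tail _ _).
apply: le_trans (_ : \sum_(a <- t) `|PP a.1 a.2 z| * B `^ (p - 1) <= _).
  apply: ler_sum => a _; rewrite -mulr_powRB1// ?p_gt0// ler_wpM2l//.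
  by apply: ge0_ler_powR; rewrite ?nnegrE ?subr_ge0.
by rewrite -mulr_suml ler_wpM2r ?powR_ge0//; exact: le_trans (sumB _ _ _ tt) (tail _ _).
Qed.

Lemma Zp_has_sup z : fdd_c00 E z -> has_sup (Zp_set z).
Proof.
move=> zc; split.
  by exists (lp_norm p%:E 0 (fun j => `|PP 0 0 z|)), (fun=> 0%N), (fun=> 0%N), 0%N.
have [B B0 hB] := vsum_bounded zc; exists (B `^ p^-1) => _ [l [r [k [lr ->]]]].
rewrite lp_normE; apply: root_mono; first exact: vsum_ge0.
by have [n hn] := intervals_wtest lr; exact: hB hn.
Qed.

Lemma Zp_ge0 z : fdd_c00 E z -> 0 <= Zp z.
Proof.
move=> zc; apply: le_trans (_ : lp_norm p%:E 0 (fun j => `|PP 0 0 z|) <= _).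
  exact: powR_ge0.
by apply: sup_upper_bound; [exact: Zp_has_sup|exists (fun=> 0%N), (fun=> 0%N), 0%N].
Qed.

Lemma vsum_le_Zp z n t : fdd_c00 E z -> wtest 0 n t -> vsum t z <= Zp z `^ p.
Proof.
move=> zc tt; have [t' [tt' ->]] := wtest_strict z tt.
rewrite -(powR_root (vsum_ge0 t' z)); apply: powR_mono; first exact: powR_ge0.
apply: sup_upper_bound; first exact: Zp_has_sup.
exists (fun j => (nth (0, 0)%N t' j).1), (fun j => (nth (0, 0)%N t' j).2), (size t').
split; first exact: swtest_intervals tt'.
rewrite lp_normE; congr (vsum _ _ `^ _).
rewrite -[LHS](mkseq_nth (0, 0)%N); apply: eq_map => j; by case: nth.
Qed.

Lemma Zp_le z (S : R) : fdd_c00 E z -> 0 <= S ->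
  (forall n t, wtest 0 n t -> vsum t z <= S) -> Zp z `^ p <= S.
Proof.
move=> zc S0 h; rewrite -(powR_root S0); apply: powR_mono; first exact: Zp_ge0.
apply: ge_sup; first by case: (Zp_has_sup zc).
move=> _ [l [r [k [lr ->]]]]; rewrite lp_normE; apply: root_mono; first exact: vsum_ge0.
by have [n hn] := intervals_wtest lr; exact: h hn.
Qed.

Lemma Zp_PP_le m n z (S : R) : (m <= n)%N -> 0 <= S ->
  (forall t, wtest m n t -> vsum t z <= S) -> Zp (PP m n z) `^ p <= S.
Proof.
move=> mn S0 h; apply: Zp_le => // [|k t tt]; first exact: PP_c00.
rewrite (vsum_clamp _ mn tt); apply: h; apply: wtest_widen (wtest_clamp mn tt).
  by rewrite /clampn; lia.
exact: geq_minr.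
Qed.

Lemma Zp_contract m n z : (m <= n)%N -> fdd_c00 E z -> Zp (PP m n z) <= Zp z.
Proof.
move=> mn zc.
have : Zp (PP m n z) `^ p <= Zp z `^ p.
  apply: Zp_PP_le => // [|t tt]; first exact: powR_ge0.
  by apply: vsum_le_Zp (_ : wtest 0 n t) => //; exact: wtest_widen tt.
move: (Zp (PP m n z)) (Zp z) (Zp_ge0 (PP_c00 m n z)) (Zp_ge0 zc) => a b a0 b0.
by move=> /(root_mono (powR_ge0 _ _)); rewrite !root_powR.
Qed.

Lemma Zp_superadd (r : nat -> nat) k z : fdd_c00 E z -> (forall i, (r i <= r i.+1)%N) ->
  \sum_(i < k) Zp (PP (r i) (r i.+1) z) `^ p <= Zp z `^ p.
Proof.
(* The induction carries a test to the right of [r k]: the last norm is approached by tests, which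
   are concatenated with it. *)
move=> zc rm; suff h n t : wtest (r k) n t ->
    \sum_(i < k) Zp (PP (r i) (r i.+1) z) `^ p + vsum t z <= Zp z `^ p.
  have := h (r k) [::] (leqnn _); by rewrite /vsum big_nil addr0.
elim: k n t => [|k IH] n t tt.
  rewrite big_ord0 add0r; apply: vsum_le_Zp (_ : wtest 0 n t) => //; exact: wtest_widen tt.
set S := \sum_(i < k) Zp (PP (r i) (r i.+1) z) `^ p in IH.
have h t' : wtest (r k) (r k.+1) t' -> vsum t' z <= Zp z `^ p - S - vsum t z.
  move=> tt'; have := IH n (t' ++ t) (wtest_cat tt' tt).
  rewrite /vsum big_cat -!/(vsum _ _) /=; lra.
have : Zp (PP (r k) (r k.+1) z) `^ p <= Zp z `^ p - S - vsum t z.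
  apply: (Zp_PP_le (rm k) _ h); have := h [::] (rm k).
  by rewrite [X in X <= _ -> _]/vsum big_nil.
by rewrite !lerBrDr big_ord_recr /= -/S => h2; rewrite -addrA addrC.
Qed.

End interval_sums.

Section embedded_trees.
Context {R : realType} {X : normedModType R}.
Context (p : R) (p1 : 1 <= p) (Z W : completeNormedModType R) (E : nat -> set Z).
Context (hE : is_FDD E) (J : Z -> W) (hJ : is_Zp E p%:E J) (T : {linear dual X -> W}).
Context (Tc : continuous (T : wstar X -> Zp_wstar E J)).

Local Notation PP := (fdd_proj E).

Lemma J_lin a x y : fdd_c00 E x -> fdd_c00 E y -> J (a *: x + y) = a *: J x + J y.
Proof. by case: hJ => h _ _; exact: h. Qed.

Lemma J_norm z : fdd_c00 E z -> `|J z| = Zp_norm E p%:E z.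
Proof. by case: hJ => _ h _; exact: h. Qed.

Lemma J_0 : J 0 = 0.
Proof.
have := J_lin 1 (c00_0 hE) (c00_0 hE).
by rewrite !scale1r addr0 => /eqP; rewrite -subr_eq subrr => /eqP <-.
Qed.

Lemma J_D x y : fdd_c00 E x -> fdd_c00 E y -> J (x + y) = J x + J y.
Proof. by move=> xc yc; rewrite -[x in LHS]scale1r J_lin// scale1r. Qed.

Lemma J_Z a x : fdd_c00 E x -> J (a *: x) = a *: J x.
Proof. by move=> xc; rewrite -[a *: x]addr0 J_lin ?J_0 ?addr0//; exact: c00_0. Qed.

Lemma c00_sum n (h : nat -> Z) (a : nat -> R) : (forall i, fdd_c00 E (h i)) ->
  fdd_c00 E (\sum_(i < n) a i *: h i) /\
  J (\sum_(i < n) a i *: h i) = \sum_(i < n) a i *: J (h i).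
Proof.
move=> hc; elim: n => [|n [IH1 IH2]]; first by rewrite !big_ord0 J_0; split => //; exact: c00_0.
rewrite !big_ord_recr /= ![_ + a n *: _]addrC J_lin// IH2; split => //.
exact: c00_lin.
Qed.

Lemma J_lspan (b : seq Z) x : (forall v, v \in b -> fdd_c00 E v) -> lspan b x ->
  fdd_c00 E x /\ lspan (map J b) (J x).
Proof.
elim: b x => [|v b IH] x bc /=; first by move=> ->; rewrite J_0; split => //; exact: c00_0.
move=> [t [y [yb ->]]]; have [|yc yJ] := IH y _ yb.
  by move=> u ub; apply: bc; rewrite inE ub orbT.
have vc : fdd_c00 E v by apply: bc; rewrite mem_head.
split; first exact: c00_lin.
by exists t, (J y); rewrite J_lin.
Qed.

Lemma head_lspan m : exists B : seq W, forall h, lspan B (J (PP 0 m h)).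
Proof.
elim: m => [|m [B hB]].
  by exists [::] => h; rewrite PP_empty// J_0.
have [[ES EF] _] : (is_subspace (E m) /\ fin_dim (E m)) /\ True by split => //; case: hE.
have [b [bE Eb]] := fin_dim_list ES EF.
exists (B ++ map J b) => h.
have -> : PP 0 m.+1 h = PP 0 m h + fdd_coord E h m by rewrite /fdd_proj big_nat_recr.
have mE := E_coord hE h m; have [mc _] := c00_E hE mE.
rewrite J_D//; last exact: PP_c00.
apply: lspanD; first exact: lspan_catl.
apply: lspan_catr; have [] := @J_lspan b _ _ (Eb _ mE) => // v vb.
by have [] := c00_E hE (bE v vb).
Qed.

Lemma J_PP_le m h : fdd_c00 E h -> `|J (PP 0 m h)| <= `|J h|.
Proof.
move=> hc; rewrite (J_norm (PP_c00 hE 0 m h)) (J_norm hc); exact: Zp_contract.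
Qed.

(** The head projection contracts the Z_p norm, so composing it with functionals gives bounded
    functionals on the image of [J]; their extensions vanish beyond [m] and are thus weak*
    continuous. *)
Lemma head_operator m : exists l : seq (dual W * W),
  (forall q, q \in l -> dual_c00 E J q.1) /\ forall h, fdd_c00 E h -> fr l (J h) = J (PP 0 m h).
Proof.
have [B hB] := head_lspan m; have [l [_ lB]] := lspan_projection B.
have ext (g : dual W) : exists phi : dual W,
    forall h, fdd_c00 E h -> phi (J h) = g (J (PP 0 m h)).
  pose G := [set q : W * R | exists2 h, fdd_c00 E h & q = (J h, g (J (PP 0 m h)) : R)].
  have [||phi [phiG _]] := @dual_extension R W G _ (normr_ge0 g).
  - split.
      exists 0; first exact: c00_0.
      by rewrite PP_0// J_0 du0.
    move=> t _ _ _ _ [x xc [-> ->]] [y yc [-> ->]]; exists (t *: x + y); first exact: c00_lin.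
    by rewrite PP_lin// !J_lin ?duD ?duZ//; exact: PP_c00.
  - move=> _ _ [x xc [-> ->]]; apply: le_trans (ler_norm _) (le_trans (dualP _ _) _).
    by rewrite ler_wpM2l// J_PP_le.
  by exists phi => h hc; apply: phiG; exists h.
have [F FP] := choice ext.
exists [seq (F q.1, q.2) | q <- l]; split.
  move=> _ /mapP[q _ ->] /=; exists m => i x mi xi; have [xc x0] := c00_E hE xi.
  rewrite FP// /fdd_proj big1_seq ?J_0 ?du0// => j /andP[_]; rewrite mem_index_iota => jm.
  by apply: x0; lia.
move=> h hc; rewrite -[RHS](lB _ (hB h)) /fr big_map; apply: eq_bigr => q _.
by rewrite FP.
Qed.

Definition block (eta : R) (r : nat) (y : dual X) (h : Z) (r' : nat) : Prop :=
  [/\ fdd_c00 E h, (r <= r')%N, h = PP r r' h & `|T y - J h| <= eta].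

(** Weak* continuity makes the heads of [T (u n)] tend to 0; a finitely supported approximation with
    its head removed is the required block, with error at most [eta / 4 + eta / 2]. *)
Lemma block_exists (eta : R) r (u : nat -> dual X) : 0 < eta -> wstar_null u ->
  exists M, forall n, (M <= n)%N -> exists h r', block eta r (u n) h r'.
Proof.
move=> eta0 un; have [l [lc lP]] := head_operator r.
have [M0 M00 hM0] := fr_bound l.
have eta4 : 0 < eta / 4 by rewrite divr_gt0.
have [d d0 hd] := fr_small l eta4.
have phi0 (phi : dual W) : dual_c00 E J phi ->
    exists M, forall n, (M <= n)%N -> `|phi (T (u n))| <= d.
  move=> pc; pose ph := exist (fun f => closure (dual_c00 E J) f) phi (subset_closure pc).
  have h : ((fun n => T (u n)) : nat -> Zp_wstar E J) @ \oo --> (T 0 : Zp_wstar E J).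
    exact: (cvg_comp _ _ un (@Tc 0)).
  have := (pairing_cvgP _ _ _ _).1 h ph; rewrite /= linear0 du0.
  move=> /(_ _)/cvgn_distP/(_ d d0)[M hM]; exists M => n Mn.
  by have := hM n Mn; rewrite subr0 => /ltW.
have [M hM] : exists M, forall n, (M <= n)%N -> forall q, q \in l -> `|q.1 (T (u n))| <= d.
  elim: (l) lc => [|q l' IH] lc; first by exists 0%N.
  have [|M hM] := IH; first by move=> q' ql; apply: lc; rewrite inE ql orbT.
  have [M' hM'] := phi0 _ (lc q (mem_head _ _)).
  exists (maxn M M') => n; rewrite geq_max => /andP[Mn Mn'] q'.
  by rewrite inE => /predU1P[->|ql]; [exact: hM'|exact: hM].
exists M => n Mn.
pose e := Num.min (eta / 4) (eta / 4 / M0).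
have e0 : 0 < e by rewrite lt_min eta4 divr_gt0.
have [h0 [h0c h0d]] : exists h0, fdd_c00 E h0 /\ `|T (u n) - J h0| < e.
  have : closure (J @` fdd_c00 E) (T (u n)) by case: hJ => _ _ ->.
  move=> /(_ (ball (T (u n)) e))[|_ [[h hc <-] hd0]]; first exact: nbhsx_ballx.
  by exists h; split => //; move: hd0; rewrite -ball_normE.
have small : `|J (PP 0 r h0)| <= eta / 2.
  rewrite -lP//; have -> : fr l (J h0) = fr l (T (u n)) - fr l (T (u n) - J h0).
    by rewrite frB opprB addrC subrK.
  apply: le_trans (ler_normB _ _) _.
  have h1 : `|fr l (T (u n))| <= eta / 4 by apply: hd; exact: hM.
  have h2 : `|fr l (T (u n) - J h0)| <= eta / 4.
    apply: le_trans (hM0 _) _; rewrite mulrC -ler_pdivlMr//; apply: le_trans (ltW h0d) _.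
    by rewrite ge_min lexx orbT.
  lra.
have [k hk] := c00_coord hE h0c; pose r' := maxn r k.
have rr : (r <= r')%N by exact: leq_maxl.
have hE' : h0 = PP 0 r h0 + PP r r' h0.
  rewrite -{1}(c00_PP hE (n := r') h0c) => [|i]; last by rewrite geq_max => /andP[_ /hk].
  by rewrite /fdd_proj (big_cat_nat (leq0n r) rr).
exists (PP r r' h0), r'; split => //; first exact: PP_c00.
  rewrite PP_clamp//; congr (fdd_proj _ _ _ _); rewrite /clampn; lia.
have -> : J (PP r r' h0) = J h0 - J (PP 0 r h0).
  by rewrite {2}hE' J_D ?[_ + J _ - _]addrAC ?subrr ?add0r//; exact: PP_c00.
rewrite opprB addrCA addrC; apply: le_trans (ler_normD _ _) _.
have : e <= eta / 4 by rewrite ge_min lexx.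
lra.
Qed.

(** Some branch is a small perturbation of successive blocks, for which superadditivity of the Z_p
    norm gives the lower p-estimate. *)
Lemma lower_tree_estimate (c C : R) : 0 < c -> 0 < C ->
  (forall f : dual X, c * `|f| <= `|T f| <= C * `|f|) ->
  forall x, tree_in_sphere x -> tree_nodes (@wstar_null R X) x ->
  exists2 b, is_branch x b & lower_estimate p%:E (2 * C / c) b.
Proof.
move=> c0 C0 hT x xS xN; pose eta i : R := c / 8 * 2^-1 ^+ i.
have eta0 i : 0 < eta i by rewrite mulr_gt0 ?divr_gt0// exprn_gt0// invr_gt0.
have pick (q : nat * nat * dual X) : exists hr : Z * nat,
    (exists h r', block (eta q.1.1) q.1.2 q.2 h r') -> block (eta q.1.1) q.1.2 q.2 hr.1 hr.2.
  have [[h [r' hh]]|no] := pselect (exists h r', block (eta q.1.1) q.1.2 q.2 h r').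
    by exists (h, r').
  by exists (0, 0%N).
have [F FP] := choice pick.
(* State after reading [b]: the number of vectors and the right end of the last block. *)
pose stt (b : seq (dual X)) := foldl (fun st y => (st.1.+1, (F (st.1, st.2, y)).2)) (0, 0)%N b.
have [b u un|b [bb hb]] := @tree_branch R (dual X) (@wstar_null R X)
    (fun b y => block (eta (stt b).1) (stt b).2 y
      (F ((stt b).1, (stt b).2, y)).1 (F ((stt b).1, (stt b).2, y)).2) x xS xN.
  have [M hM] := block_exists (stt b).2 (eta0 (stt b).1) un.
  by exists M => n Mn _; apply: (FP ((stt b).1, (stt b).2, u n)); exact: hM.
pose q i := ((stt (mkseq b i)).1, (stt (mkseq b i)).2, b i).
pose h i := (F (q i)).1; pose r i := (stt (mkseq b i)).2.
have st1 i : (stt (mkseq b i)).1 = i.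
  by elim: i => [//|i IH]; rewrite mkseqS /stt -cats1 foldl_cat /= -/(stt _) IH.
have rS i : r i.+1 = (F (q i)).2 by rewrite /r mkseqS /stt -cats1 foldl_cat.
have hblk i : block (eta i) (r i) (b i) (h i) (r i.+1).
  by have [_] := hb i; rewrite rS /h /q {1}st1.
exists b => // n a.
have hc i : fdd_c00 E (h i) by case: (hblk i).
have rm i : (r i <= r i.+1)%N by case: (hblk i).
have [zc Jz] := c00_sum n a hc; set z := \sum_(i < n) a i *: h i in zc Jz.
have p0 := p_gt0 p1.
have rmono i j : (i <= j)%N -> (r i <= r j)%N.
  by elim: j => [|j IH]; [rewrite leqn0 => /eqP ->|
     rewrite leq_eqVlt ltnS => /predU1P[->//|/IH/leq_trans]; apply].
have PPz i : (i < n)%N -> PP (r i) (r i.+1) z = a i *: h i.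
  move=> i_n; have lin k : PP (r i) (r i.+1) (\sum_(j < k) a j *: h j) =
      if (i < k)%N then a i *: h i else 0.
    elim: k => [|k IH].
      by rewrite big_ord0 PP_0.
    rewrite big_ord_recr /= addrC PP_lin// IH.
    have [_ _ hk _] := hblk k.
    have -> : PP (r i) (r i.+1) (h k) =
        PP (clampn (r k) (r k.+1) (r i)) (clampn (r k) (r k.+1) (r i.+1)) (h k).
      by rewrite {1}hk PP_clamp.
    have [ik|ki|->] := ltngtP i k.
    - rewrite (PP_empty E (m := clampn _ _ _)) => [|]; last first.
        by have := rmono i.+1 k ik; have := rm k; have := rm i; rewrite /clampn; lia.
      by rewrite scaler0 add0r ltnS (ltnW ik).
    - rewrite (PP_empty E (m := clampn _ _ _)) => [|]; last first.
        by have := rmono k.+1 i ki; have := rm k; have := rm i; rewrite /clampn; lia.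
      by rewrite scaler0 add0r ltnS leqNgt ki.
    rewrite ltnS leqnn addr0; congr (_ *: _); rewrite [RHS]hk.
    by congr (fdd_proj _ _ _ _); have := rm k; rewrite /clampn; lia.
  by rewrite /z lin i_n.
have Tb i : c <= `|T (b i)|.
  by have /andP[] := hT (b i); have [-> _] := hb i; rewrite mulr1.
have eta8 i : eta i <= c / 8.
  by rewrite /eta ler_piMr ?divr_ge0 ?(ltW c0)// exprn_ile1 ?invr_ge0// invf_le1// ler1n.
have Jh i : 7 / 8 * c <= `|J (h i)|.
  have [_ _ _ hd] := hblk i; have := ler_distD 0 (T (b i)) (J (h i)).
  have := ler_normD (T (b i) - J (h i)) (J (h i)); rewrite subrK.
  have := Tb i; have := eta8 i; lra.
set lpn := lp_norm p%:E n a.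
have lp0 : 0 <= lpn by exact: powR_ge0.
have sum0 : 0 <= \sum_(i < n) `|a i| `^ p by apply: sumr_ge0 => i _; exact: powR_ge0.
have c8 : 0 <= 7 / 8 * c by rewrite mulr_ge0// ltW.
have low : 7 / 8 * c * lpn <= `|J z|.
  have : \sum_(i < n) (7 / 8 * c * `|a i|) `^ p <= `|J z| `^ p.
    apply: le_trans (_ : \sum_(i < n) Zp_norm E p%:E (PP (r i) (r i.+1) z) `^ p <= _).
      apply: ler_sum => i _; rewrite PPz// -J_norm; last first.
        by rewrite -[_ *: _]addr0; apply: c00_lin => //; exact: c00_0.
      rewrite J_Z// normrZ; apply: (powR_mono p1); first by rewrite mulr_ge0.
      by rewrite mulrC ler_wpM2l.
    by rewrite J_norm//; exact: Zp_superadd.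
  have -> : \sum_(i < n) (7 / 8 * c * `|a i|) `^ p = (7 / 8 * c * lpn) `^ p.
    rewrite powRM// (powR_root p1 sum0) mulr_sumr; apply: eq_bigr => i _.
    by rewrite powRM.
  move=> /(root_mono p1 (powR_ge0 _ _)).
  by rewrite (root_powR p1 (mulr_ge0 c8 lp0)) (root_powR p1 (normr_ge0 _)).
have ai (i : 'I_n) : `|a i| <= lpn.
  rewrite -[leLHS](root_powR p1)//; apply: (root_mono p1); first exact: powR_ge0.
  rewrite (bigD1 i)//= lerDl; apply: sumr_ge0 => j _; exact: powR_ge0.
(* The tolerances [eta i] sum to at most [c / 4]; subtracted from [7/8 * c] this leaves at least
   [c / 2]. *)
have close : `|T (\sum_(i < n) a i *: b i) - J z| <= c / 4 * lpn.
  rewrite linear_sum Jz -sumrB; apply: le_trans (ler_norm_sum _ _ _) _.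
  apply: le_trans (_ : \sum_(i < n) lpn * eta i <= _).
    apply: ler_sum => i _; rewrite linearZ -scalerBr normrZ.
    by have [_ _ _ hd] := hblk i; exact: ler_pM.
  rewrite -mulr_sumr mulrC ler_wpM2r// /eta -mulr_sumr.
  have : \sum_(i < n) 2^-1 ^+ i = 2 - 2 * 2^-1 ^+ n :> R.
    elim: (n) => [|m IH]; first by rewrite big_ord0 expr0; lra.
    by rewrite big_ord_recr /= IH exprS; lra.
  move=> ->; have : 0 <= c / 8 * (2 * 2^-1 ^+ n).
    by rewrite mulr_ge0 ?divr_ge0 ?mulr_ge0 ?exprn_ge0 ?invr_ge0// ltW.
  lra.
have /andP[_ up] := hT (\sum_(i < n) a i *: b i).
have fin : c / 2 * lpn <= C * `|\sum_(i < n) a i *: b i|.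
  apply: le_trans up.
  have := ler_normD (J z - T (\sum_(i < n) a i *: b i)) (T (\sum_(i < n) a i *: b i)).
  rewrite subrK distrC => h1; have : 0 <= c * lpn by rewrite mulr_ge0// ltW.
  lra.
have -> : (2 * C / c)^-1 * lpn = C^-1 * (c / 2 * lpn) by field; rewrite !gt_eqF.
by rewrite ler_pdivrMl.
Qed.

End embedded_trees.

Lemma wstar_trees_of_embedding {R : realType} {X : normedModType R} (p : R)
    (Z : completeNormedModType R) (E : nat -> set Z) : 1 <= p -> is_FDD E ->
  wstar_embeds_in_Zp X p%:E E -> wstar_tree_estimates X p%:E 1%E.
Proof.
move=> p1 hE [W [J [T [hJ [c [C [c0 C0 hT]]] Tc _]]]].
have K0 : 0 < 2 * C / c by rewrite divr_gt0// mulr_gt0.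
exists (2 * C / c + 1) => [|x xS xN]; first by rewrite addr_gt0.
split.
  have [b bb hb] := lower_tree_estimate p1 hE hJ Tc c0 C0 hT xS xN.
  exists b => // n a; have := hb n a; rewrite !ler_pdivrMl ?addr_gt0// => h.
  by apply: le_trans h _; rewrite ler_wpM2r// lerDl.
exists (fun i => x (mkseq id i.+1)); first by exists id.
move=> n a; apply: le_trans (_ : \sum_(i < n) `|a i| <= _).
  apply: le_trans (ler_norm_sum _ _ _) _; apply: ler_sum => i _.
  by rewrite normrZ xS ?mulr1// /in_Tinf mkseq_sorted// -size_eq0 size_mkseq.
have -> : lp_norm 1%E n a = \sum_(i < n) `|a i|.
  rewrite /lp_norm invr1 powRr1; last by apply: sumr_ge0 => i _; exact: powR_ge0.
  by apply: eq_bigr => i _; rewrite powRr1.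
by rewrite ler_peMl ?sumr_ge0// lerDr ltW.
Qed.

(** * The cycle of equivalences *)

Theorem theorem3p4 (R : realType) (X : completeNormedModType R)
    (Xinf : ~ fin_dim [set: X]) (Xsep : separable (dual X)) :
  [<->
   (* 1 *) is_szlenk_index X (Some co_omega);
   (* 2 *) exists q K : R, 1 < q /\
             forall (n : nat) (V : normedModType R) (e : 'I_n -> V),
               asymptotic_structure X e ->
               forall a : 'I_n -> R,
                 `|\sum_i a i *: e i| <= K * (\sum_i `|a i| `^ q) `^ q^-1;
   (* 3 *) exists q : \bar R, (1 < q)%E /\ weak_tree_estimates X +oo%E q;
   (* 4 *) exists p : R, 1 <= p /\ wstar_tree_estimates X p%:E 1%E;
   (* 5 *) exists (p : R) (Z : completeNormedModType R) (E : nat -> set Z),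
             [/\ 1 <= p, is_FDD E, boundedly_complete E &
                 wstar_embeds_in_Zp X p%:E E];
   (* 6 *) exists q : R, 1 < q /\
             can_be_renormed X (fun Y => aus_power_type Y q);
   (* 7 *) can_be_renormed X (fun Y => aus Y);
   (* 8 *) can_be_renormed X (fun Y =>
             exists t : R, 0 < t /\ (rho_bar Y t < t%:E)%E);
   (* 9 *) exists p c : R, [/\ 1 <= p, 0 < c &
             can_be_renormed X (fun Y => exists delta : R -> R,
               wstar_UKK_with Y delta /\
               forall eps, 0 < eps -> c * eps `^ p <= delta eps)];
   (* 10 *) can_be_renormed X (fun Y => wstar_UKK Y);
   (* 11 *) exists p : R, 1 <= p /\
             can_be_renormed X (fun Y => delta_power_type Y p);
   (* 12 *) can_be_renormed X (fun Y => wstar_auc Y)].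
Proof.
have [fs fsD] := separable_dense_seq Xsep; have [ys ysT] := total_seq fsD.
have [g [g1 g0]] := wstar_null_sphere Xinf ysT.
(* Hub of the proof: the implications of the cycle that are not immediate lead from one statement to
   [good] and from [good] to the next. *)
pose good := exists (q : R) (N : equiv_norm X), 1 < q /\ aus_power_type (renorm N) q.
have of_game (N : equiv_norm X) : sub_linear_game N -> good.
  by move=> /power_type_renorming[q [q1 [N' hN']]]; exists q, N'.
have of_szlenk_index : is_szlenk_index X (Some co_omega) -> good.
  by move=> /(Lset_empty ysT fsD)[N /sub_linear_of_Lset /of_game].
have of_szlenk : szlenk_finite X -> good.
  by move=> /(szlenk_index_omega Xinf ysT)/of_szlenk_index.
have of_asymptotic := fun h => of_game _ (sub_linear_of_asymptotic Xinf h).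
have of_trees := fun h => of_game _ (sub_linear_of_trees Xinf fsD h).
have of_wstar_trees p : 1 <= p -> wstar_tree_estimates X p%:E 1%E -> good.
  by move=> p1 hp; apply: of_szlenk; exact: szlenk_finite_of_trees g1 g0 p1 hp.
have of_rho_bar (N : equiv_norm X) t : 0 < t -> (rho_bar (renorm N) t < t%:E)%E -> good.
  by move=> t0 /(sub_linear_game_of_rho_bar t0)/of_game.
have of_UKK (N : equiv_norm X) : wstar_UKK (renorm N) -> good.
  by move=> /szlenk_finite_of_UKK/of_szlenk.
have of_auc (N : equiv_norm X) : wstar_auc (renorm N) -> good.
  by move=> /szlenk_finite_of_auc/of_szlenk.
have smooth_of : good -> exists N : equiv_norm X, smooth_norm N.
  by move=> [q [N [q1 hN]]]; exists N; exact: smooth_norm_of_power_type q1 hN.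
have embeds_of : good -> exists (p : R) (Z : completeNormedModType R) (E : nat -> set Z),
    [/\ 1 <= p, is_FDD E, boundedly_complete E & wstar_embeds_in_Zp X p%:E E].
  by move=> /smooth_of[N hN]; exact: wstar_embeds_of_smooth hN ysT.
have wstar_trees_of : good -> exists p : R, 1 <= p /\ wstar_tree_estimates X p%:E 1%E.
  move=> /embeds_of[p [Z [E [p1 hE _ hT]]]].
  by exists p; split => //; exact: wstar_trees_of_embedding p1 hE hT.
tfae.
- by move=> /of_szlenk_index/smooth_of[N /asymptotic_upper[q [K [q1 h]]]]; exists q, K.
- by move=> /of_asymptotic/smooth_of[N]; exact: weak_tree_of_smooth.
- by move=> /of_trees/wstar_trees_of.
- by move=> [p [p1 /(of_wstar_trees p p1)/embeds_of]].
- move=> [p [Z [E [p1 hE _ hT]]]].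
  have [q [N [q1 hN]]] := of_wstar_trees p p1 (wstar_trees_of_embedding p1 hE hT).
  by exists q; split => //; exists N.
- move=> [q [q1 [N hN]]]; exists N.
  have [x [_ x1]] := unit_in_kerl [::] N Xinf.
  exact: (aus_of_power_type (x := x : renorm N) x1 q1 hN).
- by move=> [N hN]; exists N; exact: aus_rho_bar_lt.
- move=> [N [t [t0 ht]]]; have [N' /smooth_norm_renorm hN'] := smooth_of (of_rho_bar N t t0 ht).
  have [p [c [p1 c0 hp]]] := UKK_of_smooth hN'.
  by exists p, c; split => //; exists N'.
- by move=> [p [c [_ _ [N [delta [hd _]]]]]]; exists N; exists delta.
- move=> [N hN]; have [N' /smooth_norm_renorm hN'] := smooth_of (of_UKK N hN).
  have [p [p1 hp]] := delta_power_type_of_smooth hN'.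
  by exists p; split => //; exists N'.
- by move=> [p [_ [N hN]]]; exists N; exact: wstar_auc_of_power_type hN.
move=> [N hN]; have [p [p1 hp]] := wstar_trees_of (of_auc N hN).
by apply: (szlenk_index_omega Xinf ysT); exact: szlenk_finite_of_trees g1 g0 p1 hp.
Qed.
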